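(* Assume the standing assumption (A), Assumption (F1), Assumption (F2) and Assumption (SF). Then the process $(X,\Lambda)$ has the strong Feller property: for every $t>0$ and every bounded measurable $f:\mathbb R^d\times\mathbb S\to\mathbb R$, the map $(x,k)\mapsto\mathbb E_{x,k}[f(X(t),\Lambda(t))]$ is continuous on $\mathbb R^d\times\mathbb S$.
   Context: Let $d,n_0\ge1$ be integers, $\mathbb S=\{1,\dots,n_0\}$ (discrete topology), $\mathbb R^d_0=\mathbb R^d\setminus\{0\}$, $B(0,r)=\{x\in\mathbb R^d:|x|<r\}$, and fix $\varepsilon_0>0$. For each $(x,k)\in\mathbb R^d\times\mathbb S$ let $a(x,k)$ be a symmetric nonnegative definite real $d\times d$ matrix, $b(x,k)\in\mathbb R^d$, and $\nu(x,k,\cdot)$ a $\sigma$-finite measure on $\mathbb R^d_0$ with $\int|u|^2\mathbf 1_{B(0,\varepsilon_0)}(u)\nu(x,k,du)<\infty$ and $\nu(x,k,\mathbb R^d\setminus B(0,\varepsilon_0))<\infty$, all measurable in $(x,k)$. For $k\in\mathbb S$ and $g\in C^2(\mathbb R^d)$ let $\mathcal L_kg(x)=\frac12\mathrm{tr}(a(x,k)\nabla^2g(x))+\langle b(x,k),\nabla g(x)\rangle+\int_{\mathbb R^d_0}\big(g(x+u)-g(x)-\langle\nabla g(x),u\rangle\mathbf 1_{B(0,\varepsilon_0)}(u)\big)\nu(x,k,du)$. Let $Q(x)=(q_{kl}(x))_{k,l\in\mathbb S}$ be measurable in $x$, with $q_{kl}(x)\ge0$ for $k\ne l$ and $\sum_{l}q_{kl}(x)=0$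 for each $k$. For $f:\mathbb R^d\times\mathbb S\to\mathbb R$ with each $f(\cdot,k)\in C^2(\mathbb R^d)$, put $\mathcal Af(x,k)=\mathcal L_kf(\cdot,k)(x)+\sum_{l\in\mathbb S}q_{kl}(x)(f(x,l)-f(x,k))$. Let $\Omega=D([0,\infty),\mathbb R^d\times\mathbb S)$ (càdlàg paths, Skorohod topology), $(X(t),\Lambda(t))=\omega(t)$ the coordinate process, $\mathcal F_t$ the $\sigma$-field generated by the coordinates up to time $t$, $\mathcal F=\bigvee_t\mathcal F_t$. A probability $P$ on $(\Omega,\mathcal F)$ is a martingale solution for $\mathcal A$ starting from $(x,k)$ if $P((X(0),\Lambda(0))=(x,k))=1$ and, for every $f$ with $f(\cdot,k)\in C_c^\infty(\mathbb R^d)$ for all $k$, $f(X(t),\Lambda(t))-f(X(0),\Lambda(0))-\int_0^t\mathcal Af(X(s),\Lambda(s))ds$ is an $\{\mathcal F_t\}$-martingale under $P$. Martingale solutions for $\mathcal L_k$ starting from $x$ are defined analogously on $D([0,\infty),\mathbb R^d)$ with coordinate process $X$ and test functions $g\in C_c^\infty(\mathbb R^d)$. Standing assumption (A): (i) for each $k\in\mathbb S$ and $x\in\mathbb R^d$ the martingale problem for $\mathcal L_k$ starting from $x$ has a unique solution; (ii) each $q_{kk}$ is bounded from below; (iii) $\sup_{(x,k)}\int_{\mathbb R^d_0}(1\wedge|y|^2)\nu(x,k,dy)<\infty$. Under (A) the martingale problem for $\mathcal A$ has a unique solution $P^{(x,k)}$ from each $(x,k)$; $\mathbb E_{x,k}$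 denotes expectation under $P^{(x,k)}$. Assumption (F1): there exist a constant $H>0$ and a nondecreasing concave $\rho:[0,\infty)\to[0,\infty)$ with $\rho(r)>0$ for $r>0$ and $\int_{0+}dr/\rho(r)=\infty$, such that for all $k\in\mathbb S$ and $x,z\in\mathbb R^d$: $\|\sigma(x,k)-\sigma(z,k)\|^2+2\langle x-z,b(x,k)-b(z,k)\rangle\le H|x-z|\rho(|x-z|)$ and $\int_{\mathbb R^d_0}|u|\,\|\nu(x,k,\cdot)-\nu(z,k,\cdot)\|(du)\le H\rho(|x-z|)$, where $\sigma(x,k)$ is a $d\times d$ matrix with $\sigma\sigma^T=a$, $\|\cdot\|$ is the Hilbert–Schmidt norm for matrices and $\|\mu\|$ denotes the total variation measure of a signed measure $\mu$. Assumption (F2): $|q_{kl}(x)-q_{kl}(z)|\le H|x-z|$ for all $x,z\in\mathbb R^d$ and $k\ne l$, with the same $H$. Assumption (SF): there is $\lambda_0>0$ with $\langle\xi,a(x,k)\xi\rangle\ge\lambda_0|\xi|^2$ for all $x,\xi\in\mathbb R^d$, $k\in\mathbb S$; let $\sigma_{\lambda_0}(x,k)$ be the unique symmetric nonnegative definite matrix with $\sigma_{\lambda_0}(x,k)^2=a(x,k)-\lambda_0I$. Moreover there exist constants $\delta_0>0$, $H>0$ and a nonnegative function $\vartheta$ on $[0,\delta_0]$ with $\lim_{r\to0}\vartheta(r)=0$ such that for all $k\in\mathbb S$ and $x,z\in\mathbb R^d$ with $|x-z|\le\delta_0$: $2\langle x-z,b(x,k)-b(z,k)\rangle+\|\sigma_{\lambda_0}(x,k)-\sigma_{\lambda_0}(z,k)\|^2\le2H|x-z|\vartheta(|x-z|)$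 and $\int_{\mathbb R^d_0}|u|\,\|\nu(x,k,\cdot)-\nu(z,k,\cdot)\|(du)\le\frac H2\vartheta(|x-z|)$. *)

(* Defs.v *)
From HB Require Import structures.
From mathcomp Require Import all_boot all_order all_algebra.
From mathcomp Require Import all_classical all_reals all_analysis.
From mathcomp Require Import measurable_realfun.
Set Implicit Arguments. Unset Strict Implicit. Unset Printing Implicit Defensive.
Import Order.TTheory GRing.Theory Num.Theory.
Import numFieldNormedType.Exports.
Local Open Scope classical_set_scope.
Local Open Scope ring_scope.

Definition inner (R : realType) (d : nat) (x y : 'rV[R]_d) : R :=
  \sum_(i < d) x 0 i * y 0 i.
Definition enorm (R : realType) (d : nat) (x : 'rV[R]_d) : R :=
  Num.sqrt (inner x x).
Definition quadform (R : realType) (d : nat) (A : 'M[R]_d) (xi : 'rV[R]_d) : R :=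
  \sum_(i < d) \sum_(j < d) xi 0 i * A i j * xi 0 j.
Definition hs2 (R : realType) (d : nat) (A : 'M[R]_d) : R :=
  \sum_(i < d) \sum_(j < d) A i j ^+ 2.
Definition eball0 (R : realType) (d : nat) (r : R) : set 'rV[R]_d :=
  [set u | enorm u < r].
Definition evec (R : realType) (d : nat) (i : 'I_d) : 'rV[R]_d := delta_mx 0 i.

Definition Rd (R : realType) (d : nat) := g_sigma_algebraType (@open 'rV[R]_d).

Definition Rd0 (R : realType) (d : nat) : set (Rd R d) := ~` [set (0 : 'rV[R]_d)].

Definition borel_fun (R : realType) (d : nat) (g : 'rV[R]_d -> R) :=
  @measurable_fun _ _ (Rd R d) R setT g.

Definition pd (R : realType) (d : nat) (g : 'rV[R]_d -> R) (i : 'I_d) :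
  'rV[R]_d -> R := fun x => derive g x (evec R i).
Definition grad (R : realType) (d : nat) (g : 'rV[R]_d -> R) (x : 'rV[R]_d) :
  'rV[R]_d := \row_i pd g i x.
Definition hess (R : realType) (d : nat) (g : 'rV[R]_d -> R) (x : 'rV[R]_d) :
  'M[R]_d := \matrix_(i, j) pd (pd g i) j x.
Definition iter_pd (R : realType) (d : nat) (l : seq 'I_d) (g : 'rV[R]_d -> R) :
  'rV[R]_d -> R := foldr (fun i h => pd h i) g l.
Definition smooth (R : realType) (d : nat) (g : 'rV[R]_d -> R) :=
  forall l : seq 'I_d, continuous (iter_pd l g) /\
    forall (i : 'I_d) (x : 'rV[R]_d), derivable (iter_pd l g) x (evec R i).
Definition compact_support (R : realType) (d : nat) (g : 'rV[R]_d -> R) :=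
  exists r : R, forall x, r < enorm x -> g x = 0.
Definition Cc_infty (R : realType) (d : nat) (g : 'rV[R]_d -> R) :=
  smooth g /\ compact_support g.

Definition Lop (R : realType) (d : nat) (eps0 : R)
  (a : 'rV[R]_d -> 'M[R]_d) (b : 'rV[R]_d -> 'rV[R]_d)
  (nu : 'rV[R]_d -> {measure set Rd R d -> \bar R})
  (g : 'rV[R]_d -> R) (x : 'rV[R]_d) : R :=
  2^-1 * \tr (a x *m hess g x) + inner (b x) (grad g x)
  + Rintegral (nu x) (@Rd0 R d)
      (fun u : 'rV[R]_d => g (x + u) - g x
                           - inner (grad g x) u * \1_(@eball0 R d eps0) u).

Definition Aop (R : realType) (d n : nat) (eps0 : R)
  (a : 'rV[R]_d -> 'I_n.+1 -> 'M[R]_d) (b : 'rV[R]_d -> 'I_n.+1 -> 'rV[R]_d)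
  (nu : 'rV[R]_d -> 'I_n.+1 -> {measure set Rd R d -> \bar R})
  (q : 'rV[R]_d -> 'I_n.+1 -> 'I_n.+1 -> R)
  (f : 'rV[R]_d -> 'I_n.+1 -> R) (x : 'rV[R]_d) (k : 'I_n.+1) : R :=
  Lop eps0 (a ^~ k) (b ^~ k) (nu ^~ k) (f ^~ k) x
  + \sum_(l < n.+1) q x k l * (f x l - f x k).

(* Paths are defined on R, frozen at their time-0 value for t < 0.     *)
Definition cadlag_Rd (R : realType) (d : nat) (w : R -> 'rV[R]_d) :=
  forall t : R, 0 <= t ->
    (w s @[s --> t^'+] --> w t) /\
    (0 < t -> exists l : 'rV[R]_d, w s @[s --> t^'-] --> l).
Definition cadlag_S (R : realType) (n : nat) (w : R -> 'I_n.+1) :=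
  forall t : R, 0 <= t ->
    (exists e : R, 0 < e /\ forall s, t <= s -> s < t + e -> w s = w t) /\
    (0 < t -> exists (e : R) (l : 'I_n.+1), 0 < e /\
        forall s, t - e < s -> s < t -> w s = l).
Definition frozen_neg (R : realType) (T : Type) (w : R -> T) :=
  forall t : R, t < 0 -> w t = w 0.

Record pathRdS (R : realType) (d n : nat) := PathRdS {
  pX : R -> 'rV[R]_d;
  pL : R -> 'I_n.+1;
  pX_cadlag : cadlag_Rd pX;
  pL_cadlag : cadlag_S pL;
  pX_frozen : frozen_neg pX;
  pL_frozen : frozen_neg pL }.

Record pathRd (R : realType) (d : nat) := PathRd {
  qX : R -> 'rV[R]_d;
  qX_cadlag : cadlag_Rd qX;
  qX_frozen : frozen_neg qX }.

Lemma cst_cadlag_Rd (R : realType) (d : nat) (x : 'rV[R]_d) :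
  cadlag_Rd (fun _ : R => x).
Proof.
move=> t _; split; first exact: cvg_cst.
by move=> _; exists x; exact: cvg_cst.
Qed.

Lemma cst_cadlag_S (R : realType) (n : nat) (k : 'I_n.+1) :
  cadlag_S (fun _ : R => k).
Proof.
move=> t _; split; first by exists 1; split => //; rewrite ltr01.
by move=> _; exists 1, k; split => //; rewrite ltr01.
Qed.

Definition pathRdS0 (R : realType) (d n : nat) : pathRdS R d n :=
  @PathRdS R d n (fun _ => 0) (fun _ => ord0) (cst_cadlag_Rd 0)
     (cst_cadlag_S ord0) (fun _ _ => erefl) (fun _ _ => erefl).
Definition pathRd0 (R : realType) (d : nat) : pathRd R d :=
  @PathRd R d (fun _ => 0) (cst_cadlag_Rd 0) (fun _ _ => erefl).

HB.instance Definition _ (R : realType) (d n : nat) := gen_eqMixin (pathRdS R d n).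
HB.instance Definition _ (R : realType) (d n : nat) := gen_choiceMixin (pathRdS R d n).
HB.instance Definition _ (R : realType) (d n : nat) :=
  isPointed.Build (pathRdS R d n) (pathRdS0 R d n).
HB.instance Definition _ (R : realType) (d : nat) := gen_eqMixin (pathRd R d).
HB.instance Definition _ (R : realType) (d : nat) := gen_choiceMixin (pathRd R d).
HB.instance Definition _ (R : realType) (d : nat) :=
  isPointed.Build (pathRd R d) (pathRd0 R d).

(* generators of F_T (coordinates up to time T); T = +oo gives F *)
Definition genS (R : realType) (d n : nat) (T : \bar R) : set (set (pathRdS R d n)) :=
  [set A | exists t : R, 0 <= t /\ (t%:E <= T)%E /\
     ((exists B : set 'rV[R]_d, open B /\ A = [set w | B (pX w t)]) \/
      (exists k : 'I_n.+1, A = [set w | pL w t = k]))].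
Definition genD (R : realType) (d : nat) (T : \bar R) : set (set (pathRd R d)) :=
  [set A | exists t : R, 0 <= t /\ (t%:E <= T)%E /\
     (exists B : set 'rV[R]_d, open B /\ A = [set w | B (qX w t)])].

Definition OmegaS (R : realType) (d n : nat) := g_sigma_algebraType (@genS R d n +oo%E).
Definition OmegaD (R : realType) (d : nat) := g_sigma_algebraType (@genD R d +oo%E).

Definition is_martingale (dT : measure_display) (Om : measurableType dT)
  (R : realType) (P : probability Om R) (Ft : R -> set (set Om))
  (M : R -> Om -> R) :=
  forall t : R, 0 <= t ->
    (forall B : set R, measurable B -> Ft t (M t @^-1` B)) /\
    P.-integrable setT (EFin \o M t) /\
    (forall s : R, 0 <= s -> s <= t -> forall A : set Om, Ft s A ->
       (\int[P]_(w in A) (M t w)%:E = \int[P]_(w in A) (M s w)%:E)%E).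

Definition mg_sol_A (R : realType) (d n : nat) (eps0 : R)
  (a : 'rV[R]_d -> 'I_n.+1 -> 'M[R]_d) (b : 'rV[R]_d -> 'I_n.+1 -> 'rV[R]_d)
  (nu : 'rV[R]_d -> 'I_n.+1 -> {measure set Rd R d -> \bar R})
  (q : 'rV[R]_d -> 'I_n.+1 -> 'I_n.+1 -> R)
  (P : probability (OmegaS R d n) R) (x : 'rV[R]_d) (k : 'I_n.+1) :=
  P [set w : OmegaS R d n | pX w 0 = x /\ pL w 0 = k] = 1%E /\
  forall f : 'rV[R]_d -> 'I_n.+1 -> R, (forall l, Cc_infty (f ^~ l)) ->
    is_martingale P (fun t => <<s @genS R d n t%:E >>)
      (fun t (w : OmegaS R d n) =>
         f (pX w t) (pL w t) - f (pX w 0) (pL w 0)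
         - Rintegral (@lebesgue_measure R) `[0, t]
             (fun r => Aop eps0 a b nu q f (pX w r) (pL w r))).

Definition mg_sol_L (R : realType) (d : nat) (eps0 : R)
  (a : 'rV[R]_d -> 'M[R]_d) (b : 'rV[R]_d -> 'rV[R]_d)
  (nu : 'rV[R]_d -> {measure set Rd R d -> \bar R})
  (P : probability (OmegaD R d) R) (x : 'rV[R]_d) :=
  P [set w : OmegaD R d | qX w 0 = x] = 1%E /\
  forall g : 'rV[R]_d -> R, Cc_infty g ->
    is_martingale P (fun t => <<s @genD R d t%:E >>)
      (fun t (w : OmegaD R d) =>
         g (qX w t) - g (qX w 0)
         - Rintegral (@lebesgue_measure R) `[0, t]
             (fun r => Lop eps0 a b nu g (qX w r))).

Definition psd (R : realType) (d : nat) (A : 'M[R]_d) :=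
  A^T = A /\ forall xi : 'rV[R]_d, 0 <= quadform A xi.

Definition coefficients_ok (R : realType) (d n : nat) (eps0 : R)
  (a : 'rV[R]_d -> 'I_n.+1 -> 'M[R]_d) (b : 'rV[R]_d -> 'I_n.+1 -> 'rV[R]_d)
  (nu : 'rV[R]_d -> 'I_n.+1 -> {measure set Rd R d -> \bar R})
  (q : 'rV[R]_d -> 'I_n.+1 -> 'I_n.+1 -> R) :=
  (forall x k, psd (a x k)) /\
  (forall k (i j : 'I_d), borel_fun (fun x => a x k i j)) /\
  (forall k (i : 'I_d), borel_fun (fun x => b x k 0 i)) /\
  (* nu(x,k,.) : sigma-finite measure on R^d_0 *)
  (forall x k, nu x k [set (0 : 'rV[R]_d)] = 0%E) /\
  (forall x k, sigma_finite (@Rd0 R d) (nu x k)) /\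
  (forall x k, (\int[nu x k]_(u in @Rd0 R d)
                  ((enorm u) ^+ 2 * \1_(@eball0 R d eps0) u)%:E < +oo)%E) /\
  (forall x k, (nu x k (~` @eball0 R d eps0) < +oo)%E) /\
  (forall k (B : set (Rd R d)), measurable B ->
     measurable_fun setT (fun x : Rd R d => nu x k B)) /\
  (forall k l, borel_fun (fun x => q x k l)) /\
  (forall x k l, k != l -> 0 <= q x k l) /\
  (forall x k, \sum_(l < n.+1) q x k l = 0).

Definition assumption_A (R : realType) (d n : nat) (eps0 : R)
  (a : 'rV[R]_d -> 'I_n.+1 -> 'M[R]_d) (b : 'rV[R]_d -> 'I_n.+1 -> 'rV[R]_d)
  (nu : 'rV[R]_d -> 'I_n.+1 -> {measure set Rd R d -> \bar R})
  (q : 'rV[R]_d -> 'I_n.+1 -> 'I_n.+1 -> R) :=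
  (forall k x, exists P : probability (OmegaD R d) R,
     mg_sol_L eps0 (a ^~ k) (b ^~ k) (nu ^~ k) P x /\
     forall P' : probability (OmegaD R d) R,
       mg_sol_L eps0 (a ^~ k) (b ^~ k) (nu ^~ k) P' x ->
       forall A, measurable A -> P' A = P A) /\
  (forall k, exists c : R, forall x, c <= q x k k) /\
  (exists C : R, forall x k,
     (\int[nu x k]_(u in @Rd0 R d) (Num.min 1 (enorm u ^+ 2))%:E <= C%:E)%E).

(* integral of a nonnegative h against the total variation measure
   ||mu1 - mu2|| over D: the total variation of the signed measure
   h.mu1 - h.mu2 on D, i.e. the supremum over countable measurable
   partitions (E_i) of D (with finite h-weighted masses) of
   sum_i | int_{E_i} h dmu1 - int_{E_i} h dmu2 |. *)
Definition tv_integral (R : realType) (d : nat)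
  (h : 'rV[R]_d -> R) (mu1 mu2 : {measure set Rd R d -> \bar R})
  (D : set (Rd R d)) : \bar R :=
  ereal_sup [set s | exists E : (set (Rd R d))^nat,
     (forall i, measurable (E i)) /\ trivIset setT E /\
     \bigcup_i E i = D /\
     (forall i, (\int[mu1]_(u in E i) (h u)%:E < +oo)%E /\
                (\int[mu2]_(u in E i) (h u)%:E < +oo)%E) /\
     s = (\sum_(i <oo) `| \int[mu1]_(u in E i) (h u)%:E
                          - \int[mu2]_(u in E i) (h u)%:E |)%E].

Definition concave_on_nonneg (R : realType) (rho : R -> R) :=
  forall x y t : R, 0 <= x -> 0 <= y -> 0 <= t -> t <= 1 ->
    t * rho x + (1 - t) * rho y <= rho (t * x + (1 - t) * y).

Definition assumption_F1_F2 (R : realType) (d n : nat)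
  (a : 'rV[R]_d -> 'I_n.+1 -> 'M[R]_d) (b : 'rV[R]_d -> 'I_n.+1 -> 'rV[R]_d)
  (nu : 'rV[R]_d -> 'I_n.+1 -> {measure set Rd R d -> \bar R})
  (q : 'rV[R]_d -> 'I_n.+1 -> 'I_n.+1 -> R) :=
  exists (H : R) (rho : R -> R) (sigma : 'rV[R]_d -> 'I_n.+1 -> 'M[R]_d),
    0 < H /\
    (forall r, 0 <= r -> 0 <= rho r) /\
    (forall r s, 0 <= r -> r <= s -> rho r <= rho s) /\
    concave_on_nonneg rho /\
    (forall r, 0 < r -> 0 < rho r) /\
    (forall c : R, 0 < c ->
       (\int[@lebesgue_measure R]_(r in `]0%R, c]) ((rho r)^-1)%:E = +oo)%E) /\
    (forall x k, sigma x k *m (sigma x k)^T = a x k) /\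
    (forall k x z,
       hs2 (sigma x k - sigma z k) + 2 * inner (x - z) (b x k - b z k)
       <= H * enorm (x - z) * rho (enorm (x - z))) /\
    (forall k x z,
       (tv_integral (@enorm R d) (nu x k) (nu z k) (@Rd0 R d)
        <= (H * rho (enorm (x - z)))%:E)%E) /\
    (forall k l x z, k != l ->
       `|q x k l - q z k l| <= H * enorm (x - z)).

Definition assumption_SF (R : realType) (d n : nat)
  (a : 'rV[R]_d -> 'I_n.+1 -> 'M[R]_d) (b : 'rV[R]_d -> 'I_n.+1 -> 'rV[R]_d)
  (nu : 'rV[R]_d -> 'I_n.+1 -> {measure set Rd R d -> \bar R}) :=
  exists (lambda0 : R) (sl : 'rV[R]_d -> 'I_n.+1 -> 'M[R]_d)
         (delta0 H : R) (theta : R -> R),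
    0 < lambda0 /\
    (forall x k xi, lambda0 * enorm xi ^+ 2 <= quadform (a x k) xi) /\
    (forall x k, psd (sl x k) /\ sl x k *m sl x k = a x k - lambda0%:M) /\
    0 < delta0 /\ 0 < H /\
    (forall r, 0 <= r -> r <= delta0 -> 0 <= theta r) /\
    (theta r @[r --> 0^'+] --> 0) /\
    (forall k x z, enorm (x - z) <= delta0 ->
       2 * inner (x - z) (b x k - b z k) + hs2 (sl x k - sl z k)
       <= 2 * H * enorm (x - z) * theta (enorm (x - z))) /\
    (forall k x z, enorm (x - z) <= delta0 ->
       (tv_integral (@enorm R d) (nu x k) (nu z k) (@Rd0 R d)
        <= (H / 2 * theta (enorm (x - z)))%:E)%E).

(* Main.v *)
(** The proof is a dual form of coupling by reflection, and needs neither the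
    Feller property nor a coupling of the two processes.

    Mollified functions [S f] are test functions, and on a ball the generator
    [A (S f)] is uniformly close to [S (G f)], where [G] is the generator of a
    compound Poisson process whose coefficients are frozen at the current point.
    For two such generators frozen at [y] and [y'], the drift, the diffusion
    [sl] and the common part of the jumps are coupled synchronously, and the part
    [lambda0 I] of the diffusion, realised as a fine random walk, is coupled by
    reflection (a Lindeberg replacement turns the walk into one with reflected
    steps).  With [R = sqrt (|w|^2 + eta^2)], this shows that the relation
    [f x - g x' <= (1 / s + kap) * R / (1 + lam * R) + beta], for [w = x - x'],
    is preserved when a time step [delta] is added to [s], up to an increase of
    [beta] by [delta * bbar], provided that [f] and [g] are replaced by their
    transforms with respect to this cost.  The increase of [1 / s] is paid for
    by the strict concavity of the cost, and only [theta -> 0] is used.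

    Iterating over a grid of [0, T] with the martingale property bounds
    [E_x f - E_z f] by [(1 / T + kap) * |x - z|] plus a small error, for all
    Lipschitz [f] with values in [0, 1], uniformly in the Lipschitz constant,
    because [1 / s] may start from an arbitrarily large value.  Borel functions
    are then approximated by Lipschitz functions in [L^1] of both laws at time
    [T]. *)

Require Import Defs.
From HB Require Import structures.
From mathcomp Require Import all_boot all_order all_algebra.
From mathcomp Require Import all_classical all_reals all_analysis.
From mathcomp Require Import measurable_realfun.
From mathcomp Require Import ring lra zify.
Import Order.TTheory GRing.Theory Num.Theory.
Import numFieldNormedType.Exports.
Set Implicit Arguments. Unset Strict Implicit. Unset Printing Implicit Defensive.
Local Open Scope classical_set_scope.
Local Open Scope ring_scope.

(** * Euclidean norm and Lipschitz functions *)

Section euclid.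
Context {R : realType} {d : nat}.
Implicit Types (x y z u v w : 'rV[R]_d) (a c : R).

(** A mollified function averages over positions [x] while the generator is evaluated at a nearby
    [y]; the relation is therefore proved for all pairs with [y] close to [x] and [y'] close to
    [x'], and the cost transform takes a supremum over [y]. Since the functions have values in
    [0, 1], only displacements of cost below 1 matter. There [lam * R <= 1], which brings the points
    into the range of the local assumption, and [psi R <= s + delta], so that the change of [1 / s]
    costs at most [1 / s] per unit time: this is at most the cost coefficient, and the reflected
    walk outweighs it when [lam] is large. Within distance [r1] of the diagonal no reflection is
    used, and [theta] is so small there that the cost goes into [beta]. As the coefficients are
    bounded only on balls, localisation is asymmetric: the first law is restricted to paths staying
    in a ball, whereas the second needs a lower bound of nonnegative functions, which the positive
    maximum principle supplies far away. *)

Lemma innerC x y : inner x y = inner y x.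
Proof. by apply: eq_bigr => i _; rewrite mulrC. Qed.

Lemma innerDl x y z : inner (x + y) z = inner x z + inner y z.
Proof. by rewrite -big_split; apply: eq_bigr => i _; rewrite /= !mxE mulrDl. Qed.

Lemma innerZl a x y : inner (a *: x) y = a * inner x y.
Proof. by rewrite /inner big_distrr; apply: eq_bigr => i _; rewrite /= !mxE mulrA. Qed.

Lemma innerNl x y : inner (- x) y = - inner x y.
Proof. by rewrite -scaleN1r innerZl mulN1r. Qed.

Lemma innerBl x y z : inner (x - y) z = inner x z - inner y z.
Proof. by rewrite innerDl innerNl. Qed.

Lemma innerDr x y z : inner x (y + z) = inner x y + inner x z.
Proof. by rewrite innerC innerDl !(innerC _ x). Qed.

Lemma innerZr a x y : inner x (a *: y) = a * inner x y.
Proof. by rewrite innerC innerZl innerC. Qed.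

Lemma innerNr x y : inner x (- y) = - inner x y.
Proof. by rewrite innerC innerNl innerC. Qed.

Lemma innerBr x y z : inner x (y - z) = inner x y - inner x z.
Proof. by rewrite innerDr innerNr. Qed.

Lemma inner0l x : inner 0 x = 0.
Proof. by rewrite -(scale0r 0) innerZl mul0r. Qed.

Lemma inner0r x : inner x 0 = 0.
Proof. by rewrite innerC inner0l. Qed.

Lemma innerxx_ge0 x : 0 <= inner x x.
Proof. by apply: sumr_ge0 => i _; rewrite -expr2 sqr_ge0. Qed.

Lemma inner_sumr (I : Type) (r : seq I) (P : pred I) (F : I -> 'rV[R]_d) x :
  inner x (\sum_(i <- r | P i) F i) = \sum_(i <- r | P i) inner x (F i).
Proof.
elim/big_rec2: _ => [|i y1 y2 _ <-]; first by rewrite inner0r.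
by rewrite innerDr.
Qed.

Lemma enorm_ge0 x : 0 <= enorm x.
Proof. exact: sqrtr_ge0. Qed.
Hint Resolve enorm_ge0 : core.

Lemma sqr_enorm x : enorm x ^+ 2 = inner x x.
Proof. by rewrite sqr_sqrtr ?innerxx_ge0. Qed.

Lemma enorm0 : enorm (0 : 'rV[R]_d) = 0.
Proof. by rewrite /enorm inner0l sqrtr0. Qed.

Lemma enormN x : enorm (- x) = enorm x.
Proof. by rewrite /enorm innerNl innerNr opprK. Qed.

Lemma enormB x y : enorm (x - y) = enorm (y - x).
Proof. by rewrite -enormN opprB. Qed.

Lemma enormZ a x : enorm (a *: x) = `|a| * enorm x.
Proof. by rewrite /enorm innerZl innerZr mulrA sqrtrM -?expr2 ?sqr_ge0// sqrtr_sqr. Qed.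

Lemma cauchy_schwarz x y : `|inner x y| <= enorm x * enorm y.
Proof.
have [x0|x0] := eqVneq (inner x x) 0.
  have -> : inner x y = 0.
    have {}x0 : forall i, x 0 i = 0.
      move=> i; move/eqP: x0; rewrite psumr_eq0 => [|j _]; last by rewrite -expr2 sqr_ge0.
      by move/allP/(_ i); rewrite mem_index_enum => /(_ erefl); rewrite mulf_eq0 orbb => /eqP.
    by rewrite /inner big1// => i _; rewrite x0 mul0r.
  by rewrite normr0 mulr_ge0.
have xp : 0 < inner x x by rewrite lt_def x0 innerxx_ge0.
rewrite -(@ler_pXn2r _ 2)// ?nnegrE ?mulr_ge0// real_normK ?num_real// exprMn !sqr_enorm.
have := innerxx_ge0 (inner x x *: y - inner x y *: x).
rewrite innerBl !innerBr !innerZl !innerZr (innerC y x).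
set A := inner x x in xp *; set B := inner x y; set C := inner y y => h.
have : 0 <= A * (A * C - B ^+ 2) by apply: le_trans h _; rewrite le_eqVlt; apply/orP; left; apply/eqP; ring.
by rewrite pmulr_rge0// subr_ge0.
Qed.

Lemma inner_le x y : inner x y <= enorm x * enorm y.
Proof. exact: le_trans (ler_norm _) (cauchy_schwarz _ _). Qed.

Lemma enormD x y : enorm (x + y) <= enorm x + enorm y.
Proof.
rewrite -(@ler_pXn2r _ 2)// ?nnegrE ?addr_ge0// sqr_enorm innerDl !innerDr (innerC y x).
rewrite sqrrD !sqr_enorm; have := inner_le x y; lra.
Qed.

Lemma enorm_tri x y z : enorm (x - z) <= enorm (x - y) + enorm (y - z).
Proof. by rewrite -[x - z](subrKA y) enormD. Qed.

Lemma enorm_triB x y : enorm (x - y) <= enorm x + enorm y.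
Proof. by rewrite -(enormN y) enormD. Qed.

Lemma enorm_lip x y : `|enorm x - enorm y| <= enorm (x - y).
Proof.
rewrite ler_norml; have := enormD (x - y) y; have := enormD (y - x) x.
rewrite !subrK (enormB y x); lra.
Qed.

Lemma enorm_evec (i : 'I_d) : enorm (evec R i) = 1.
Proof.
rewrite /enorm /inner (bigD1 i)//= big1 => [|j ji]; rewrite /evec !mxE/= ?eqxx/=.
  by rewrite mul1r addr0 sqrtr1.
by rewrite (negbTE ji) mul0r.
Qed.

Lemma inner_evecr x (i : 'I_d) : inner x (evec R i) = x 0 i.
Proof.
rewrite /inner (bigD1 i)//= big1 => [|j ji]; rewrite /evec !mxE/= ?eqxx/= ?mulr1 ?addr0//.
by rewrite (negbTE ji) mulr0.
Qed.

Lemma coord_le_enorm x (i : 'I_d) : `|x 0 i| <= enorm x.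
Proof. by rewrite -inner_evecr; apply: le_trans (cauchy_schwarz _ _) _; rewrite enorm_evec mulr1. Qed.

Lemma row_sum_evec x : x = \sum_(i < d) x 0 i *: evec R i.
Proof. by rewrite {1}(row_sum_delta x). Qed.

Lemma enorm_sum (I : Type) (r : seq I) (P : pred I) (F : I -> 'rV[R]_d) :
  enorm (\sum_(i <- r | P i) F i) <= \sum_(i <- r | P i) enorm (F i).
Proof.
elim/big_rec2: _ => [|i y1 y2 _ le12]; first by rewrite enorm0.
by apply: le_trans (enormD _ _) _; rewrite lerD2l.
Qed.

Lemma enorm_le_sum x : enorm x <= \sum_(i < d) `|x 0 i|.
Proof.
rewrite {1}(row_sum_evec x); apply: le_trans (enorm_sum _ _ _) _.
by apply: ler_sum => i _; rewrite enormZ enorm_evec mulr1.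
Qed.

Lemma enorm_eq0 x : enorm x = 0 -> x = 0.
Proof.
move=> x0; apply/rowP => i; rewrite mxE; apply/eqP.
by have := coord_le_enorm x i; rewrite x0 normr_le0.
Qed.

Lemma enorm_le_norm x : enorm x <= d%:R * `|x|.
Proof.
apply: le_trans (enorm_le_sum x) _.
apply: (@le_trans _ _ (\sum_(i < d) `|x|)).
  by apply: ler_sum => i _; rewrite [leRHS]mx_normrE; apply: le_trans (le_bigmax _ _ (0, i)).
by rewrite sumr_const card_ord mulr_natl.
Qed.

Lemma norm_le_enorm x : `|x| <= enorm x.
Proof.
rewrite [leLHS]mx_normrE; apply: bigmax_le => //= -[i j] _ /=.
by rewrite (ord1 i) coord_le_enorm.
Qed.

Definition elip (K : R) (F : 'rV[R]_d -> R) := forall x y, `|F x - F y| <= K * enorm (x - y).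

Lemma elip_continuous K F : 0 <= K -> elip K F -> continuous F.
Proof.
move=> K0 FK x; have FF : Filter (nbhs x) by exact: nbhs_filter.
apply/(@cvgrPdist_le _ _ _ (nbhs x)) => e e0.
have Kp : 0 < K + 1 by rewrite ltr_wpDl.
have dp : 0 < d.+1%:R :> R by [].
have e'0 : 0 < d.+1%:R^-1 * ((K + 1)^-1 * e) by rewrite !mulr_gt0 ?invr_gt0.
have /cvgr_dist_le/(_ _ e'0) : id y @[y --> x] --> x by exact: cvg_id.
apply: filterS => y /=; rewrite ler_pdivlMl// ler_pdivlMl// => xy.
apply: le_trans (FK x y) _; apply: le_trans _ xy.
apply: ler_pM => //; first by rewrite lerDl.
by apply: le_trans (enorm_le_norm _) _; rewrite ler_wpM2r// ler_nat.
Qed.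

End euclid.
#[export] Hint Resolve enorm_ge0 : core.

(** * Mollification *)

Section derivatives.
Context {R : realType}.

(** A quadratic Taylor remainder suffices for differentiability along [v]. The derivatives of
    mollified functions are obtained from such estimates, which avoids differentiating under an
    integral. *)
Lemma is_derive_quad (V : normedModType R) (f : V -> R) (x v : V) (l C rho : R) :
  0 < rho -> (forall h, `|h| <= rho -> `|f (h *: v + x) - f x - h * l| <= C * h ^+ 2) ->
  is_derive x v f l.
Proof.
move=> rho0 H.
suff cv : h^-1 *: (f (h *: v + x) - f x) @[h --> 0^'] --> (l : R^o).
  apply: DeriveDef; first by apply/cvg_ex; exists l.
  exact: cvg_lim cv.
apply/cvgrPdist_le => e e0.
near=> h.
have h0 : h != 0 by near: h; exact: nbhs_dnbhs_neq.
have hr : `|h| <= rho by near: h; apply: dnbhs0_le.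
have he : `|C| * `|h| <= e.
  have : `|h| <= (`|C| + 1)^-1 * e by near: h; apply: dnbhs0_le; rewrite mulr_gt0 ?invr_gt0 ?ltr_wpDl.
  rewrite ler_pdivlMl ?ltr_wpDl// => /(le_trans _); apply.
  by rewrite ler_wpM2r// lerDl.
have -> : l - h^-1 *: (f (h *: v + x) - f x) = - (h^-1 * (f (h *: v + x) - f x - h * l)).
  by rewrite /GRing.scale/=; field.
rewrite normrN normrM normfV ler_pdivrMl ?normr_gt0//.
apply: le_trans (H h hr) _.
rewrite -(ger0_norm (sqr_ge0 h)) normrX expr2 mulrA.
rewrite (mulrC `|h| e) ler_wpM2r//; apply: le_trans he.
by rewrite ler_wpM2r// ler_norm.
Unshelve. all: by end_near. Qed.

Lemma MVT_bound (f df : R -> R) (B : R) (x y : R) :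
  (forall s : R, is_derive s 1 f (df s)) ->
  (forall s, Num.min x y <= s <= Num.max x y -> `|df s| <= B) ->
  `|f y - f x| <= B * `|y - x|.
Proof.
move=> fdf dfB; have cf : continuous f.
  by move=> s; apply/differentiable_continuous/derivable1_diffP; apply: ex_derive.
wlog xy : x y dfB / x <= y.
  move=> W; have [xy|/ltW yx] := leP x y; first exact: W.
  by rewrite distrC (distrC y); apply: W => //; rewrite minC maxC.
have [c] := @MVT_segment _ f df x y xy (fun s _ => fdf s) (continuous_subspaceT cf).
rewrite in_itv/= => cxy ->; rewrite normrM ler_wpM2r// dfB//.
by rewrite (min_idPl xy) (max_idPr xy).
Qed.

End derivatives.

(** * A smooth compactly supported kernel and its derivatives *)

Section bump.
Context {R : realType}.
Implicit Types (p q : {poly R}) (s t : R).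

(** Polynomials in [1 / s] times [exp (- 1 / s)], extended by 0 to [s <= 0]: a class closed under
    differentiation. *)
Definition flat p s : R := if 0 < s then p.[s^-1] * expR (- s^-1) else 0.

(** Comparison with one term of the exponential series, of degree one more than [size p], leaves a
    spare factor [1 / x]. *)
Lemma poly_expR_bound p : exists C : R, 0 <= C /\ forall x, 1 <= x -> `|p.[x] * expR (- x)| <= C * x^-1.
Proof.
exists ((\sum_(i < size p) `|p`_i|) * (size p).+1`!%:R); split.
  by rewrite mulr_ge0 ?sumr_ge0.
move=> x x1; have x0 : 0 < x by apply: lt_le_trans x1.
rewrite ler_pdivlMr// normrM (ger0_norm (expR_ge0 _)) expRN mulrAC ler_pdivrMr ?expR_gt0//.
have E : x ^+ (size p).+1 <= (size p).+1`!%:R * expR x.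
  have := expR_ge1Dxn (size p) (ltW x0); set e := expR x.
  rewrite -ler_pdivrMl ?ltr0n ?fact_gt0// mulrC; lra.
apply: le_trans (_ : (\sum_(i < size p) `|p`_i|) * x ^+ (size p).+1 <= _); last first.
  by rewrite -mulrA ler_wpM2l// sumr_ge0.
rewrite exprSr mulrA ler_wpM2r ?(ltW x0)// horner_coef.
apply: le_trans (ler_norm_sum _ _ _) _; rewrite mulr_suml ler_sum// => i _.
rewrite normrM ler_wpM2l// normrX (ger0_norm (ltW x0)) ler_weXn2l//.
exact: ltnW.
Qed.

(** The action of d/ds on the polynomial: the derivative of [p(1/s) exp(-1/s)] is
    [s^-2 (p - p')(1/s) exp(-1/s)]. *)
Definition dflat p : {poly R} := 'X ^+ 2 * (p - p^`()).

(** Quadratic flatness at the junction point 0, where [is_derive_quad] is applied. One extra factor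
    ['X] turns the bound [C / x] at [x = 1 / s] into [C * s ^+ 2]. *)
Lemma flat_bound p : exists C : R, forall s, `|s| <= 1 -> `|flat p s| <= C * s ^+ 2.
Proof.
have [C [C0 H]] := poly_expR_bound (p * 'X); exists C => s s1; rewrite /flat.
case: ifP => [s0|_]; last by rewrite normr0 mulr_ge0 ?sqr_ge0.
have i1 : 1 <= s^-1 by rewrite invf_ge1//; apply: le_trans s1; exact: ler_norm.
have := H _ i1; rewrite hornerMX invrK mulrAC normrM (@gtr0_norm _ s^-1) ?invr_gt0//.
by rewrite ler_pdivrMr// -mulrA -expr2.
Qed.

Lemma is_derive_flat p s : is_derive s 1 (flat p) (flat (dflat p) s).
Proof.
have [s0|s0|->] := ltrgtP s 0.
- have -> : flat (dflat p) s = 0 by rewrite /flat ltNge (ltW s0).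
  apply: (@is_derive_quad _ _ _ _ _ _ 0 (- s / 2)); first by lra.
  move=> h; rewrite ler_norml => /andP[h1 h2].
  rewrite /GRing.scale/= /flat !ifF ?mulr0 ?subr0 ?normr0 ?mul0r//; apply/negbTE; rewrite -leNgt; lra.
- have sn : s != 0 by rewrite gt_eqF.
  apply: (@near_eq_is_derive _ _ _ (fun t => p.[t^-1] * expR (- t^-1))).
    by near=> t; rewrite /flat ifT//; near: t; exact: lt_nbhsr.
  have di : is_derive s 1 (fun t : R => t^-1) (- s ^- 2).
    have := @is_deriveV R id s 1 1 sn (is_derive_id _ _).
    by rewrite /GRing.scale/= mulr1.
  have d1 : is_derive s 1 (horner p \o (fun t : R => t^-1)) (p^`().[s^-1] * - s ^- 2).
    exact: is_derive1_comp.
  have d2 : is_derive s 1 (expR \o (fun t : R => - t^-1)) (expR (- s^-1) * s ^- 2).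
    apply: is_derive1_comp.
    by have := is_deriveN di; rewrite opprK.
  have := is_deriveM d1 d2.
  rewrite /flat s0 /dflat /GRing.scale/= !hornerE/=.
  set a := p.[_]; set b := p^`().[_]; set c := expR _.
  have -> : a * c * s ^- 2 + c * b * - s ^- 2 = s^-1 ^+ 2 * (a - b) * c.
    by rewrite exprVn; ring.
  by [].
have -> : flat (dflat p) 0 = 0 by rewrite /flat ltxx.
have [C HC] := flat_bound p.
apply: (@is_derive_quad _ _ _ _ _ _ C 1) => // h h1.
rewrite /GRing.scale/= mulr1 addr0 mulr0 subr0 [flat p 0]/flat ltxx subr0.
exact: HC.
Unshelve. all: by end_near. Qed.

(** Leibniz expansion: the pairs [(p, q)] whose products [flat p (1 + s) * flat q (1 - s)] sum to
    the [n]-th derivative of [exp(-1/(1+s)) exp(-1/(1-s))]. The sign coming from the inner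
    derivative of [1 - s] is carried by the first factor. *)
Fixpoint bumplist n : seq ({poly R} * {poly R}) :=
  if n is n'.+1 then
    flatten [seq [:: (dflat pq.1, pq.2); (- pq.1, dflat pq.2)] | pq <- bumplist n']
  else [:: (1, 1)].

Definition bump0 n s : R := \sum_(pq <- bumplist n) flat pq.1 (1 + s) * flat pq.2 (1 - s).

Lemma flatN p s : flat (- p) s = - flat p s.
Proof. by rewrite /flat; case: ifP; rewrite ?oppr0// hornerN mulNr. Qed.

Lemma is_derive_bump0 n s : is_derive s 1 (bump0 n) (bump0 n.+1 s).
Proof.
rewrite /bump0 /=; elim: (bumplist n) => [|[p q] l IH].
  rewrite /= big_nil.
  have -> : (fun s => \sum_(pq <- [::]) flat pq.1 (1 + s) * flat pq.2 (1 - s)) = cst 0.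
    by apply/funext => t; rewrite big_nil.
  exact: is_derive_cst.
have -> : (fun s => \sum_(pq <- (p, q) :: l) flat pq.1 (1 + s) * flat pq.2 (1 - s)) =
   (fun s => flat p (1 + s) * flat q (1 - s)) \+ (fun s => \sum_(pq <- l) flat pq.1 (1 + s) * flat pq.2 (1 - s)).
  by apply/funext => t; rewrite big_cons.
rewrite /= !big_cons /= addrA; apply: is_deriveD.
have d1 : is_derive s 1 (flat p \o (fun t => 1 + t)) (flat (dflat p) (1 + s) * 1).
  apply: is_derive1_comp; first exact: is_derive_flat.
  by have := is_deriveD (is_derive_cst (1 : R) s 1) (is_derive_id s 1); rewrite add0r.
have d2 : is_derive s 1 (flat q \o (fun t => 1 - t)) (flat (dflat q) (1 - s) * (- 1)).
  apply: is_derive1_comp; first exact: is_derive_flat.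
  by have := is_deriveB (is_derive_cst (1 : R) s 1) (is_derive_id s 1); rewrite sub0r.
have := is_deriveM d1 d2; rewrite /GRing.scale/= flatN.
set a := flat p _; set b := flat q _; set c := flat (dflat p) _; set e := flat (dflat q) _.
by have -> : a * (e * -1) + b * (c * 1) = c * b + - a * e by ring.
Qed.

Lemma bump0_supp n s : 1 <= `|s| -> bump0 n s = 0.
Proof.
move=> s1; rewrite /bump0 big1// => -[p q] _ /=.
have [s0|s0] := leP 0 s; move: s1; rewrite ?(ger0_norm s0) ?(ltr0_norm s0) => s1.
  by rewrite {2}/flat ifF ?mulr0//; apply/negbTE; rewrite -leNgt; lra.
by rewrite {1}/flat ifF ?mul0r//; apply/negbTE; rewrite -leNgt; lra.
Qed.

Lemma flat1_ge0 s : 0 <= flat 1 s.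
Proof. by rewrite /flat; case: ifP => // _; rewrite hornerC mul1r expR_ge0. Qed.

Lemma bump00_ge0 s : 0 <= bump0 0 s.
Proof. by rewrite /bump0 /= big_seq1 mulr_ge0// flat1_ge0. Qed.

Lemma bump0_continuous n : continuous (bump0 n).
Proof.
move=> s; apply/differentiable_continuous/derivable1_diffP.
by have := is_derive_bump0 n s => H; apply: ex_derive.
Qed.

Local Notation mu := (@lebesgue_measure R).

Lemma continuous_integrable_itv (f : R -> R) (a b : R) : continuous f ->
  mu.-integrable `[a, b] (EFin \o f).
Proof.
move=> cf; apply: continuous_compact_integrable; first exact: segment_compact.
exact: continuous_subspaceT.
Qed.

Lemma bump0_int_gt0 : 0 < Rintegral mu `[-2, 2] (bump0 0).
Proof.
have h0 : 0 < 2^-1 :> R by lra.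
(* On [[-1/2, 1/2]] both [1 / (1 + s)] and [1 / (1 - s)] are at most 2. *)
set m := expR (- 2) ^+ 2 : R.
apply: (@lt_le_trans _ _ (m * 1)); first by rewrite mulr1 exprn_gt0// expR_gt0.
have -> : m * 1 = Rintegral mu `[-2^-1, 2^-1] (fun=> m).
  rewrite Rintegral_cst//= lebesgue_measure_itv/= lte_fin ifT; last lra.
  by congr (_ * _); rewrite EFinN fineB//=; lra.
have sub : `[-2^-1, 2^-1]%classic `<=` (`[-2, 2]%classic : set R).
  by move=> x /=; rewrite !in_itv/= => /andP[? ?]; apply/andP; split; lra.
apply: (@le_trans _ _ (Rintegral mu `[-2^-1, 2^-1] (bump0 0))).
  apply: le_Rintegral => //.
  - by apply: (continuous_integrable_itv (f := cst m)) => x; exact: cst_continuous.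
  - by apply: continuous_integrable_itv; exact: bump0_continuous.
  move=> x /=; rewrite in_itv/= => /andP[x1 x2].
  rewrite /bump0/= big_seq1 /= /m expr2 /flat !ifT; [|lra|lra].
  rewrite !hornerC !mul1r ler_pM ?expR_ge0// ler_expR lerN2.
    by rewrite -[leRHS]invrK lef_pV2 ?posrE; lra.
  by rewrite -[leRHS]invrK lef_pV2 ?posrE; lra.
have := bump00_ge0; have := @bump0_continuous 0; move: (bump0 0) => f cf f0.
rewrite Rintegral_mkcond [leRHS]Rintegral_mkcond; apply: le_Rintegral => //.
- by rewrite -restrict_EFin; apply/integrable_restrict => //=; rewrite setTI; exact: continuous_integrable_itv.
- by rewrite -restrict_EFin; apply/integrable_restrict => //=; rewrite setTI; exact: continuous_integrable_itv.
move=> x _; rewrite !patchE; case: ifPn => [|_].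
  by rewrite inE => /sub; rewrite -inE => ->.
by case: ifP => // _; exact: f0.
Qed.

(** The [n]-th derivative of a probability density supported in [-1, 1]. The integration interval
    [-2, 2] is wider than the support, so that translating the kernel by [|t| <= 1] moves no mass
    out of it. *)
Definition ker n s : R := (Rintegral mu `[-2, 2] (bump0 0))^-1 * bump0 n s.

Lemma is_derive_ker n s : is_derive s 1 (ker n) (ker n.+1 s).
Proof.
rewrite /ker; set c := _^-1; have H := is_derive_bump0 n s.
exact: (@is_deriveZ _ _ _ (bump0 n) c s 1).
Qed.

Lemma ker_supp n s : 1 <= `|s| -> ker n s = 0.
Proof. by move=> s1; rewrite /ker bump0_supp// mulr0. Qed.

Lemma ker0_ge0 s : 0 <= ker 0 s.
Proof. by rewrite /ker mulr_ge0 ?bump00_ge0// invr_ge0 ltW// bump0_int_gt0. Qed.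

Lemma ker_continuous n : continuous (ker n).
Proof.
move=> s; apply/differentiable_continuous/derivable1_diffP.
by have := is_derive_ker n s => H; apply: ex_derive.
Qed.

Lemma ker0_int : Rintegral mu `[-2, 2] (ker 0) = 1.
Proof.
rewrite /ker RintegralZl//; last by apply: continuous_integrable_itv; exact: bump0_continuous.
by rewrite mulVf// gt_eqF// bump0_int_gt0.
Qed.

Lemma ker_bounded n : exists B : R, 0 <= B /\ forall s, `|ker n s| <= B.
Proof.
have cf : continuous (fun s => `|ker n s|).
  by move=> s; apply: continuous_comp; [exact: ker_continuous|exact: norm_continuous].
have le11 : -1 <= 1 :> R by lra.
have [c _ cP] := @EVT_max R (fun s => `|ker n s|) (-1) 1 le11 (continuous_subspaceT cf).
exists `|ker n c|; split=> // s; have [s1|s1] := leP 1 `|s|; first by rewrite ker_supp// normr0.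
by apply: cP; rewrite in_itv/=; move/ltW: s1; rewrite ler_norml.
Qed.

Lemma ker_taylor n : exists B : R, 0 <= B /\
  forall s t, `|ker n (s - t) - ker n s + t * ker n.+1 s| <= B * t ^+ 2.
Proof.
have [B [B0 HB]] := ker_bounded n.+2; exists B; split=> // s t.
have fd (u : R) : is_derive u 1 (fun v => ker n v - v * ker n.+1 s) (ker n.+1 u - ker n.+1 s).
  apply: is_deriveB; first exact: is_derive_ker.
  have := @is_deriveM R R^o id (cst (ker n.+1 s)) u 1 _ _ (is_derive_id _ _) (is_derive_cst _ _ _).
  by rewrite /GRing.scale/= mulr0 add0r mulr1.
have := @MVT_bound _ _ _ (B * `|t|) s (s - t) fd.
have -> : ker n (s - t) - (s - t) * ker n.+1 s - (ker n s - s * ker n.+1 s) = ker n (s - t) - ker n s + t * ker n.+1 s by ring.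
have -> : s - t - s = - t by ring.
rewrite normrN -mulrA -normrM -expr2 (ger0_norm (sqr_ge0 _)); apply=> u us.
apply: le_trans (@MVT_bound _ _ _ B s u (is_derive_ker n.+1) _) _ => [v _|]; first exact: HB.
rewrite ler_wpM2l//; move: us; rewrite ge_min le_max => /andP[/orP[?|?] /orP[?|?]];
  rewrite ler_norml; have := ler_norm t; have := ler_norm (- t); rewrite normrN; lra.
Qed.

End bump.

(** * Mollification in one coordinate direction *)

Section mollifier.
Context {R : realType} {d : nat}.
Variable eps : R.
Hypothesis eps0 : 0 < eps.
Local Notation V := 'rV[R]_d.
Local Notation mu := (@lebesgue_measure R).
Local Notation e_ := (evec R).
Implicit Types (F G : V -> R) (p v : V) (i j : 'I_d) (n : nat) (al : 'I_d -> nat).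

Lemma lipR_continuous (f : R -> R) (K : R) :
  (forall s t, `|f s - f t| <= K * `|s - t|) -> continuous f.
Proof.
move=> H s; apply/cvgrPdist_le => e e0; near=> t.
apply: le_trans (H s t) _.
have Kp : 0 < `|K| + 1 by rewrite ltr_wpDl.
apply: (@le_trans _ _ ((`|K| + 1) * `|s - t|)).
  by rewrite ler_wpM2r// (le_trans (ler_norm K))// lerDl.
rewrite -ler_pdivlMl//; near: t.
by apply: cvgr_dist_le; [exact: cvg_id|rewrite mulr_gt0 ?invr_gt0].
Unshelve. all: by end_near. Qed.

Lemma cstM_continuous (c : R) (f : R -> R) : continuous f -> continuous (fun s => c * f s).
Proof. by move=> cf s; apply: cvgM; [exact: cvg_cst|exact: cf]. Qed.

Lemma cRintegralD (f g : R -> R) (a b : R) : continuous f -> continuous g ->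
  Rintegral mu `[a, b] (fun s => f s + g s) = Rintegral mu `[a, b] f + Rintegral mu `[a, b] g.
Proof. by move=> cf cg; rewrite RintegralD//; exact: continuous_integrable_itv. Qed.

Lemma cRintegralB (f g : R -> R) (a b : R) : continuous f -> continuous g ->
  Rintegral mu `[a, b] (fun s => f s - g s) = Rintegral mu `[a, b] f - Rintegral mu `[a, b] g.
Proof. by move=> cf cg; rewrite RintegralB//; exact: continuous_integrable_itv. Qed.

Lemma cRintegralZl (f : R -> R) (c a b : R) : continuous f ->
  Rintegral mu `[a, b] (fun s => c * f s) = c * Rintegral mu `[a, b] f.
Proof. by move=> cf; rewrite RintegralZl//; exact: continuous_integrable_itv. Qed.

(** Mollifying one coordinate at a time keeps all integrals one-dimensional; [n] is the order of the
    derivative placed on the kernel. *)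
Definition mT i n F p : R := Rintegral mu `[-2, 2] (fun s => F (p + (eps * s) *: e_ i) * ker n s).

(** An upper bound for the norm of [mT i n], both on suprema and on Lipschitz constants. *)
Definition kI n : R := Rintegral mu `[-2, 2] (fun s => `|ker n s|).

Lemma norm_ker_continuous n : continuous (fun s : R => `|ker n s|).
Proof. by move=> s; apply: continuous_comp; [exact: ker_continuous|exact: norm_continuous]. Qed.

Lemma kI_ge0 n : 0 <= kI n. Proof. exact: Rintegral_ge0. Qed.

Lemma kI0 : kI 0 = 1.
Proof. by rewrite -ker0_int /kI; apply: eq_Rintegral => s _; rewrite ger0_norm ?ker0_ge0. Qed.

Lemma line_continuous K F p i : elip K F -> continuous (fun s => F (p + (eps * s) *: e_ i)).
Proof.
move=> FK; apply: (@lipR_continuous _ (K * eps)) => s t; apply: le_trans (FK _ _) _.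
by rewrite opprD addrACA subrr add0r -scalerBl -mulrBr enormZ enorm_evec mulr1 normrM (gtr0_norm eps0) mulrA.
Qed.

Lemma mT_cont K F n p i : elip K F -> continuous (fun s => F (p + (eps * s) *: e_ i) * ker n s).
Proof. by move=> FK s; apply: cvgM; [exact: line_continuous FK _|exact: ker_continuous]. Qed.

Lemma mT_int K F n p i : elip K F ->
  mu.-integrable `[-2, 2] (EFin \o (fun s => F (p + (eps * s) *: e_ i) * ker n s)).
Proof. by move=> FK; apply: continuous_integrable_itv; exact: mT_cont FK. Qed.

Lemma elipD K L F G : elip K F -> elip L G -> elip (K + L) (fun p => F p + G p).
Proof.
move=> HF HG x y; rewrite opprD addrACA mulrDl.
exact: le_trans (ler_normD _ _) (lerD (HF _ _) (HG _ _)).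
Qed.

Lemma elipZ K F c : elip K F -> elip (`|c| * K) (fun p => c * F p).
Proof. by move=> HF x y; rewrite -mulrBr normrM -mulrA ler_wpM2l. Qed.

Lemma elip_shift K F v : elip K F -> elip K (fun p => F (p + v)).
Proof. by move=> HF x y; apply: le_trans (HF _ _) _; rewrite opprD addrACA subrr addr0. Qed.

Lemma elip_cst c : elip 0 (fun _ : V => c).
Proof. by move=> x y; rewrite subrr normr0 mul0r. Qed.

Lemma mTD K L F G i n p : elip K F -> elip L G ->
  mT i n (fun p => F p + G p) p = mT i n F p + mT i n G p.
Proof.
move=> HF HG; rewrite -RintegralD//; [|exact: mT_int HF|exact: mT_int HG].
by apply: eq_Rintegral => s _; rewrite mulrDl.
Qed.

Lemma mTZ K F c i n p : elip K F -> mT i n (fun p => c * F p) p = c * mT i n F p.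
Proof.
move=> HF; rewrite -RintegralZl//; last exact: mT_int HF.
by apply: eq_Rintegral => s _; rewrite mulrA.
Qed.

Lemma mT_shift F i n p v : mT i n (fun q => F (q + v)) p = mT i n F (p + v).
Proof. by apply: eq_Rintegral => s _; rewrite addrAC. Qed.

Lemma mT_bound K F (M : R) i n p : elip K F ->
  (forall s, `|s| <= 1 -> `|F (p + (eps * s) *: e_ i)| <= M) -> `|mT i n F p| <= M * kI n.
Proof.
move=> HF FM; apply: le_trans (le_normr_Rintegral _ (mT_int n p i HF)) _ => //.
rewrite -RintegralZl//; last by apply: continuous_integrable_itv; exact: norm_ker_continuous.
apply: le_Rintegral => //.
- apply: continuous_integrable_itv => s; apply: cvg_norm; exact: mT_cont HF _.
- by apply: continuous_integrable_itv; apply: cstM_continuous; exact: norm_ker_continuous.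
move=> s _; rewrite normrM; have [s1|/ltW s1] := leP `|s| 1; first by rewrite ler_wpM2r// FM.
by rewrite ker_supp// normr0 !mulr0.
Qed.

Lemma mT_le K L F G i p : elip K F -> elip L G ->
  (forall s, `|s| <= 1 -> F (p + (eps * s) *: e_ i) <= G (p + (eps * s) *: e_ i)) ->
  mT i 0 F p <= mT i 0 G p.
Proof.
move=> HF HG FG; apply: le_Rintegral => //; [exact: mT_int HF|exact: mT_int HG|].
move=> s _; have [s1|/ltW s1] := leP `|s| 1; first by rewrite ler_wpM2r ?ker0_ge0// FG.
by rewrite ker_supp// !mulr0.
Qed.

Lemma mT_ext F G i n p :
  (forall s, `|s| <= 1 -> F (p + (eps * s) *: e_ i) = G (p + (eps * s) *: e_ i)) ->
  mT i n F p = mT i n G p.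
Proof.
move=> FG; apply: eq_Rintegral => s _.
by have [s1|/ltW s1] := leP `|s| 1; [rewrite FG|rewrite ker_supp// !mulr0].
Qed.

Lemma mT_cst c i p : mT i 0 (fun=> c) p = c.
Proof.
rewrite /mT RintegralZl//; first by rewrite ker0_int mulr1.
by apply: continuous_integrable_itv; exact: ker_continuous.
Qed.

Lemma mT_elip K F i n : elip K F -> elip (K * kI n) (mT i n F).
Proof.
move=> HF x y.
have -> : mT i n F x = mT i n (fun q => F (q + (x - y))) y by rewrite mT_shift addrC subrK.
have HG : elip (K + `|-1| * K) (fun q => F (q + (x - y)) + (-1) * F q).
  by apply: elipD; [exact: elip_shift|exact: elipZ].
have := @mT_bound _ _ (K * enorm (x - y)) i n y HG.
rewrite (mTD _ _ _ (elip_shift _ HF) (elipZ _ HF)) (mTZ _ _ _ _ HF) mulN1r mulrAC.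
apply=> s _; rewrite mulN1r; apply: le_trans (HF _ _) _.
by rewrite addrAC subrr add0r.
Qed.

(** Translating [p] by [h *: e_ i] amounts to translating the kernel by [t = h / eps], and the
    kernel, unlike [F], has a Taylor expansion. The remainder therefore depends on [F] only through
    its supremum. *)
Lemma mT_derive n : exists B : R, 0 <= B /\ forall (K : R) F (M : R) i p (h : R), elip K F -> (forall x, `|F x| <= M) ->
  `|h| <= eps ->
  `|mT i n F (p + h *: e_ i) - mT i n F p + h / eps * mT i n.+1 F p| <= B * M * h ^+ 2.
Proof.
have [B [B0 HB]] := @ker_taylor R n.
exists (4 * B / eps ^+ 2); split; first by rewrite divr_ge0 ?sqr_ge0// mulr_ge0.
move=> K F M i p h HF HM hh.
have M0 : 0 <= M by apply: le_trans (HM p); exact: normr_ge0.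
set t := h / eps.
have t1 : `|t| <= 1 by rewrite /t normrM normfV (gtr0_norm eps0) ler_pdivrMr// mul1r.
pose f s := F (p + (eps * s) *: e_ i).
have cf : continuous f by exact: line_continuous HF.
have ckt k : continuous (fun s => f s * ker k (s - t)).
  have ct : continuous (fun s : R => s - t) by move=> s; apply: cvgB; [exact: cvg_id|exact: cvg_cst].
  have ck : continuous (fun s : R => ker k (s - t)).
    by move=> s; exact: (continuous_comp (ct s) (@ker_continuous R k (s - t))).
  by move=> s; apply: cvgM; [exact: cf|exact: ck].
(* Substitution of [s + t] for [s]; as [|t| <= 1], the support of the translated kernel lies in both
   integration intervals. *)
have -> : mT i n F (p + h *: e_ i) = Rintegral mu `[-2, 2] (fun s => f s * ker n (s - t)).
  have lt22 : (-2 : R) <= 2 by lra.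
  have id1 (s : R) : is_derive s 1 (fun u : R => u + t) 1.
    by have := is_deriveD (is_derive_id s 1) (is_derive_cst t s 1); rewrite addr0.
  have dF : derive1 (fun u : R => u + t) = cst 1.
    by apply/funext => s; rewrite derive1E; have H := id1 s; rewrite derive_val.
  have cF : continuous (fun u : R => u + t).
      by move=> s; apply: cvgD; [exact: cvg_id|exact: cvg_cst].
  have := @integration_by_substitution_increasing R (fun u => u + t) (fun s => f s * ker n (s - t)) _ _ lt22.
  rewrite dF.
  move=> H; rewrite /mT /Rintegral [RHS](_ : _ = fine (\int[mu]_(x in `[(-2 + t)%R, (2 + t)%R]) (f x * ker n (x - t))%:E)%E); last first.
    rewrite integral_mkcond [in RHS]integral_mkcond; congr fine; apply: eq_integral => x _.
    have [xt|xt] := leP 1 `|x - t|.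
      by rewrite !patchE; do 2 case: ifP => //; rewrite ker_supp// mulr0.
    move: xt t1; rewrite ltr_norml ler_norml => /andP[? ?] /andP[? ?].
    by rewrite !patchE !ifT// inE/= in_itv/=; apply/andP; split; lra.
  rewrite {}H.
  - congr fine; apply: eq_integral => s _.
    have -> : (((fun s : R => f s * ker n (s - t)) \o +%R^~ t) * cst 1) s = f (s + t) * ker n (s + t - t) * 1 by [].
    rewrite mulr1 /f addrK; congr (F _ * _)%:E.
    by rewrite -addrA -scalerDl; congr (_ + _ *: _); rewrite mulrDr /t mulrCA divff ?gt_eqF// mulr1 addrC.
  - by move=> x y _ _; rewrite ltrD2r.
  - by move=> x _; exact: cvg_cst.
  - exact: is_cvg_cst.
  - exact: is_cvg_cst.
  - split; first by move=> x _; have H := id1 x; exact: ex_derive.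
    + by apply: cvg_at_right_filter; exact: cF.
    + by apply: cvg_at_left_filter; exact: cF.
  - by apply: continuous_subspaceT; exact: ckt.
have cf2 k : continuous (fun s => f s * ker k s) by exact: mT_cont HF.
have cg2 : continuous (fun s => f s * ker n (s - t) - f s * ker n s + t * (f s * ker n.+1 s)).
  move=> s; apply: cvgD; first by apply: cvgB; [exact: ckt|exact: mT_cont HF _].
  by apply: cvgM; [exact: cvg_cst|exact: mT_cont HF _].
have -> : Rintegral mu `[-2, 2] (fun s => f s * ker n (s - t)) - mT i n F p + t * mT i n.+1 F p =
    Rintegral mu `[-2, 2] (fun s => f s * ker n (s - t) - f s * ker n s + t * (f s * ker n.+1 s)).
  rewrite cRintegralD; [|by move=> s; apply: cvgB; [exact: ckt|exact: cf2]|by apply: cstM_continuous; exact: cf2].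
  by rewrite cRintegralB// cRintegralZl.
apply: le_trans (le_normr_Rintegral _ _) _ => //; first exact: continuous_integrable_itv.
(* The factor 4 is the length of [-2, 2]. *)
have -> : 4 * B / eps ^+ 2 * M * h ^+ 2 = Rintegral mu `[-2, 2] (fun=> M * (B * t ^+ 2)).
  rewrite Rintegral_cst//= lebesgue_measure_itv/= lte_fin ifT; last lra.
  rewrite -EFinD /= opprK /t expr_div_n; field; rewrite gt_eqF//.
apply: le_Rintegral => //.
- by apply: continuous_integrable_itv => s; apply: cvg_norm; exact: cg2.
- by apply: (continuous_integrable_itv (f := cst _)) => s; exact: cvg_cst.
move=> s _; have -> : f s * ker n (s - t) - f s * ker n s + t * (f s * ker n.+1 s) =
  f s * (ker n (s - t) - ker n s + t * ker n.+1 s) by ring.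
by rewrite normrM; apply: ler_pM; [exact: normr_ge0|exact: normr_ge0|exact: HM|exact: HB].
Qed.

End mollifier.

(** * Mollification in all coordinates *)

Section multivariate.
Context {R : realType} {d : nat}.
Variable eps : R.
Hypothesis eps0 : 0 < eps.
Local Notation V := 'rV[R]_d.
Local Notation e_ := (evec R).
Implicit Types (F G : V -> R) (p v : V) (i j : 'I_d) (n : nat) (al : 'I_d -> nat) (L : seq 'I_d).

Definition moll L al F : V -> R := foldr (fun i G => mT eps i (al i) G) F L.

Definition kprod L al : R := \prod_(i <- L) kI (al i).

Lemma kprod_ge0 L al : 0 <= kprod L al.
Proof. by apply: prodr_ge0 => i _; exact: kI_ge0. Qed.

Lemma moll_elip K F L al : elip K F -> elip (K * kprod L al) (moll L al F).
Proof.
move=> HF; elim: L => [|i L IH] /=; first by rewrite /kprod big_nil mulr1.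
by rewrite /kprod big_cons mulrC -mulrA [_ * K]mulrC; rewrite mulrC; apply: mT_elip.
Qed.

Lemma moll_bound K F (M : R) L al : elip K F -> (forall x, `|F x| <= M) ->
  forall x, `|moll L al F x| <= M * kprod L al.
Proof.
move=> HF HM; elim: L => [|i L IH] x /=; first by rewrite /kprod big_nil mulr1.
rewrite /kprod big_cons [kI _ * _]mulrC mulrA -/(kprod L al).
by apply: (@mT_bound _ _ _ eps0 _ _ _ _ _ _ (moll_elip L al HF)) => s _; exact: IH.
Qed.

Lemma moll_shift L al F p v : moll L al (fun q => F (q + v)) p = moll L al F (p + v).
Proof.
elim: L p => [//|i L IH] p.
rewrite [LHS](_ : _ = mT eps i (al i) (moll L al (fun q => F (q + v))) p)//.
rewrite [RHS](_ : _ = mT eps i (al i) (moll L al F) (p + v))// -mT_shift.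
by have -> : moll L al (fun q => F (q + v)) = (fun q => moll L al F (q + v)) by apply/funext => q; rewrite IH.
Qed.

Lemma mollD K K' F G L al p : elip K F -> elip K' G ->
  moll L al (fun p => F p + G p) p = moll L al F p + moll L al G p.
Proof.
move=> HF HG; elim: L p => [|i L IH] p //=.
rewrite -(mTD eps0 _ _ _ (moll_elip L al HF) (moll_elip L al HG)); congr (mT _ _ _ _ _).
by apply/funext => q; exact: IH.
Qed.

Lemma mollZ K F c L al p : elip K F -> moll L al (fun p => c * F p) p = c * moll L al F p.
Proof.
move=> HF; elim: L p => [|i L IH] p //=.
rewrite -(mTZ eps0 _ _ _ _ (moll_elip L al HF)); congr (mT _ _ _ _ _).
by apply/funext => q; exact: IH.
Qed.

Definition Sm F : V -> R := moll (enum 'I_d) (fun=> 0%N) F.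

Lemma enorm_epsZ (s : R) i p : `|s| <= 1 -> enorm (p + (eps * s) *: e_ i - p) <= eps.
Proof.
move=> s1; rewrite addrAC subrr add0r enormZ enorm_evec mulr1 normrM (gtr0_norm eps0).
by rewrite ler_piMr// ltW.
Qed.

Lemma moll_le K K' F G L p : elip K F -> elip K' G ->
  (forall x, enorm (x - p) <= eps * (size L)%:R -> F x <= G x) ->
  moll L (fun=> 0%N) F p <= moll L (fun=> 0%N) G p.
Proof.
move=> HF HG; elim: L p => [|i L IH] p FG /=.
  by apply: FG; rewrite subrr enorm0 mulr0.
apply: (mT_le eps0 (moll_elip _ _ HF) (moll_elip _ _ HG)) => s s1; apply: IH => x xp; apply: FG.
apply: le_trans (enorm_tri x (p + (eps * s) *: e_ i) p) _.
by rewrite /= -natr1 mulrDr mulr1 lerD// enorm_epsZ.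
Qed.

Lemma moll_ext F G L al p :
  (forall x, enorm (x - p) <= eps * (size L)%:R -> F x = G x) ->
  moll L al F p = moll L al G p.
Proof.
elim: L p => [|i L IH] p FG /=.
  by apply: FG; rewrite subrr enorm0 mulr0.
apply: mT_ext => s s1; apply: IH => x xp; apply: FG.
apply: le_trans (enorm_tri x (p + (eps * s) *: e_ i) p) _.
by rewrite /= -natr1 mulrDr mulr1 lerD// enorm_epsZ.
Qed.

Lemma moll_cst c L p : moll L (fun=> 0%N) (fun=> c) p = c.
Proof.
elim: L p => [|i L IH] p //=; rewrite -[RHS](mT_cst eps c i p); congr (mT _ _ _ _ _).
by apply/funext => q; exact: IH.
Qed.

Lemma kprod0 L : kprod L (fun=> 0%N) = 1.
Proof. by rewrite /kprod big1// => i _; exact: kI0. Qed.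

Lemma Sm_elip K F : elip K F -> elip K (Sm F).
Proof. by move=> HF; have := moll_elip (enum 'I_d) (fun=> 0%N) HF; rewrite kprod0 mulr1. Qed.

Lemma Sm_le K K' F G p : elip K F -> elip K' G ->
  (forall x, enorm (x - p) <= eps * d%:R -> F x <= G x) -> Sm F p <= Sm G p.
Proof. by move=> HF HG FG; apply: (moll_le HF HG) => x; rewrite size_enum_ord; exact: FG. Qed.

Lemma SmD K K' F G p : elip K F -> elip K' G -> Sm (fun p => F p + G p) p = Sm F p + Sm G p.
Proof. by move=> HF HG; exact: mollD HF HG. Qed.

Lemma SmZ K F c p : elip K F -> Sm (fun p => c * F p) p = c * Sm F p.
Proof. by move=> HF; exact: mollZ HF. Qed.

Lemma Sm_shift F p v : Sm (fun q => F (q + v)) p = Sm F (p + v).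
Proof. exact: moll_shift. Qed.

Lemma Sm_cst c p : Sm (fun=> c) p = c. Proof. exact: moll_cst. Qed.

Lemma Sm_ext F G p : (forall x, enorm (x - p) <= eps * d%:R -> F x = G x) -> Sm F p = Sm G p.
Proof. by move=> FG; apply: moll_ext => x; rewrite size_enum_ord; exact: FG. Qed.

Lemma Sm_ge0 K F p : elip K F -> (forall x, 0 <= F x) -> 0 <= Sm F p.
Proof. by move=> HF F0; rewrite -(Sm_cst 0 p); apply: (Sm_le (elip_cst _) HF). Qed.

Lemma Sm_le1 K F p : elip K F -> (forall x, F x <= 1) -> Sm F p <= 1.
Proof. by move=> HF F0; rewrite -(Sm_cst 1 p); apply: (Sm_le HF (elip_cst _)). Qed.

Lemma Sm_close K F p : 0 <= K -> elip K F -> `|Sm F p - F p| <= K * (eps * d%:R).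
Proof.
move=> K0 HF; rewrite ler_distl; apply/andP; split.
  rewrite -(Sm_cst (F p - _) p); apply: (Sm_le (elip_cst _) HF) => x xp.
  have := HF x p; rewrite ler_distl => /andP[H _]; apply: le_trans H.
  by rewrite lerD2l lerN2 ler_wpM2l.
rewrite -(Sm_cst (F p + _) p); apply: (Sm_le HF (elip_cst _)) => x xp.
have := HF x p; rewrite ler_distl => /andP[_ H]; apply: le_trans H _.
by rewrite lerD2l ler_wpM2l.
Qed.

Definition incr al j : 'I_d -> nat := fun i => (al i + (i == j))%N.

Lemma moll_incr_notin L al j F : j \notin L -> moll L (incr al j) F = moll L al F.
Proof.
elim: L => [|i L IH] //=; rewrite inE negb_or => /andP[ji jL]; rewrite IH//.
by rewrite /incr [i == j]eq_sym (negbTE ji) addn0.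
Qed.

(** If the head of the list mollifies in direction [j], its kernel is expanded by [mT_derive];
    otherwise the remainder obtained for the tail is averaged by the linear map [mT]. As the list is
    duplicate-free, exactly one factor is differentiated. *)
Lemma moll_derive L al j : uniq L -> j \in L -> exists B : R, 0 <= B /\
  forall (K : R) F (M : R) p (h : R), elip K F -> (forall x, `|F x| <= M) -> `|h| <= eps ->
  `|moll L al F (p + h *: e_ j) - moll L al F p + h / eps * moll L (incr al j) F p| <= B * M * h ^+ 2.
Proof.
elim: L => [|i L IH] //= /andP[iL uL]; rewrite inE => /orP[/eqP ji|jL].
  subst i.
  have [B [B0 HB]] := @mT_derive R d eps eps0 (al j).
  exists (B * kprod L al); split; first by rewrite mulr_ge0 ?kprod_ge0.
  move=> K F M p h HF HM hh; rewrite -(mulrA B) [kprod _ _ * M]mulrC.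
  have -> : incr al j j = (al j).+1 by rewrite /incr eqxx addn1.
  rewrite moll_incr_notin//.
  exact: HB (moll_elip L al HF) (moll_bound L al HF HM) hh.
have {IH}[B [B0 HB]] := IH uL jL.
exists (B * kI (al i)); split; first by rewrite mulr_ge0 ?kI_ge0.
move=> K F M p h HF HM hh.
have ij : i != j by apply: contraNneq iL => ->.
have -> : incr al j i = al i by rewrite /incr (negbTE ij) addn0.
set G := moll L al F; set G' := moll L (incr al j) F.
have HG : elip _ G := moll_elip L al HF.
have HG' : elip _ G' := moll_elip L (incr al j) HF.
have HGs := elip_shift (h *: e_ j) HG.
have H1 := elipD HGs (elipZ (-1) HG).
have -> : mT eps i (al i) G (p + h *: e_ j) - mT eps i (al i) G p + h / eps * mT eps i (al i) G' p =
  mT eps i (al i) (fun q => (G (q + h *: e_ j) + (-1) * G q) + h / eps * G' q) p.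
  rewrite (mTD eps0 _ _ _ H1 (elipZ _ HG')) (mTZ eps0 _ _ _ _ HG').
  by rewrite (mTD eps0 _ _ _ HGs (elipZ _ HG)) (mTZ eps0 _ _ _ _ HG) mT_shift mulN1r.
have -> : B * kI (al i) * M * h ^+ 2 = B * M * h ^+ 2 * kI (al i) by ring.
apply: (@mT_bound _ _ _ eps0 _ _ _ _ _ _ (elipD H1 (elipZ _ HG'))) => s _.
by rewrite mulN1r; exact: HB HF HM hh.
Qed.

Lemma is_derive_moll K F (M : R) al j p : elip K F -> (forall x, `|F x| <= M) ->
  is_derive p (e_ j) (moll (enum 'I_d) al F) (- eps^-1 * moll (enum 'I_d) (incr al j) F p).
Proof.
move=> HF HM; have [B [B0 HB]] := moll_derive al (enum_uniq 'I_d) (mem_enum 'I_d j).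
apply: (@is_derive_quad _ _ _ _ _ _ (B * M) eps) => // h hh.
rewrite [h *: _ + p]addrC; have := HB K F M p h HF HM hh.
by congr (`|_| <= _); ring.
Qed.

Definition alphas (l : seq 'I_d) : 'I_d -> nat := foldr (fun j al => incr al j) (fun=> 0%N) l.

Lemma iter_pd_Sm K F (M : R) l : elip K F -> (forall x, `|F x| <= M) ->
  iter_pd l (Sm F) = fun p => (- eps^-1) ^+ size l * moll (enum 'I_d) (alphas l) F p.
Proof.
move=> HF HM; elim: l => [|j l IH]; first by apply/funext => p; rewrite expr0 mul1r.
apply/funext => p; rewrite /= IH /pd.
have D := is_derive_moll (alphas l) j p HF HM.
have D' := @is_deriveZ _ _ _ (moll (enum 'I_d) (alphas l) F) ((- eps^-1) ^+ size l) p (e_ j) _.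
rewrite (_ : (fun q : V => _) = (- eps^-1) ^+ size l \*: moll (enum 'I_d) (alphas l) F) //.
by rewrite derive_val /GRing.scale/= mulrA -exprSr.
Qed.

Lemma iter_pd_Sm_derive K F (M : R) l j p : elip K F -> (forall x, `|F x| <= M) ->
  is_derive p (e_ j) (iter_pd l (Sm F)) (iter_pd (j :: l) (Sm F) p).
Proof.
move=> HF HM; rewrite !(iter_pd_Sm _ HF HM) /=.
have D := is_derive_moll (alphas l) j p HF HM.
rewrite exprSr -mulrA.
exact: (@is_deriveZ _ _ _ (moll (enum 'I_d) (alphas l) F) ((- eps^-1) ^+ size l) p (e_ j) _ D).
Qed.

Lemma Sm_smooth K F (M : R) : 0 <= K -> elip K F -> (forall x, `|F x| <= M) -> smooth (Sm F).
Proof.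
move=> K0 HF HM l; split; last by move=> i x; have H := iter_pd_Sm_derive l i x HF HM; exact: ex_derive.
rewrite (iter_pd_Sm _ HF HM); apply: elip_continuous; last exact/elipZ/moll_elip/HF.
by rewrite mulr_ge0// mulr_ge0// kprod_ge0.
Qed.

Lemma Sm_supp F (r : R) p : (forall x, r < enorm x -> F x = 0) -> r + eps * d%:R < enorm p -> Sm F p = 0.
Proof.
move=> F0 rp; rewrite -(Sm_cst 0 p); apply: Sm_ext => x xp; apply: F0.
have := enorm_lip p x; rewrite enormB => /(le_trans (ler_norm _)); lra.
Qed.

Lemma Sm_Cc K F (M r : R) : 0 <= K -> elip K F -> (forall x, `|F x| <= M) ->
  (forall x, r < enorm x -> F x = 0) -> Cc_infty (Sm F).
Proof.
move=> K0 HF HM F0; split; first exact: Sm_smooth HF HM.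
by exists (r + eps * d%:R) => x; exact: Sm_supp.
Qed.

End multivariate.

(** * Uniform derivative bounds and Taylor estimates *)

Section regular.
Context {R : realType} {d : nat}.
Local Notation V := 'rV[R]_d.
Local Notation e_ := (evec R).
Implicit Types (F G : V -> R) (p v : V) (i j : 'I_d).

(** The interface through which the Taylor estimates see a test function. Order 4 serves the second
    differences of the Hessian in [reg_T2sym]. *)
Definition reg (C : R) (phi : V -> R) := 0 <= C /\
  (forall l p, (size l <= 4)%N -> `|iter_pd l phi p| <= C) /\
  (forall l j p, (size l <= 3)%N -> is_derive p (e_ j) (iter_pd l phi) (iter_pd (j :: l) phi p)).

Lemma alphas_le (l : seq 'I_d) i : (alphas l i <= size l)%N.
Proof.
elim: l => //= j l IH; rewrite /incr -addn1 leq_add//.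
by case: (i == j).
Qed.

(** All derivatives fall on the kernel, so [C] depends on [eps] but not on the Lipschitz constant of
    [F]: one constant serves every function of the recursion. *)
Lemma Sm_reg (eps : R) : 0 < eps -> exists C : R, forall (K : R) F,
  elip K F -> (forall x, `|F x| <= 1) -> reg C (Sm eps F).
Proof.
move=> eps0; pose k : R := 1 + \sum_(n < 5) kI n.
have k1 : 1 <= k by rewrite lerDl sumr_ge0// => n _; exact: kI_ge0.
have kk n : (n <= 4)%N -> kI n <= k.
  move=> n4; rewrite /k (bigD1 (Ordinal (n4 : (n < 5)%N)))//=.
  have : 0 <= \sum_(i < 5 | i != Ordinal (n4 : (n < 5)%N)) (kI i : R) by apply: sumr_ge0 => i _; exact: kI_ge0.
  lra.
pose e1 := 1 + eps^-1.
have e11 : 1 <= e1 by rewrite lerDl invr_ge0 ltW.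
have ee : eps^-1 <= e1 by rewrite lerDr.
exists (e1 ^+ 4 * k ^+ d) => K F HF HM; split; first by rewrite mulr_ge0 ?exprn_ge0//; lra.
split=> [l p sl|l j p sl]; last exact: iter_pd_Sm_derive HF HM.
rewrite (iter_pd_Sm eps0 _ HF HM) normrM ler_pM//.
  rewrite normrX normrN gtr0_norm ?invr_gt0//; apply: (@le_trans _ _ (e1 ^+ size l)).
    by rewrite lerXn2r// nnegrE ?invr_ge0 ?(ltW eps0)//; lra.
  by rewrite ler_weXn2l.
apply: le_trans (moll_bound eps0 _ _ HF HM p) _; rewrite mul1r /kprod.
rewrite -[X in _ ^+ X](size_enum_ord d); elim: (enum 'I_d) => [|i L IH]; first by rewrite big_nil.
rewrite big_cons exprS ler_pM ?kI_ge0 ?kprod_ge0//.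
by apply: kk; apply: leq_trans (alphas_le _ _) sl.
Qed.

Definition l1 v : R := \sum_(i < d) `|v 0 i|.

Lemma l1_le v : l1 v <= d%:R * enorm v.
Proof.
apply: (@le_trans _ _ (\sum_(i < d) enorm v)); first by apply: ler_sum => i _; exact: coord_le_enorm.
by rewrite sumr_const card_ord mulr_natl.
Qed.

Lemma l1_ge0 v : 0 <= l1 v. Proof. exact: sumr_ge0. Qed.

Lemma l1Z (a : R) v : l1 (a *: v) = `|a| * l1 v.
Proof. by rewrite /l1 mulr_sumr; apply: eq_bigr => i _; rewrite mxE normrM. Qed.

Lemma is_derive_line (psi : V -> R) p v (t : R) (c : R) : is_derive (p + t *: v) v psi c ->
  is_derive t 1 (fun s : R => psi (p + s *: v)) c.
Proof.
move=> [H1 H2].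
have E : (fun h : R => h^-1 *: ((fun s : R => psi (p + s *: v)) (h *: (1 : R) + t) - psi (p + t *: v))) =
         (fun h : R => h^-1 *: (psi (h *: v + (p + t *: v)) - psi (p + t *: v))).
  apply/funext => h; congr (_ *: (psi _ - _)).
  have -> : h *: (1 : R) = h by exact: mulr1.
  by rewrite scalerDl addrCA.
apply: DeriveDef; first by rewrite /derivable E.
by rewrite /derive E.
Qed.

Lemma lip_of_partials (psi : V -> R) (g : 'I_d -> V -> R) (C : R) :
  (forall p j, is_derive p (e_ j) psi (g j p)) -> (forall p j, `|g j p| <= C) ->
  forall p v, `|psi (p + v) - psi p| <= C * l1 v.
Proof.
move=> D B p v; rewrite {1}(row_sum_evec v) /l1.
elim: (index_enum _) p => [|i L IH] p; first by rewrite !big_nil addr0 subrr normr0 mulr0.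
rewrite !big_cons addrA mulrDr.
set q := p + _; set w := \sum_(j <- L) _ *: _.
have -> : psi (q + w) - psi p = (psi q - psi p) + (psi (q + w) - psi q) by ring.
apply: le_trans (ler_normD _ _) _; apply: lerD; last exact: IH.
have := @MVT_bound _ (fun s : R => psi (p + s *: e_ i)) (fun s => g i (p + s *: e_ i)) C 0 (v 0 i).
rewrite scale0r addr0 subr0; apply=> [s|s _]; last exact: B.
exact: is_derive_line.
Qed.

(** The displacement is made one coordinate at a time. Moving the expansion point from [p] to [q]
    changes the partial derivatives by at most [C * |a|], and [A^2 + A |a| + |a|^2 <= (A + |a|)^2]
    closes the induction. *)
Lemma taylor1 (psi : V -> R) (g : 'I_d -> V -> R) (C : R) : 0 <= C ->
  (forall p j, is_derive p (e_ j) psi (g j p)) ->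
  (forall p v j, `|g j (p + v) - g j p| <= C * l1 v) ->
  forall p v, `|psi (p + v) - psi p - \sum_(j < d) v 0 j * g j p| <= C * l1 v ^+ 2.
Proof.
move=> C0 D B p v; rewrite {1}(row_sum_evec v) /l1.
elim: (index_enum _) p => [|i L IH] p.
  by rewrite !big_nil addr0 subrr subr0 normr0 expr2 !mulr0.
rewrite !big_cons addrA.
set q := p + _; pose a : R := v 0 i; set w := \sum_(j <- L) _ *: _; pose A : R := \sum_(j <- L) `|v 0 j|.
rewrite -/a -/A.
have A0 : 0 <= A by apply: sumr_ge0.
have -> : psi (q + w) - psi p - (a * g i p + \sum_(j <- L) v 0 j * g j p) =
  (psi (q + w) - psi q - \sum_(j <- L) v 0 j * g j q) +
  \sum_(j <- L) v 0 j * (g j q - g j p) + (psi q - psi p - a * g i p).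
  under [\sum_(j <- L) v 0 j * (_ - _)]eq_bigr do rewrite mulrBr.
  by rewrite sumrB; ring.
have l1a : l1 (a *: e_ i) = `|a|.
  rewrite l1Z /l1 (bigD1 i)//= big1 => [|j ji]; rewrite /evec !mxE/= ?eqxx/=.
    by rewrite normr1 addr0 mulr1.
  by rewrite (negbTE ji) normr0.
apply: (@le_trans _ _ (C * A ^+ 2 + A * (C * `|a|) + C * `|a| * `|a|)); last first.
  rewrite -subr_ge0 (_ : _ - _ = C * (A * `|a|)); first by rewrite !mulr_ge0.
  by ring.
apply: le_trans (ler_normD _ _) _; apply: lerD.
  apply: le_trans (ler_normD _ _) _; apply: lerD; first exact: IH.
  apply: le_trans (ler_norm_sum _ _ _) _; rewrite mulr_suml ler_sum// => j _.
  by rewrite normrM ler_wpM2l// -l1a; exact: B.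
have := @MVT_bound _ (fun s : R => psi (p + s *: e_ i) - s * g i p) (fun s => g i (p + s *: e_ i) - g i p) (C * `|a|) 0 a.
rewrite scale0r addr0 mul0r !subr0.
have -> : psi (p + a *: e_ i) - a * g i p - psi p = psi q - psi p - a * g i p by rewrite addrAC.
apply=> [s|s].
  apply: is_deriveB; first exact: is_derive_line.
  have := @is_deriveM R R^o id (cst (g i p)) s 1 _ _ (is_derive_id _ _) (is_derive_cst _ _ _).
  by rewrite /GRing.scale/= mulr0 add0r mulr1.
rewrite ge_min le_max => H; apply: le_trans (B _ _ _) _.
have -> : l1 (s *: e_ i) = `|s|.
  rewrite l1Z /l1 (bigD1 i)//= big1 => [|j ji]; rewrite /evec !mxE/= ?eqxx/=.
    by rewrite normr1 addr0 mulr1.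
  by rewrite (negbTE ji) normr0.
rewrite ler_wpM2l// ler_norml; move: H => /andP[/orP[?|?] /orP[?|?]];
 have := ler_norm a; have := ler_norm (- a); rewrite normrN; lra.
Qed.

(** The even part of [psi] along [v], minus [Q * t^2], has derivative [g' t - g' (- t) - 2 t Q].
    This is the difference of the first-order remainders of [g'] at [t] and at [- t], since [g' 0]
    cancels. *)
Lemma taylor2 (psi : V -> R) (g : 'I_d -> V -> R) (H : 'I_d -> 'I_d -> V -> R) (C : R) : 0 <= C ->
  (forall p j, is_derive p (e_ j) psi (g j p)) ->
  (forall p v j, `|g j (p + v) - g j p| <= C * l1 v) ->
  (forall p v i, `|g i (p + v) - g i p - \sum_(j < d) v 0 j * H i j p| <= C * l1 v ^+ 2) ->
  forall p v, `|psi (p + v) + psi (p - v) - 2 * psi p - \sum_(i < d) \sum_(j < d) v 0 i * H i j p * v 0 j|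
    <= 2 * C * l1 v ^+ 3.
Proof.
move=> C0 D B T p v.
set Q := \sum_(i < d) _.
pose g' (t : R) := \sum_(j < d) v 0 j * g j (p + t *: v).
have dg (t : R) : is_derive t 1 (fun s : R => psi (p + s *: v)) (g' t).
  apply: is_derive_line; apply: (@is_derive_quad _ _ _ _ _ _ (C * l1 v ^+ 2) 1) => // h _.
  have := taylor1 C0 D B (p + t *: v) (h *: v); rewrite l1Z exprMn real_normK ?num_real//.
  rewrite [_ + h *: v]addrC [h ^+ 2 * _]mulrC mulrA.
  congr (_ <= _); congr (`|_ - _|); rewrite /g' mulr_sumr.
  by apply: eq_bigr => j _; rewrite mxE mulrA.
have dgN (t : R) : is_derive t 1 (fun s : R => psi (p - s *: v)) (- g' (- t)).
  have dN : is_derive t 1 (fun s : R => - s) (- 1) := is_deriveN (is_derive_id t 1).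
  have := @is_derive1_comp _ (fun s : R => psi (p + s *: v)) (fun s : R => - s) t _ _ (dg _) dN.
  rewrite mulrN1; congr (is_derive _ _ _ _); by apply/funext => s /=; rewrite scaleNr.
have dD (t : R) : is_derive t 1 (fun s : R => psi (p + s *: v) + psi (p - s *: v) - Q * (s * s)) (g' t - g' (- t) - Q * (t + t)).
  have dS := is_deriveD (dg t) (dgN t).
  have d1 := @is_deriveM R R^o id id t 1 _ _ (is_derive_id _ _) (is_derive_id _ _).
  have dQ := @is_deriveZ _ _ _ _ Q t 1 _ d1.
  have := is_deriveB dS dQ.
  by rewrite /GRing.scale/= mulr1.
have := @MVT_bound _ _ _ (2 * C * l1 v ^+ 3) 0 1 dD.
rewrite !scale1r !scale0r subr0 addr0 !mulr1 !mulr0 !subr0 normr1 mulr1.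
rewrite (_ : _ - _ - (psi p + psi p) = psi (p + v) + psi (p - v) - 2 * psi p - Q); last by ring.
apply=> t; rewrite (min_idPl ler01) (max_idPr ler01) => /andP[t0 t1].
have E (s : R) : `|s| <= 1 -> `|g' s - g' 0 - s * Q| <= C * l1 v ^+ 3.
  move=> s1; rewrite /g' /Q mulr_sumr -!sumrB.
  apply: (@le_trans _ _ (\sum_(i < d) `|v 0 i| * (C * l1 v ^+ 2))); last first.
    by rewrite -mulr_suml -/(l1 v) mulrCA exprS.
  apply: le_trans (ler_norm_sum _ _ _) _; apply: ler_sum => i _.
  have -> : v 0 i * g i (p + s *: v) - v 0 i * g i (p + 0 *: v) - s * (\sum_(j < d) v 0 i * H i j p * v 0 j) =
     v 0 i * (g i (p + s *: v) - g i p - \sum_(j < d) (s *: v) 0 j * H i j p).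
    rewrite scale0r addr0 !mulrBr; congr (_ - _); rewrite !mulr_sumr; apply: eq_bigr => j _.
    by rewrite mxE; ring.
  rewrite normrM ler_wpM2l//; apply: le_trans (T _ _ _) _; rewrite ler_wpM2l// l1Z exprMn.
  by rewrite ler_piMl ?exprn_ge0 ?l1_ge0// exprn_ile1.
have -> : g' t - g' (- t) - Q * (t + t) = (g' t - g' 0 - t * Q) - (g' (- t) - g' 0 - (- t) * Q) by ring.
apply: le_trans (ler_normB _ _) _; rewrite -mulrA [leRHS]mulr_natl mulr2n.
by apply: lerD; apply: E; rewrite ?normrN ger0_norm.
Qed.

End regular.

(** * Random walks and Lindeberg replacement *)

Section regular_consequences.
Context {R : realType} {d : nat}.
Local Notation V := 'rV[R]_d.
Implicit Types (phi F G : V -> R) (p v : V) (i j : 'I_d).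

Lemma reg_lip C phi l p v : reg C phi -> (size l <= 3)%N ->
  `|iter_pd l phi (p + v) - iter_pd l phi p| <= C * l1 v.
Proof.
move=> [C0 [B D]] sl; apply: (@lip_of_partials _ _ _ (fun j => iter_pd (j :: l) phi)).
  by move=> q j; exact: D.
by move=> q j; apply: B.
Qed.

Lemma reg_T1' C phi l p v : reg C phi -> (size l <= 2)%N ->
  `|iter_pd l phi (p + v) - iter_pd l phi p - \sum_(j < d) v 0 j * iter_pd (j :: l) phi p| <= C * l1 v ^+ 2.
Proof.
move=> rC sl; have [C0 [B D]] := rC.
apply: (@taylor1 _ _ _ (fun j => iter_pd (j :: l) phi)) => //.
  by move=> q j; apply: D; apply: leq_trans sl _.
by move=> q w j; apply: (reg_lip q w rC).
Qed.

Lemma l1_enorm v n : l1 v ^+ n <= (d%:R * enorm v) ^+ n.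
Proof.
by apply: lerXn2r; rewrite ?nnegrE; [exact: l1_ge0|rewrite mulr_ge0 ?enorm_ge0|exact: l1_le].
Qed.

Lemma reg_T1 C phi p v : reg C phi -> `|phi (p + v) - phi p| <= C * (d%:R * enorm v).
Proof.
move=> rC; apply: le_trans (reg_lip (l := [::]) p v rC _) _ => //.
by rewrite ler_wpM2l ?l1_le//; case: rC.
Qed.

Lemma reg_T2 C phi p v : reg C phi ->
  `|phi (p + v) - phi p - inner (grad phi p) v| <= C * (d%:R * enorm v) ^+ 2.
Proof.
move=> rC; have := reg_T1' (l := [::]) p v rC isT => /= H.
apply: le_trans (le_trans H _); last by rewrite ler_wpM2l ?l1_enorm//; case: rC.
have -> : inner (grad phi p) v = \sum_(j < d) v 0 j * pd phi j p by rewrite innerC; apply: eq_bigr => j _; rewrite mxE.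
by [].
Qed.

Lemma reg_T3 C phi p v : reg C phi ->
  `|phi (p + v) + phi (p - v) - 2 * phi p - quadform (hess phi p) v| <= 2 * C * (d%:R * enorm v) ^+ 3.
Proof.
move=> rC; have [C0 [B D]] := rC.
have := @taylor2 _ _ phi (fun j => iter_pd [:: j] phi) (fun i j => iter_pd [:: j; i] phi) C C0
  (fun q j => D [::] j q isT) (fun q w j => reg_lip (l := [:: j]) q w rC isT)
  (fun q w i => reg_T1' (l := [:: i]) q w rC isT) p v => H.
apply: le_trans (le_trans H _); last by rewrite ler_wpM2l ?l1_enorm// mulr_ge0.
have -> : quadform (hess phi p) v = \sum_(i < d) \sum_(j < d) v 0 i * iter_pd [:: j; i] phi p * v 0 j.
  by apply: eq_bigr => i _; apply: eq_bigr => j _; rewrite mxE.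
by [].
Qed.

Lemma second_difference (psi : V -> R) (g : 'I_d -> R) (C : R) p v : 0 <= C ->
  (forall w : V, `|psi (p + w) - psi p - \sum_(j < d) w 0 j * g j| <= C * l1 w ^+ 2) ->
  `|psi (p + v) + psi (p - v) - 2 * psi p| <= 2 * C * (d%:R * enorm v) ^+ 2.
Proof.
move=> C0 H; have H1 := H v; have H2 := H (- v).
have E : \sum_(j < d) (- v) 0 j * g j = - \sum_(j < d) v 0 j * g j.
  by rewrite -sumrN; apply: eq_bigr => k _; rewrite mxE mulNr.
have N : l1 (- v) = l1 v by rewrite -scaleN1r l1Z normrN1 mul1r.
rewrite E N in H2; set S := \sum_(_ < _) _ in H1 H2.
have -> : psi (p + v) + psi (p - v) - 2 * psi p
  = (psi (p + v) - psi p - S) + (psi (p - v) - psi p - - S) by ring.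
apply: le_trans (ler_normD _ _) _; apply: le_trans (lerD H1 H2) _.
have := ler_wpM2l C0 (l1_enorm v 2); lra.
Qed.

Lemma reg_T2sym C phi p v i j : reg C phi ->
  `|hess phi (p + v) i j + hess phi (p - v) i j - 2 * hess phi p i j| <= 2 * C * (d%:R * enorm v) ^+ 2.
Proof.
move=> rC; have C0 : 0 <= C by case: rC.
have hE : iter_pd [:: j; i] phi = (fun q => hess phi q i j) by apply/funext => q; rewrite mxE.
have H w := reg_T1' (l := [:: j; i]) p w rC isT.
have := second_difference v C0 H; rewrite hE; exact.
Qed.

Lemma reg_hess C phi p i j : reg C phi -> `|hess phi p i j| <= C.
Proof. by move=> [_ [B _]]; rewrite mxE; apply: (B [:: j; i]). Qed.

Lemma reg_grad C phi p : reg C phi -> enorm (grad phi p) <= d%:R * C.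
Proof.
move=> [_ [B _]]; apply: le_trans (enorm_le_sum _) _.
apply: (@le_trans _ _ (\sum_(i < d) C)); last by rewrite sumr_const card_ord mulr_natl.
by apply: ler_sum => i _; rewrite mxE; apply: (B [:: i]).
Qed.

Lemma reg_bound C phi p : reg C phi -> `|phi p| <= C.
Proof. by move=> [_ [B _]]; apply: (B [::]). Qed.

End regular_consequences.

(** * Averages over the steps of a symmetric walk *)

Section averages.
Context {R : realType} {d : nat} {V : lmodType R}.
Hypothesis d0 : (0 < d)%N.
Implicit Types (F G : V -> R) (v x w : V) (i j : 'I_d) (E : 'I_d -> V) (tau : R).

(** One step of the walk that adds or subtracts [tau *: E i], each with probability [1 / (2 d)]. The
    space is an arbitrary module because the difference of two coupled walks is later read on a
    line. *)
Definition avg E tau F x : R := (2 * d%:R)^-1 * \sum_(i < d) (F (x + tau *: E i) + F (x - tau *: E i)).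

Let d2 : 0 < 2 * d%:R :> R. Proof. by rewrite mulr_gt0// ltr0n. Qed.

Lemma avg_le E tau F G x : (forall y, F y <= G y) -> avg E tau F x <= avg E tau G x.
Proof.
move=> FG; rewrite /avg ler_wpM2l ?invr_ge0 ?(ltW d2)//.
by apply: ler_sum => i _; rewrite lerD.
Qed.

Lemma avgD E tau F G x : avg E tau (fun y => F y + G y) x = avg E tau F x + avg E tau G x.
Proof. by rewrite /avg -mulrDr -big_split; congr (_ * _); apply: eq_bigr => i _ /=; ring. Qed.

Lemma avgZ E tau c F x : avg E tau (fun y => c * F y) x = c * avg E tau F x.
Proof. by rewrite /avg mulrCA; congr (_ * _); rewrite mulr_sumr; apply: eq_bigr => i _; ring. Qed.

Lemma avg_cst E tau c x : avg E tau (fun=> c) x = c.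
Proof.
rewrite /avg sumr_const card_ord -mulr_natl; field.
by rewrite pnatr_eq0 -lt0n.
Qed.

Definition avgm m E tau F := iter m (avg E tau) F.

Lemma avgmS m E tau F : avgm m.+1 E tau F = avgm m E tau (avg E tau F).
Proof. by rewrite /avgm iterSr. Qed.

Lemma avgm_le m E tau F G x : (forall y, F y <= G y) -> avgm m E tau F x <= avgm m E tau G x.
Proof. by move=> FG; elim: m x => [|m IH] x /=; [exact: FG|exact: avg_le]. Qed.

Lemma avgm_ext m E tau F G x : (forall y, F y = G y) -> avgm m E tau F x = avgm m E tau G x.
Proof. by move=> FG; have -> : F = G by apply/funext. Qed.

Lemma avgmD m E tau F G x : avgm m E tau (fun y => F y + G y) x = avgm m E tau F x + avgm m E tau G x.
Proof.
elim: m x => [//|m IH] x /=; rewrite -avgD; congr (avg _ _ _ _).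
by apply/funext => y; exact: IH.
Qed.

Lemma avgmZ m E tau c F x : avgm m E tau (fun y => c * F y) x = c * avgm m E tau F x.
Proof.
elim: m x => [//|m IH] x /=; rewrite -avgZ; congr (avg _ _ _ _).
by apply/funext => y; exact: IH.
Qed.

Lemma avgm_cst m E tau c x : avgm m E tau (fun=> c) x = c.
Proof.
elim: m x => [//|m IH] x /=; rewrite -[RHS](avg_cst E tau c x); congr (avg _ _ _ _).
by apply/funext => y; exact: IH.
Qed.

Lemma avgm_bound m E tau F M x : (forall y, `|F y| <= M) -> `|avgm m E tau F x| <= M.
Proof.
move=> FM; rewrite ler_norml; apply/andP; split.
  rewrite -[- M](avgm_cst m E tau _ x); apply: avgm_le => y.
  by have := FM y; rewrite ler_norml => /andP[].
rewrite -[M](avgm_cst m E tau _ x); apply: avgm_le => y.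
by have := FM y; rewrite ler_norml => /andP[].
Qed.

Lemma avgmB_bound m E tau F G e x : (forall y, `|F y - G y| <= e) ->
  `|avgm m E tau F x - avgm m E tau G x| <= e.
Proof.
move=> FG; have := @avgm_bound m E tau (fun y => F y + (-1) * G y) e x.
rewrite avgmD avgmZ mulN1r; apply=> y; rewrite mulN1r; exact: FG.
Qed.

Lemma avg_shift E tau F x v : avg E tau (fun y => F (y + v)) x = avg E tau F (x + v).
Proof. by rewrite /avg; congr (_ * _); apply: eq_bigr => i _; congr (F _ + F _); rewrite addrAC. Qed.

Lemma avgm_shift m E tau F x v : avgm m E tau (fun y => F (y + v)) x = avgm m E tau F (x + v).
Proof.
elim: m x => [//|m IH] x /=; rewrite -avg_shift; congr (avg _ _ _ _).
by apply/funext => y; exact: IH.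
Qed.

(** Steps act by translations, hence commute; this is what allows them to be exchanged one at a time
    in [avgm_diff]. *)
Lemma avg_comm E E' tau tau' F x : avg E tau (avg E' tau' F) x = avg E' tau' (avg E tau F) x.
Proof.
have T E1 t1 E2 t2 : avg E1 t1 (avg E2 t2 F) x = (2 * d%:R)^-1 * (2 * d%:R)^-1 *
    \sum_(i < d) \sum_(j < d) (F (x + t1 *: E1 i + t2 *: E2 j) + F (x + t1 *: E1 i - t2 *: E2 j)
         + (F (x - t1 *: E1 i + t2 *: E2 j) + F (x - t1 *: E1 i - t2 *: E2 j))).
  rewrite /avg -mulrA; congr (_ * _); rewrite mulr_sumr; apply: eq_bigr => i _.
  by rewrite -mulrDr -big_split.
rewrite !T exchange_big/=; congr (_ * _).
apply: eq_bigr => j _; apply: eq_bigr => i _.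
rewrite (addrAC x (tau *: E i) (tau' *: E' j)) (addrAC x (tau *: E i) (- (tau' *: E' j))).
by rewrite (addrAC x (- (tau *: E i)) (tau' *: E' j)) (addrAC x (- (tau *: E i)) (- (tau' *: E' j))); ring.
Qed.

(** Lindeberg replacement: steps are exchanged one by one, and the averages over the other steps do
    not enlarge the error of an exchange. *)
Lemma avgm_diff m E E' tau F e : (forall x, `|avg E tau F x - avg E' tau F x| <= e) ->
  forall x, `|avgm m E tau F x - avgm m E' tau F x| <= m%:R * e.
Proof.
elim: m F => [|m IH] F H x; first by rewrite subrr normr0 mul0r.
rewrite !avgmS -(subrKA (avgm m E tau (avg E' tau F) x)) -natr1 mulrDl mul1r addrC.
rewrite [X in `|X|]addrC.
apply: le_trans (ler_normD _ _) _; rewrite addrC; apply: lerD; last first.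
  exact: avgmB_bound.
apply: IH => y.
have := @avgmB_bound 1 E' tau (avg E tau F) (avg E' tau F) e y H.
by rewrite /avgm/= avg_comm.
Qed.

(** Both walks use the same index and the same sign, so their difference is again a walk, with steps
    [E i - E' i]. *)
Lemma avg_coupled E E' tau F G (Th : V -> R) :
  (forall x x', F x - G x' <= Th (x - x')) ->
  forall x x', avg E tau F x - avg E' tau G x' <= avg (fun i => E i - E' i) tau Th (x - x').
Proof.
move=> H x x'; rewrite /avg -mulrBr ler_wpM2l ?invr_ge0 ?(ltW d2)// -sumrB.
apply: ler_sum => i _; rewrite opprD addrACA; apply: lerD.
  by apply: le_trans (H _ _) _; rewrite scalerBr opprD addrACA.
by apply: le_trans (H _ _) _; rewrite scalerBr !opprD !opprK addrACA.
Qed.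

Lemma avgm_coupled m E E' tau F G (Th : V -> R) :
  (forall x x', F x - G x' <= Th (x - x')) ->
  forall x x', avgm m E tau F x - avgm m E' tau G x' <= avgm m (fun i => E i - E' i) tau Th (x - x').
Proof. by move=> H; elim: m => [//|m IH] x x' /=; exact: avg_coupled. Qed.

Lemma avg_second E tau F B x : (forall i, `|F (x + tau *: E i) + F (x - tau *: E i) - 2 * F x| <= B) ->
  `|avg E tau F x - F x| <= B / 2.
Proof.
move=> H.
have -> : avg E tau F x - F x = (2 * d%:R)^-1 * \sum_(i < d) (F (x + tau *: E i) + F (x - tau *: E i) - 2 * F x).
  by rewrite sumrB sumr_const card_ord -(mulr_natl _ d) /avg; field; rewrite pnatr_eq0 -lt0n.
rewrite normrM gtr0_norm ?invr_gt0// ler_pdivrMl//.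
apply: le_trans (ler_norm_sum _ _ _) _; apply: le_trans (ler_sum _ (fun i _ => H i)) _.
by rewrite sumr_const card_ord -mulr_natl le_eqVlt; apply/orP; left; apply/eqP; field.
Qed.

End averages.

(** Used to read a walk with parallel steps as a walk on the real line. *)
Lemma avgm_affine (R : realType) (d : nat) (V W : lmodType R) (E : 'I_d -> W) (L : W -> V) (E' : 'I_d -> V)
    (tau : R) (F : V -> R) m (x : W) :
  (forall i y, L (y + tau *: E i) = L y + tau *: E' i) -> (forall i y, L (y - tau *: E i) = L y - tau *: E' i) ->
  avgm m E' tau F (L x) = avgm m E tau (F \o L) x.
Proof.
move=> H1 H2; elim: m x => [//|m IH] x /=; rewrite /avg; congr (_ * _).
by apply: eq_bigr => i _; rewrite -!IH H1 H2.
Qed.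


(** * Walks with tight steps and the Laplacian *)

Section laplacian.
Context {R : realType} {d : nat}.
Hypothesis d0 : (0 < d)%N.
Local Notation V := 'rV[R]_d.
Local Notation e_ := (evec R).
Implicit Types (phi F G : V -> R) (p v x w : V) (i j : 'I_d) (E : 'I_d -> V) (tau : R).

Let d2 : 0 < 2 * d%:R :> R. Proof. by rewrite mulr_gt0// ltr0n. Qed.

(* Tight frames: the steps of random walks with the same covariance, such as a basis and its image by a reflection. *)
Definition tight E := (forall a b : 'I_d, \sum_(i < d) E i 0 a * E i 0 b = (a == b)%:R) /\
   forall i, enorm (E i) <= 1.

Lemma tight_evec : tight (@evec R d).
Proof.
split=> [a b|i]; last by rewrite enorm_evec.
rewrite (bigD1 a)//= big1 => [|j ja]; rewrite /evec !mxE/= ?eqxx/=.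
  by rewrite mul1r addr0 eq_sym.
by rewrite eq_sym (negbTE ja) mul0r.
Qed.

Lemma tight_refl (e : V) : enorm e = 1 -> tight (fun i => e_ i - (2 * e 0 i) *: e).
Proof.
move=> e1; have ee : inner e e = 1 by rewrite -sqr_enorm e1 expr1n.
split=> [a b|i].
  rewrite (eq_bigr (fun i => e_ i 0 a * e_ i 0 b - 2 * e 0 b * (e_ i 0 a * e 0 i) - 2 * e 0 a * (e_ i 0 b * e 0 i)
         + 4 * e 0 a * e 0 b * (e 0 i * e 0 i))); last by move=> i _; rewrite !mxE; ring.
  rewrite big_split/= !sumrB -!mulr_sumr.
  have [-> _] := tight_evec.
  have S (c : 'I_d) : \sum_(i < d) e_ i 0 c * e 0 i = e 0 c.
    rewrite (bigD1 c)//= big1 => [|j jc]; rewrite /evec !mxE/= ?eqxx/= ?mul1r ?addr0//.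
    by rewrite eq_sym (negbTE jc) mul0r.
  rewrite !S -/(inner e e) ee; ring.
rewrite /enorm -[X in _ <= X]sqrtr1 ler_wsqrtr//.
rewrite innerBl !innerBr !innerZl !innerZr ee.
rewrite [inner e (@evec _ _ i)]inner_evecr inner_evecr [inner (@evec _ _ i) e]innerC inner_evecr.
rewrite /evec mxE !eqxx/=; lra.
Qed.

Lemma quadformZ (A : 'M[R]_d) (t : R) v : quadform A (t *: v) = t ^+ 2 * quadform A v.
Proof.
rewrite /quadform mulr_sumr; apply: eq_bigr => i _; rewrite mulr_sumr; apply: eq_bigr => j _.
by rewrite !mxE; ring.
Qed.

Lemma quadform_tight (A : 'M[R]_d) E : tight E -> \sum_(i < d) quadform A (E i) = \tr A.
Proof.
move=> [T _]; transitivity (\sum_(a < d) \sum_(b < d) A a b * \sum_(i < d) E i 0 a * E i 0 b).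
  rewrite /quadform exchange_big/=; apply: eq_bigr => a _.
  rewrite exchange_big/=; apply: eq_bigr => b _; rewrite mulr_sumr.
  by apply: eq_bigr => i _; ring.
apply: eq_bigr => a _; rewrite (bigD1 a)//= T eqxx mulr1 big1 ?addr0// => b ba.
by rewrite T eq_sym (negbTE ba) mulr0.
Qed.

Lemma trace_second (A B C : 'M[R]_d) :
  \tr A + \tr B - 2 * \tr C = \sum_(a < d) (A a a + B a a - 2 * C a a).
Proof. by rewrite sumrB big_split/= -mulr_sumr. Qed.

(** Odd terms cancel by symmetry, and a tight frame sees the Hessian only through its trace; what
    remains is of third order. *)
Lemma avg_gen C phi E tau x : reg C phi -> tight E -> 0 <= tau ->
  `|avg E tau phi x - phi x - tau ^+ 2 / (2 * d%:R) * \tr (hess phi x)| <= C * (d%:R * tau) ^+ 3.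
Proof.
move=> rC tE t0; have C0 : 0 <= C by case: rC.
have -> : avg E tau phi x - phi x - tau ^+ 2 / (2 * d%:R) * \tr (hess phi x) =
  (2 * d%:R)^-1 * \sum_(i < d) (phi (x + tau *: E i) + phi (x - tau *: E i) - 2 * phi x - quadform (hess phi x) (tau *: E i)).
  rewrite !sumrB sumr_const card_ord -(mulr_natl _ d).
  under [\sum_(i < d) quadform _ _]eq_bigr do rewrite quadformZ.
  rewrite -mulr_sumr (quadform_tight _ tE) /avg; field.
  by rewrite pnatr_eq0 -lt0n.
rewrite normrM gtr0_norm ?invr_gt0// ler_pdivrMl//.
apply: le_trans (ler_norm_sum _ _ _) _.
apply: (@le_trans _ _ (\sum_(i < d) (2 * C * (d%:R * tau) ^+ 3))).
  apply: ler_sum => i _; apply: le_trans (reg_T3 x _ rC) _.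
  rewrite ler_wpM2l ?mulr_ge0// lerXn2r ?nnegrE ?mulr_ge0 ?enorm_ge0//.
  rewrite ler_wpM2l// enormZ (ger0_norm t0) ler_piMr//.
  by case: tE.
by rewrite sumr_const card_ord -mulr_natl le_eqVlt; apply/orP; left; apply/eqP; ring.
Qed.

Lemma avg_diff_reg C phi E E' tau x : reg C phi -> tight E -> tight E' -> 0 <= tau ->
  `|avg E tau phi x - avg E' tau phi x| <= 2 * (C * (d%:R * tau) ^+ 3).
Proof.
move=> rC tE tE' t0; have := avg_gen x rC tE t0; have := avg_gen x rC tE' t0.
by rewrite !ler_norml; lra.
Qed.

(** [F] is only Lipschitz, so it is mollified at scale [sg]; two tight frames then agree to second
    order at each step. With [m * tau ^+ 2] fixed, the [m] third-order errors add up to order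
    [tau]. *)
Lemma avgm_lindeberg (sg C : R) : 0 < sg -> (forall (K : R) F, elip K F -> (forall x, `|F x| <= 1) -> reg C (Sm sg F)) ->
  forall m E E' tau (K : R) F x, 0 <= K -> elip K F -> (forall x, `|F x| <= 1) ->
  tight E -> tight E' -> 0 <= tau ->
  `|avgm m E tau F x - avgm m E' tau F x| <= 2 * (K * (sg * d%:R)) + m%:R * (2 * (C * (d%:R * tau) ^+ 3)).
Proof.
move=> sg0 HC m E E' tau K F x K0 HF F1 tE tE' t0.
have rC := HC K F HF F1.
have cl y : `|F y - Sm sg F y| <= K * (sg * d%:R) by rewrite distrC; exact: Sm_close.
have H1 := avgmB_bound d0 m E tau x cl.
have H2 := avgmB_bound d0 m E' tau x cl.
have H3 := @avgm_diff _ _ _ d0 m E E' tau _ _ (fun y => avg_diff_reg y rC tE tE' t0) x.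
by move: H1 H2 H3; rewrite !ler_norml; lra.
Qed.

(** Along the walk the mean of the trace of the Hessian changes by at most [k] per step. This
    produces the second error term and is where fourth derivatives enter. *)
Lemma avgm_gen C phi E tau m x : reg C phi -> tight E -> 0 <= tau ->
  `|avgm m E tau phi x - phi x - m%:R * tau ^+ 2 / (2 * d%:R) * \tr (hess phi x)| <=
  m%:R * (C * (d%:R * tau) ^+ 3) + m%:R ^+ 2 * tau ^+ 2 * (d%:R * C * (d%:R * tau) ^+ 2).
Proof.
move=> rC tE t0; have C0 : 0 <= C by case: rC.
have dt : 0 <= d%:R * tau by rewrite mulr_ge0.
set k := d%:R * C * (d%:R * tau) ^+ 2.
have k0 : 0 <= k by rewrite /k !mulr_ge0// exprn_ge0.
have trE y : `|avg E tau (fun z => \tr (hess phi z)) y - \tr (hess phi y)| <= k.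
  have -> : k = (d%:R * (2 * C * (d%:R * tau) ^+ 2)) / 2 by rewrite /k; field.
  apply: (avg_second d0) => i.
  rewrite trace_second.
  apply: le_trans (ler_norm_sum _ _ _) _.
  apply: (@le_trans _ _ (\sum_(a < d) (2 * C * (d%:R * tau) ^+ 2))); last first.
    by rewrite sumr_const card_ord -[X in X <= _](mulr_natl _ d).
  apply: ler_sum => a _; apply: le_trans (reg_T2sym y _ a a rC) _.
  rewrite ler_wpM2l ?mulr_ge0// lerXn2r ?nnegrE ?mulr_ge0 ?enorm_ge0//.
  rewrite ler_wpM2l// enormZ (ger0_norm t0) ler_piMr//.
  by case: tE.
have trm n y : `|avgm n E tau (fun z => \tr (hess phi z)) y - \tr (hess phi y)| <= n%:R * k.
  elim: n y => [|n IH] y; first by rewrite subrr normr0 mul0r.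
  rewrite avgmS -(subrKA (avgm n E tau (fun z => \tr (hess phi z)) y)) -natr1 mulrDl mul1r addrC.
  apply: le_trans (ler_normD _ _) _; apply: lerD; first exact: IH.
  exact: (avgmB_bound d0).
elim: m => [|m IH]; first by rewrite !mul0r subrr subr0 normr0 expr0n/= !mul0r addr0.
have H1 := @avgmB_bound _ _ _ d0 m E tau (avg E tau phi) (fun y => phi y + tau ^+ 2 / (2 * d%:R) * \tr (hess phi y)) (C * (d%:R * tau) ^+ 3) x.
have {}H1 := H1 (fun y => _).
have {}H1 : `|avgm m E tau (avg E tau phi) x - avgm m E tau (fun y => phi y + tau ^+ 2 / (2 * d%:R) * \tr (hess phi y)) x| <= C * (d%:R * tau) ^+ 3.
  by apply: H1 => y; have := avg_gen y rC tE t0; rewrite opprD addrA.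
rewrite avgmD avgmZ in H1; have H2 := trm m x; rewrite avgmS.
move: IH H1 H2; set A := avgm m E tau phi x; set B := avgm m E tau (avg _ _ _) x.
set D := avgm m E tau _ x; set T := \tr _; set c := C * _; set P := phi x.
have q0 : 0 <= tau ^+ 2 / (2 * d%:R) by rewrite divr_ge0 ?sqr_ge0// ltW.
have q1 : tau ^+ 2 / (2 * d%:R) <= tau ^+ 2.
  rewrite ler_piMr ?sqr_ge0// invf_le1//; have : 1 <= d%:R :> R by rewrite ler1n.
  lra.
rewrite -!(mulrA _ (tau ^+ 2) (2 * d%:R)^-1) -(natr1 m).
set q := tau ^+ 2 / _ in q0 q1 *; set t2 := tau ^+ 2 in q1 *.
move=> IH H1 H2.
have H3 : `|q * (D - T)| <= t2 * (m%:R * k) by rewrite normrM (ger0_norm q0) ler_pM.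
have -> : B - P - (m%:R + 1) * q * T = (A - P - m%:R * q * T) + (B - (A + q * D)) + q * (D - T) by ring.
apply: le_trans (ler_normD _ _) _; apply: le_trans (lerD (ler_normD _ _) (lexx _)) _.
apply: le_trans (lerD (lerD IH H1) H3) _.
have m0 : 0 <= m%:R :> R by [].
rewrite -subr_ge0 (_ : _ - _ = t2 * k * (m%:R + 1)); first by rewrite !mulr_ge0 ?sqr_ge0 ?addr_ge0.
by ring.
Qed.

End laplacian.

(** * Concavity of the cost under reflection *)

Section scalar.
Context {R : realType}.
Implicit Types (r t lam eta : R).

Lemma le_of_sqr (a b : R) : 0 <= b -> a ^+ 2 <= b ^+ 2 -> a <= b.
Proof. by move=> b0 ab; case: (leP a b) => // ba; have := ba; nra. Qed.

(** A concave profile of slope 1 at the origin and, for [lam > 0], bounded by [1 / lam]: it equals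
    [(1 - 1 / (1 + lam r)) / lam]. *)
Definition psi lam r : R := r / (1 + lam * r).

Lemma psi_tangent lam r r' : 0 <= lam -> 0 <= r -> 0 <= r' ->
  psi lam r' <= psi lam r + (1 + lam * r) ^- 2 * (r' - r).
Proof.
move=> l0 r0 r'0; rewrite /psi.
have a0 : 0 < 1 + lam * r by rewrite ltr_wpDr// mulr_ge0.
have b0 : 0 < 1 + lam * r' by rewrite ltr_wpDr// mulr_ge0.
rewrite -subr_ge0 (_ : _ - _ = lam * (r' - r) ^+ 2 / ((1 + lam * r) ^+ 2 * (1 + lam * r'))).
  by apply: divr_ge0; rewrite mulr_ge0 ?sqr_ge0// ltW.
by field; rewrite !gt_eqF.
Qed.

Lemma psi_ge0 lam r : 0 <= lam -> 0 <= r -> 0 <= psi lam r.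
Proof. by move=> l0 r0; rewrite divr_ge0 ?addr_ge0 ?mulr_ge0. Qed.

Lemma psi_slope lam r : 0 <= lam -> 0 <= r -> 0 <= (1 + lam * r) ^- 2 <= 1.
Proof.
move=> l0 r0; have a1 : 1 <= 1 + lam * r by rewrite lerDl mulr_ge0.
by rewrite invr_ge0 sqr_ge0 invf_le1 ?exprn_gt0 ?exprn_ege1 ?(lt_le_trans _ a1).
Qed.

Lemma psi_up lam r r' s : 0 <= lam -> 0 <= r -> 0 <= r' -> 0 <= s -> r' <= r + s -> psi lam r' <= psi lam r + s.
Proof.
move=> l0 r0 r'0 s0 rs; apply: le_trans (psi_tangent l0 r0 r'0) _.
have /andP[a0 a1] := psi_slope l0 r0; rewrite lerD2l.
apply: (@le_trans _ _ ((1 + lam * r) ^- 2 * s)); last by rewrite ler_piMl.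
by rewrite ler_wpM2l// lerBlDl.
Qed.

Lemma psi_le lam r : 0 <= lam -> 0 <= r -> psi lam r <= r.
Proof.
move=> l0 r0; rewrite /psi ler_pdivrMr ?ltr_wpDr ?mulr_ge0//.
by rewrite ler_peMr// lerDl mulr_ge0.
Qed.

(** The cost of a vector of length [r] after a radial displacement [t]. *)
Definition Fl lam eta r t : R := psi lam (Num.sqrt ((r + t) ^+ 2 + eta ^+ 2)).

(** With [p] and [q] the two displaced radii, convexity of [1 / (1 + lam z)] gives a gain from the
    spread [p - q], while the smoothing by [eta] raises the mean radius [M] above [R0]. Before
    division by [lam], the bound on [eta ^+ 2] keeps this loss below [lam^2 t^2 / 96], against a
    gain of at least [lam^2 t^2 / 24]. *)
Lemma Fl_sym_small lam eta r t : 0 < lam -> 0 < r -> eta <= r / 2 -> 0 <= eta ->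
  let R0 := Num.sqrt (r ^+ 2 + eta ^+ 2) in
  lam * R0 <= 1 -> eta ^+ 2 <= lam * R0 ^+ 3 / 64 -> `|t| <= R0 / 2 ->
  (Fl lam eta r t + Fl lam eta r (- t)) / 2 <= Fl lam eta r 0 - lam / 64 * t ^+ 2.
Proof.
move=> l0 r0 er e0 R0 lR eR tR; rewrite /Fl addr0 -/R0.
set p := Num.sqrt _; set q := Num.sqrt ((r - t) ^+ 2 + _).
have sp : p ^+ 2 = (r + t) ^+ 2 + eta ^+ 2 by rewrite sqr_sqrtr// addr_ge0 ?sqr_ge0.
have sq : q ^+ 2 = (r - t) ^+ 2 + eta ^+ 2 by rewrite sqr_sqrtr// addr_ge0 ?sqr_ge0.
have sR : R0 ^+ 2 = r ^+ 2 + eta ^+ 2 by rewrite sqr_sqrtr// addr_ge0 ?sqr_ge0.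
have p0 : 0 <= p by rewrite sqrtr_ge0.
have q0 : 0 <= q by rewrite sqrtr_ge0.
have R00 : 0 < R0 by rewrite sqrtr_gt0 ltr_wpDr ?sqr_ge0 ?exprn_gt0.
have t2 : t ^+ 2 <= R0 ^+ 2 / 4.
  rewrite -(real_normK (num_real t)) (_ : R0 ^+ 2 / 4 = (R0 / 2) ^+ 2); last by field.
  by rewrite lerXn2r// nnegrE// ltW// divr_gt0.
set M := (p + q) / 2.
have pq : p ^+ 2 + q ^+ 2 = 2 * R0 ^+ 2 + 2 * t ^+ 2 by rewrite sp sq sR; ring.
(* [M^2 = (R0^2 + t^2 + p q) / 2], and [p q] is nearly [R0^2 - t^2]: bounds on the product become
   bounds on the mean. *)
set w := p * q.
have w0 : 0 <= w by rewrite mulr_ge0.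
have ww : w ^+ 2 = (R0 ^+ 2 - t ^+ 2) ^+ 2 + 4 * t ^+ 2 * eta ^+ 2.
  by rewrite exprMn sp sq sR; ring.
have MM : M ^+ 2 = (R0 ^+ 2 + t ^+ 2 + w) / 2.
  by rewrite /M expr_div_n sqrrD -/w; move: pq; lra.
have tt0 := sqr_ge0 t; have ee0 := sqr_ge0 eta.
have Rt : 0 < R0 ^+ 2 - t ^+ 2 by have := exprn_gt0 2 R00; lra.
have wl : R0 ^+ 2 - t ^+ 2 <= w.
  apply: le_of_sqr => //; rewrite ww; have := mulr_ge0 tt0 ee0; lra.
(* The excess due to [eta] at the scales of [w] and of [M]: below, [w <= R0^2 - t^2 + 8 x / 3] and
   [M <= R0 + 2 y / 3]. *)
pose x := t ^+ 2 * eta ^+ 2 / R0 ^+ 2; pose y := t ^+ 2 * eta ^+ 2 / R0 ^+ 3.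
have R2 : 0 < R0 ^+ 2 by rewrite exprn_gt0.
have xE : t ^+ 2 * eta ^+ 2 = x * R0 ^+ 2 by rewrite /x; field; rewrite gt_eqF.
have xy : x = y * R0 by rewrite /x /y; field; rewrite gt_eqF.
have x0 : 0 <= x by apply: divr_ge0; [exact: mulr_ge0|exact: ltW].
have y0 : 0 <= y by apply: divr_ge0; [exact: mulr_ge0|rewrite exprn_ge0// ltW].
have wu : w <= R0 ^+ 2 - t ^+ 2 + 8 / 3 * x.
  apply: le_of_sqr; first by lra.
  have := mulr_ge0 x0 (_ : 0 <= R0 ^+ 2 / 4 - t ^+ 2); rewrite subr_ge0 => /(_ t2).
  have := sqr_ge0 x; rewrite ww -(mulrA 4) xE; lra.
have M0 : 0 <= M by rewrite divr_ge0 ?addr_ge0.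
have MR : R0 <= M by apply: le_of_sqr => //; rewrite MM; lra.
have Mp : 0 < M by apply: lt_le_trans MR.
have MRu : M <= R0 + 2 / 3 * y.
  apply: le_of_sqr; first by lra.
  have := sqr_ge0 y; rewrite MM; move: wu; rewrite xy; lra.
have e2 : eta ^+ 2 <= R0 ^+ 2 / 5.
  have : eta ^+ 2 <= (r / 2) ^+ 2 by rewrite lerXn2r// nnegrE// divr_ge0// ltW.
  by rewrite expr_div_n; lra.
have M2 : M ^+ 2 <= 17 / 15 * R0 ^+ 2.
  have : x <= eta ^+ 2 / 4; last by rewrite MM; lra.
  rewrite -(ler_pM2r R2) -xE.
  have := mulr_ge0 ee0 (_ : 0 <= R0 ^+ 2 / 4 - t ^+ 2); rewrite subr_ge0 => /(_ t2); lra.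
have MR2 : M <= 11 / 10 * R0.
  apply: le_of_sqr; first by lra.
  by rewrite (_ : (11 / 10 * R0) ^+ 2 = 121 / 100 * R0 ^+ 2); [lra|field].
set m := 1 + lam * M.
have m1 : 1 <= m by rewrite lerDl mulr_ge0 ?(ltW l0).
have m2 : m <= 21 / 10.
  have := ler_wpM2l (ltW l0) MR2; rewrite /m; lra.
have A1 : 1 <= 1 + lam * R0 by rewrite lerDl mulr_ge0 ?(ltW l0) ?(ltW R00).
have mp : 0 < m by lra.
(* Half the spread of the two arguments: [1 + lam p = m + D] and [1 + lam q = m - D]. *)
set D := lam * (p - q) / 2.
have DD : D ^+ 2 = lam ^+ 2 * r ^+ 2 * t ^+ 2 / M ^+ 2.
  have : (p - q) * (p + q) = 4 * r * t by rewrite -subr_sqr sp sq; ring.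
  rewrite (_ : p + q = 2 * M); last by rewrite /M; field.
  move=> H; have pqE : p - q = 2 * r * t / M.
    apply: (@mulIf _ (2 * M)); first by rewrite mulf_neq0// gt_eqF.
    by rewrite H; field; rewrite gt_eqF.
  by rewrite /D pqE; field; rewrite gt_eqF.
have pp : 1 + lam * p = m + D by rewrite /m /D /M; field.
have qq : 1 + lam * q = m - D by rewrite /m /D /M; field.
have pp0 : 0 < m + D by rewrite -pp ltr_wpDr// mulr_ge0// ltW.
have qq0 : 0 < m - D by rewrite -qq ltr_wpDr// mulr_ge0// ltW.
have psiE z : 0 <= z -> psi lam z = lam^-1 * (1 - (1 + lam * z)^-1).
  move=> z0; have zp : 1 + lam * z != 0 by rewrite gt_eqF// ltr_wpDr// mulr_ge0// ltW.
  by rewrite /psi; field; rewrite zp gt_eqF.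
rewrite !psiE ?(ltW R00)// pp qq.
(* Convexity of the inverse with an explicit second-order gain. *)
have H1 : (m^-1 + D ^+ 2 / m ^+ 3) * 2 <= (m + D)^-1 + (m - D)^-1.
  rewrite -subr_ge0 (_ : _ - _ = 2 * D ^+ 4 / (m ^+ 3 * ((m + D) * (m - D)))).
    apply: divr_ge0; first by rewrite mulr_ge0// exprn_even_ge0.
    by rewrite mulr_ge0 ?exprn_ge0 ?mulr_ge0 ?(ltW mp) ?(ltW pp0) ?(ltW qq0).
  by field; rewrite !gt_eqF.
have H2 : (1 + lam * R0)^-1 - m^-1 <= lam * (M - R0).
  rewrite (_ : _ - _ = lam * (M - R0) / ((1 + lam * R0) * m)); last first.
    by rewrite /m; field; rewrite !gt_eqF//; lra.
  rewrite ler_pdivrMr ?mulr_gt0//; last lra.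
  rewrite ler_peMr ?mulr_ge0 ?subr_ge0 ?(ltW l0)//.
  exact: mulr_ege1.
have H3 : lam * (M - R0) <= lam ^+ 2 / 96 * t ^+ 2.
  have yl : y <= lam / 64 * t ^+ 2.
    rewrite /y ler_pdivrMr ?exprn_gt0//; have := ler_wpM2l tt0 eR; lra.
  have : M - R0 <= lam / 96 * t ^+ 2 by lra.
  move=> H; have := ler_wpM2l (ltW l0) H; lra.
have H4 : lam ^+ 2 / 24 * t ^+ 2 <= D ^+ 2 / m ^+ 3.
  rewrite ler_pdivlMr ?exprn_gt0// DD ler_pdivlMr ?exprn_gt0//.
  have m3 : m ^+ 3 <= 10.
    have : m ^+ 3 <= (21 / 10) ^+ 3 by rewrite lerXn2r// nnegrE ?(ltW mp)//; lra.
    by rewrite (_ : (21 / 10 : R) ^+ 3 = 9261 / 1000); [lra|field].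
  have rM : M ^+ 2 <= 17 / 12 * r ^+ 2 by lra.
  have K : m ^+ 3 * M ^+ 2 <= 10 * (17 / 12 * r ^+ 2).
    by rewrite ler_pM ?exprn_ge0 ?(ltW mp).
  have lt0 : 0 <= lam ^+ 2 * t ^+ 2 by rewrite mulr_ge0 ?sqr_ge0.
  have := ler_wpM2l lt0 K; have := mulr_ge0 lt0 (sqr_ge0 r); lra.
have : lam^-1 * (((1 + lam * R0)^-1 - ((m + D)^-1 + (m - D)^-1) / 2)) <= lam^-1 * - (lam ^+ 2 / 64 * t ^+ 2).
  rewrite ler_wpM2l ?invr_ge0 ?(ltW l0)//; have := mulr_ge0 (sqr_ge0 lam) tt0; lra.
rewrite (_ : lam^-1 * - (lam ^+ 2 / 64 * t ^+ 2) = - (lam / 64 * t ^+ 2)); last by field; rewrite gt_eqF.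
lra.
Qed.

(** For [|t| > R0 / 2] concavity is replaced by the 1-Lipschitz bound, which the [t ^+ 4] term
    absorbs since [2 |t| / r1 >= 1]. The fourth moment of a short walk is of smaller order than its
    variance, so this term is harmless. *)
Lemma Fl_sym lam eta r r1 t : 0 < lam -> 0 < r1 -> r1 <= r -> eta <= r / 2 -> 0 <= eta ->
  let R0 := Num.sqrt (r ^+ 2 + eta ^+ 2) in
  lam * R0 <= 1 -> eta ^+ 2 <= lam * r1 ^+ 3 / 64 ->
  (Fl lam eta r t + Fl lam eta r (- t)) / 2 <= Fl lam eta r 0 - lam / 64 * t ^+ 2 + (8 / r1 ^+ 3 + lam / r1 ^+ 2) * t ^+ 4.
Proof.
move=> l0 r10 r1r er e0 R0 lR eR.
have r0 : 0 < r by apply: lt_le_trans r1r.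
have rR : r <= R0.
  by rewrite -[leLHS]gtr0_norm// -sqrtr_sqr ler_wsqrtr// lerDl sqr_ge0.
have [tR|tR] := leP `|t| (R0 / 2).
  apply: le_trans (Fl_sym_small l0 r0 er e0 lR _ tR) _.
    apply: le_trans eR _; rewrite ler_wpM2r// ler_wpM2l ?(ltW l0)//.
    by rewrite -/R0 lerXn2r ?nnegrE ?(ltW r10) ?sqrtr_ge0//; exact: le_trans r1r rR.
  rewrite lerDl mulr_ge0 ?exprn_even_ge0//.
  by rewrite addr_ge0 ?divr_ge0 ?exprn_ge0 ?(ltW r10) ?(ltW l0).
have t1 : r1 / 2 < `|t| by apply: le_lt_trans tR; rewrite ler_wpM2r//; lra.
have Flip s : Fl lam eta r s <= Fl lam eta r 0 + `|s|.
  rewrite /Fl addr0 -/R0; apply: psi_up; rewrite ?sqrtr_ge0 ?(ltW l0)//.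
  apply: le_of_sqr; first by rewrite addr_ge0 ?sqrtr_ge0.
  rewrite sqr_sqrtr ?addr_ge0 ?sqr_ge0//.
  rewrite [leRHS]sqrrD sqr_sqrtr ?addr_ge0 ?sqr_ge0// sqrrD real_normK ?num_real//.
  have : r * s <= `|s| * R0.
    apply: le_trans (ler_norm _) _; rewrite normrM mulrC ler_wpM2l// gtr0_norm//.
  rewrite (mulrC `|s|); lra.
have F1 := Flip t; have F2 := Flip (- t); rewrite normrN in F2.
have t0 : 0 < `|t| by apply: lt_trans t1; rewrite divr_gt0.
have tE : t ^+ 4 = `|t| ^+ 4 by rewrite -normrX ger0_norm// exprn_even_ge0.
have t2E : t ^+ 2 = `|t| ^+ 2 by rewrite real_normK// num_real.
have u1 : 1 <= 2 * `|t| / r1 by rewrite ler_pdivlMr//; lra.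
have a1 : `|t| <= 8 / r1 ^+ 3 * t ^+ 4.
  rewrite tE (_ : _ * _ = `|t| * (2 * `|t| / r1) ^+ 3); last by field; rewrite gt_eqF.
  by rewrite ler_peMr ?exprn_ege1// ltW.
have a2 : 0 <= lam / r1 ^+ 2 * t ^+ 4 by rewrite mulr_ge0 ?divr_ge0 ?sqr_ge0 ?(ltW l0)// tE exprn_ge0.
have a3 : lam / 64 * t ^+ 2 <= lam / r1 ^+ 2 * t ^+ 4.
  rewrite tE t2E (_ : lam / r1 ^+ 2 * _ = lam / 64 * `|t| ^+ 2 * (16 * (2 * `|t| / r1) ^+ 2)).
    rewrite ler_peMr ?mulr_ge0 ?sqr_ge0 ?invr_ge0 ?(ltW l0)//.
    by have := exprn_ege1 2 u1; lra.
  by field; rewrite gt_eqF.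
lra.
Qed.

End scalar.

(** * Coupling of frozen jump generators *)

Section walk.
Context {R : realType} {d : nat}.
Hypothesis d0 : (0 < d)%N.
Variables (E : 'I_d -> R) (tau : R).
Hypothesis E2 : \sum_(i < d) E i ^+ 2 = 4.
Local Notation W := R^o.
Local Notation EW := (E : 'I_d -> W).

Let dR : 1 <= d%:R :> R. Proof. by rewrite ler1n. Qed.
Let dn0 : d%:R != 0 :> R. Proof. by rewrite pnatr_eq0 -lt0n. Qed.

Lemma avg_sq (t : R) : avg EW tau (fun s : R => s ^+ 2) t = t ^+ 2 + 4 * tau ^+ 2 / d%:R.
Proof.
transitivity ((2 * d%:R)^-1 * \sum_(i < d) (2 * t ^+ 2 + 2 * tau ^+ 2 * E i ^+ 2) : R).
  by congr (_ * _); apply: eq_bigr => i _; rewrite /GRing.scale/=; ring.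
by rewrite big_split/= sumr_const card_ord -(mulr_natl _ d) -mulr_sumr E2; field.
Qed.

Lemma avg_pow4 (t : R) : avg EW tau (fun s : R => s ^+ 4) t <= t ^+ 4 + 24 * tau ^+ 2 * t ^+ 2 + 16 * tau ^+ 4.
Proof.
have -> : avg EW tau (fun s : R => s ^+ 4) t = (2 * d%:R)^-1 *
    \sum_(i < d) (2 * t ^+ 4 + 12 * t ^+ 2 * tau ^+ 2 * E i ^+ 2 + 2 * tau ^+ 4 * E i ^+ 4) :> R.
  by congr (_ * _); apply: eq_bigr => i _; rewrite /GRing.scale/=; ring.
rewrite !big_split/= -!mulr_sumr E2 sumr_const card_ord -(mulr_natl _ d).
have E4 : \sum_(i < d) E i ^+ 4 <= 16.
  have -> : 16 = \sum_(i < d) E i ^+ 2 * 4 :> R by rewrite -mulr_suml E2; ring.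
  apply: ler_sum => i _; rewrite (_ : E i ^+ 4 = E i ^+ 2 * E i ^+ 2); last by rewrite -exprD.
  by rewrite ler_wpM2l ?sqr_ge0// -E2 (bigD1 i)//= lerDl sumr_ge0// => j _; rewrite sqr_ge0.
have t4 : 0 <= tau ^+ 4 by rewrite exprn_even_ge0.
have tt : 0 <= t ^+ 2 * tau ^+ 2 by rewrite mulr_ge0 ?sqr_ge0.
rewrite ler_pdivrMl ?mulr_gt0 ?ltr0n//.
have := ler_wpM2l t4 E4; have := mulr_ge0 tt (_ : 0 <= d%:R - 1 :> R); have := mulr_ge0 t4 (_ : 0 <= d%:R - 1 :> R).
rewrite subr_ge0 => /(_ dR) h1 /(_ dR) h2 h3; lra.
Qed.

Lemma avgm_sq m (t : R) : avgm m EW tau (fun s : R => s ^+ 2) t = t ^+ 2 + m%:R * (4 * tau ^+ 2 / d%:R).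
Proof.
elim: m t => [|m IH] t; first by rewrite mul0r addr0.
rewrite /avgm/= -/(avgm m EW tau _) (_ : avgm m EW tau _ = fun t : R => t ^+ 2 + m%:R * (4 * tau ^+ 2 / d%:R)); last by apply/funext.
by rewrite avgD avg_sq (avg_cst d0) -natr1; ring.
Qed.

Lemma avgm_pow4 m (t : R) : avgm m EW tau (fun s : R => s ^+ 4) t <=
  t ^+ 4 + m%:R * (24 * tau ^+ 2) * t ^+ 2 + m%:R ^+ 2 * (64 * tau ^+ 4).
Proof.
elim: m t => [|m IH] t; first by rewrite !mul0r expr0n/= mul0r !addr0.
rewrite /avgm/= -/(avgm m EW tau _).
apply: le_trans (avg_le d0 EW tau t IH) _.
rewrite !avgD avgZ (avg_cst d0) avg_sq.
have t4 : 0 <= tau ^+ 4 by rewrite exprn_even_ge0.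
have m0 : 0 <= m%:R :> R by [].
have q : 4 * tau ^+ 2 / d%:R <= 4 * tau ^+ 2.
  rewrite ler_pdivrMr ?ltr0n// ler_peMr// mulr_ge0 ?sqr_ge0//.
have := ler_wpM2l (mulr_ge0 m0 (mulr_ge0 (ler0n _ 24) (sqr_ge0 tau))) q.
have := avg_pow4 t; rewrite -natr1.
have := mulr_ge0 m0 t4; lra.
Qed.

Lemma avgm_opp m (F : R -> R) (t : R) : avgm m EW tau (fun s => F (- s)) t = avgm m EW tau F (- t).
Proof.
elim: m t => [//|m IH] t /=; rewrite /avg; congr (_ * _); apply: eq_bigr => i _.
by rewrite -/(avgm m EW tau _) !IH opprD opprB addrC [tau *: _ - t]addrC.
Qed.

(** Started at 0, the symmetric walk sees only the even part of [F]: the variance gives the gain and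
    the fourth moment the loss. The sum 4 of the squared steps is that of [2 e_i] for a unit vector
    [e], the steps produced by a reflection. *)
Lemma walk_sym m (F : R -> R) (A a b : R) : 0 <= b ->
  (forall t, (F t + F (- t)) / 2 <= A - a * t ^+ 2 + b * t ^+ 4) ->
  avgm m EW tau F 0 <= A - a * (m%:R * (4 * tau ^+ 2 / d%:R)) + b * (m%:R ^+ 2 * (64 * tau ^+ 4)).
Proof.
move=> b0 H.
have -> : avgm m EW tau F 0 = avgm m EW tau (fun t => 2^-1 * F t + 2^-1 * F (- t)) 0.
  by rewrite avgmD !avgmZ avgm_opp oppr0; field.
have H' (t : R) : 2^-1 * F t + 2^-1 * F (- t) <= A + ((- a) * t ^+ 2 + b * t ^+ 4).
  have := H t; lra.
apply: le_trans (avgm_le d0 m EW tau 0 H') _.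
rewrite (avgmD m EW tau (fun=> A)) (avgm_cst d0) avgmD !avgmZ avgm_sq.
have := ler_wpM2l b0 (avgm_pow4 m 0); rewrite !(expr0n _ 2) !(expr0n _ 4)/=; lra.
Qed.

End walk.

(** * Coupling one time step of two frozen generators *)

Section coupling.
Context {R : realType} {d n : nat}.
Hypothesis d0 : (0 < d)%N.
Local Notation V := 'rV[R]_d.
Local Notation I := 'I_n.+1.
Local Notation e_ := (@evec R d).
Variables (lam eta : R).
Hypotheses (lam0 : 0 < lam) (eta0 : 0 < eta).
Implicit Types (x w u v : V) (c be : R).

Definition Rr w : R := Num.sqrt (inner w w + eta ^+ 2).
Definition Th c be w : R := c * psi lam (Rr w) + be.

Lemma Rr_arg_gt0 w : 0 < inner w w + eta ^+ 2.
Proof. by rewrite ltr_wpDl ?innerxx_ge0// exprn_gt0. Qed.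

Lemma Rr_gt0 w : 0 < Rr w. Proof. by rewrite sqrtr_gt0 Rr_arg_gt0. Qed.

Lemma Rr_sqr w : Rr w ^+ 2 = inner w w + eta ^+ 2.
Proof. by rewrite sqr_sqrtr// ltW// Rr_arg_gt0. Qed.

Lemma Rr_ge w : enorm w <= Rr w.
Proof. by rewrite /enorm ler_wsqrtr// lerDl sqr_ge0. Qed.

Lemma Rr_geeta w : eta <= Rr w.
Proof. by apply: le_of_sqr; [exact/ltW/Rr_gt0|rewrite Rr_sqr lerDr innerxx_ge0]. Qed.

Lemma Rr_le w : Rr w <= enorm w + eta.
Proof.
apply: le_of_sqr; first by rewrite addr_ge0 ?enorm_ge0 ?(ltW eta0).
rewrite Rr_sqr sqrrD sqr_enorm; have := mulr_ge0 (enorm_ge0 w) (ltW eta0); lra.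
Qed.

Lemma Rr_add w u : Rr (w + u) <= Rr w + enorm u.
Proof.
apply: le_of_sqr; first by rewrite addr_ge0 ?enorm_ge0 ?(ltW (Rr_gt0 _)).
rewrite sqrrD !Rr_sqr innerDl !innerDr (innerC u w) -(sqr_enorm u).
have := inner_le w u; have := ler_wpM2r (enorm_ge0 u) (Rr_ge w); lra.
Qed.

(** The derivative of [psi lam (Rr w)] with respect to [|w|^2]. *)
Definition slope w : R := (1 + lam * Rr w) ^- 2 / (2 * Rr w).

Lemma slope_ge0 w : 0 <= slope w.
Proof.
have /andP[s0 _] := psi_slope (ltW lam0) (ltW (Rr_gt0 w)).
by rewrite /slope divr_ge0// mulr_ge0// ltW// Rr_gt0.
Qed.

(** [psi] and the square root are concave, so the cost lies below its tangent in the variable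
    [|w|^2]. The increment [2 <w, v> + |v|^2] is the quantity that the one-sided assumptions on
    drift and diffusion control. *)
Lemma Th_quad c be w v : 0 <= c ->
  Th c be (w + v) <= Th c be w + c * (slope w * (2 * inner w v + inner v v)).
Proof.
move=> c0; rewrite /Th addrAC lerD2r -mulrDr ler_wpM2l//.
apply: le_trans (psi_tangent (ltW lam0) (ltW (Rr_gt0 w)) (ltW (Rr_gt0 _))) _.
have /andP[s0 _] := psi_slope (ltW lam0) (ltW (Rr_gt0 w)).
rewrite lerD2l /slope -mulrA ler_wpM2l// ler_pdivlMl; last by rewrite mulr_gt0// Rr_gt0.
have -> : 2 * inner w v + inner v v = Rr (w + v) ^+ 2 - Rr w ^+ 2.
  by rewrite !Rr_sqr innerDl !innerDr (innerC v w); ring.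
by have := sqr_ge0 (Rr (w + v) - Rr w); lra.
Qed.

Lemma Th_up c be w u : 0 <= c -> Th c be (w + u) <= Th c be w + c * enorm u.
Proof.
move=> c0; rewrite /Th addrAC lerD2r -mulrDr ler_wpM2l//.
by apply: psi_up; rewrite ?(ltW lam0) ?(ltW (Rr_gt0 _))// Rr_add.
Qed.

Lemma Th_ge0 c be w : 0 <= c -> 0 <= be -> 0 <= Th c be w.
Proof. by move=> c0 b0; rewrite /Th addr_ge0// mulr_ge0// psi_ge0 ?(ltW lam0) ?(ltW (Rr_gt0 _)). Qed.

(* Drift, [d] diffusion directions, an [m]-step random walk of covariance [lambda0 h I], jumps by the marks [uu]
   and switching, each as a compound Poisson generator; [h] is the time scale of the first three parts. *)
Definition Gop (J : finType) (h tau : R) (m : nat) (uu : J -> V) (bb : V) (ss : 'I_d -> V) (pp : J -> R)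
    (qq : I -> R) (k : I) (f : I -> V -> R) x : R :=
  h^-1 * (f k (x + h *: bb) - f k x)
  + \sum_(i < d) (2 * h)^-1 * (f k (x + Num.sqrt h *: ss i) + f k (x - Num.sqrt h *: ss i) - 2 * f k x)
  + h^-1 * (avgm m e_ tau (f k) x - f k x)
  + \sum_(a : J) pp a * (f k (x + uu a) - f k x)
  + \sum_(l < n.+1) qq l * (f l x - f k x).

(** Each part of the generator is coupled separately and contributes its rate times the slack
    [T - D], plus a cost. As [delta] times the total rate [Lam] is at most 1 and [T - D >= 0], the
    slack terms satisfy [D + delta * Lam * (T - D) <= T], and only the costs remain. *)
Lemma Gop_couple (J : finType) (h tau : R) (m : nat) (uu : J -> V) (bb bb' : V) (ss ss' : 'I_d -> V)
   (pp pp' : J -> R) (qq qq' : I -> R) (k : I) (f g : I -> V -> R) x x' c be (delta g3 : R) :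
  0 < h -> 0 <= c -> 0 <= be ->
  (forall k x x', f k x - g k x' <= Th c be (x - x')) ->
  (forall k l x x', f k x - g l x' <= 1) ->
  (forall a, 0 <= pp a) -> (forall a, 0 <= pp' a) -> (forall l, 0 <= qq l) -> (forall l, 0 <= qq' l) ->
  avgm m e_ tau (f k) x - avgm m e_ tau (g k) x' <= Th c be (x - x') + h * g3 ->
  0 <= delta ->
  delta * (h^-1 + d%:R * h^-1 + h^-1 + \sum_(a : J) Num.max (pp a) (pp' a) + \sum_(l < n.+1) Num.max (qq l) (qq' l)) <= 1 ->
  f k x + delta * Gop h tau m uu bb ss pp qq k f x - (g k x' + delta * Gop h tau m uu bb' ss' pp' qq' k g x')
  <= Th c be (x - x') + delta *
    (c * (slope (x - x') * (2 * inner (x - x') (bb - bb') + h * inner (bb - bb') (bb - bb') + \sum_(i < d) inner (ss i - ss' i) (ss i - ss' i)))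
     + g3 + c * \sum_(a : J) `|pp a - pp' a| * enorm (uu a) + \sum_(l < n.+1) `|qq l - qq' l|).
Proof.
move=> h0 c0 b0 fg fg1 p0 p'0 q0 q'0 H3 dl0 dl1.
set w := x - x'; set T := Th c be w; set D := f k x - g k x'.
have DT : 0 <= T - D by rewrite subr_ge0; exact: fg.
have hi : 0 <= h^-1 by rewrite invr_ge0 ltW.
have P1 : h^-1 * (f k (x + h *: bb) - f k x) - h^-1 * (g k (x' + h *: bb') - g k x') <=
   h^-1 * (T - D) + c * (slope w * (2 * inner w (bb - bb') + h * inner (bb - bb') (bb - bb'))).
  have := fg k (x + h *: bb) (x' + h *: bb').
  have -> : x + h *: bb - (x' + h *: bb') = w + h *: (bb - bb') by rewrite opprD addrACA -scalerBr.
  move/le_trans/(_ (Th_quad be w _ c0)); rewrite innerZl !innerZr -/T => H.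
  have := ler_wpM2l hi H.
  set S1 := inner w _; set S2 := inner (bb - bb') _; set Q := slope w.
  have -> : h^-1 * (T + c * (Q * (2 * (h * S1) + h * (h * S2)))) = h^-1 * T + c * (Q * (2 * S1 + h * S2)).
    by field; rewrite gt_eqF.
  rewrite /D; lra.
(* Both diffusions use the same index and sign; adding the two signs cancels the terms linear in the
   increment. *)
have P2 : \sum_(i < d) (2 * h)^-1 * (f k (x + Num.sqrt h *: ss i) + f k (x - Num.sqrt h *: ss i) - 2 * f k x)
   - \sum_(i < d) (2 * h)^-1 * (g k (x' + Num.sqrt h *: ss' i) + g k (x' - Num.sqrt h *: ss' i) - 2 * g k x') <=
   d%:R * h^-1 * (T - D) + c * (slope w * \sum_(i < d) inner (ss i - ss' i) (ss i - ss' i)).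
  have -> : d%:R * h^-1 * (T - D) = \sum_(i < d) h^-1 * (T - D).
    by rewrite sumr_const card_ord -(mulr_natl _ d); ring.
  rewrite !mulr_sumr -sumrB -big_split/=; apply: ler_sum => i _.
  have h2 : 0 <= (2 * h)^-1 by rewrite invr_ge0 mulr_ge0// ltW.
  have H1 := fg k (x + Num.sqrt h *: ss i) (x' + Num.sqrt h *: ss' i).
  have H2 := fg k (x - Num.sqrt h *: ss i) (x' - Num.sqrt h *: ss' i).
  have E1 : x + Num.sqrt h *: ss i - (x' + Num.sqrt h *: ss' i) = w + Num.sqrt h *: (ss i - ss' i).
    by rewrite opprD addrACA -scalerBr.
  have E2 : x - Num.sqrt h *: ss i - (x' - Num.sqrt h *: ss' i) = w + - (Num.sqrt h *: (ss i - ss' i)).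
    by rewrite opprD addrACA scalerBr opprD.
  rewrite E1 in H1; rewrite E2 in H2.
  have {}H1 := le_trans H1 (Th_quad be w _ c0); have {}H2 := le_trans H2 (Th_quad be w _ c0).
  have hh : Num.sqrt h * Num.sqrt h = h by rewrite -expr2 sqr_sqrtr// ltW.
  move: H1 H2; rewrite !innerNr innerNl opprK !innerZl !innerZr (mulrA (Num.sqrt h)) hh -/T.
  move=> H1 H2; have := ler_wpM2l h2 (lerD H1 H2).
  set S := inner (ss i - _) _; set Q := slope w.
  rewrite (_ : (2 * h)^-1 * (T + _ + _) = h^-1 * T + c * (Q * S)); last by field; rewrite gt_eqF.
  have -> : (2 * h)^-1 = h^-1 / 2 by field; rewrite gt_eqF.
  rewrite /D; lra.
have P3 : h^-1 * (avgm m e_ tau (f k) x - f k x) - h^-1 * (avgm m e_ tau (g k) x' - g k x') <=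
    h^-1 * (T - D) + g3.
  have := ler_wpM2l hi H3; rewrite (mulrDr _ (Th _ _ _)) mulKf ?gt_eqF// -/w -/T /D; lra.
(* The common part of the rates makes both points jump together and leaves [w] unchanged; the excess
   moves one point alone and costs at most [c * enorm (uu a)]. *)
have P4 : \sum_(a : J) pp a * (f k (x + uu a) - f k x) - \sum_(a : J) pp' a * (g k (x' + uu a) - g k x') <=
   \sum_(a : J) Num.max (pp a) (pp' a) * (T - D) + c * \sum_(a : J) `|pp a - pp' a| * enorm (uu a).
  rewrite mulr_sumr -sumrB -big_split/=; apply: ler_sum => a _.
  have H1 := fg k (x + uu a) (x' + uu a); have H2 := fg k (x + uu a) x'; have H4 := fg k x (x' + uu a).
  have E1 : x + uu a - (x' + uu a) = w by rewrite opprD addrACA subrr addr0.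
  have E2 : x + uu a - x' = w + uu a by rewrite addrAC.
  have E4 : x - (x' + uu a) = w + - uu a by rewrite opprD addrA.
  rewrite E1 -/T in H1; rewrite E2 in H2; rewrite E4 in H4.
  have {}H2 := le_trans H2 (Th_up be w _ c0); have {}H4 := le_trans H4 (Th_up be w _ c0).
  rewrite enormN in H4; rewrite -/T in H2 H4.
  have [pq|/ltW pq] := leP (pp a) (pp' a).
    have := ler_wpM2l (p0 a) H1.
    have pq' : 0 <= pp' a - pp a by rewrite subr_ge0.
    have := ler_wpM2l pq' H4; rewrite ler0_norm ?subr_le0// /D; lra.
  have := ler_wpM2l (p'0 a) H1.
  have pq' : 0 <= pp a - pp' a by rewrite subr_ge0.
  have := ler_wpM2l pq' H2; rewrite ger0_norm// /D; lra.
have T0 : 0 <= T by exact: Th_ge0.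
(* Common switching keeps the regimes equal; after an excess switch they differ, and only the bound
   1 on the difference of the functions is left. *)
have P5 : \sum_(l < n.+1) qq l * (f l x - f k x) - \sum_(l < n.+1) qq' l * (g l x' - g k x') <=
   \sum_(l < n.+1) Num.max (qq l) (qq' l) * (T - D) + \sum_(l < n.+1) `|qq l - qq' l|.
  rewrite -sumrB -big_split/=; apply: ler_sum => l _.
  have H1 := fg l x x'; have H2 := fg1 l k x x'; have H4 := fg1 k l x x'.
  rewrite -/w -/T in H1.
  have [pq|/ltW pq] := leP (qq l) (qq' l).
    have := ler_wpM2l (q0 l) H1.
    have pq' : 0 <= qq' l - qq l by rewrite subr_ge0.
    have := ler_wpM2l pq' H4; have := mulr_ge0 pq' T0; rewrite ler0_norm ?subr_le0// /D; lra.
  have := ler_wpM2l (q'0 l) H1.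
  have pq' : 0 <= qq l - qq' l by rewrite subr_ge0.
  have := ler_wpM2l pq' H2; have := mulr_ge0 pq' T0; rewrite ger0_norm// /D; lra.
rewrite -!mulr_suml in P4 P5.
set G := Gop _ _ _ _ _ _ _ _ _ _ x; set G' := Gop _ _ _ _ _ _ _ _ _ _ x'.
set Lam := (X in delta * X <= 1) in dl1.
set gam := (X in _ <= T + delta * X).
have GG : G - G' <= Lam * (T - D) + gam.
  rewrite /G /G' /Gop /Lam /gam; move: P1 P2 P3 P4 P5.
  set s1 := \sum_(i < d) _ * _; set s1' := \sum_(i < d) _ * _.
  set s2 := \sum_(a : J) _ * _; set s2' := \sum_(a : J) _ * _.
  set s3 := \sum_(l < n.+1) _ * _; set s3' := \sum_(l < n.+1) _ * _.
  set m1 := \sum_(a : J) Num.max _ _; set m2 := \sum_(l < n.+1) Num.max _ _.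
  set n1 := \sum_(a : J) _ * _; set n2 := \sum_(l < n.+1) `|_|; set n3 := \sum_(i < d) inner _ _.
  lra.
have -> : f k x + delta * G - (g k x' + delta * G') = D + delta * (G - G') by rewrite /D; ring.
have H1 := ler_wpM2l dl0 GG; have H2 := ler_wpM2r DT dl1; lra.
Qed.

(** For [e = w / |w|], a step and its reflection differ by [2 e_i e], so the difference of the
    coupled walks stays on the line through [w] along [e], where [Fl_sym] and [walk_sym] apply. The
    reflected frame is tight, so it can later be replaced by the original one. *)
Lemma refl_part m (tau c be r1 : R) w (f g : V -> R) x x' : 0 <= c -> 0 < r1 -> x - x' = w ->
  r1 <= enorm w -> eta <= enorm w / 2 -> lam * Rr w <= 1 -> eta ^+ 2 <= lam * r1 ^+ 3 / 64 ->
  (forall x x', f x - g x' <= Th c be (x - x')) ->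
  exists2 E' : 'I_d -> V, tight E' &
  avgm m e_ tau f x - avgm m E' tau g x' <=
  Th c be w + c * (- (lam / 64 * (m%:R * (4 * tau ^+ 2 / d%:R))) + (8 / r1 ^+ 3 + lam / r1 ^+ 2) * (m%:R ^+ 2 * (64 * tau ^+ 4))).
Proof.
move=> c0 r10 xw rw ew lR eR fg.
set r := enorm w in rw ew *.
have r0 : 0 < r by apply: lt_le_trans rw.
pose e : V := r^-1 *: w.
have e1 : enorm e = 1 by rewrite /e enormZ gtr0_norm ?invr_gt0// mulVf// gt_eqF.
have we : inner w e = r by rewrite /e innerZr -sqr_enorm -/r; field; rewrite gt_eqF.
have ee : inner e e = 1 by rewrite -sqr_enorm e1 expr1n.
clearbody e; exists (fun i => e_ i - (2 * e 0 i) *: e); first exact: tight_refl.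
apply: le_trans (avgm_coupled d0 m e_ (fun i => e_ i - (2 * e 0 i) *: e) tau fg x x') _.
have -> : (fun i : 'I_d => e_ i - (e_ i - (2 * e 0 i) *: e)) = (fun i => (2 * e 0 i) *: e).
  by apply/funext => i; rewrite opprB addrCA subrr addr0.
have -> : x - x' = w + (0 : R^o) *: e by rewrite scale0r addr0.
rewrite (@avgm_affine R d V R^o (fun i => 2 * e 0 i) (fun t : R^o => w + t *: e)); first last.
- move=> i y; transitivity (w + (y *: e - (tau * (2 * e 0 i)) *: e)); last by rewrite addrA (scalerA tau).
  by congr (_ + _); exact: scalerBl.
- move=> i y; transitivity (w + (y *: e + (tau * (2 * e 0 i)) *: e)); last by rewrite addrA (scalerA tau).
  by congr (_ + _); exact: scalerDl.
have FlE (t : R) : Th c be (w + t *: e) = c * Fl lam eta r t + be.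
  rewrite /Th /Fl /Rr; congr (_ * psi lam (Num.sqrt (_ + _)) + _).
  rewrite innerDl !innerDr !innerZl !innerZr (innerC e) we ee -sqr_enorm -/r.
  by ring.
have E2 : \sum_(i < d) (2 * e 0 i) ^+ 2 = 4.
  transitivity (4 * inner e e); last by rewrite -sqr_enorm e1 expr1n mulr1.
  by rewrite /inner mulr_sumr; apply: eq_bigr => i _; ring.
set b := 8 / r1 ^+ 3 + _.
have b0 : 0 <= b by rewrite addr_ge0 ?divr_ge0 ?exprn_ge0 ?(ltW r10) ?(ltW lam0).
have Tw : Th c be w = c * Fl lam eta r 0 + be by rewrite -FlE scale0r addr0.
have RE : Rr w = Num.sqrt (r ^+ 2 + eta ^+ 2) by rewrite /Rr -sqr_enorm.
rewrite RE in lR.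
have S t := @Fl_sym _ lam eta r r1 t lam0 r10 rw ew (ltW eta0) lR eR.
have := @walk_sym _ _ d0 _ tau E2 m (fun t : R^o => Th c be (w + t *: e)) (Th c be w) (c * (lam / 64)) (c * b) (mulr_ge0 c0 b0) _.
move=> HW; apply: le_trans (HW _) _; last first.
  by rewrite le_eqVlt; apply/orP; left; apply/eqP; ring.
move=> t; rewrite Tw !FlE; have := ler_wpM2l c0 (S t); rewrite -/b; lra.
Qed.

End coupling.

Section frozen.
Context {R : realType} {d n : nat}.
Hypothesis d0 : (0 < d)%N.
Local Notation V := 'rV[R]_d.
Local Notation I := 'I_n.+1.
Local Notation e_ := (@evec R d).
Variables (lam eta : R).
Hypotheses (lam0 : 0 < lam) (eta0 : 0 < eta).

Lemma slope_bound (H th tv ev D Db h S : R) (w v bb db dj : V) :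
  0 <= H -> 0 <= th -> 0 <= ev -> 0 <= tv -> tv <= H / 2 * th -> 0 <= h ->
  bb = db - dj -> enorm dj <= tv -> enorm (w - v) <= ev -> enorm bb <= D -> enorm db <= Db ->
  2 * inner v db + S <= 2 * H * th * enorm v ->
  slope lam eta w * (2 * inner w bb + h * inner bb bb + S) <=
  3 / 2 * H * th + (H * th * ev + ev * Db + h * D ^+ 2 / 2) / eta.
Proof.
move=> H0 th0 ev0 tv0 tvl h0 bbE djl wv bD bDb vS.
have Rg := Rr_gt0 eta0 w; have Re := Rr_geeta eta0 w; have Rw := Rr_ge eta w.
have D0 : 0 <= D by apply: le_trans bD; exact: enorm_ge0.
have Db0 : 0 <= Db by apply: le_trans bDb; exact: enorm_ge0.
set X := 3 * H * th * Rr eta w + 2 * H * th * ev + 2 * ev * Db + h * D ^+ 2.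
have HX : 0 <= X.
  by rewrite !addr_ge0 ?mulr_ge0 ?sqr_ge0 ?addr_ge0// ltW.
have vle : enorm v <= Rr eta w + ev.
  have -> : v = w - (w - v) by rewrite subKr.
  by apply: le_trans (enorm_triB _ _) _; exact: lerD.
have XB : 2 * inner w bb + h * inner bb bb + S <= X.
  have e1 : inner w bb = inner v db - inner w dj + inner (w - v) db.
    by rewrite bbE innerBl innerBr; ring.
  have e2 : inner (w - v) db <= ev * Db.
    by apply: le_trans (inner_le _ _) _; rewrite ler_pM ?enorm_ge0.
  have e3 : - inner w dj <= Rr eta w * tv.
    rewrite -innerNr; apply: le_trans (inner_le _ _) _; rewrite enormN.
    by rewrite ler_pM ?enorm_ge0.
  have e4 : inner bb bb <= D ^+ 2.
    by rewrite -sqr_enorm lerXn2r// nnegrE ?enorm_ge0.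
  have e5 := ler_wpM2l h0 e4.
  have e6 := ler_wpM2l (ltW Rg) tvl.
  have e7 : (2 * H * th) * enorm v <= 2 * H * th * (Rr eta w + ev).
    by rewrite ler_wpM2l// !mulr_ge0.
  rewrite e1 /X; lra.
have s0 := slope_ge0 lam0 eta0 w.
apply: le_trans (ler_wpM2l s0 XB) _.
have s1 : slope lam eta w <= (2 * Rr eta w)^-1.
  have /andP[_ p1] := psi_slope (ltW lam0) (ltW Rg).
  by rewrite /slope ler_piMl// invr_ge0 mulr_ge0 ?(ltW Rg).
apply: le_trans (ler_wpM2r HX s1) _.
have -> : (2 * Rr eta w)^-1 * X = 3 / 2 * H * th + (H * th * ev + ev * Db + h * D ^+ 2 / 2) / Rr eta w.
  by rewrite /X; field; rewrite gt_eqF.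
rewrite lerD2l ler_wpM2l//; last by rewrite lef_pV2// posrE.
by rewrite !addr_ge0// ?divr_ge0// !mulr_ge0 ?sqr_ge0 ?divr_ge0.
Qed.

Lemma avgm0E m tau (F : V -> R) x : avgm m (fun _ : 'I_d => (0 : V)) tau F x = F x.
Proof.
elim: m F x => [//|m IH] F x; rewrite avgmS IH /avg.
rewrite (eq_bigr (fun=> 2 * F x)); last by move=> i _; rewrite scaler0 addr0 subr0; ring.
by rewrite sumr_const card_ord -(mulr_natl _ d); field; rewrite pnatr_eq0 -lt0n.
Qed.

(** If [lam r > 1], then [c * psi >= 2 lam r / (1 + lam r) >= 1]: cost below 1 forces the points to
    be close. *)
Lemma psi_small c : 2 * lam <= c -> forall r, 0 <= r -> c * psi lam r < 1 -> lam * r <= 1.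
Proof.
move=> cl r r0; rewrite leNgt => H; apply/negP => rl; move: H; apply/negP; rewrite -leNgt.
rewrite /psi mulrA ler_pdivlMr; last by rewrite ltr_wpDr// mulr_ge0// ltW.
have := ler_wpM2r r0 cl; lra.
Qed.

(* The supersolution property of [c psi(R) + beta], [c = 1/(time + s0) + kap]: the increase of [c] along the
   time step pays for the cost of the coupling. *)
Lemma frozen_couple (J : finType) (h tau : R) (m : nat) (uu : J -> V) (bb bb' : V) (ss ss' : 'I_d -> V)
   (pp pp' : J -> R) (qq qq' : I -> R) (k : I) (f g : I -> V -> R) x x'
   (sg kap be bbar s0 delta H Q lambda0 r1 th ths tv ev D Db err1 err2 err3 : R) (v db dj : V) :
  0 < h -> 0 <= be -> 0 < s0 -> s0 <= sg -> 0 <= delta -> 0 <= bbar -> 0 <= H -> 0 <= Q -> 0 < r1 ->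
  16 * (2 * H + 3) <= lam * lambda0 -> 2 * lam <= kap -> Q / lam <= kap ->
  eta <= r1 / 2 -> eta ^+ 2 <= lam * r1 ^+ 3 / 64 ->
  0 <= th -> th <= 1 -> (enorm (x - x') < r1 -> th <= ths) -> 0 <= ev -> 0 <= tv -> tv <= H / 2 * th ->
  m%:R * tau ^+ 2 = lambda0 * h * d%:R ->
  (H * ev + ev * Db + h * D ^+ 2 / 2) / eta <= err1 ->
  (8 / r1 ^+ 3 + lam / r1 ^+ 2) * (64 * lambda0 ^+ 2 * d%:R ^+ 2 * h) <= err2 ->
  err1 + err2 <= 1 -> 0 <= err2 -> 0 <= err3 ->
  err3 + Q * ev <= bbar ->
  (s0^-1 + kap) * (2 * H * ths + err1) + Q * (r1 + ev) + (r1 + eta) / s0 ^+ 2 <= bbar ->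
  (forall E', tight E' -> `|avgm m e_ tau (g k) x' - avgm m E' tau (g k) x'| <= h * err3) ->
  let c := sg^-1 + kap in
  (forall k x x', f k x - g k x' <= Th lam eta c be (x - x')) ->
  (forall k l x x', f k x - g l x' <= 1) ->
  (forall a, 0 <= pp a) -> (forall a, 0 <= pp' a) -> (forall l, 0 <= qq l) -> (forall l, 0 <= qq' l) ->
  delta * (h^-1 + d%:R * h^-1 + h^-1 + \sum_(a : J) Num.max (pp a) (pp' a) + \sum_(l < n.+1) Num.max (qq l) (qq' l)) <= 1 ->
  bb - bb' = db - dj -> enorm dj <= tv -> enorm (x - x' - v) <= ev -> enorm (bb - bb') <= D -> enorm db <= Db ->
  2 * inner v db + \sum_(i < d) inner (ss i - ss' i) (ss i - ss' i) <= 2 * H * th * enorm v ->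
  \sum_(a : J) `|pp a - pp' a| * enorm (uu a) <= tv ->
  \sum_(l < n.+1) `|qq l - qq' l| <= Q * enorm v ->
  Th lam eta ((sg + delta)^-1 + kap) (be + delta * bbar) (x - x') < 1 ->
  f k x + delta * Gop h tau m uu bb ss pp qq k f x - (g k x' + delta * Gop h tau m uu bb' ss' pp' qq' k g x')
  <= Th lam eta ((sg + delta)^-1 + kap) (be + delta * bbar) (x - x').
Proof.
move=> h0 be0 s00 ssg dl0 bb0 H0 Q0 r10 lamH kapl kapQ er1 er13 th0 th1 thr ev0 tv0 tvth mtau E1 E2 E12 err20 err30
  B1 B2 LB c fg fg1 p0 p0' q0 q0' rates bbE djl wv bD bDb vS pq qv Tl.
set w := x - x' in fg thr wv Tl *.
have sg0 : 0 < sg by apply: lt_le_trans ssg.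
have sgd0 : 0 < sg + delta by rewrite ltr_wpDr.
have kap0 : 0 < kap by apply: lt_le_trans kapl; rewrite mulr_gt0.
have c0 : 0 <= c by rewrite addr_ge0// ?invr_ge0 ltW.
set c' := (sg + delta)^-1 + kap.
have c'0 : 0 <= c' by rewrite addr_ge0// ?invr_ge0 ltW.
have Rg := Rr_gt0 eta0 w.
have ps0 := psi_ge0 (ltW lam0) (ltW Rg).
have cps : c' * psi lam (Rr eta w) < 1.
  by apply: le_lt_trans Tl; rewrite /Th lerDl addr_ge0// mulr_ge0.
have Rlam : lam * Rr eta w <= 1.
  by apply: (psi_small _ (ltW Rg) cps); rewrite (le_trans kapl)// lerDr invr_ge0 ltW.
set gr := slope lam eta w * (2 * inner w (bb - bb') + h * inner (bb - bb') (bb - bb') +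
    \sum_(i < d) inner (ss i - ss' i) (ss i - ss' i)).
have gr1 : gr <= 3 / 2 * H * th + err1.
  apply: le_trans (slope_bound H0 th0 ev0 tv0 tvth (ltW h0) bbE djl wv bD bDb vS) _.
  rewrite lerD2l (le_trans _ E1)// ler_wpM2r ?invr_ge0 ?(ltW eta0)// !lerD2r.
  by rewrite ler_wpM2r// ler_piMr// mulr_ge0// divr_ge0.
have vle : enorm v <= enorm w + ev.
  have -> : v = w - (w - v) by rewrite subKr.
  by apply: le_trans (enorm_triB _ _) _; rewrite lerD2l.
have tvc : c * \sum_(a : J) `|pp a - pp' a| * enorm (uu a) <= c * (H / 2 * th).
  by rewrite ler_wpM2l// (le_trans pq).
have qle : \sum_(l < n.+1) `|qq l - qq' l| <= Q * (enorm w + ev).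
  by rewrite (le_trans qv)// ler_wpM2l.
(* The contribution [g3] of the walk is left open. The last term is the rate at which the cost
   decreases when [c] becomes [c']. *)
have key g3 : avgm m e_ tau (f k) x - avgm m e_ tau (g k) x' <= Th lam eta c be w + h * g3 ->
   c * (2 * H * th + err1) + g3 + Q * (enorm w + ev) + psi lam (Rr eta w) / (sg * (sg + delta)) <= bbar ->
  f k x + delta * Gop h tau m uu bb ss pp qq k f x - (g k x' + delta * Gop h tau m uu bb' ss' pp' qq' k g x')
  <= Th lam eta c' (be + delta * bbar) w.
  move=> H1 H2; apply: le_trans (Gop_couple lam0 eta0 uu bb bb' ss ss' h0 c0 be0 fg fg1 p0 p0' q0 q0' H1 dl0 rates) _.
  rewrite -/w -/gr.
  have -> : Th lam eta c' (be + delta * bbar) w =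
      Th lam eta c be w + delta * (bbar - psi lam (Rr eta w) / (sg * (sg + delta))).
    by rewrite /Th /c' /c; field; rewrite !gt_eqF.
  rewrite lerD2l ler_wpM2l//.
  clear h0 be0 s00 ssg H0 Q0 r10 lamH kapl kapQ er1 er13 th0 th1 thr ev0 tv0 tvth mtau E1 E2 E12 err20 err30 B1 B2 rates bbE djl
    wv bD bDb vS pq qv Tl sg0 sgd0 kap0 c'0 Rg ps0 cps Rlam vle dl0 bb0 H1.
  have := ler_wpM2l c0 gr1; lra.
(* Near the diagonal the walks are coupled synchronously, without gain. There [th <= ths], and
   everything is absorbed by [bbar], with [c] replaced by its largest value [s0^-1 + kap]. *)
have [rw|rw] := ltP (enorm w) r1.
  apply: (key 0).
    rewrite mulr0 addr0; apply: le_trans (avgm_coupled d0 m e_ e_ tau (fg k) x x') _.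
    rewrite (_ : (fun i => _) = fun=> 0); last by apply/funext => i; rewrite subrr.
    by rewrite avgm0E.
  have cm : c <= s0^-1 + kap by rewrite lerD2r lef_pV2// posrE.
  have th' := thr rw.
  have e0 : 0 <= err1.
    apply: le_trans E1; have D0 : 0 <= Db by apply: le_trans bDb; exact: enorm_ge0.
    apply: divr_ge0; last exact: ltW.
    have hD : 0 <= h * D ^+ 2 / 2 by rewrite divr_ge0// mulr_ge0 ?sqr_ge0// ltW.
    by rewrite !addr_ge0// mulr_ge0.
  have X1 : c * (2 * H * th + err1) <= (s0^-1 + kap) * (2 * H * ths + err1).
    apply: ler_pM => //; first by rewrite addr_ge0// !mulr_ge0.
    by rewrite lerD2r ler_wpM2l// mulr_ge0.
  have X2 : Q * (enorm w + ev) <= Q * (r1 + ev) by rewrite ler_wpM2l// lerD2r ltW.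
  have X3 : psi lam (Rr eta w) / (sg * (sg + delta)) <= (r1 + eta) / s0 ^+ 2.
    apply: ler_pM => //.
    - by rewrite invr_ge0 mulr_ge0 ?ltW.
    - apply: le_trans (psi_le (ltW lam0) (ltW Rg)) _.
      by apply: le_trans (Rr_le eta0 w) _; rewrite lerD2r ltW.
    - rewrite lef_pV2 ?posrE ?mulr_gt0 ?exprn_gt0// expr2 ler_pM ?(ltW s00)//.
      by apply: le_trans ssg _; rewrite lerDl.
  clear be0 s00 ssg h0 r10 lamH kapl kapQ er1 er13 thr ev0 tv0 tvth mtau E1 E2 E12 B1 rates bbE djl
    wv bD bDb vS pq qv Tl sg0 sgd0 kap0 c'0 Rg ps0 cps Rlam vle dl0 gr1 tvc qle key rw.
  lra.
have ew : eta <= enorm w / 2 by apply: le_trans er1 _; rewrite ler_wpM2r.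
(* Away from the diagonal the walk of [g] is reflected; returning to the original frame costs
   [h * err3]. *)
have [E' tE' HE'] := @refl_part R d d0 lam eta lam0 eta0 m tau c be r1 w (f k) (g k) x x' c0 r10 erefl rw ew Rlam er13 (fg k).
apply: (key (c * (- (lam * lambda0 / 16) + err2) + err3)).
  have L1 := LB E' tE'; rewrite distrC in L1; have {}L1 := le_trans (ler_norm _) L1.
  set T := Th lam eta c be w in HE' *.
  have Y1 : lam / 64 * (m%:R * (4 * tau ^+ 2 / d%:R)) = h * (lam * lambda0 / 16).
    rewrite (_ : _ * (_ / _) = 4 * (m%:R * tau ^+ 2) / d%:R); last by ring.
    by rewrite mtau; field; rewrite pnatr_eq0 -lt0n.
  have Y2 : (8 / r1 ^+ 3 + lam / r1 ^+ 2) * (m%:R ^+ 2 * (64 * tau ^+ 4)) <= h * err2.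
    rewrite (_ : _ ^+ 2 * (64 * tau ^+ 4) = 64 * (m%:R * tau ^+ 2) ^+ 2); last by ring.
    have := ler_wpM2l (ltW h0) E2; rewrite mtau; apply: le_trans.
    by rewrite le_eqVlt; apply/orP; left; apply/eqP; ring.
  clear be0 s00 ssg H0 Q0 r10 lamH kapl kapQ er1 er13 th0 th1 thr ev0 tv0 tvth mtau E1 E2 E12 err20 err30 B1 B2 rates bbE djl
    wv bD bDb vS pq qv Tl sg0 sgd0 kap0 c'0 Rg ps0 cps Rlam vle dl0 bb0 gr1 tvc qle key ew rw.
  rewrite Y1 in HE'; have := ler_wpM2l c0 Y2; lra.
(* Cost below 1 gives [psi <= sg + delta], so the decrease of [c] costs at most [1 / sg <= c]. *)
have sgc : psi lam (Rr eta w) / (sg * (sg + delta)) <= c.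
  have P : psi lam (Rr eta w) <= sg + delta.
    have : (sg + delta)^-1 * psi lam (Rr eta w) <= 1.
      apply: le_trans (ltW cps); rewrite ler_wpM2r// lerDl ltW//.
    by rewrite ler_pdivrMl// mulr1.
  apply: (@le_trans _ _ sg^-1); last by rewrite lerDl ltW.
  rewrite ler_pdivrMr ?mulr_gt0// mulrA mulVf ?gt_eqF// mul1r//.
have Qw : Q * enorm w <= c.
  apply: (@le_trans _ _ (Q / lam)); last by rewrite (le_trans kapQ)// lerDr invr_ge0 ltW.
  rewrite ler_wpM2l// -[leRHS]mul1r ler_pdivlMr// mulrC (le_trans _ Rlam)//.
  by rewrite ler_wpM2l ?(ltW lam0)// Rr_ge.
(* The gain is [c * lam * lambda0 / 16]. In [2 * H + 3], the part [2 * H] pays for drift, diffusion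
   and jumps, and 3 pays for three terms of size at most [c]: the errors [err1 + err2], the decrease
   of [c], and the switching [Q * |w|]. *)
have Z1 := ler_wpM2l c0 lamH.
have Z2 := ler_wpM2l c0 E12.
have Z3 : c * (2 * H * th) <= c * (2 * H) by rewrite ler_wpM2l// ler_piMr// mulr_ge0.
clear be0 s00 ssg h0 r10 lamH kapl kapQ er1 er13 thr ev0 tv0 tvth mtau E1 E2 E12 B2 rates bbE djl
  wv bD bDb vS pq qv Tl sg0 sgd0 kap0 c'0 Rg ps0 cps Rlam vle dl0 gr1 tvc qle key ew rw.
lra.
Qed.

End frozen.

(** * Local bounds on the coefficients *)

Section local_bounds.
Context {R : realType} {d : nat}.
Local Notation V := 'rV[R]_d.
Local Notation e_ := (@evec R d).

Lemma fin_bound (J : finType) (T : Type) (P : J -> T -> Prop) (F : J -> T -> R) :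
  (forall j, exists B, forall x, P j x -> F j x <= B) ->
  exists2 B, 0 <= B & forall j x, P j x -> F j x <= B.
Proof.
move=> /choice[B HB]; exists (\sum_j `|B j|); first by rewrite sumr_ge0.
move=> j x /HB; move/le_trans; apply; apply: le_trans (ler_norm _) _.
by rewrite (bigD1 j)//= lerDl sumr_ge0.
Qed.

(* Testing the one-sided condition at the points [+-M e_i] bounds each coordinate of [b x] from both sides. *)
Lemma onesided_locbdd (b : V -> V) (H : R) (rho : R -> R) : 0 <= H ->
  (forall r s, 0 <= r -> r <= s -> rho r <= rho s) -> (forall r, 0 <= r -> 0 <= rho r) ->
  (forall x z, 2 * inner (x - z) (b x - b z) <= H * enorm (x - z) * rho (enorm (x - z))) ->
  forall N, exists B, forall x, enorm x <= N -> enorm (b x) <= B.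
Proof.
move=> H0 rm r0 Hb N.
have [N0|N0] := ltP N 0; first by exists 0 => x xN; have := enorm_ge0 x; lra.
(* Summing the coordinate bounds gives [(M - d N) * S <= d * C], so [M] is chosen with
   [M - d N = 1]. *)
pose M := d%:R * N + 1.
have M0 : 0 <= M by rewrite addr_ge0// mulr_ge0.
pose C := H * (N + M) * rho (N + M) / 2 + (N + M) * (\sum_(i < d) (enorm (b (M *: e_ i)) + enorm (b (- M *: e_ i)))).
have NM : 0 <= N + M by rewrite addr_ge0.
have Cz x z : enorm x <= N -> enorm z <= M -> inner (x - z) (b x) <= H * (N + M) * rho (N + M) / 2 + (N + M) * enorm (b z).
  move=> xN zM; have xz : enorm (x - z) <= N + M by apply: le_trans (enorm_triB _ _) _; exact: lerD.
  have h1 := Hb x z; rewrite innerBr in h1.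
  have h2 : H * enorm (x - z) * rho (enorm (x - z)) <= H * (N + M) * rho (N + M).
    apply: ler_pM; rewrite ?mulr_ge0 ?enorm_ge0 ?r0 ?enorm_ge0 ?ler_wpM2l//.
    by apply: rm => //; exact: enorm_ge0.
  have h3 : inner (x - z) (b z) <= (N + M) * enorm (b z).
    by apply: le_trans (inner_le _ _) _; rewrite ler_wpM2r ?enorm_ge0.
  lra.
have Me i : enorm (M *: e_ i) <= M by rewrite enormZ enorm_evec mulr1 ger0_norm.
have Mne i : enorm (- M *: e_ i) <= M by rewrite enormZ enorm_evec mulr1 normrN ger0_norm.
have Ci x i : enorm x <= N -> M * `|b x 0 i| + inner x (b x) <= C.
  move=> xN; have S1 : enorm (b (M *: e_ i)) + enorm (b (- M *: e_ i)) <= \sum_(i < d) (enorm (b (M *: e_ i)) + enorm (b (- M *: e_ i))).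
    by rewrite [leRHS](bigD1 i)//= lerDl sumr_ge0// => j _; rewrite addr_ge0 ?enorm_ge0.
  have h1 := Cz x _ xN (Me i); have h2 := Cz x _ xN (Mne i).
  rewrite !innerBl !innerZl !(innerC (e_ i)) inner_evecr in h1 h2.
  have h3 := ler_wpM2l NM S1.
  have h4 := mulr_ge0 NM (enorm_ge0 (b (M *: e_ i))); have h5 := mulr_ge0 NM (enorm_ge0 (b (- M *: e_ i))).
  rewrite /C; have [bx|bx] := leP 0 (b x 0 i); [rewrite ger0_norm// | rewrite ltr0_norm//]; lra.
exists (d%:R * C) => x xN; apply: le_trans (enorm_le_sum _) _.
set S := \sum_(i < d) _.
have h1 : M * S + d%:R * inner x (b x) <= d%:R * C.
  have dE (t : R) : d%:R * t = \sum_(i < d) t by rewrite sumr_const card_ord mulr_natl.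
  by rewrite !dE mulr_sumr -big_split/= ler_sum// => i _; exact: Ci.
have h2 : - inner x (b x) <= N * S.
  rewrite -innerNl; apply: le_trans (inner_le _ _) _; rewrite enormN.
  by rewrite ler_pM ?enorm_ge0// enorm_le_sum.
have := ler_wpM2l (ler0n R d) h2; rewrite /M in h1; lra.
Qed.

Lemma hs2_ge0 (A : 'M[R]_d) : 0 <= hs2 A.
Proof. by rewrite !sumr_ge0// => i _; rewrite sumr_ge0// => j _; rewrite sqr_ge0. Qed.

Lemma hs2_tr (A : 'M[R]_d) : hs2 A = \tr (A *m A^T).
Proof. by apply: eq_bigr => i _; rewrite mxE; apply: eq_bigr => j _; rewrite mxE expr2. Qed.

Lemma hs2D (A B : 'M[R]_d) : hs2 A <= 2 * hs2 (A - B) + 2 * hs2 B.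
Proof.
rewrite -mulrDr -big_split/= mulr_sumr ler_sum// => i _.
rewrite -big_split/= mulr_sumr ler_sum// => j _; rewrite !mxE.
have := sqr_ge0 (A i j - 2 * B i j); lra.
Qed.

Lemma hs2_rows (A B : 'M[R]_d) : hs2 (A - B) = \sum_(i < d) inner (row i A - row i B) (row i A - row i B).
Proof. by apply: eq_bigr => i _; apply: eq_bigr => j _; rewrite !mxE expr2. Qed.

Lemma enorm_row (A : 'M[R]_d) i : enorm (row i A) ^+ 2 <= hs2 A.
Proof.
rewrite sqr_enorm /hs2 (bigD1 i)//= (_ : inner _ _ = \sum_(j < d) A i j ^+ 2).
  by rewrite lerDl sumr_ge0// => j _; rewrite sumr_ge0// => l _; rewrite sqr_ge0.
by apply: eq_bigr => j _; rewrite !mxE expr2.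
Qed.

(** The Hilbert-Schmidt norm of [sl] is at most that of [sigma], their squares being the traces of
    [a - lambda0 I] and of [a]. Once the drift is locally bounded, the one-sided condition compares
    [sigma x] with [sigma 0]. *)
Lemma sqrt_locbdd (a sl sigma : V -> 'M[R]_d) (b : V -> V) (lambda0 H : R) (rho : R -> R) : 0 <= H -> 0 <= lambda0 ->
  (forall r s, 0 <= r -> r <= s -> rho r <= rho s) -> (forall r, 0 <= r -> 0 <= rho r) ->
  (forall x z, hs2 (sigma x - sigma z) + 2 * inner (x - z) (b x - b z) <= H * enorm (x - z) * rho (enorm (x - z))) ->
  (forall x, sigma x *m (sigma x)^T = a x) -> (forall x, (sl x)^T = sl x) ->
  (forall x, sl x *m sl x = a x - lambda0%:M) ->
  forall N, exists B, forall x, enorm x <= N -> forall i, enorm (row i (sl x)) <= B.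
Proof.
move=> H0 l0 rm r0 Hb sa slT sls N.
have [N0|N0] := ltP N 0; first by exists 0 => x xN; have := enorm_ge0 x; lra.
have Hb' x z : 2 * inner (x - z) (b x - b z) <= H * enorm (x - z) * rho (enorm (x - z)).
  by apply: le_trans (Hb x z); rewrite lerDr hs2_ge0.
have [B HB] := onesided_locbdd H0 rm r0 Hb' N.
have B0 : 0 <= B by apply: le_trans (HB 0 _); rewrite ?enorm_ge0// enorm0.
pose S := 2 * (H * N * rho N + 4 * N * B) + 2 * hs2 (sigma 0).
exists (1 + S) => x xN i.
have h1 := Hb x 0; rewrite subr0 in h1.
have h2 : H * enorm x * rho (enorm x) <= H * N * rho N.
  apply: ler_pM; rewrite ?mulr_ge0 ?enorm_ge0 ?r0 ?enorm_ge0 ?ler_wpM2l//.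
  by apply: rm => //; exact: enorm_ge0.
have h3 : - inner x (b x - b 0) <= N * (2 * B).
  rewrite -innerNl; apply: le_trans (inner_le _ _) _; rewrite enormN ler_pM ?enorm_ge0//.
  apply: le_trans (enorm_triB _ _) _; have := HB x xN; have := HB 0; rewrite enorm0 => /(_ N0); lra.
have h4 := hs2D (sigma x) (sigma 0).
have h5 : hs2 (sl x) <= S.
  apply: (@le_trans _ _ (hs2 (sigma x))); last by rewrite /S; lra.
  rewrite !hs2_tr sa slT sls mxtraceD raddfN/= mxtrace_scalar lerBlDr lerDl.
  by rewrite mulrn_wge0.
have h6 := enorm_row (sl x) i.
have S0 : 0 <= S by apply: le_trans h5; exact: hs2_ge0.
apply: le_of_sqr; first by rewrite addr_ge0.
rewrite (_ : (1 + S) ^+ 2 = 1 + 2 * S + S ^+ 2); last by ring.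
clearbody S; have := sqr_ge0 S; lra.
Qed.

End local_bounds.

(** * Jump measures *)

Section borel.
Context {R : realType} {d : nat}.
Local Notation V := 'rV[R]_d.

Lemma Rd_open (U : set V) : open U -> measurable (U : set (Rd R d)).
Proof. by move=> oU; apply: sub_sigma_algebra. Qed.

Lemma borel_cont (g : V -> R) : continuous g -> borel_fun g.
Proof.
move=> /continuousP cg; apply: (measurability _ (RGenOpens.measurableE R)).
by move=> _ [_ [a [b ->] <-]]; rewrite setTI; apply: Rd_open; exact/cg/interval_open.
Qed.

Lemma enorm_continuous : continuous (@enorm R d).
Proof. by apply: (@elip_continuous _ _ 1) => // x y; rewrite mul1r; exact: enorm_lip. Qed.

Lemma borel_enorm : borel_fun (@enorm R d).
Proof. by apply: borel_cont; exact: enorm_continuous. Qed.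

Lemma measurable_Rd0 : measurable (@Rd0 R d).
Proof.
rewrite (_ : @Rd0 R d = (@enorm R d) @^-1` `]0, +oo[%classic).
  by rewrite -[X in measurable X]setTI; apply: borel_enorm.
apply/seteqP; split => x /=; rewrite in_itv/= andbT.
  by move=> x0; rewrite lt_neqAle enorm_ge0 andbT eq_sym; apply/eqP => /enorm_eq0.
by move=> x0 xE; rewrite xE enorm0 ltxx in x0.
Qed.

Lemma Rd0P (u : V) : @Rd0 R d u <-> 0 < enorm u.
Proof.
split=> [u0|u0 uE]; last by rewrite uE enorm0 ltxx in u0.
by rewrite lt_neqAle enorm_ge0 andbT eq_sym; apply/eqP => /enorm_eq0.
Qed.

Lemma borel_set (g : V -> R) (B : set R) : borel_fun g -> measurable B ->
  measurable ([set u | B (g u)] : set (Rd R d)).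
Proof. by move=> mg mB; rewrite -[X in measurable X]setTI; apply: mg. Qed.

Definition mm (u : V) : R := Num.min 1 (enorm u ^+ 2).

Lemma borel_mm : borel_fun mm.
Proof.
apply: measurable_minr; first exact: measurable_cst.
by apply: measurable_funX; exact: borel_enorm.
Qed.

Lemma mm_ge0 u : 0 <= mm u. Proof. by rewrite le_min ler01 sqr_ge0. Qed.
(** Grading by [|u| + 1 / |u|] treats small and large jumps at once: high indices leave every
    compact set of nonzero vectors, and on a shell [|u|] is comparable with [j * mm u]. *)
Definition shell (j : nat) : set (Rd R d) := 
  [set u : V | 0 < enorm u /\ j%:R <= enorm u + (enorm u)^-1 < j.+1%:R].

(** [|u|] is [mm u] times the larger of [|u|] and [1 / |u|]; the smaller of the two is at most 1,
    whence the shifts of the index by one. *)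
Lemma shell_mm j u : shell j u -> enorm u <= j.+1%:R * mm u /\ j.-1%:R * mm u <= enorm u.
Proof.
case=> u0 /andP[ju uj]; set r := enorm u in u0 ju uj *.
have ri : 0 < r^-1 by rewrite invr_gt0.
have j1 : j.-1%:R <= r /\ j.-1%:R <= r^-1 \/ j.-1%:R + 1 <= r + r^-1.
  case: j ju {uj} => [|j] ju; first by left; rewrite !ltW.
  by right; rewrite -natr1 in ju.
have rr : r * r^-1 = 1 by rewrite mulfV// gt_eqF.
have jn : 0 <= j.-1%:R :> R by [].
have jn' : 0 <= j.+1%:R :> R by [].
rewrite /mm; have [r1|r1] := leP 1 (r ^+ 2).
  rewrite !mulr1; have r1' : 1 <= r by rewrite -(@ler_pXn2r _ 2)// ?nnegrE ?expr1n// ltW.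
  have ri1 : r^-1 <= 1 by rewrite invf_le1.
  by split; lra.
have r1' : r <= 1 by rewrite -(@ler_pXn2r _ 2)// ?nnegrE ?expr1n// ltW.
rewrite expr2 !mulrA; split.
  rewrite -[leLHS]mul1r ler_wpM2r ?(ltW u0)// -(ler_pM2r ri) -mulrA rr mul1r mulr1; lra.
rewrite -[leRHS]mul1r ler_wpM2r ?(ltW u0)// -(ler_pM2r ri) -mulrA rr mul1r mulr1; lra.
Qed.

Lemma measurable_shell j : measurable (shell j).
Proof.
pose g (i : nat) (u : V) := enorm u ^+ 2 + 1 - i%:R * enorm u.
have mg i : borel_fun (g i).
  apply: measurable_funB; last by apply: measurable_funM; [exact: measurable_cst|exact: borel_enorm].
  by apply: measurable_funD; [apply: measurable_funX; exact: borel_enorm|exact: measurable_cst].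
have -> : shell j = [set u : V | `]0, +oo[%classic (enorm u)] `&`
    ([set u : V | `[0, +oo[%classic (g j u)] `&` [set u : V | `]-oo, 0[%classic (g j.+1 u)]).
  apply/seteqP; split => u; rewrite /shell/= !in_itv/= !andbT /g subr_ge0 subr_lt0.
    move=> [u0 /andP[]]; have -> : enorm u + (enorm u)^-1 = (enorm u ^+ 2 + 1) / enorm u by field; rewrite gt_eqF.
    by rewrite ler_pdivlMr// ltr_pdivrMr.
  move=> [u0 []]; split => //; have -> : enorm u + (enorm u)^-1 = (enorm u ^+ 2 + 1) / enorm u by field; rewrite gt_eqF.
  by rewrite ler_pdivlMr// ltr_pdivrMr//; apply/andP.
apply: measurableI; last apply: measurableI; apply: borel_set => //; exact: borel_enorm.
Qed.

Lemma shell_disj i j u : shell i u -> shell j u -> i = j.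
Proof.
move=> [_ /andP[i1 i2]] [_ /andP[j1 j2]]; apply/eqP; rewrite eqn_leq.
have a1 := le_lt_trans i1 j2; have a2 := le_lt_trans j1 i2.
by rewrite !ltr_nat !ltnS in a1 a2; rewrite a1 a2.
Qed.

Lemma shell_cover u : 0 < enorm u -> exists j, shell j u.
Proof.
move=> u0; exists (Num.truncn (enorm u + (enorm u)^-1)); split => //.
by apply: truncn_itv; rewrite addr_ge0 ?invr_ge0 ?ltW.
Qed.

End borel.

Lemma Rintegral_sum d (T : measurableType d) (R : realType) (mu : {measure set T -> \bar R}) (D : set T)
    (J : finType) (F : J -> T -> R) : measurable D -> (forall a, mu.-integrable D (EFin \o F a)) ->
  Rintegral mu D (fun x => \sum_a F a x) = \sum_a Rintegral mu D (F a).
Proof.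
move=> mD iF; rewrite /Rintegral sum_fine; last by move=> a _; exact: integrable_fin_num (iF a).
rewrite -(integral_sum mD iF); congr fine; apply: eq_integral => x _ /=.
by rewrite sumEFin.
Qed.

Lemma Rintegral_mul_indic d (T : measurableType d) (R : realType) (mu : {measure set T -> \bar R}) (D E : set T)
    (f : T -> R) : E `<=` D -> Rintegral mu D (fun x => f x * \1_E x) = Rintegral mu E f.
Proof.
move=> ED; rewrite -[in RHS](setIidr ED) Rintegral_mkcondr; apply: eq_Rintegral => x xD.
by rewrite patchE indicE; case: ifP => _; rewrite ?mulr1 ?mulr0.
Qed.

(** * Integrals against a jump measure with finite mass of min(1, |u|^2) *)

Section mass.
Context {R : realType} {d : nat}.
Local Notation V := 'rV[R]_d.
Variables (mu : {measure set Rd R d -> \bar R}) (C : R).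
Hypothesis HC : (\int[mu]_(u in @Rd0 R d) (mm u)%:E <= C%:E)%E.
Local Notation Ig D f := (Rintegral mu D f).
Implicit Types (D : set (Rd R d)) (f : V -> R).

Let mmE D : measurable D -> D `<=` @Rd0 R d -> measurable_fun D (EFin \o @mm R d).
Proof. by move=> mD _; apply/measurable_EFinP; apply: measurable_funTS; exact: borel_mm. Qed.

Lemma mm_le_mass D D' : measurable D -> measurable D' -> D' `<=` @Rd0 R d -> D `<=` D' ->
  (\int[mu]_(u in D) (mm u)%:E <= \int[mu]_(u in D') (mm u)%:E)%E.
Proof.
move=> mD mD' D0 DD; apply: ge0_subset_integral => //; first exact: mmE.
by move=> x _; rewrite lee_fin mm_ge0.
Qed.

Lemma mm_int D : measurable D -> D `<=` @Rd0 R d -> mu.-integrable D (EFin \o @mm R d).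
Proof.
move=> mD D0; apply/integrableP; split; first exact: mmE.
apply: (@le_lt_trans _ _ (\int[mu]_(u in @Rd0 R d) (mm u)%:E)%E).
  rewrite (_ : (fun x => `|_|%E) = EFin \o @mm R d); last by apply/funext => u /=; rewrite ger0_norm// mm_ge0.
  by apply: mm_le_mass => //; exact: measurable_Rd0.
by apply: le_lt_trans HC _; rewrite ltry.
Qed.

Lemma mm_intZ D (c : R) : measurable D -> D `<=` @Rd0 R d ->
  mu.-integrable D (EFin \o (fun u : V => c * mm u)).
Proof.
move=> mD D0; rewrite (_ : _ \o _ = fun u => (c%:E * (EFin \o @mm R d) u)%E); last exact/funext.
by apply: integrableZl => //; exact: mm_int.
Qed.

Lemma dom_int D c f : measurable D -> D `<=` @Rd0 R d -> borel_fun f ->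
  (forall u, D u -> `|f u| <= c * mm u) -> mu.-integrable D (EFin \o f).
Proof.
move=> mD D0 mf fc; apply: (@le_integrable _ _ _ _ _ mD _ (EFin \o (fun u => c * mm u))).
- by apply/measurable_EFinP; apply: measurable_funTS.
- by move=> u Du /=; rewrite lee_fin (le_trans (fc u Du))// ler_norm.
- exact: mm_intZ.
Qed.

Lemma dom_bound D c f : measurable D -> D `<=` @Rd0 R d -> borel_fun f ->
  (forall u, D u -> `|f u| <= c * mm u) -> `|Ig D f| <= c * Ig D (@mm R d).
Proof.
move=> mD D0 mf fc; have fi := dom_int mD D0 mf fc.
apply: le_trans (le_normr_Rintegral mD fi) _.
rewrite -RintegralZl//; last exact: mm_int.
apply: le_Rintegral => //.
  by apply: (@dom_int _ c) => // [|u Du]; [exact: measurableT_comp|rewrite normr_id fc].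
exact: mm_intZ.
Qed.

Lemma Ig_mm_le D : measurable D -> D `<=` @Rd0 R d -> Ig D (@mm R d) <= C.
Proof.
move=> mD D0; rewrite -lee_fin fineK; last exact: integrable_fin_num (mm_int mD D0).
by apply: le_trans HC; apply: mm_le_mass => //; exact: measurable_Rd0.
Qed.

(* Riemann sums over cells, weighted by the first moment of the cells. *)
Lemma jump_approx (J : finType) (E : J -> set (Rd R d)) (uu : J -> V) (T : set (Rd R d)) (D : V -> R) (c z K : R) :
  (forall a, measurable (E a)) -> (forall a b u, E a u -> E b u -> a = b) -> (forall a, E a `<=` @Rd0 R d) ->
  measurable T -> T `<=` @Rd0 R d -> (forall u, @Rd0 R d u -> T u \/ exists a, E a u) -> (forall a u, E a u -> ~ T u) ->
  borel_fun D -> (forall u, @Rd0 R d u -> `|D u| <= c * mm u) ->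
  (forall a u, E a u -> enorm u <= K * mm u) -> 0 <= z -> 0 <= c -> 0 <= K ->
  (forall a u, E a u -> `|D u - enorm u * (D (uu a) / enorm (uu a))| <= z * enorm u) ->
  `|Ig (@Rd0 R d) D - \sum_(a : J) Ig (E a) (@enorm R d) / enorm (uu a) * D (uu a)| <=
  c * Ig T (@mm R d) + z * K * C.
Proof.
move=> mE dE E0 mT T0 cov ET mD Dc EK z0 c0 K0 Dz.
have m0 := @measurable_Rd0 R d.
(* On the cell [E a] the integrand is replaced by [|u| * w a]. Weighting by [|u|] rather than by
   mass makes the cell weights at two points comparable through the total variation of [|u| nu]. *)
pose w a : R := D (uu a) / enorm (uu a).
pose Sa a (u : V) := enorm u * w a * \1_(E a) u.
have mSa a : borel_fun (Sa a).
  apply: measurable_funM; last exact: measurable_indic.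
  by apply: measurable_funM => //; exact: borel_enorm.
have iSa a : mu.-integrable (@Rd0 R d) (EFin \o Sa a).
  apply: (@dom_int _ (K * `|w a|)) => // u u0; rewrite /Sa indicE.
  case: (boolP (u \in E a)) => ua; last by rewrite mulr0 normr0 !mulr_ge0 ?mm_ge0.
  by rewrite mulr1 normrM ger0_norm ?enorm_ge0// mulrAC ler_wpM2r// (EK a)//; exact/set_mem.
have SaE a : Ig (@Rd0 R d) (Sa a) = Ig (E a) (@enorm R d) / enorm (uu a) * D (uu a).
  have -> : Ig (@Rd0 R d) (Sa a) = Ig (E a) (fun u => enorm u * w a).
    exact: (Rintegral_mul_indic mu (fun u => enorm u * w a) (E0 a)).
  rewrite RintegralZr//; first by rewrite /w; ring.
  apply: (@dom_int _ K) => // [|u ua]; first exact: borel_enorm.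
  by rewrite ger0_norm ?enorm_ge0// (EK a).
have iS : mu.-integrable (@Rd0 R d) (EFin \o (fun u => \sum_a Sa a u)).
  rewrite (_ : _ \o _ = fun u => (\sum_(a <- index_enum J) (EFin \o Sa a) u)%E); last first.
    by apply/funext => u /=; rewrite sumEFin.
  exact: integrable_sum.
have iD : mu.-integrable (@Rd0 R d) (EFin \o D) by apply: (@dom_int _ c).
have -> : \sum_a Ig (E a) (@enorm R d) / enorm (uu a) * D (uu a) = Ig (@Rd0 R d) (fun u => \sum_a Sa a u).
  by rewrite Rintegral_sum//; apply: eq_bigr => a _; rewrite SaE.
rewrite -RintegralB//.
have iDS := integrableB m0 iD iS.
have mS : borel_fun (fun u => \sum_a Sa a u) by apply: measurable_sum.
have iT : mu.-integrable (@Rd0 R d) (EFin \o (fun u => c * (mm u * \1_T u))).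
  apply: (@dom_int _ c) => // [|u u0].
    by apply: measurable_funM => //; apply: measurable_funM; [exact: borel_mm|exact: measurable_indic].
  by rewrite ger0_norm ?mulr_ge0 ?mm_ge0// ler_wpM2l// ler_piMr ?mm_ge0.
have iZ : mu.-integrable (@Rd0 R d) (EFin \o (fun u => z * K * mm u)).
  exact: mm_intZ.
apply: le_trans (le_normr_Rintegral m0 iDS) _.
apply: (@le_trans _ _ (Ig (@Rd0 R d) (fun u => c * (mm u * \1_T u) + z * K * mm u))).
  apply: le_Rintegral => //.
  - exact: (integrable_abse iDS).
  - exact: (integrableD m0 iT iZ).
  - move=> u u0; have [uT|[a ua]] := cov u u0.
      rewrite big1; last first.
        move=> a _; rewrite /Sa indicE; case: (boolP (u \in E a)) => [/set_mem/ET//|_].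
        by rewrite mulr0.
      by rewrite subr0 indicE mem_set// mulr1 (le_trans (Dc u u0))// lerDl !mulr_ge0// mm_ge0.
    rewrite (bigD1 a)//= big1 ?addr0; last first.
      move=> b ba; rewrite /Sa indicE; case: (boolP (u \in E b)) => [/set_mem ub|_]; last by rewrite mulr0.
      by rewrite (dE _ _ _ ua ub) eqxx in ba.
    rewrite /Sa (_ : \1_(E a) u = 1); last by rewrite indicE mem_set.
    rewrite mulr1 (le_trans (Dz a u ua))//.
    apply: (@le_trans _ _ (z * K * mm u)); first by rewrite -mulrA ler_wpM2l// (EK a).
    by rewrite lerDr mulr_ge0// mulr_ge0 ?mm_ge0.
rewrite RintegralD// RintegralZl//; last first.
  apply: (@dom_int _ 1) => // [|u u0].
    by apply: measurable_funM; [exact: borel_mm|exact: measurable_indic].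
  by rewrite ger0_norm ?mulr_ge0 ?mm_ge0// mul1r ler_piMr ?mm_ge0// indicE; case: (u \in T).
apply: lerD.
  by rewrite ler_wpM2l// (Rintegral_mul_indic mu (@mm R d) T0).
rewrite RintegralZl//; last exact: mm_int.
by rewrite ler_wpM2l ?mulr_ge0// Ig_mm_le.
Qed.

End mass.

(** * Total variation on cells and on tails *)

Section tails.
Context {R : realType} {d : nat}.
Local Notation V := 'rV[R]_d.
Local Notation Ig mu D f := (Rintegral mu D f).
Implicit Types (mu : {measure set Rd R d -> \bar R}).

Definition tail (K : nat) : set (Rd R d) := \bigcup_i shell (K + i).

Lemma shell_Rd0 j : shell j `<=` @Rd0 R d.
Proof. by move=> u [u0 _]; apply/Rd0P. Qed.

Lemma measurable_tail K : measurable (tail K).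
Proof. by apply: bigcup_measurable => i _; exact: measurable_shell. Qed.

Lemma tail_Rd0 K : tail K `<=` @Rd0 R d.
Proof. by move=> u [i _ /shell_Rd0]. Qed.

Lemma tail_trivIset K : trivIset setT (fun i => @shell R d (K + i)).
Proof.
by apply/trivIsetP => i j _ _ ij; rewrite -subset0 => u [ui uj]; move: ij; rewrite -(eqn_add2l K) (shell_disj ui uj) eqxx.
Qed.

Lemma int_fin_Rint mu D (f : V -> R) : mu.-integrable D (EFin \o f) -> measurable D ->
  (\int[mu]_(u in D) (f u)%:E = (Ig mu D f)%:E)%E.
Proof. by move=> fi mD; rewrite fineK//; exact: integrable_fin_num fi. Qed.

Lemma shell_int mu C j : (\int[mu]_(u in @Rd0 R d) (mm u)%:E <= C%:E)%E ->
  mu.-integrable (shell j) (EFin \o @enorm R d).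
Proof.
move=> HC; apply: (@dom_int _ _ _ _ HC _ j.+1%:R); [exact: measurable_shell|exact: shell_Rd0|exact: borel_enorm|].
by move=> u /shell_mm[h _]; rewrite ger0_norm ?enorm_ge0.
Qed.

Lemma tv_partial mu1 mu2 (t : R) (P : nat -> set (Rd R d)) n :
  (tv_integral (@enorm R d) mu1 mu2 (@Rd0 R d) <= t%:E)%E ->
  (forall i, measurable (P i)) -> trivIset setT P -> \bigcup_i P i = @Rd0 R d ->
  (forall i, mu1.-integrable (P i) (EFin \o @enorm R d)) -> (forall i, mu2.-integrable (P i) (EFin \o @enorm R d)) ->
  \sum_(i < n) `|Ig mu1 (P i) (@enorm R d) - Ig mu2 (P i) (@enorm R d)| <= t.
Proof.
move=> tv mP tP cP i1 i2; rewrite -lee_fin; apply: le_trans tv; rewrite -sumEFin.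
have fin (mu : {measure set Rd R d -> \bar R}) i : mu.-integrable (P i) (EFin \o @enorm R d) ->
    (\int[mu]_(u in P i) (enorm u)%:E < +oo)%E.
  by move=> ii; rewrite int_fin_Rint// ltry.
apply: (@le_trans _ _ (\sum_(i <oo) `| \int[mu1]_(u in P i) (enorm u)%:E - \int[mu2]_(u in P i) (enorm u)%:E |)%E).
  rewrite (eq_bigr (fun i : 'I_n => `| \int[mu1]_(u in P i) (enorm u)%:E - \int[mu2]_(u in P i) (enorm u)%:E |)%E); last first.
    by move=> i _; rewrite !int_fin_Rint.
  by rewrite -(big_mkord xpredT (fun i => `| \int[mu1]_(u in P i) (enorm u)%:E - \int[mu2]_(u in P i) (enorm u)%:E |)%E); exact: nneseries_lim_ge.
apply: ereal_sup_ubound; exists P; split => //; split => //; split => //; split => // i.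
by split; exact: fin.
Qed.

(** The cells and the shells of the tail form a countable partition of the nonzero vectors, and the
    sum over the cells is one of its partial sums. *)
Lemma tv_cells mu1 mu2 (C t : R) (J : finType) (E : J -> set (Rd R d)) K :
  (\int[mu1]_(u in @Rd0 R d) (mm u)%:E <= C%:E)%E -> (\int[mu2]_(u in @Rd0 R d) (mm u)%:E <= C%:E)%E ->
  (tv_integral (@enorm R d) mu1 mu2 (@Rd0 R d) <= t%:E)%E ->
  (forall a, measurable (E a)) -> (forall a b u, E a u -> E b u -> a = b) -> (forall a, E a `<=` @Rd0 R d) ->
  (forall u, @Rd0 R d u -> tail K u \/ exists a, E a u) -> (forall a u, E a u -> ~ tail K u) ->
  (forall a u, E a u -> enorm u <= K%:R * mm u) ->
  \sum_(a : J) `|Ig mu1 (E a) (@enorm R d) - Ig mu2 (E a) (@enorm R d)| <= t.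
Proof.
move=> C1 C2 tv mE dE E0 cov ET EK.
(* The tail is cut into shells because every set of the partition must have a finite first
   moment. *)
pose P i := if insub i is Some a then E (enum_val (a : 'I_#|J|)) else shell (K + (i - #|J|)).
have PE (a : 'I_#|J|) : P a = E (enum_val a) by rewrite /P valK.
have PS i : (#|J| <= i)%N -> P i = shell (K + (i - #|J|)) by move=> ji; rewrite /P insubN// -leqNgt.
have Pi mu i : (\int[mu]_(u in @Rd0 R d) (mm u)%:E <= C%:E)%E -> mu.-integrable (P i) (EFin \o @enorm R d).
  move=> HC; case: (ltnP i #|J|) => ij; last by rewrite PS//; exact: shell_int HC.
  rewrite (PE (Ordinal ij)); apply: (@dom_int _ _ _ _ HC _ K%:R) => //; first exact: borel_enorm.
  by move=> u ua; rewrite ger0_norm ?enorm_ge0// (EK _ _ ua).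
have := @tv_partial mu1 mu2 t P #|J| tv _ _ _ _ _.
rewrite (eq_bigr (fun a : 'I_#|J| => `|Ig mu1 (E (enum_val a)) (@enorm R d) - Ig mu2 (E (enum_val a)) (@enorm R d)|)); last first.
  by move=> a _; rewrite PE.
rewrite -(big_enum_val (fun a => `|Ig mu1 (E a) (@enorm R d) - Ig mu2 (E a) (@enorm R d)|)).
rewrite (eq_bigl xpredT)//; apply.
- move=> i; case: (ltnP i #|J|) => ij; last by rewrite PS//; exact: measurable_shell.
  by rewrite (PE (Ordinal ij)).
- apply/trivIsetP => i j _ _ ij; rewrite -subset0 => u [].
  case: (ltnP i #|J|) => iJ; case: (ltnP j #|J|) => jJ.
  + rewrite (PE (Ordinal iJ)) (PE (Ordinal jJ)) => u1 u2.
    by move/enum_val_inj: (dE _ _ _ u1 u2) => -[] ijE; rewrite ijE eqxx in ij.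
  + rewrite (PE (Ordinal iJ)) (PS j)// => /ET h u2; apply: h; exists (j - #|J|)%N => //.
  + rewrite (PE (Ordinal jJ)) (PS i)// => u2 /ET h; apply: h; exists (i - #|J|)%N => //.
  + rewrite !PS// => u1 u2; have := shell_disj u1 u2 => /eqP; rewrite eqn_add2l => /eqP e.
    by move: ij; rewrite -(subnK iJ) -(subnK jJ) e eqxx.
- apply/seteqP; split => u.
    case=> i _; case: (ltnP i #|J|) => iJ; first by rewrite (PE (Ordinal iJ)); exact: E0.
    by rewrite PS//; exact: shell_Rd0.
  move=> /cov[[i _ ui]|[a ua]].
    by exists (#|J| + i)%N => //; rewrite PS ?leq_addr// addKn.
  by exists (enum_rank a) => //; rewrite PE enum_rankK.
- by move=> i; exact: Pi.
- by move=> i; exact: Pi.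
Qed.

Lemma tail_small mu (C e : R) : (\int[mu]_(u in @Rd0 R d) (mm u)%:E <= C%:E)%E -> 0 < e ->
  exists K0, forall K, (K0 <= K)%N -> Ig mu (tail K) (@mm R d) <= e.
Proof.
move=> HC e0; pose m i : \bar R := (\int[mu]_(u in shell i) (mm u)%:E)%E.
have m0 i : (0 <= m i)%E by apply: integral_ge0 => u _; rewrite lee_fin mm_ge0.
have tE K : (\int[mu]_(u in tail K) (mm u)%:E = \sum_(K <= i <oo) m i)%E.
  rewrite ge0_integral_bigcup.
  - rewrite -(nneseries_addn _ m0); congr (limn _); apply/funext => M.
    by apply: eq_bigr => i _; rewrite addnC.
  - by move=> i; exact: measurable_shell.
  - by apply/measurable_EFinP; apply: measurable_funTS; exact: borel_mm.
  - by move=> u _; rewrite lee_fin mm_ge0.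
  - exact: tail_trivIset.
have fin : (\sum_(0 <= i <oo) m i < +oo)%E.
  rewrite -tE; apply: (@le_lt_trans _ _ C%:E); last by rewrite ltry.
  by apply: le_trans HC; apply: mm_le_mass; [exact: measurable_tail|exact: measurable_Rd0| |exact: tail_Rd0].
have /fine_cvgP[_ /cvgrPdist_le/(_ e e0)[K0 _ HK]] := nneseries_tail_cvg fin (fun k _ => m0 k).
exists K0 => K K0K; have := HK K K0K; rewrite sub0r normrN /= -tE; exact: le_trans (ler_norm _).
Qed.

(** On a shell of index [j] the first moment is comparable with [j] times the mass, so a small tail
    of one measure gives a small tail of the other, at the price of the total variation divided by
    [K - 1]. *)
Lemma tail_compare mu1 mu2 (C t : R) K : (1 < K)%N ->
  (\int[mu1]_(u in @Rd0 R d) (mm u)%:E <= C%:E)%E -> (\int[mu2]_(u in @Rd0 R d) (mm u)%:E <= C%:E)%E ->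
  (tv_integral (@enorm R d) mu1 mu2 (@Rd0 R d) <= t%:E)%E ->
  Ig mu1 (tail K) (@mm R d) <= 3 * Ig mu2 (tail K) (@mm R d) + t / K.-1%:R.
Proof.
move=> K1 C1 C2 tv.
have K0 : 0 < K.-1%:R :> R by rewrite ltr0n -ltnS prednK// ltnW.
have mi mu i : (\int[mu]_(u in @Rd0 R d) (mm u)%:E <= C%:E)%E -> mu.-integrable (shell i) (EFin \o @mm R d).
  by move=> HC; apply: (mm_int HC); [exact: measurable_shell|exact: shell_Rd0].
have ei mu i (HC : (\int[mu]_(u in @Rd0 R d) (mm u)%:E <= C%:E)%E) := shell_int i HC.
pose I1 i := Ig mu1 (shell (K + i)) (@enorm R d); pose I2 i := Ig mu2 (shell (K + i)) (@enorm R d).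
have step i : Ig mu1 (shell (K + i)) (@mm R d) <= 3 * Ig mu2 (shell (K + i)) (@mm R d) + `|I1 i - I2 i| / K.-1%:R.
  have KiK : K.-1%:R <= (K + i).-1%:R :> R by rewrite ler_nat -subn1 -subn1 leq_sub2r// leq_addr.
  have a1 : (K + i).-1%:R * Ig mu1 (shell (K + i)) (@mm R d) <= I1 i.
    rewrite -RintegralZl; [|exact: measurable_shell|exact: mi].
    apply: le_Rintegral; [exact: measurable_shell| |exact: ei|by move=> u /shell_mm[]].
    by apply: (mm_intZ C1); [exact: measurable_shell|exact: shell_Rd0].
  have a2 : I2 i <= (K + i).+1%:R * Ig mu2 (shell (K + i)) (@mm R d).
    rewrite -RintegralZl; [|exact: measurable_shell|exact: mi].
    apply: le_Rintegral; [exact: measurable_shell|exact: ei| |by move=> u /shell_mm[]].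
    by apply: (mm_intZ C2); [exact: measurable_shell|exact: shell_Rd0].
  have m2 : 0 <= Ig mu2 (shell (K + i)) (@mm R d) by apply: Rintegral_ge0 => u _; exact: mm_ge0.
  have Kp : 0 < (K + i).-1%:R :> R by apply: lt_le_trans KiK.
  (* [j + 1 <= 3 * (j - 1)] holds from [j = 2] on, whence [1 < K]. *)
  have K3 : (K + i).+1%:R <= 3 * (K + i).-1%:R :> R.
    rewrite -natrM ler_nat; clear -K1; lia.
  rewrite -(ler_pM2l Kp) mulrDr.
  have a3 := ler_norm (I1 i - I2 i).
  have a4 := ler_wpM2r m2 K3.
  have a5 : `|I1 i - I2 i| <= (K + i).-1%:R * (`|I1 i - I2 i| / K.-1%:R).
    by rewrite mulrCA ler_peMr// ler_pdivlMr// mul1r.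
  lra.
have iT mu (HC : (\int[mu]_(u in @Rd0 R d) (mm u)%:E <= C%:E)%E) := mm_int HC (measurable_tail K) (@tail_Rd0 K).
have tE mu : (\int[mu]_(u in tail K) (mm u)%:E = \sum_(i <oo) \int[mu]_(u in shell (K + i)) (mm u)%:E)%E.
  rewrite ge0_integral_bigcup//.
  - by move=> i; exact: measurable_shell.
  - by apply/measurable_EFinP; apply: measurable_funTS; exact: borel_mm.
  - by move=> u _; rewrite lee_fin mm_ge0.
  - exact: tail_trivIset.
have p0 mu i : (0 <= \int[mu]_(u in shell i) (mm u)%:E)%E by apply: integral_ge0 => u _; rewrite lee_fin mm_ge0.
rewrite -lee_fin -(int_fin_Rint (iT mu1 C1) (measurable_tail K)) tE; apply: lime_le.
  by apply: is_cvg_nneseries => i _ _; exact: p0.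
apply: nearW => M /=; rewrite big_mkord.
rewrite (eq_bigr (fun i : 'I_M => (Ig mu1 (shell (K + i)) (@mm R d))%:E)); last first.
  by move=> i _; rewrite int_fin_Rint//; [exact: mi|exact: measurable_shell].
rewrite sumEFin lee_fin.
apply: (@le_trans _ _ (\sum_(i < M) (3 * Ig mu2 (shell (K + i)) (@mm R d) + `|I1 i - I2 i| / K.-1%:R))).
  by apply: ler_sum => i _; exact: step.
rewrite big_split/= -mulr_sumr -mulr_suml lerD//.
  rewrite ler_wpM2l// -lee_fin -(int_fin_Rint (iT mu2 C2) (measurable_tail K)) tE -sumEFin.
  rewrite (eq_bigr (fun i : 'I_M => \int[mu2]_(u in shell (K + i)) (mm u)%:E)%E); last first.
    by move=> i _; rewrite int_fin_Rint//; [exact: mi|exact: measurable_shell].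
  by rewrite -(big_mkord xpredT (fun i => \int[mu2]_(u in shell (K + i)) (mm u)%:E)%E); exact: nneseries_lim_ge.
rewrite ler_pM2r ?invr_gt0//.
have := @tv_partial mu1 mu2 t (fun i => shell i) (K + M) tv.
rewrite big_split_ord/=.
move=> h; apply: le_trans (h _ _ _ _ _); first by rewrite lerDr sumr_ge0.
- exact: measurable_shell.
- apply/trivIsetP => i j _ _ ij; rewrite -subset0 => u [ui uj].
  by move: ij; rewrite (shell_disj ui uj) eqxx.
- apply/seteqP; split=> u; first by case=> i _ /shell_Rd0.
  by move=> /Rd0P/shell_cover[j uj]; exists j.
- by move=> i; exact: ei C1.
- by move=> i; exact: ei C2.
Qed.

End tails.

(** * Discretisation of the jump part *)

Section jumps.
Context {R : realType} {d : nat}.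
Local Notation V := 'rV[R]_d.
Variable (eps0 : R).
Hypothesis e0 : 0 < eps0.
Local Notation Ig mu D f := (Rintegral mu D f).
Implicit Types (u v y p : V) (C : R) (phi : V -> R) (K : nat).

Definition Dj (phi : V -> R) (y u : V) : R :=
  phi (y + u) - phi y - inner (grad phi y) u * \1_(@eball0 R d eps0) u.

Lemma ball_indic u : \1_(@eball0 R d eps0) u = (enorm u < eps0)%R%:R :> R.
Proof.
rewrite indicE; case: (boolP (enorm u < eps0)%R) => h; first by rewrite mem_set.
by rewrite memNset//; exact/negP.
Qed.

(** The first summand serves jumps shorter than [eps0], by second-order Taylor expansion, the second
    one all others. The powers of [eps0] compare with [mm u] whether or not [eps0] exceeds 1. *)
Definition Cj (C : R) : R := C * (d%:R ^+ 2 * (1 + eps0 ^+ 2) + 2 * (1 + eps0 ^- 2)).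

Lemma Cj_ge0 C : 0 <= C -> 0 <= Cj C.
Proof.
by move=> C0; rewrite /Cj mulr_ge0// addr_ge0// mulr_ge0 ?sqr_ge0// addr_ge0// ?invr_ge0 ?sqr_ge0.
Qed.

Lemma Dj_bound C phi y u : reg C phi -> `|Dj phi y u| <= Cj C * mm u.
Proof.
move=> rC; have C0 : 0 <= C by case: rC.
have d2 : 0 <= d%:R ^+ 2 * (1 + eps0 ^+ 2) * mm u.
  by rewrite mulr_ge0 ?mm_ge0// mulr_ge0 ?sqr_ge0// addr_ge0 ?sqr_ge0.
have e2 : 0 < eps0 ^+ 2 by rewrite exprn_gt0.
have c2 : 0 <= 2 * (1 + eps0 ^- 2) * mm u.
  by rewrite mulr_ge0 ?mm_ge0// mulr_ge0// addr_ge0// invr_ge0 ltW.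
rewrite /Dj ball_indic; have [ue|ue] := ltP (enorm u) eps0.
  rewrite mulr1; apply: le_trans (reg_T2 y u rC) _.
  rewrite /Cj -mulrA ler_wpM2l// mulrDl -[leLHS]addr0 lerD// exprMn -mulrA ler_wpM2l ?sqr_ge0//.
  rewrite /mm; have [h|h] := leP 1 (enorm u ^+ 2); last by rewrite ler_peMl ?sqr_ge0// lerDl ltW.
  rewrite mulr1; apply: (@le_trans _ _ (eps0 ^+ 2)); last by rewrite lerDr.
  by rewrite lerXn2r ?nnegrE ?enorm_ge0 ?(ltW e0) ?(ltW ue).
rewrite mulr0 subr0.
have h1 : `|phi (y + u) - phi y| <= C + C.
  by apply: le_trans (ler_normB _ _) _; rewrite lerD ?(reg_bound _ rC).
apply: le_trans h1 _; rewrite /Cj -mulrA (_ : C + C = C * 2) ?ler_wpM2l// ?mulrDl; last by ring.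
suff h2 : 1 <= (1 + eps0 ^- 2) * mm u by lra.
rewrite /mm; have [h|h] := leP 1 (enorm u ^+ 2); first by rewrite mulr1 lerDl invr_ge0 ltW.
have h3 : eps0 ^+ 2 <= enorm u ^+ 2 by rewrite lerXn2r ?nnegrE ?enorm_ge0 ?(ltW e0).
have : 1 <= eps0 ^- 2 * enorm u ^+ 2 by rewrite ler_pdivlMl// mulr1.
by have := sqr_ge0 (enorm u); rewrite mulrDl mul1r; lra.
Qed.

Lemma Dj_lip C phi y u v : reg C phi -> (enorm u < eps0) = (enorm v < eps0) ->
  `|Dj phi y u - Dj phi y v| <= 2 * (d%:R * C) * enorm (u - v).
Proof.
move=> rC uv; rewrite /Dj !ball_indic -uv; set i := (_ %:R).
have h1 := reg_T1 (y + v) (u - v) rC.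
have E1 : y + v + (u - v) = y + u by rewrite -addrA; congr (_ + _); rewrite addrC subrK.
rewrite E1 in h1.
have h2 : `|inner (grad phi y) (u - v) * i| <= d%:R * C * enorm (u - v).
  rewrite normrM; apply: (@le_trans _ _ `|inner (grad phi y) (u - v)|).
    by rewrite ler_piMr// /i; case: (_ < _); rewrite ?normr0 ?normr1.
  apply: le_trans (cauchy_schwarz _ _) _; rewrite ler_wpM2r ?enorm_ge0//; exact: reg_grad rC.
have -> : phi (y + u) - phi y - inner (grad phi y) u * i - (phi (y + v) - phi y - inner (grad phi y) v * i) =
  phi (y + u) - phi (y + v) - inner (grad phi y) (u - v) * i by rewrite innerBr; ring.
apply: le_trans (ler_normB _ _) _; lra.
Qed.

Lemma Dj_lin C phi y u : reg C phi -> `|Dj phi y u| <= 2 * (d%:R * C) * enorm u.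
Proof.
move=> rC; rewrite /Dj ball_indic; set i := (_ %:R).
have h1 := reg_T1 y u rC.
have h2 : `|inner (grad phi y) u * i| <= d%:R * C * enorm u.
  rewrite normrM; apply: (@le_trans _ _ `|inner (grad phi y) u|).
    by rewrite ler_piMr// /i; case: (_ < _); rewrite ?normr0 ?normr1.
  apply: le_trans (cauchy_schwarz _ _) _; rewrite ler_wpM2r ?enorm_ge0//; exact: reg_grad rC.
apply: le_trans (ler_normB _ _) _; lra.
Qed.

Lemma reg_elip C phi : reg C phi -> elip (C * d%:R) phi.
Proof. by move=> rC x y; have := reg_T1 y (x - y) rC; rewrite (addrC y) subrK mulrA. Qed.

Lemma borel_coord (i : 'I_d) : borel_fun (fun u : V => u 0 i).
Proof.
apply: borel_cont; apply: (@elip_continuous _ _ 1) => // x y; rewrite mul1r.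
by have := coord_le_enorm (x - y) i; rewrite !mxE.
Qed.

Lemma borel_inner (v : V) : borel_fun (inner v).
Proof.
apply: borel_cont; apply: (@elip_continuous _ _ (enorm v)); first exact: enorm_ge0.
by move=> x y; rewrite -innerBr; exact: cauchy_schwarz.
Qed.

Lemma borel_shift C phi y : reg C phi -> borel_fun (fun u : V => phi (y + u)).
Proof.
move=> rC; have C0 : 0 <= C by case: rC.
apply: borel_cont; apply: (@elip_continuous _ _ (C * d%:R)); first by rewrite mulr_ge0.
by move=> u v; have := reg_elip rC (y + u) (y + v); rewrite opprD addrACA subrr add0r.
Qed.

Lemma measurable_ball : measurable (@eball0 R d eps0 : set (Rd R d)).
Proof.
rewrite (_ : @eball0 R d eps0 = [set u | `]-oo, eps0[%classic (enorm u)]).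
  by apply: borel_set => //; exact: borel_enorm.
by apply/seteqP; split => u; rewrite /eball0/= in_itv.
Qed.

Lemma borel_Dj C phi y : reg C phi -> borel_fun (Dj phi y).
Proof.
move=> rC; apply: measurable_funB.
  by apply: measurable_funB; [exact: borel_shift rC|exact: measurable_cst].
apply: measurable_funM; first exact: borel_inner.
by apply: measurable_indic; exact: measurable_ball.
Qed.

(** A finite partition of the complement of a tail. [c_pt] picks a point in each nonempty cell;
    [c_side] keeps cells from crossing the sphere of radius [eps0], where the compensator jumps. *)
Record cells (J : finType) (E : J -> set (Rd R d)) (uu : J -> V) (K : nat) (z : R) : Prop := Cells {
  c_meas : forall a, measurable (E a);
  c_disj : forall a b u, E a u -> E b u -> a = b;
  c_sub : forall a, E a `<=` @Rd0 R d;
  c_cov : forall u, @Rd0 R d u -> tail K u \/ exists a, E a u;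
  c_tail : forall a u, E a u -> ~ tail K u;
  c_bnd : forall a u, E a u -> enorm u < K%:R /\ 1 < K%:R * enorm u /\ enorm u <= K%:R * mm u;
  c_pt : forall a u, E a u -> E a (uu a);
  c_diam : forall a u v, E a u -> E a v -> enorm (u - v) <= z;
  c_side : forall a u v, E a u -> E a v -> (enorm u < eps0) = (enorm v < eps0) }.

Lemma not_tail K u : 0 < enorm u -> ~ tail K u -> enorm u < K%:R /\ 1 < K%:R * enorm u /\ enorm u <= K%:R * mm u.
Proof.
move=> u0 nt; have [j sj] := shell_cover u0.
have jK : (j < K)%N.
  by rewrite ltnNge; apply/negP => Kj; apply: nt; exists (j - K)%N => //; rewrite subnKC.
have jK' : j.+1%:R <= K%:R :> R by rewrite ler_nat.
have [h1 _] := shell_mm sj; have [_ /andP[_ h2]] := sj.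
have ui : 0 < (enorm u)^-1 by rewrite invr_gt0.
split; first by lra.
split; first by rewrite -ltr_pdivrMr// div1r; lra.
by apply: le_trans h1 _; rewrite ler_wpM2r ?mm_ge0.
Qed.

Lemma cells_exist (K : nat) (z : R) : 0 < z ->
  exists (J : finType) (E : J -> set (Rd R d)) (uu : J -> V), cells E uu K z.
Proof.
move=> z0; pose s : R := z / d.+1%:R.
have s0 : 0 < s by rewrite divr_gt0.
pose M := Num.truncn ((2 * K%:R) / s).
pose J := ({ffun 'I_d -> 'I_M.+1} * bool)%type.
pose E (a : J) : set (Rd R d) := [set u : V | (0 < enorm u /\ ~ tail K u) /\ (enorm u < eps0) = a.2 /\
   forall i, (a.1 i)%:R <= (u 0 i + K%:R) / s < (a.1 i).+1%:R].
have uE a u i : E a u -> 0 <= (u 0 i + K%:R) / s.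
  by move=> [_ [_ /(_ i) /andP[h _]]]; apply: le_trans h.
(* An empty cell receives the mark 0, which [c_pt] permits. *)
exists J, E, (fun a => xget 0 (E a)); split.
- move=> [a b].
  have -> : E (a, b) = ([set u : V | 0 < enorm u] `&` ~` tail K) `&` ([set u : V | (enorm u < eps0) = b] `&`
     \bigcap_(i in [set: 'I_d]) [set u : V | `[(a i)%:R, (a i).+1%:R[%classic ((u 0 i + K%:R) / s)]).
    apply/seteqP; split => u.
      by move=> [[u0 nt] [h1 h2]]; split; split => //; move=> i _ /=; rewrite in_itv/=; exact: h2.
    by move=> [[u0 nt] [h1 h2]]; do 2?split => //; move=> i; have := h2 i I; rewrite /= in_itv.
  apply: measurableI; apply: measurableI.
  + rewrite (_ : [set u : V | _] = @Rd0 R d); first exact: measurable_Rd0.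
    by apply/seteqP; split => u /Rd0P.
  + by apply: measurableC; exact: measurable_tail.
  + case: b; first by rewrite (_ : mkset _ = @eball0 R d eps0); [exact: measurable_ball|apply/seteqP; split].
    rewrite (_ : mkset _ = ~` @eball0 R d eps0); first by apply: measurableC; exact: measurable_ball.
    by apply/seteqP; split => u; rewrite /eball0/= => h; apply/negP; rewrite ?h// => /h.
  + apply: fin_bigcap_measurable; first exact: finite_finset.
    move=> i _; apply: borel_set => //; apply: measurable_funM; last exact: measurable_cst.
    by apply: measurable_funD; [exact: borel_coord|exact: measurable_cst].
- move=> [a1 a2] [b1 b2] u [_ [ha ha']] [_ [hb hb']]; rewrite /= in ha hb; congr pair; last by rewrite -ha -hb.
  apply/ffunP => i; apply/val_inj; have /= /andP[x1 x2] := ha' i; have /= /andP[y1 y2] := hb' i.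
  apply/eqP; rewrite eqn_leq.
  have := le_lt_trans x1 y2; have := le_lt_trans y1 x2; rewrite !ltr_nat !ltnS => -> ->.
  by [].
- by move=> a u [[u0 _] _]; apply/Rd0P.
- move=> u /Rd0P u0; case: (pselect (tail K u)) => nt; [by left|right].
  have [uK _] := not_tail u0 nt.
  have ui i : 0 <= u 0 i + K%:R.
    have := coord_le_enorm u i; rewrite ler_norml => /andP[h _]; lra.
  have us i : 0 <= (u 0 i + K%:R) / s by rewrite divr_ge0// ltW.
  have uM i : (Num.truncn ((u ord0 i + K%:R : R) / s) < M.+1)%N.
    rewrite ltnS /M; apply: le_truncn; rewrite ler_pM2r ?invr_gt0//.
    have := coord_le_enorm u i; rewrite ler_norml => /andP[_ h]; lra.
  exists ([ffun i => Ordinal (uM i)], enorm u < eps0); split => //; split => // i.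
  by rewrite ffunE /=; exact: truncn_itv.
- by move=> a u [[_ nt] _].
- by move=> a u [[u0 nt] _]; exact: not_tail.
- by move=> a u ua; apply: (@xgetI _ _ _ u).
- move=> a u v [_ [_ ua]] [_ [_ va]]; apply: le_trans (enorm_le_sum _) _.
  apply: (@le_trans _ _ (\sum_(i < d) s)).
    apply: ler_sum => i _; rewrite !mxE.
    have /andP[u1 u2] := ua i; have /andP[v1 v2] := va i.
    rewrite ler_pdivlMr// in u1; rewrite ltr_pdivrMr// in u2; rewrite ler_pdivlMr// in v1; rewrite ltr_pdivrMr// in v2.
    rewrite -natr1 in u2; rewrite -natr1 in v2.
    rewrite ler_norml; apply/andP; split; lra.
  rewrite sumr_const card_ord -mulr_natl /s mulrCA ler_piMr ?(ltW z0)//.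
  by rewrite ler_pdivrMr// mul1r ler_nat.
- by move=> a u v [_ [ha _]] [_ [hb _]]; rewrite ha hb.
Qed.

Lemma cells_approx (mu : {measure set Rd R d -> \bar R}) (Cn C : R) (J : finType) (E : J -> set (Rd R d)) uu K z phi y :
  (\int[mu]_(u in @Rd0 R d) (mm u)%:E <= Cn%:E)%E -> cells E uu K z -> 0 <= z -> reg C phi ->
  `|Ig mu (@Rd0 R d) (Dj phi y) - \sum_(a : J) Ig mu (E a) (@enorm R d) / enorm (uu a) * Dj phi y (uu a)| <=
  Cj C * Ig mu (tail K) (@mm R d) + (4 * (d%:R * C) * z * K%:R) * K%:R * Cn.
Proof.
move=> HC cE z0 rC; have C0 : 0 <= C by case: rC.
apply: (jump_approx HC (c_meas cE) (c_disj cE) (c_sub cE) (measurable_tail K) (@tail_Rd0 R d K) (c_cov cE) (c_tail cE)).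
- exact: borel_Dj rC.
- by move=> u _; exact: Dj_bound.
- by move=> a u /(c_bnd cE)[_ []].
- by rewrite !mulr_ge0.
- exact: Cj_ge0.
- by [].
move=> a u ua; have va := c_pt cE ua; set v := uu a in va *.
have [_ [Ku _]] := c_bnd cE ua; have [_ [Kv _]] := c_bnd cE va.
have v0 : 0 < enorm v by apply/Rd0P; exact: (c_sub cE va).
have -> : Dj phi y u - enorm u * (Dj phi y v / enorm v) =
   (Dj phi y u - Dj phi y v) + (enorm v - enorm u) * (Dj phi y v / enorm v).
  by field; rewrite gt_eqF.
have h1 := Dj_lip y rC (c_side cE ua va).
have h2 : `|Dj phi y v / enorm v| <= 2 * (d%:R * C).
  by rewrite normrM [X in _ * X]ger0_norm ?invr_ge0 ?enorm_ge0// ler_pdivrMr//; exact: Dj_lin.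
have h3 : `|enorm v - enorm u| <= enorm (u - v) by rewrite distrC; exact: enorm_lip.
have h4 : `|(enorm v - enorm u) * (Dj phi y v / enorm v)| <= enorm (u - v) * (2 * (d%:R * C)).
  by rewrite normrM ler_pM.
apply: le_trans (ler_normD _ _) _.
have h5 : 4 * (d%:R * C) * enorm (u - v) <= 4 * (d%:R * C) * z.
  by rewrite ler_wpM2l ?mulr_ge0// (c_diam cE ua va).
(* On a cell [1 < K * |u|], which turns a constant error into a multiple of [|u|], as [jump_approx]
   requires. *)
have h6 : 4 * (d%:R * C) * z <= 4 * (d%:R * C) * z * K%:R * enorm u.
  by rewrite -[leRHS]mulrA ler_peMr ?(ltW Ku)// !mulr_ge0.
lra.
Qed.

End jumps.

(** * Approximation of the generator by frozen jump generators *)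

Section approximations.
Context {R : realType} {d : nat}.
Hypothesis d0 : (0 < d)%N.
Local Notation V := 'rV[R]_d.
Local Notation e_ := (@evec R d).
Implicit Types (u v x y : V) (C h : R) (phi : V -> R).

Lemma drift_approx C phi h x v : reg C phi -> 0 < h ->
  `|h^-1 * (phi (x + h *: v) - phi x) - inner (grad phi x) v| <= C * d%:R ^+ 2 * h * enorm v ^+ 2.
Proof.
move=> rC h0; have := reg_T2 x (h *: v) rC; rewrite innerZr enormZ (gtr0_norm h0) => H.
rewrite (_ : h^-1 * _ - _ = h^-1 * (phi (x + h *: v) - phi x - h * inner (grad phi x) v)); last first.
  by field; rewrite gt_eqF.
rewrite normrM gtr0_norm ?invr_gt0// ler_pdivrMl//; apply: le_trans H _.
by rewrite le_eqVlt; apply/orP; left; apply/eqP; ring.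
Qed.

Lemma diffusion_approx C phi h x (S : R) (ss : 'I_d -> V) : reg C phi -> 0 < h -> 0 <= S -> (forall i, enorm (ss i) <= S) ->
  `|\sum_(i < d) (2 * h)^-1 * (phi (x + Num.sqrt h *: ss i) + phi (x - Num.sqrt h *: ss i) - 2 * phi x)
    - 2^-1 * \sum_(i < d) quadform (hess phi x) (ss i)| <= C * d%:R ^+ 4 * Num.sqrt h * S ^+ 3.
Proof.
move=> rC h0 S0 sS; have C0 : 0 <= C by case: rC.
have s0 : 0 < Num.sqrt h by rewrite sqrtr_gt0.
have ss2 : Num.sqrt h ^+ 2 = h by rewrite sqr_sqrtr// ltW.
rewrite mulr_sumr -sumrB; apply: le_trans (ler_norm_sum _ _ _) _.
apply: (@le_trans _ _ (\sum_(i < d) C * d%:R ^+ 3 * Num.sqrt h * S ^+ 3)); last first.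
  by rewrite sumr_const card_ord -(mulr_natl _ d) le_eqVlt; apply/orP; left; apply/eqP; ring.
apply: ler_sum => i _.
have := reg_T3 x (Num.sqrt h *: ss i) rC; rewrite quadformZ ss2 enormZ (gtr0_norm s0) => H.
set P := _ + _ - 2 * phi x in H *.
rewrite (_ : (2 * h)^-1 * P - _ = (2 * h)^-1 * (P - h * quadform (hess phi x) (ss i))); last first.
  by field; rewrite gt_eqF.
rewrite normrM gtr0_norm ?invr_gt0 ?mulr_gt0// ler_pdivrMl ?mulr_gt0//; apply: le_trans H _.
have -> : 2 * h * (C * d%:R ^+ 3 * Num.sqrt h * S ^+ 3) = 2 * C * (d%:R * (Num.sqrt h * S)) ^+ 3.
  by rewrite -[X in 2 * X * _]ss2; ring.
rewrite ler_wpM2l ?mulr_ge0// lerXn2r ?nnegrE ?mulr_ge0 ?enorm_ge0 ?(ltW s0)//.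
by rewrite ler_wpM2l// ler_wpM2l// ltW.
Qed.

Lemma walk_approx C phi h tau x (m : nat) (lambda0 : R) : reg C phi -> 0 < h -> 0 <= tau -> 0 <= lambda0 ->
  m%:R * tau ^+ 2 = lambda0 * h * d%:R ->
  `|h^-1 * (avgm m e_ tau phi x - phi x) - 2^-1 * (lambda0 * \tr (hess phi x))| <=
  C * d%:R ^+ 4 * lambda0 * tau + C * d%:R ^+ 5 * lambda0 ^+ 2 * h.
Proof.
move=> rC h0 t0 l0 mt; have := avgm_gen d0 m x rC (@tight_evec R d) t0 => H.
set A := avgm _ _ _ _ _ in H *; set T := \tr _ in H *.
have dn : d%:R != 0 :> R by rewrite pnatr_eq0 -lt0n.
have E1 : m%:R * tau ^+ 2 / (2 * d%:R) * T = h * (2^-1 * (lambda0 * T)) by rewrite mt; field.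
rewrite E1 in H.
rewrite (_ : h^-1 * (A - phi x) - _ = h^-1 * (A - phi x - h * (2^-1 * (lambda0 * T)))); last first.
  by field; rewrite gt_eqF.
rewrite normrM gtr0_norm ?invr_gt0// ler_pdivrMl//; apply: le_trans H _.
have -> : m%:R * (C * (d%:R * tau) ^+ 3) = (m%:R * tau ^+ 2) * (C * d%:R ^+ 3 * tau) by ring.
have -> : m%:R ^+ 2 * tau ^+ 2 * (d%:R * C * (d%:R * tau) ^+ 2) = (m%:R * tau ^+ 2) ^+ 2 * (C * d%:R ^+ 3) by ring.
by rewrite mt le_eqVlt; apply/orP; left; apply/eqP; ring.
Qed.

(** The rows of the square root become the diffusion directions, and the part [lambda0 I] becomes a
    multiple of the Laplacian, which the walk approximates. *)
Lemma trace_rows (S A : 'M[R]_d) (lambda0 : R) (a : 'M[R]_d) : S^T = S -> S *m S = a - lambda0%:M ->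
  \tr (a *m A) = \sum_(i < d) quadform A (row i S) + lambda0 * \tr A.
Proof.
move=> ST SS; have -> : a = S *m S + lambda0%:M by rewrite SS subrK.
rewrite mulmxDl mul_scalar_mx raddfD/= linearZ/= ; congr (_ + _).
rewrite -mulmxA mxtrace_mulC -{2}ST /mxtrace; apply: eq_bigr => i _.
rewrite mxE /quadform exchange_big/=; apply: eq_bigr => j _.
by rewrite !mxE mulr_suml; apply: eq_bigr => l _; rewrite !mxE.
Qed.

End approximations.

Section setting.
Context {R : realType} {d n : nat}.
Hypothesis d0 : (0 < d)%N.
Local Notation V := 'rV[R]_d.
Local Notation I := 'I_n.+1.
Local Notation Ig mu D f := (Rintegral mu D f).
Variables (eps0 : R) (a : V -> I -> 'M[R]_d) (b : V -> I -> V) (nu : V -> I -> {measure set Rd R d -> \bar R})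
  (q : V -> I -> I -> R) (sl : V -> I -> 'M[R]_d) (lambda0 Cn : R).
Hypotheses (e0 : 0 < eps0) (l0 : 0 < lambda0).
Hypothesis nuC : forall x k, (\int[nu x k]_(u in @Rd0 R d) (mm u)%:E <= Cn%:E)%E.
Hypothesis slT : forall x k, (sl x k)^T = sl x k.
Hypothesis sls : forall x k, sl x k *m sl x k = a x k - lambda0%:M.
Hypothesis bB : forall N, exists B, forall x k, enorm x <= N -> enorm (b x k) <= B.
Hypothesis sB : forall N, exists B, forall x k, enorm x <= N -> forall i, enorm (row i (sl x k)) <= B.
Hypothesis tB : forall N e, 0 < e -> exists K0, forall K, (K0 <= K)%N -> forall x k, enorm x <= N ->
  Ig (nu x k) (tail K) (@mm R d) <= e.

Section frozen_coefficients.
Variables (J : finType) (E : J -> set (Rd R d)) (uu : J -> V).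

(** Rate of the mark [uu j], normalised so that rate times length is the first moment of the
    cell. *)
Definition pj x k (j : J) : R := Ig (nu x k) (E j) (@enorm R d) / enorm (uu j).
(** The compensator of the small marks. It is moved into the drift [bz], because the jumps in [Gop]
    are not compensated. *)
Definition bj x k : V := \sum_(j : J) (pj x k j * \1_(@eball0 R d eps0) (uu j)) *: uu j.
Definition bz x k : V := b x k - bj x k.
Definition sz x k (i : 'I_d) : V := row i (sl x k).
(** The diagonal entry, which multiplies [f k - f k], is set to 0 so that all rates are
    nonnegative. *)
Definition qz x (k l : I) : R := if l == k then 0 else q x k l.

Definition Gz (h tau : R) (m : nat) y k (f : I -> V -> R) x : R :=
  Gop h tau m uu (bz y k) (sz y k) (pj y k) (qz y k) k f x.

Lemma pj_ge0 x k j : 0 <= pj x k j.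
Proof. by rewrite divr_ge0 ?enorm_ge0// Rintegral_ge0// => u _; exact: enorm_ge0. Qed.

Lemma Cn_ge0 : 0 <= Cn.
Proof.
rewrite -lee_fin; apply: le_trans (nuC 0 ord0); apply: integral_ge0 => u _.
by rewrite lee_fin mm_ge0.
Qed.

Lemma mom_le K z x k j : cells eps0 E uu K z -> Ig (nu x k) (E j) (@enorm R d) <= K%:R * Cn.
Proof.
move=> cE; apply: le_trans (ler_norm _) _.
have := dom_bound (nuC x k) (c_meas cE j) (@c_sub _ _ _ _ _ _ _ _ cE j) (@borel_enorm R d) (c := K%:R) => H.
apply: le_trans (H _) _.
  by move=> u uj; rewrite ger0_norm ?enorm_ge0//; have [_ []] := c_bnd cE uj.
by rewrite ler_wpM2l// (Ig_mm_le (nuC x k))//; [exact: c_meas cE j|exact: (@c_sub _ _ _ _ _ _ _ _ cE j)].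
Qed.

Lemma pj_mom x k j : pj x k j * enorm (uu j) <= Ig (nu x k) (E j) (@enorm R d).
Proof.
have I0 : 0 <= Ig (nu x k) (E j) (@enorm R d) by rewrite Rintegral_ge0// => u _; exact: enorm_ge0.
rewrite /pj; have [->|u0] := eqVneq (enorm (uu j)) 0; first by rewrite mulr0.
by rewrite divfK.
Qed.

Lemma pj_le K z x k j : cells eps0 E uu K z -> pj x k j <= K%:R * (K%:R * Cn).
Proof.
move=> cE; have := mom_le x k j cE; rewrite /pj.
have I0 : 0 <= Ig (nu x k) (E j) (@enorm R d) by rewrite Rintegral_ge0// => u _; exact: enorm_ge0.
(* In a nonempty cell [1 < K * |uu j|] controls the division; an empty cell has moment 0. *)
case: (pselect (exists u, E j u)) => [[u uj]|nE] H.
  have [_ [Ku _]] := c_bnd cE (c_pt cE uj).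
  rewrite mulrC ler_pM ?invr_ge0 ?enorm_ge0//.
  rewrite -[leLHS]mul1r ler_pdivrMr ?(ltW Ku)//.
  by apply/Rd0P; exact: (c_sub cE (c_pt cE uj)).
rewrite (_ : E j = set0); last by apply/seteqP; split => u // uj; case: nE; exists u.
by rewrite Rintegral_set0 mul0r !mulr_ge0// Cn_ge0.
Qed.

Lemma bj_le K z x k : cells eps0 E uu K z -> enorm (bj x k) <= #|J|%:R * (K%:R * Cn).
Proof.
move=> cE; apply: le_trans (enorm_sum _ _ _) _.
apply: (@le_trans _ _ (\sum_(j : J) (K%:R * Cn))); last by rewrite sumr_const [leRHS]mulr_natl.
apply: ler_sum => j _; rewrite enormZ; apply: le_trans (mom_le x k j cE); apply: le_trans (pj_mom x k j).
rewrite ler_wpM2r ?enorm_ge0// normrM ger0_norm ?pj_ge0// ler_piMr ?pj_ge0// ball_indic.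
by case: (_ < _); rewrite ?normr0 ?normr1.
Qed.

Lemma AopE (f : I -> V -> R) y k : Aop eps0 a b nu q (fun x l => f l x) y k =
  2^-1 * \tr (a y k *m hess (f k) y) + inner (grad (f k) y) (b y k) + Ig (nu y k) (@Rd0 R d) (Dj eps0 (f k) y)
  + \sum_(l < n.+1) qz y k l * (f l y - f k y).
Proof.
rewrite /Aop /Lop /=; congr (_ + _ + _ + _); first by rewrite innerC.
by apply: eq_bigr => l _; rewrite /qz; case: eqP => [->|]; rewrite ?subrr ?mulr0 ?mul0r.
Qed.

(** Diffusion, walk, drift and jumps are approximated separately, the compensator passing from the
    jump sum to the drift through [E1] and [E2]. The bound is the same for all [f] with the same
    [C]. *)
Lemma gen_approx K z C (N B S t h tau : R) (m : nat) (f : I -> V -> R) y k :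
  cells eps0 E uu K z -> 0 <= z -> 0 < h -> 0 <= tau -> m%:R * tau ^+ 2 = lambda0 * h * d%:R ->
  (forall l, reg C (f l)) -> enorm y <= N ->
  enorm (b y k) <= B -> 0 <= S -> (forall i, enorm (row i (sl y k)) <= S) -> Ig (nu y k) (tail K) (@mm R d) <= t ->
  `|Aop eps0 a b nu q (fun x l => f l x) y k - Gz h tau m y k f y| <=
  C * d%:R ^+ 4 * Num.sqrt h * S ^+ 3 + (C * d%:R ^+ 4 * lambda0 * tau + C * d%:R ^+ 5 * lambda0 ^+ 2 * h)
  + C * d%:R ^+ 2 * h * (B + #|J|%:R * (K%:R * Cn)) ^+ 2
  + (Cj eps0 (d := d) C * t + (4 * (d%:R * C) * z * K%:R) * K%:R * Cn).
Proof.
move=> cE z0 h0 t0 mt rC yN yB S0 yS yt; have C0 : 0 <= C by case: (rC k).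
rewrite AopE (trace_rows (hess (f k) y) (slT y k) (sls y k)) /Gz /Gop.
have X1 := diffusion_approx y (rC k) h0 S0 yS.
have X2 := walk_approx d0 y (rC k) h0 t0 (ltW l0) mt.
have X3 := drift_approx y (bz y k) (rC k) h0.
have X4 := cells_approx e0 y (nuC y k) cE z0 (rC k).
have bzB : enorm (bz y k) <= B + #|J|%:R * (K%:R * Cn).
  by apply: le_trans (enorm_triB _ _) _; rewrite lerD// (bj_le _ _ cE).
have X5 : C * d%:R ^+ 2 * h * enorm (bz y k) ^+ 2 <= C * d%:R ^+ 2 * h * (B + #|J|%:R * (K%:R * Cn)) ^+ 2.
  by rewrite ler_wpM2l ?mulr_ge0 ?sqr_ge0 ?(ltW h0)// lerXn2r ?nnegrE ?enorm_ge0// (le_trans (enorm_ge0 _) bzB).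
have X6 := ler_wpM2l (@Cj_ge0 R d eps0 C C0) yt.
have E1 : \sum_(j : J) Ig (nu y k) (E j) (@enorm R d) / enorm (uu j) * Dj eps0 (f k) y (uu j) =
   \sum_(j : J) pj y k j * (f k (y + uu j) - f k y) - inner (grad (f k) y) (bj y k).
  rewrite inner_sumr -sumrB; apply: eq_bigr => j _; rewrite /Dj innerZr -/(pj y k j); ring.
rewrite E1 in X4.
have E2 : inner (grad (f k) y) (bz y k) = inner (grad (f k) y) (b y k) - inner (grad (f k) y) (bj y k).
  by rewrite innerBr.
rewrite E2 in X3.
move: X1 X2 X3 X4; rewrite /sz.
set T1 := \sum_(i < d) quadform _ _; set T2 := \tr _; set G1 := \sum_(i < d) _; set G2 := h^-1 * (avgm _ _ _ _ _ - _).
set G3 := h^-1 * (_ - _); set G4 := \sum_j _; set T4 := Ig _ _ _; set T3 := inner _ (b y k); set T5 := inner _ (bj y k).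
set G5 := \sum_l _.
rewrite !ler_norml => /andP[x1 x1'] /andP[x2 x2'] /andP[x3 x3'] /andP[x4 x4'].
by apply/andP; split; lra.
Qed.

End frozen_coefficients.
End setting.

(** * The generator on test functions *)

Section vanishing.
Context {R : realType} {d : nat}.
Local Notation V := 'rV[R]_d.
Implicit Types (x y v : V) (C r : R) (phi : V -> R).

Lemma small_eq0 (x c t0 : R) : 0 < t0 -> (forall t, 0 < t -> t <= t0 -> `|x| <= c * t) -> x = 0.
Proof.
move=> t00 H; apply/normr0_eq0/eqP; rewrite eq_le normr_ge0 andbT leNgt; apply/negP => x0.
have c0 : 0 < c.
  by have := lt_le_trans x0 (H t0 t00 (lexx _)); rewrite pmulr_lgt0.
pose t := Num.min t0 (`|x| / (2 * c)).
have t1 : 0 < t by rewrite lt_min t00/= divr_gt0// mulr_gt0.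
have := H t t1 (_ : t <= t0); rewrite ge_min lexx => /(_ isT).
have : c * t <= c * (`|x| / (2 * c)) by rewrite ler_wpM2l ?(ltW c0)// ge_min lexx orbT.
have -> : c * (`|x| / (2 * c)) = `|x| / 2 by field; rewrite gt_eqF.
lra.
Qed.

Lemma near_vanish phi r y v : (forall x, r < enorm x -> phi x = 0) -> r < enorm y ->
  exists2 t0, 0 < t0 & forall t, 0 < t -> t <= t0 -> phi (y + t *: v) = 0 /\ phi (y - t *: v) = 0.
Proof.
move=> p0 ry; pose t0 := (enorm y - r) / (2 * (1 + enorm v)).
have v1 : 0 < 1 + enorm v by rewrite ltr_wpDr// enorm_ge0.
have t00 : 0 < t0 by rewrite divr_gt0// ?subr_gt0// mulr_gt0.
exists t0 => // t tp tt.
have tv : enorm (t *: v) < enorm y - r.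
  rewrite enormZ gtr0_norm//; apply: (@le_lt_trans _ _ (t0 * (1 + enorm v))).
    by apply: ler_pM; rewrite ?enorm_ge0 ?(ltW tp)// lerDr.
  rewrite /t0 (_ : _ / _ * _ = (enorm y - r) / 2); first by lra.
  by field; rewrite gt_eqF.
have h1 := enorm_tri y (y + t *: v) 0; have h2 := enorm_tri y (y - t *: v) 0.
have E1 : y - (y + t *: v) = - (t *: v) by rewrite opprD addNKr.
have E2 : y - (y - t *: v) = t *: v by rewrite opprB addrC subrK.
rewrite E1 !subr0 enormN in h1; rewrite E2 !subr0 in h2.
split; apply: p0; lra.
Qed.

Lemma grad_vanish C phi r y : reg C phi -> (forall x, r < enorm x -> phi x = 0) -> r < enorm y -> grad phi y = 0.
Proof.
move=> rC p0 ry; apply/rowP => i; rewrite [RHS]mxE -inner_evecr; have [t0 t00 H] := near_vanish (evec R i) p0 ry.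
have py := p0 _ ry.
apply: (@small_eq0 _ (C * d%:R ^+ 2) t0 t00) => t tp tt.
have := reg_T2 y (t *: evec R i) rC; rewrite (H t tp tt).1 py subr0 sub0r normrN innerZr normrM enormZ enorm_evec mulr1 gtr0_norm//.
rewrite exprMn mulrA (expr2 t) mulrA [t * _]mulrC ler_pM2r//.
Qed.

Lemma quad_vanish C phi r y v : reg C phi -> (forall x, r < enorm x -> phi x = 0) -> r < enorm y ->
  quadform (hess phi y) v = 0.
Proof.
move=> rC p0 ry; have [t0 t00 H] := near_vanish v p0 ry; have py := p0 _ ry.
apply: (@small_eq0 _ (2 * C * d%:R ^+ 3 * enorm v ^+ 3) t0 t00) => t tp tt.
have [H1 H2] := H t tp tt.
have := reg_T3 y (t *: v) rC; rewrite H1 H2 py mulr0 subr0 addr0 sub0r normrN quadformZ normrM enormZ gtr0_norm ?exprn_gt0//.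
rewrite (gtr0_norm tp) (_ : 2 * C * _ = t ^+ 2 * (2 * C * d%:R ^+ 3 * enorm v ^+ 3 * t)); last by ring.
by rewrite ler_pM2l// exprn_gt0.
Qed.

Lemma quad_bound C phi y v : reg C phi -> `|quadform (hess phi y) v| <= d%:R ^+ 2 * C * enorm v ^+ 2.
Proof.
move=> rC; have C0 : 0 <= C by case: rC.
apply: le_trans (ler_norm_sum _ _ _) _.
apply: (@le_trans _ _ (\sum_(i < d) \sum_(j < d) C * enorm v ^+ 2)); last first.
  have sE (c : R) : \sum_(i < d) c = d%:R * c by rewrite sumr_const card_ord mulr_natl.
  by rewrite !sE expr2 !mulrA.
apply: ler_sum => i _; apply: le_trans (ler_norm_sum _ _ _) _; apply: ler_sum => j _.
rewrite !normrM (_ : C * enorm v ^+ 2 = enorm v * C * enorm v); last by ring.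
by rewrite !ler_pM ?mulr_ge0 ?coord_le_enorm ?(reg_hess _ _ _ rC).
Qed.

Lemma quad_trace (A : 'M[R]_d) : \tr A = \sum_(i < d) quadform A (evec R i).
Proof.
apply: eq_bigr => i _; rewrite /quadform (bigD1 i)//= [X in _ + X]big1 ?addr0; last first.
  by move=> j ji; rewrite big1// => l _; rewrite !mxE (negPf ji) andbF !mul0r.
rewrite (bigD1 i)//= big1 ?addr0; last by move=> l li; rewrite !mxE (negPf li) andbF !mulr0.
by rewrite !mxE !eqxx mul1r mulr1.
Qed.

End vanishing.

Section setting.
Context {R : realType} {d n : nat}.
Hypothesis d0 : (0 < d)%N.
Local Notation V := 'rV[R]_d.
Local Notation I := 'I_n.+1.
Local Notation Ig mu D f := (Rintegral mu D f).
Variables (eps0 : R) (a : V -> I -> 'M[R]_d) (b : V -> I -> V) (nu : V -> I -> {measure set Rd R d -> \bar R})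
  (q : V -> I -> I -> R) (sl : V -> I -> 'M[R]_d) (lambda0 Cn Qb : R).
Hypotheses (e0 : 0 < eps0) (l0 : 0 < lambda0).
Hypothesis nuC : forall x k, (\int[nu x k]_(u in @Rd0 R d) (mm u)%:E <= Cn%:E)%E.
Hypothesis slT : forall x k, (sl x k)^T = sl x k.
Hypothesis sls : forall x k, sl x k *m sl x k = a x k - lambda0%:M.
Hypothesis bB : forall N, exists B, forall x k, enorm x <= N -> enorm (b x k) <= B.
Hypothesis sB : forall N, exists B, forall x k, enorm x <= N -> forall i, enorm (row i (sl x k)) <= B.
Hypothesis qB : forall x k l, 0 <= qz q x k l <= Qb.
Hypothesis tB : forall N e, 0 < e -> exists K0, forall K, (K0 <= K)%N -> forall x k, enorm x <= N ->
  Ig (nu x k) (tail K) (@mm R d) <= e.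
Hypothesis am : forall k i j, borel_fun (fun x => a x k i j).
Hypothesis bm : forall k i, borel_fun (fun x => b x k 0 i).
Hypothesis qm : forall k l, borel_fun (fun x => q x k l).
Hypothesis num : forall k (B : set (Rd R d)), measurable B -> measurable_fun setT (fun x : Rd R d => nu x k B).
Implicit Types (f : I -> V -> R) (C r : R).
Local Notation AA f := (Aop eps0 a b nu q (fun x l => f l x)).

Lemma Aop_outside C f r y k : (forall l, reg C (f l)) -> (forall l x, r < enorm x -> f l x = 0) -> r < enorm y ->
  AA f y k = Ig (nu y k) (@Rd0 R d) (Dj eps0 (f k) y) /\ forall u, Dj eps0 (f k) y u = f k (y + u).
Proof.
move=> rC f0 ry; have g0 := grad_vanish (rC k) (f0 k) ry.
have D0 u : Dj eps0 (f k) y u = f k (y + u) by rewrite /Dj (f0 k y ry) g0 inner0l mul0r !subr0.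
split=> //; rewrite AopE (trace_rows (hess (f k) y) (slT y k) (sls y k)) g0 inner0l quad_trace.
rewrite !big1 ?mulr0 ?addr0 ?add0r ?mulr0 ?add0r//.
- by move=> l _; rewrite !f0// subrr mulr0.
- by move=> i _; exact: quad_vanish (rC k) (f0 k) ry.
- by move=> i _; exact: quad_vanish (rC k) (f0 k) ry.
Qed.

(** The positive maximum principle for a nonnegative [f] off its support. It bounds the second law
    from below far away, where the drift and diffusion are not controlled. *)
Lemma Aop_outside_ge0 C f r y k : (forall l, reg C (f l)) -> (forall l x, r < enorm x -> f l x = 0) ->
  (forall l x, 0 <= f l x) -> r < enorm y -> 0 <= AA f y k.
Proof.
move=> rC f0 fp ry; have [-> D] := Aop_outside k rC f0 ry.
rewrite (_ : Dj eps0 (f k) y = fun u => f k (y + u)); last exact/funext.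
by apply: Rintegral_ge0.
Qed.

Lemma jump_bound C f y k : reg C (f k) -> `|Ig (nu y k) (@Rd0 R d) (Dj eps0 (f k) y)| <= Cj eps0 (d := d) C * Cn.
Proof.
move=> rC; have C0 : 0 <= C by case: rC.
have := dom_bound (nuC y k) (@measurable_Rd0 R d) (@subset_refl _ _) (borel_Dj eps0 y rC) (c := Cj eps0 (d := d) C) => H.
apply: le_trans (H _) _; first by move=> u _; exact: Dj_bound.
by rewrite ler_wpM2l ?Cj_ge0// (Ig_mm_le (nuC y k))//; exact: measurable_Rd0.
Qed.

(** Drift and diffusion are bounded on the ball that carries [f] and do not act outside it; the jump
    and switching terms are bounded globally. One [M] serves all [f] with the same [C] and [r]. *)
Lemma Aop_bounded C r : 0 <= C -> exists2 M, 0 <= M & forall f, (forall l, reg C (f l)) -> (forall l x, r < enorm x -> f l x = 0) ->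
  forall y k, `|AA f y k| <= M.
Proof.
move=> C0; have [B HB] := bB r; have [S HS] := sB r.
have [S2 S20 HS2] : exists2 S2, 0 <= S2 & forall x k i, enorm x <= r -> enorm (row i (sl x k)) ^+ 2 <= S2.
  exists (S ^+ 2); first exact: sqr_ge0.
  move=> x k i xr; have sS := HS x k xr i; rewrite lerXn2r ?nnegrE ?enorm_ge0//.
  exact: le_trans (enorm_ge0 _) sS.
have Cn0 := Cn_ge0 nuC.
have Cj0 := @Cj_ge0 R d eps0 C C0.
have Q0 : 0 <= Qb by have /andP[/le_trans h /h] := qB 0 ord0 ord0.
pose M1 := d%:R * (d%:R ^+ 2 * C * S2); pose M2 := lambda0 * (d%:R * (d%:R ^+ 2 * C)).
pose M3 := d%:R * C * `|B|; pose M4 := Cj eps0 (d := d) C * Cn; pose M5 := n.+1%:R * (Qb * (2 * C)).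
have p1 : 0 <= M1 by rewrite !mulr_ge0.
have p2 : 0 <= M2 by rewrite !mulr_ge0// ltW.
have p3 : 0 <= M3 by rewrite !mulr_ge0.
have p4 : 0 <= M4 by exact: mulr_ge0.
have p5 : 0 <= M5 by rewrite !mulr_ge0.
exists (M1 + M2 + M3 + M4 + M5) => [|f rC f0 y k]; first by lra.
have J := jump_bound y (rC k).
have [ry|yr] := ltP r (enorm y).
  by have [-> _] := Aop_outside k rC f0 ry; apply: le_trans J _; rewrite -/M4; lra.
rewrite AopE (trace_rows (hess (f k) y) (slT y k) (sls y k)).
have X1 : `|\sum_(i < d) quadform (hess (f k) y) (row i (sl y k))| <= d%:R * (d%:R ^+ 2 * C * S2).
  apply: le_trans (ler_norm_sum _ _ _) _.
  apply: (@le_trans _ _ (\sum_(i < d) d%:R ^+ 2 * C * S2)); last by rewrite sumr_const card_ord [leRHS]mulr_natl.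
  apply: ler_sum => i _; apply: le_trans (quad_bound _ _ (rC k)) _.
  by rewrite ler_wpM2l ?mulr_ge0 ?sqr_ge0// HS2.
have X2 : `|\tr (hess (f k) y)| <= d%:R * (d%:R ^+ 2 * C).
  rewrite quad_trace; apply: le_trans (ler_norm_sum _ _ _) _.
  apply: (@le_trans _ _ (\sum_(i < d) d%:R ^+ 2 * C)); last by rewrite sumr_const card_ord [leRHS]mulr_natl.
  by apply: ler_sum => i _; apply: le_trans (quad_bound _ _ (rC k)) _; rewrite enorm_evec expr1n mulr1.
have X3 : `|inner (grad (f k) y) (b y k)| <= d%:R * C * `|B|.
  apply: le_trans (cauchy_schwarz _ _) _; apply: ler_pM; rewrite ?enorm_ge0 ?(reg_grad _ (rC k))//.
  by apply: le_trans (HB y k yr) _; exact: ler_norm.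
have X4 : `|\sum_(l < n.+1) qz q y k l * (f l y - f k y)| <= n.+1%:R * (Qb * (2 * C)).
  apply: le_trans (ler_norm_sum _ _ _) _.
  apply: (@le_trans _ _ (\sum_(l < n.+1) Qb * (2 * C))); last by rewrite sumr_const card_ord [leRHS]mulr_natl.
  apply: ler_sum => l _; rewrite normrM; have /andP[q0 qb] := qB y k l.
  apply: ler_pM => //; first by rewrite ger0_norm.
  apply: le_trans (ler_normB _ _) _.
  by have := reg_bound y (rC l); have := reg_bound y (rC k); lra.
have l2 := ler_wpM2l (ltW l0) X2.
have l3 : `|lambda0 * \tr (hess (f k) y)| = lambda0 * `|\tr (hess (f k) y)| by rewrite normrM gtr0_norm.
set T1 := \sum_(i < d) _ in X1 *; set T2 := \tr _ in X2 l2 l3 *; set T3 := inner _ _ in X3 *.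
set T4 := Ig _ _ _ in J *; set T5 := \sum_(l < n.+1) _ in X4 *.
have n1 := normr_ge0 T1; have n2 : 0 <= lambda0 * `|T2| by rewrite mulr_ge0// ltW.
apply: le_trans (ler_normD _ _) _; apply: lerD => //.
apply: le_trans (ler_normD _ _) _; apply: lerD => //.
apply: le_trans (ler_normD _ _) _; apply: lerD => //.
rewrite normrM ger0_norm ?invr_ge0//; have := ler_normD T1 (lambda0 * T2).
rewrite -/M1 in X1; rewrite -/M2 in l2; lra.
Qed.

Lemma borel_sum (J : finType) (F : J -> V -> R) : (forall j, borel_fun (F j)) -> borel_fun (fun x => \sum_j F j x).
Proof. by move=> mF; apply: measurable_sum. Qed.

Lemma borel_iter_pd C phi (l : seq 'I_d) : reg C phi -> (size l <= 3)%N -> borel_fun (iter_pd l phi).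
Proof.
move=> rC sl3; have C0 : 0 <= C by case: rC.
apply: borel_cont; apply: (@elip_continuous _ _ (C * d%:R)); first by rewrite mulr_ge0.
move=> x y; have := reg_lip y (x - y) rC sl3; rewrite (addrC y) subrK => /le_trans; apply.
by rewrite -mulrA ler_wpM2l// l1_le.
Qed.

Lemma borel_moment k (E : set (Rd R d)) : measurable E -> borel_fun (fun x => Ig (nu x k) E (@enorm R d)).
Proof.
move=> mE; have m1 : measurable_fun setT (fun x : Rd R d => \int[nu x k]_(u in E) (enorm u)%:E)%E.
  rewrite (_ : (fun x => _) = (fun x => \int[nu x k]_u ((EFin \o @enorm R d) \_ E) u)%E); last first.
    by apply/funext => x; rewrite integral_mkcond.
  apply: (@measurable_fun_integral_kernel _ _ (Rd R d) (Rd R d) R (fun x => nu x k)).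
  - by move=> U mU; exact: num.
  - by move=> u; apply: erestrict_ge0 => v _ /=; rewrite lee_fin enorm_ge0.
  - apply/(measurable_restrictT _ mE); apply/measurable_EFinP.
    by apply: measurable_funTS; exact: borel_enorm.
exact: (measurableT_comp (@fine_measurable R setT measurableT) m1).
Qed.

(** The measure and the integrand both depend on [y], so measurability is read off from finite
    Riemann sums whose weights are measurable moments. The [m]-th sum is accurate to [1 / (m + 1)]
    on the ball of radius [m]. *)
Lemma borel_jump C phi k : reg C phi -> borel_fun (fun y => Ig (nu y k) (@Rd0 R d) (Dj eps0 phi y)).
Proof.
move=> rC; have C0 : 0 <= C by case: rC.
have Cn0 := Cn_ge0 nuC; have Cj0 := @Cj_ge0 R d eps0 C C0.
have H m : exists h : V -> R, borel_fun h /\ forall y, enorm y <= m%:R ->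
    `|Ig (nu y k) (@Rd0 R d) (Dj eps0 phi y) - h y| <= m.+1%:R^-1.
  have e1 : 0 < m.+1%:R^-1 / 2 / (Cj eps0 (d := d) C + 1) by rewrite !divr_gt0 ?ltr_wpDl.
  have [K HK] := tB m%:R e1.
  pose w := 4 * (d%:R * C) * K%:R * K%:R * Cn + 1.
  have w0 : 0 < w by rewrite ltr_wpDl// !mulr_ge0.
  pose z := m.+1%:R^-1 / 2 / w.
  have z0 : 0 < z by rewrite !divr_gt0.
  have [J [E [uu cE]]] := @cells_exist R d eps0 K z z0.
  exists (fun y => \sum_(j : J) pj nu E uu y k j * Dj eps0 phi y (uu j)); split.
    apply: borel_sum => j; apply: measurable_funM.
      apply: measurable_funM; last exact: measurable_cst.
      by apply: borel_moment; exact: c_meas cE j.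
    apply: measurable_funB.
      apply: measurable_funB; last exact: (borel_iter_pd (l := [::]) rC).
      rewrite (_ : (fun _ => _) = (fun y => phi (uu j + y))); first exact: borel_shift rC.
      by apply/funext => y; rewrite addrC.
    apply: measurable_funM; last exact: measurable_cst.
    rewrite (_ : (fun y => inner _ _) = (fun y => \sum_(i < d) iter_pd [:: i] phi y * uu j 0 i)).
      apply: borel_sum => i; apply: measurable_funM; last exact: measurable_cst.
      exact: borel_iter_pd rC _.
    by apply/funext => y; apply: eq_bigr => i _; rewrite mxE.
  move=> y ym; apply: le_trans (cells_approx e0 y (nuC y k) cE (ltW z0) rC) _.
  have h1 : Cj eps0 (d := d) C * Ig (nu y k) (tail K) (@mm R d) <= m.+1%:R^-1 / 2.
    apply: (@le_trans _ _ ((Cj eps0 (d := d) C + 1) * Ig (nu y k) (tail K) (@mm R d))).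
      by rewrite ler_wpM2r ?lerDl// Rintegral_ge0// => u _; exact: mm_ge0.
    by rewrite mulrC -ler_pdivlMr ?ltr_wpDl//; apply: HK.
  have h2 : 4 * (d%:R * C) * z * K%:R * K%:R * Cn <= m.+1%:R^-1 / 2.
    apply: (@le_trans _ _ (z * w)); last by rewrite /z divfK// gt_eqF.
    by rewrite /w; have := ltW z0; lra.
  by apply: le_trans (lerD h1 h2) _; rewrite -splitr.
have /choice[h Hh] := H.
apply: (@measurable_fun_cvg _ (Rd R d) R setT h) => [m|]; first exact: (Hh m).1.
move=> y _; apply/cvgrPdist_le => e ep.
near=> m.
have h1 : enorm y <= m%:R.
  by near: m; exact: nbhs_infty_ger.
have h2 : m.+1%:R^-1 < e by near: m; exact: (near_infty_natSinv_lt (PosNum ep)).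
by apply: le_trans (ltW h2); exact: (Hh m).2.
Unshelve. all: by end_near. Qed.

Lemma borel_Aop C f k : (forall l, reg C (f l)) -> borel_fun (fun y => AA f y k).
Proof.
move=> rC; rewrite (_ : (fun y => _) = fun y => 2^-1 * (\sum_(i < d) \sum_(j < d) a y k i j * iter_pd [:: i; j] (f k) y) +
   \sum_(i < d) iter_pd [:: i] (f k) y * b y k 0 i + Ig (nu y k) (@Rd0 R d) (Dj eps0 (f k) y) +
   \sum_(l < n.+1) q y k l * (f l y - f k y)).
  apply: measurable_funD; last first.
    apply: borel_sum => l; apply: measurable_funM; first exact: qm.
    by apply: measurable_funB; exact: (borel_iter_pd (l := [::]) (rC _)).
  apply: measurable_funD; last exact: borel_jump (rC k).
  apply: measurable_funD.
    apply: measurable_funM; first exact: measurable_cst.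
    apply: borel_sum => i; apply: borel_sum => j; apply: measurable_funM; first exact: am.
    exact: borel_iter_pd (rC k) _.
  apply: borel_sum => i; apply: measurable_funM; last exact: bm.
  exact: borel_iter_pd (rC k) _.
apply/funext => y; rewrite /Aop /Lop; congr (_ * _ + _ + _ + _).
  by apply: eq_bigr => i _; rewrite mxE; apply: eq_bigr => j _; rewrite mxE.
by rewrite innerC; apply: eq_bigr => i _; rewrite mxE.
Qed.

End setting.

(** * Frozen generators and mollification *)

Section lipschitz.
Context {R : realType} {d : nat}.
Local Notation V := 'rV[R]_d.
Implicit Types (F G : V -> R).

(** Linearity of [Sm] only requires that some Lipschitz constant exists. *)
Definition lip F := exists K : R, elip K F.

Lemma lipD F G : lip F -> lip G -> lip (fun x => F x + G x).
Proof. by move=> [K HK] [L HL]; exists (K + L); exact: elipD. Qed.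

Lemma lipZ c F : lip F -> lip (fun x => c * F x).
Proof. by move=> [K HK]; exists (`|c| * K); exact: elipZ. Qed.

Lemma lipN F : lip F -> lip (fun x => - F x).
Proof. by move=> /(lipZ (-1))[K HK]; exists K => x y; have := HK x y; rewrite !mulN1r. Qed.

Lemma lipB F G : lip F -> lip G -> lip (fun x => F x - G x).
Proof. by move=> lF /lipN; exact: lipD. Qed.

Lemma lip_shift F v : lip F -> lip (fun x => F (x + v)).
Proof. by move=> [K HK]; exists K; exact: elip_shift. Qed.

Lemma lip_cst (c : R) : lip (fun=> c).
Proof. by exists 0; exact: elip_cst. Qed.

Lemma lip_sum (I : Type) (s : seq I) (F : I -> V -> R) : (forall i, lip (F i)) -> lip (fun x => \sum_(i <- s) F i x).
Proof.
move=> lF; elim: s => [|i s IH].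
  by rewrite (_ : (fun x => _) = fun=> 0); [exact: lip_cst|apply/funext => x; rewrite big_nil].
rewrite (_ : (fun x => _) = fun x => F i x + \sum_(j <- s) F j x); last by apply/funext => x; rewrite big_cons.
exact: lipD.
Qed.

Lemma lip_avgm m (E : 'I_d -> V) tau F : lip F -> lip (avgm m E tau F).
Proof.
elim: m F => [//|m IH] F lF; rewrite (_ : avgm m.+1 E tau F = avgm m E tau (avg E tau F)); last first.
  by apply/funext => x; rewrite avgmS.
apply: IH; apply: lipZ; apply: lip_sum => i.
by apply: lipD; apply: lip_shift.
Qed.

Variable eps : R.
Hypothesis ep : 0 < eps.
Local Notation S := (Sm eps).

Lemma SmD' F G p : lip F -> lip G -> S (fun x => F x + G x) p = S F p + S G p.
Proof. by move=> [K HK] [L HL]; exact: (SmD ep _ HK HL). Qed.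

Lemma SmZ' c F p : lip F -> S (fun x => c * F x) p = c * S F p.
Proof. by move=> [K HK]; exact: (SmZ ep _ _ HK). Qed.

Lemma SmB' F G p : lip F -> lip G -> S (fun x => F x - G x) p = S F p - S G p.
Proof.
move=> lF lG; rewrite (SmD' p lF (lipN lG)); congr (_ + _).
transitivity (S (fun x => -1 * G x) p); last by rewrite (SmZ' _ _ lG) mulN1r.
by congr (S _ p); apply/funext => x; rewrite mulN1r.
Qed.

Lemma Sm_sum (I : Type) (s : seq I) (F : I -> V -> R) p : (forall i, lip (F i)) ->
  S (fun x => \sum_(i <- s) F i x) p = \sum_(i <- s) S (F i) p.
Proof.
move=> lF; elim: s => [|i s IH].
  rewrite big_nil -[RHS](Sm_cst eps 0 p); congr (S _ p); apply/funext => x; exact: big_nil.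
rewrite big_cons -IH -SmD'//; last exact: lip_sum.
by congr (S _ p); apply/funext => x; rewrite big_cons.
Qed.

Lemma Sm_avgm m (E : 'I_d -> V) tau F p : lip F -> S (avgm m E tau F) p = avgm m E tau (S F) p.
Proof.
elim: m F p => [//|m IH] F p lF.
have lA : lip (avg E tau F) by apply: lipZ; apply: lip_sum => i; apply: lipD; apply: lip_shift.
have SA q : S (avg E tau F) q = avg E tau (S F) q.
  have lpm i : lip (fun x => F (x + tau *: E i) + F (x - tau *: E i)) by apply: lipD; apply: lip_shift.
  rewrite /avg SmZ' ?Sm_sum//; last exact: lip_sum.
  congr (_ * _); apply: eq_bigr => i _; rewrite SmD'; [|exact: lip_shift|exact: lip_shift].
  by rewrite -!Sm_shift.
by rewrite !avgmS IH//; apply: avgm_ext.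
Qed.

End lipschitz.

Section frozen.
Context {R : realType} {d n : nat}.
Hypothesis d0 : (0 < d)%N.
Local Notation V := 'rV[R]_d.
Local Notation I := 'I_n.+1.
Local Notation e_ := (@evec R d).
Variables (J : finType) (h tau : R) (m : nat) (uu : J -> V) (bb : V) (ss : 'I_d -> V) (pp : J -> R) (qq : I -> R) (k : I).
Hypotheses (h0 : 0 < h) (p0 : forall j, 0 <= pp j) (q0 : forall l, 0 <= qq l).
Implicit Types (f : I -> V -> R) (x : V).
Local Notation G := (Gop h tau m uu bb ss pp qq k).

Lemma lip_Gop f : (forall l, lip (f l)) -> lip (G f).
Proof.
move=> lf; rewrite /Gop; repeat apply: lipD.
- by apply: lipZ; apply: lipB => //; apply: lip_shift.
- apply: lip_sum => i; apply: lipZ; apply: lipB; last exact: lipZ.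
  by apply: lipD; apply: lip_shift.
- by apply: lipZ; apply: lipB => //; apply: lip_avgm.
- by apply: lip_sum => j; apply: lipZ; apply: lipB => //; apply: lip_shift.
- by apply: lip_sum => l; apply: lipZ; apply: lipB.
Qed.

(** With frozen coefficients [Gop] is a combination of translations, and these commute with
    mollification. *)
Lemma Sm_Gop eps f p : 0 < eps -> (forall l, lip (f l)) -> Sm eps (G f) p = G (fun l => Sm eps (f l)) p.
Proof.
move=> ep lf; rewrite /Gop.
have l1 : lip (fun x => h^-1 * (f k (x + h *: bb) - f k x)) by apply: lipZ; apply: lipB => //; apply: lip_shift.
have l2' i : lip (fun x => f k (x + Num.sqrt h *: ss i) + f k (x - Num.sqrt h *: ss i)) by apply: lipD; apply: lip_shift.
have l2'' i : lip (fun x => f k (x + Num.sqrt h *: ss i) + f k (x - Num.sqrt h *: ss i) - 2 * f k x).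
  by apply: lipB => //; apply: lipZ.
have l2 : lip (fun x => \sum_(i < d) (2 * h)^-1 * (f k (x + Num.sqrt h *: ss i) + f k (x - Num.sqrt h *: ss i) - 2 * f k x)).
  by apply: lip_sum => i; apply: lipZ.
have l3' : lip (avgm m e_ tau (f k)) by exact: lip_avgm.
have l3 : lip (fun x => h^-1 * (avgm m e_ tau (f k) x - f k x)) by apply: lipZ; apply: lipB.
have l4' j : lip (fun x => f k (x + uu j)) by exact: lip_shift.
have l4 : lip (fun x => \sum_(j : J) pp j * (f k (x + uu j) - f k x)) by apply: lip_sum => j; apply: lipZ; apply: lipB.
have l5 : lip (fun x => \sum_(l < n.+1) qq l * (f l x - f k x)) by apply: lip_sum => j; apply: lipZ; apply: lipB.
have l12 := lipD l1 l2; have l123 := lipD l12 l3; have l1234 := lipD l123 l4.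
rewrite SmD'// SmD'// SmD'// SmD'//; congr (_ + _ + _ + _ + _).
- rewrite SmZ' ?SmB'//; [by rewrite -Sm_shift|exact: lip_shift|apply: lipB => //; exact: lip_shift].
- rewrite Sm_sum//; last by move=> i; exact: lipZ.
  apply: eq_bigr => i _; rewrite SmZ'// SmB'//; last exact: lipZ.
  by rewrite SmD' ?SmZ' -?Sm_shift//; exact: lip_shift.
- by rewrite SmZ' ?SmB' ?Sm_avgm//; exact: lipB.
- rewrite Sm_sum//; last by move=> j; apply: lipZ; exact: lipB.
  by apply: eq_bigr => j _; rewrite SmZ' ?SmB'// -?Sm_shift//; exact: lipB.
- rewrite Sm_sum//; last by move=> j; apply: lipZ; exact: lipB.
  by apply: eq_bigr => j _; rewrite SmZ' ?SmB'//; exact: lipB.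
Qed.

Definition rate : R := h^-1 + d%:R * h^-1 + h^-1 + \sum_(j : J) pp j + \sum_(l < n.+1) qq l.

Lemma rate_ge0 : 0 <= rate.
Proof. by rewrite /rate !addr_ge0 ?mulr_ge0 ?sumr_ge0 ?invr_ge0 ?(ltW h0). Qed.

(* [G] is the generator of a jump process with total jump rate [rate]. *)
Lemma Gop_le f x M : (forall l y, f l y <= M) -> G f x + rate * f k x <= rate * M.
Proof.
move=> fM; have hi : 0 <= h^-1 by rewrite invr_ge0 ltW.
have P1 : h^-1 * (f k (x + h *: bb) - f k x) <= h^-1 * (M - f k x) by rewrite ler_wpM2l// lerD2r.
have P2 : \sum_(i < d) (2 * h)^-1 * (f k (x + Num.sqrt h *: ss i) + f k (x - Num.sqrt h *: ss i) - 2 * f k x)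
    <= d%:R * h^-1 * (M - f k x).
  have -> : d%:R * h^-1 * (M - f k x) = \sum_(i < d) h^-1 * (M - f k x).
    by rewrite sumr_const card_ord -(mulr_natl _ d); ring.
  apply: ler_sum => i _; have h1 := fM k (x + Num.sqrt h *: ss i); have h2 := fM k (x - Num.sqrt h *: ss i).
  have -> : h^-1 * (M - f k x) = (2 * h)^-1 * (2 * M - 2 * f k x) by field; rewrite gt_eqF.
  rewrite ler_wpM2l ?invr_ge0 ?mulr_ge0 ?(ltW h0)//; lra.
have P3 : h^-1 * (avgm m e_ tau (f k) x - f k x) <= h^-1 * (M - f k x).
  by rewrite ler_wpM2l// lerD2r; have := avgm_le d0 m e_ tau x (fM k); rewrite avgm_cst.
have P4 : \sum_(j : J) pp j * (f k (x + uu j) - f k x) <= (\sum_(j : J) pp j) * (M - f k x).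
  by rewrite mulr_suml; apply: ler_sum => j _; rewrite ler_wpM2l// lerD2r.
have P5 : \sum_(l < n.+1) qq l * (f l x - f k x) <= (\sum_(l < n.+1) qq l) * (M - f k x).
  by rewrite mulr_suml; apply: ler_sum => j _; rewrite ler_wpM2l// lerD2r.
rewrite /Gop /rate; lra.
Qed.

Lemma GopN f x : G (fun l y => - f l y) x = - G f x.
Proof.
rewrite /Gop (_ : avgm m e_ tau (fun y => - f k y) x = - avgm m e_ tau (f k) x); last first.
  by rewrite -mulN1r -avgmZ; apply: avgm_ext => y; rewrite mulN1r.
rewrite !opprD -!sumrN; congr (_ + _ + _ + _ + _); try ring; apply: eq_bigr => i _; ring.
Qed.

Lemma Gop_ge f x M : (forall l y, M <= f l y) -> rate * M <= G f x + rate * f k x.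
Proof.
move=> fM; have fM' l y : - f l y <= - M by rewrite lerN2.
have := @Gop_le (fun l y => - f l y) x (- M) fM'; rewrite GopN; lra.
Qed.

Lemma Gop_range f x delta : 0 <= delta -> delta * rate <= 1 -> (forall l y, 0 <= f l y <= 1) ->
  0 <= f k x + delta * G f x <= 1.
Proof.
move=> dl0 dr fr; have /andP[fk0 fk1] := fr k x.
have H1 := @Gop_le f x 1 (fun l y => proj2 (andP (fr l y))).
have H2 := @Gop_ge f x 0 (fun l y => proj1 (andP (fr l y))).
have H3 := ler_wpM2l dl0 H1; have H4 := ler_wpM2l dl0 H2.
have H5 : 0 <= (1 - delta * rate) * f k x by rewrite mulr_ge0// subr_ge0.
have H6 : 0 <= (1 - delta * rate) * (1 - f k x) by rewrite mulr_ge0// subr_ge0.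
by apply/andP; split; lra.
Qed.

Lemma Gop_shift f x v : G f (x + v) = G (fun l y => f l (y + v)) x.
Proof.
rewrite /Gop avgm_shift; congr (_ + _ + _ + _ + _).
- by rewrite addrAC.
- by apply: eq_bigr => i _; rewrite !(addrAC x v).
- by apply: eq_bigr => i _; rewrite !(addrAC x v).
Qed.

Lemma GopB f g x : G (fun l y => f l y - g l y) x = G f x - G g x.
Proof.
rewrite /Gop (_ : avgm m e_ tau (fun y => f k y - g k y) x = avgm m e_ tau (f k) x - avgm m e_ tau (g k) x); last first.
  rewrite avgmD; congr (_ + _); rewrite -mulN1r -avgmZ; apply: avgm_ext => y; by rewrite mulN1r.
have s1 : \sum_(i < d) (2 * h)^-1 * (f k (x + Num.sqrt h *: ss i) - g k (x + Num.sqrt h *: ss i) +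
   (f k (x - Num.sqrt h *: ss i) - g k (x - Num.sqrt h *: ss i)) - 2 * (f k x - g k x)) =
   \sum_(i < d) (2 * h)^-1 * (f k (x + Num.sqrt h *: ss i) + f k (x - Num.sqrt h *: ss i) - 2 * f k x)
   - \sum_(i < d) ((2 * h)^-1 * (g k (x + Num.sqrt h *: ss i) + g k (x - Num.sqrt h *: ss i) - 2 * g k x)).
  by rewrite -sumrB/=; apply: eq_bigr => i _; ring.
have s2 : \sum_(j : J) pp j * (f k (x + uu j) - g k (x + uu j) - (f k x - g k x)) =
   \sum_(j : J) pp j * (f k (x + uu j) - f k x) - \sum_(j : J) (pp j * (g k (x + uu j) - g k x)).
  by rewrite -sumrB/=; apply: eq_bigr => i _; ring.
have s3 : \sum_(l < n.+1) qq l * (f l x - g l x - (f k x - g k x)) =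
   \sum_(l < n.+1) qq l * (f l x - f k x) - \sum_(l < n.+1) (qq l * (g l x - g k x)).
  by rewrite -sumrB/=; apply: eq_bigr => i _; ring.
rewrite s1 s2 s3; ring.
Qed.

(** By translation invariance the difference is [Gop] applied to the difference of two translates of
    [f], which is bounded by [K * |x - x'|]. *)
Lemma Gop_lip f x x' K : 0 <= K -> (forall l, elip K (f l)) -> `|G f x - G f x'| <= 2 * rate * (K * enorm (x - x')).
Proof.
move=> K0 lf; pose g l y := f l (y + (x - x')) - f l y.
have gB l y : `|g l y| <= K * enorm (x - x').
  by have := lf l (y + (x - x')) y; rewrite addrAC subrr add0r.
have -> : G f x - G f x' = G g x'.
  rewrite /g GopB; congr (_ - _); rewrite -(Gop_shift f x' (x - x')); congr (G f _).
  by rewrite addrC subrK.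
have H1 := @Gop_le g x' (K * enorm (x - x')) (fun l y => le_trans (ler_norm _) (gB l y)).
have gB' l y : - (K * enorm (x - x')) <= g l y by have := gB l y; rewrite ler_norml => /andP[].
have H2 := @Gop_ge g x' _ gB'.
have r0 := rate_ge0; have /andP[g1 g2] : - (K * enorm (x - x')) <= g k x' <= K * enorm (x - x') by rewrite -ler_norml.
have H3 := ler_wpM2l r0 g1; have H4 := ler_wpM2l r0 g2.
rewrite ler_norml; apply/andP; split; lra.
Qed.

End frozen.

(** * Cost transforms *)

Section ctransform.
Context {R : realType} {d : nat} {I : Type}.
Local Notation V := 'rV[R]_d.
Variables (N e1 L : R) (Psi : V -> R) (FF GG : V -> V -> I -> R).
Hypotheses (N0 : 0 <= N) (e10 : 0 < e1) (L0 : 0 <= L).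
Hypothesis Psi01 : forall w, 0 <= Psi w <= 1.
Hypothesis PsiL : elip L Psi.
Hypothesis Psi1 : forall w, 1 <= enorm w -> Psi w = 1.
Hypothesis FF01 : forall y x k, 0 <= FF y x k <= 1.
Hypothesis GG01 : forall y x k, 0 <= GG y x k <= 1.
Hypothesis FG : forall k x x' y y', enorm x <= N + 1 -> enorm (y - x) <= e1 -> enorm (y' - x') <= e1 ->
  FF y x k - GG y' x' k <= Psi (x - x').

(* [gh] is the least function compatible with the increments [FF] and the cost [Psi], and [fh] is the cut-off
   of the largest function compatible with [gh]. *)
Definition gset k (x' : V) : set R := 0 |` [set t | exists y x, enorm x <= N + 1 /\ enorm (y - x) <= e1 /\ t = FF y x k - Psi (x - x')].
Definition gh k (x' : V) : R := sup (gset k x').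
Definition fset k (x : V) : set R := [set t | exists x', t = Num.min 1 (gh k x' + Psi (x - x'))].
Definition chi (x : V) : R := Num.max 0 (Num.min 1 (2 * (N + 1 - enorm x))).
Definition fh k (x : V) : R := chi x * inf (fset k x).

Lemma gset_ub k x' M : 0 <= M ->
  (forall y x, enorm x <= N + 1 -> enorm (y - x) <= e1 -> FF y x k - Psi (x - x') <= M) -> gh k x' <= M.
Proof.
move=> M0 H; apply: ge_sup; first by exists 0; left.
by move=> t [->//|[y [x [x1 [yx ->]]]]]; exact: H.
Qed.

Lemma gset_has k x' : has_ubound (gset k x').
Proof.
exists 1 => t [->|[y [x [x1 [yx ->]]]]]; first exact: ler01.
have /andP[_ h] := FF01 y x k; have /andP[p _] := Psi01 (x - x'); lra.
Qed.

Lemma gh_ge k x' y x : enorm x <= N + 1 -> enorm (y - x) <= e1 -> FF y x k - Psi (x - x') <= gh k x'.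
Proof. by move=> x1 yx; apply: (ub_le_sup (gset_has k x')); right; exists y, x. Qed.

Lemma gh_ge0 k x' : 0 <= gh k x'.
Proof. by apply: (ub_le_sup (gset_has k x')); left. Qed.

Lemma gh_le1 k x' : gh k x' <= 1.
Proof.
apply: gset_ub => // y x _ _.
have /andP[_ h] := FF01 y x k; have /andP[p _] := Psi01 (x - x'); lra.
Qed.

(** The coupling inequality [FG] says that every increment entering the supremum is below [GG]; the
    added value 0 is too, since [GG] is nonnegative. *)
Lemma gh_le k x' y' : enorm (y' - x') <= e1 -> gh k x' <= GG y' x' k.
Proof.
move=> yx'; apply: gset_ub; first by have /andP[] := GG01 y' x' k.
by move=> y x x1 yx; have := FG k x1 yx yx'; lra.
Qed.

Lemma gh_elip k : elip L (gh k).
Proof.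
have H x1 x2 : gh k x1 <= gh k x2 + L * enorm (x1 - x2).
  apply: gset_ub => [|y x xN yx]; first by rewrite addr_ge0 ?gh_ge0 ?mulr_ge0 ?enorm_ge0.
  have := gh_ge k x2 xN yx; have := PsiL (x - x2) (x - x1).
  have -> : x - x2 - (x - x1) = x1 - x2 by rewrite opprB [LHS]addrC addrA subrK.
  by rewrite ler_norml => /andP[h1 h2] h3; lra.
move=> x1 x2; rewrite ler_norml; have := H x1 x2; have := H x2 x1; rewrite (enormB x2).
move=> h1 h2; apply/andP; split; lra.
Qed.

(** From distance 1 on the cost is 1 and exceeds every value of [FF], so the transform reaches at
    most distance 1 beyond the ball. *)
Lemma gh_supp k x' : N + 2 < enorm x' -> gh k x' = 0.
Proof.
move=> x'2; apply/eqP; rewrite eq_le gh_ge0 andbT; apply: gset_ub => // y x xN _.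
have /andP[_ h] := FF01 y x k; rewrite Psi1; first by lra.
have := enorm_tri x' x 0; rewrite !subr0 (enormB x'); lra.
Qed.

Lemma fset_has k x : has_lbound (fset k x).
Proof.
exists 0 => t [x' ->]; rewrite le_min ler01/= addr_ge0 ?gh_ge0//.
by have /andP[] := Psi01 (x - x').
Qed.

Lemma fset_ge k x M : M <= 1 -> (forall x', M <= gh k x' + Psi (x - x')) -> M <= inf (fset k x).
Proof.
move=> M1 H; apply: lb_le_inf; first by exists (Num.min 1 (gh k 0 + Psi (x - 0))), 0.
by move=> t [x' ->]; rewrite le_min M1/=.
Qed.

Lemma fset_le k x x' : inf (fset k x) <= gh k x' + Psi (x - x').
Proof.
apply: (@le_trans _ _ (Num.min 1 (gh k x' + Psi (x - x')))); last by rewrite ge_min lexx orbT.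
by apply: (ge_inf (fset_has k x)); exists x'.
Qed.

Lemma fset01 k x : 0 <= inf (fset k x) <= 1.
Proof.
apply/andP; split.
  apply: fset_ge => // x'; rewrite addr_ge0 ?gh_ge0//.
  by have /andP[] := Psi01 (x - x').
apply: (@le_trans _ _ (Num.min 1 (gh k 0 + Psi (x - 0)))); last by rewrite ge_min lexx.
by apply: (ge_inf (fset_has k x)); exists 0.
Qed.

Lemma chi01 x : 0 <= chi x <= 1.
Proof. by rewrite /chi le_max lexx/= ge_max ler01/= ge_min lexx. Qed.

Lemma chi_in x : enorm x <= N + 2^-1 -> chi x = 1.
Proof.
move=> xN; rewrite /chi min_l; last by lra.
by rewrite max_r.
Qed.

Lemma chi_out x : N + 1 < enorm x -> chi x = 0.
Proof. by move=> xN; rewrite /chi max_l// ge_min; apply/orP; right; lra. Qed.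

Lemma chi_elip : elip 2 chi.
Proof.
have H x y : chi x <= chi y + 2 * enorm (x - y).
  have e0 := enorm_ge0 (x - y).
  rewrite {1}/chi ge_max; apply/andP; split.
    by rewrite addr_ge0 ?mulr_ge0//; have /andP[] := chi01 y.
  have h := le_trans (ler_norm _) (enorm_lip y x); rewrite enormB in h.
  apply: (@le_trans _ _ (Num.min 1 (2 * (N + 1 - enorm y)) + 2 * enorm (x - y))).
    rewrite -lerBlDr le_min; apply/andP; split.
      by rewrite lerBlDr (@le_trans _ _ 1)// ?ge_min ?lexx// lerDl mulr_ge0.
    by rewrite lerBlDr (@le_trans _ _ (2 * (N + 1 - enorm x)))// ?ge_min ?lexx ?orbT//; lra.
  by rewrite lerD2r /chi le_max lexx orbT.
move=> x y; rewrite ler_norml; have := H x y; have := H y x; rewrite (enormB y).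
move=> h1 h2; apply/andP; split; lra.
Qed.

Lemma fh01 k x : 0 <= fh k x <= 1.
Proof.
have /andP[c0 c1] := chi01 x; have /andP[f0 f1] := fset01 k x.
by rewrite /fh mulr_ge0//= mulr_ile1.
Qed.

Lemma fh_supp k x : N + 1 < enorm x -> fh k x = 0.
Proof. by move=> xN; rewrite /fh chi_out// mul0r. Qed.

Lemma fh_ge k x y : enorm x <= N + 2^-1 -> enorm (y - x) <= e1 -> FF y x k <= fh k x.
Proof.
move=> xN yx; rewrite /fh chi_in// mul1r; apply: fset_ge; first by have /andP[] := FF01 y x k.
by move=> x'; rewrite -lerBlDr; apply: gh_ge => //; lra.
Qed.

Lemma fgh k x x' : fh k x - gh k x' <= Psi (x - x').
Proof.
have /andP[c0 c1] := chi01 x; have /andP[f0 f1] := fset01 k x; have := fset_le k x x'.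
suff : fh k x <= inf (fset k x) by lra.
by rewrite /fh ler_piMl.
Qed.

Lemma fset_elip k : elip L (fun x => inf (fset k x)).
Proof.
have H x y : inf (fset k x) - L * enorm (x - y) <= inf (fset k y).
  have e0 : 0 <= L * enorm (x - y) by rewrite mulr_ge0 ?enorm_ge0.
  have /andP[f0 f1] := fset01 k x.
  apply: fset_ge => [|x']; first by lra.
  have := fset_le k x x'; have := PsiL (x - x') (y - x').
  rewrite opprB addrA subrK => /(le_trans (ler_norm _)); lra.
move=> x y; rewrite ler_norml; have := H x y; have := H y x; rewrite (enormB y).
move=> h1 h2; apply/andP; split; lra.
Qed.

Lemma fh_elip k : elip (L + 2) (fh k).
Proof.
move=> x y; rewrite /fh; have /andP[f0 f1] := fset01 k x; have /andP[c0 c1] := chi01 y.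
have -> : chi x * inf (fset k x) - chi y * inf (fset k y) =
  (chi x - chi y) * inf (fset k x) + chi y * (inf (fset k x) - inf (fset k y)) by ring.
apply: le_trans (ler_normD _ _) _; rewrite !normrM (ger0_norm f0) (ger0_norm c0) mulrDl addrC lerD//.
  by apply: le_trans (fset_elip k x y); rewrite ler_piMl.
by apply: le_trans (chi_elip x y); rewrite ler_piMr.
Qed.

End ctransform.

(** * One step of the dual recursion *)

(** Positions with [lam * R <= 1] are within [1 / lam <= delta1 / 2] of each other; frozen points,
    each moved by at most [e1 <= delta1 / 4], stay within the range [delta1] of the local
    assumption. *)
Lemma pair_geometry (R : realType) (d : nat) (N e1 lam delta1 eta r1 : R) (x x' y y' : 'rV[R]_d) :
  1 <= lam -> 2 <= lam * delta1 -> 4 * e1 <= delta1 -> 2 * e1 <= r1 -> e1 <= 1 ->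
  enorm x <= N + 1 -> enorm (y - x) <= e1 -> enorm (y' - x') <= e1 ->
  lam * Rr eta (x - x') <= 1 ->
  [/\ enorm y <= N + 5, enorm y' <= N + 5, enorm (x - x' - (y - y')) <= 2 * e1, enorm (y - y') <= delta1 &
   (enorm (x - x') < r1 -> enorm (y - y') <= 2 * r1)].
Proof.
move=> lam1 lamd P4 P3 P5 xN yx yx' Rl; have lamp : 0 < lam by apply: lt_le_trans lam1.
have wl : lam * enorm (x - x') <= 1 by apply: le_trans Rl; rewrite ler_wpM2l ?Rr_ge ?ltW.
have w1 : enorm (x - x') <= 1.
  by apply: le_trans wl; rewrite ler_peMl ?enorm_ge0.
have wd : 2 * enorm (x - x') <= delta1.
  have t1 : lam * (2 * enorm (x - x')) <= lam * delta1.
    by rewrite (le_trans _ lamd)// mulrCA -[leRHS]mulr1 ler_wpM2l.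
  by rewrite ler_pM2l in t1.
have x'N : enorm x' <= N + 2.
  have T := enorm_tri x' x 0; rewrite !subr0 (enormB x') in T; lra.
have wv : enorm (x - x' - (y - y')) <= 2 * e1.
  have -> : x - x' - (y - y') = (y' - x') - (y - x).
    by apply/rowP => i; rewrite !mxE; ring.
  by apply: le_trans (enorm_triB _ _) _; lra.
have vE : enorm (y - y') <= enorm (x - x') + 2 * e1.
  have -> : y - y' = (x - x') - (x - x' - (y - y')) by rewrite subKr.
  by apply: le_trans (enorm_triB _ _) _; rewrite lerD2l.
split=> //; [| |lra|by move=> wr; lra].
- have T := enorm_tri y x 0; rewrite !subr0 in T; lra.
- have T := enorm_tri y' x' 0; rewrite !subr0 in T; lra.
Qed.

Section coupling_setting.
Context {R : realType} {d n : nat}.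
Hypothesis d0 : (0 < d)%N.
Local Notation V := 'rV[R]_d.
Local Notation I := 'I_n.+1.
Local Notation e_ := (@evec R d).
Implicit Types (x y w v : V) (k l : I) (f g : I -> V -> R).
Variables (eps0 : R) (a : V -> I -> 'M[R]_d) (b : V -> I -> V) (nu : V -> I -> {measure set Rd R d -> \bar R})
  (q : V -> I -> I -> R) (sl : V -> I -> 'M[R]_d) (lambda0 Cn Qb Q H delta1 : R) (theta : R -> R).
Hypotheses (e0 : 0 < eps0) (l0 : 0 < lambda0).
Hypothesis nuC : forall x k, (\int[nu x k]_(u in @Rd0 R d) (mm u)%:E <= Cn%:E)%E.
Hypothesis qB : forall x k l, 0 <= qz q x k l <= Qb.
Hypotheses (H0 : 0 <= H) (Q0 : 0 <= Q).
Hypothesis th0 : forall r, 0 < r -> r <= delta1 -> 0 <= theta r.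
Hypothesis th1 : forall r, 0 < r -> r <= delta1 -> theta r <= 1.
Hypothesis SFb : forall k x z, enorm (x - z) <= delta1 ->
  2 * inner (x - z) (b x k - b z k) + hs2 (sl x k - sl z k) <= 2 * H * enorm (x - z) * theta (enorm (x - z)).
Hypothesis SFt : forall k x z, enorm (x - z) <= delta1 ->
  (tv_integral (@enorm R d) (nu x k) (nu z k) (@Rd0 R d) <= (H / 2 * theta (enorm (x - z)))%:E)%E.
Hypothesis F2 : forall k x z, \sum_(l < n.+1) `|qz q x k l - qz q z k l| <= Q * enorm (x - z).

Variables (J : finType) (E : J -> set (Rd R d)) (uu : J -> V) (K : nat) (z : R).
Hypothesis cE : cells eps0 E uu K z.
Local Notation pj := (pj nu E uu).
Local Notation bj := (bj eps0 nu E uu).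
Local Notation bz := (bz eps0 b nu E uu).
Local Notation sz := (sz sl).
Local Notation qz := (qz q).

Lemma pj_diff k x y t : (tv_integral (@enorm R d) (nu x k) (nu y k) (@Rd0 R d) <= t%:E)%E ->
  \sum_(j : J) `|pj x k j - pj y k j| * enorm (uu j) <= t.
Proof.
move=> tv; apply: le_trans (tv_cells (nuC x k) (nuC y k) tv (c_meas cE) (c_disj cE) (c_sub cE) (c_cov cE) (c_tail cE) _).
  apply: ler_sum => j _; rewrite /pj -mulrBl normrM [X in _ * X * _]ger0_norm ?invr_ge0 ?enorm_ge0//.
  have [->|u0] := eqVneq (enorm (uu j)) 0; first by rewrite mulr0.
  by rewrite divfK.
by move=> j u /(c_bnd cE)[_ []].
Qed.

Lemma bj_diff k x y : enorm (bj x k - bj y k) <= \sum_(j : J) `|pj x k j - pj y k j| * enorm (uu j).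
Proof.
rewrite /bj -sumrB; apply: le_trans (enorm_sum _ _ _) _; apply: ler_sum => j _.
rewrite -scalerBl enormZ ler_wpM2r ?enorm_ge0// -mulrBl normrM ler_piMr// ball_indic.
by case: (_ < _); rewrite ?normr0 ?normr1.
Qed.

Variables (lam kap : R).
Hypotheses (lam1 : 1 <= lam) (lamd : 2 <= lam * delta1) (lamH : 16 * (2 * H + 3) <= lam * lambda0)
  (kapl : 2 * lam <= kap) (kapQ : Q / lam <= kap).

Variables (N B s0 bbar eta r1 ths e1 err1 err2 err3 h tau : R) (m : nat) (Kf : R).
Hypotheses (N0 : 0 <= N) (s00 : 0 < s0) (bbar0 : 0 <= bbar) (eta0 : 0 < eta) (r10 : 0 < r1) (e10 : 0 < e1)
  (err20 : 0 <= err2) (err30 : 0 <= err3) (h0 : 0 < h).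
Hypothesis bB : forall x k, enorm x <= N + 5 -> enorm (b x k) <= B.
Hypothesis thsH : forall r, 0 < r -> r <= 2 * r1 -> r <= delta1 -> theta r <= ths.
Hypothesis ths0 : 0 <= ths.
Hypotheses (P1 : eta <= r1 / 2) (P3 : 2 * e1 <= r1) (P4 : 4 * e1 <= delta1) (P5 : e1 <= 1).
(** The numerical hypotheses of [frozen_couple] with [ev = 2 * e1] and with [D], [Db] twice the
    local drift bounds, bundled so that [scheme] can settle them together. *)
Definition small_params : Prop :=
  [/\ eta ^+ 2 <= lam * r1 ^+ 3 / 64,
  m%:R * tau ^+ 2 = lambda0 * h * d%:R,
  (H * (2 * e1) + 2 * e1 * (2 * B) + h * (2 * (B + #|J|%:R * (K%:R * Cn))) ^+ 2 / 2) / eta <= err1,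
  (8 / r1 ^+ 3 + lam / r1 ^+ 2) * (64 * lambda0 ^+ 2 * d%:R ^+ 2 * h) <= err2 &
  [/\ err1 + err2 <= 1, err3 + Q * (2 * e1) <= bbar &
  (s0^-1 + kap) * (2 * H * ths + err1) + Q * (r1 + 2 * e1) + (r1 + eta) / s0 ^+ 2 <= bbar]].
Hypothesis PP : small_params.
Hypothesis LB : forall (F : V -> R) x' E', elip Kf F -> (forall x, `|F x| <= 1) -> tight E' ->
  `|avgm m e_ tau F x' - avgm m E' tau F x'| <= h * err3.

Lemma lam_gt0 : 0 < lam. Proof. by apply: lt_le_trans lam1. Qed.

Definition Lam : R := h^-1 + d%:R * h^-1 + h^-1 + #|J|%:R * (2 * (K%:R * (K%:R * Cn))) + n.+1%:R * (2 * Qb).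
Variable delta : R.
Hypotheses (dl0 : 0 <= delta) (dlL : delta * Lam <= 1).

Local Notation G := (Gz eps0 b nu q sl E uu h tau m).

Lemma Cn0 : 0 <= Cn. Proof. exact: Cn_ge0 nuC. Qed.

Lemma Qb0 : 0 <= Qb. Proof. by have /andP[x y] := qB 0 ord0 ord0; apply: le_trans y. Qed.

Lemma rates_le y k y' : h^-1 + d%:R * h^-1 + h^-1 + \sum_(j : J) Num.max (pj y k j) (pj y' k j)
   + \sum_(l < n.+1) Num.max (qz y k l) (qz y' k l) <= Lam.
Proof.
have p x j : pj x k j <= K%:R * (K%:R * Cn) := pj_le nuC x k j cE.
have C0 := Cn0.
rewrite /Lam -!addrA !lerD2l; apply: lerD.
  apply: (@le_trans _ _ (\sum_(j : J) 2 * (K%:R * (K%:R * Cn)))); last by rewrite sumr_const [leRHS]mulr_natl.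
  apply: ler_sum => j _; have h1 := p y j; have h2 := p y' j; have h3 : 0 <= K%:R * (K%:R * Cn) by rewrite !mulr_ge0.
  by rewrite ge_max; apply/andP; split; lra.
apply: (@le_trans _ _ (\sum_(l < n.+1) 2 * Qb)); last by rewrite sumr_const card_ord [leRHS]mulr_natl.
apply: ler_sum => l _; have /andP[h1 h2] := qB y k l; have /andP[h3 h4] := qB y' k l.
by rewrite ge_max; apply/andP; split; lra.
Qed.

Lemma rate_le y k : @rate R d n J h (pj y k) (qz y k) <= Lam.
Proof.
have := rates_le y k y; apply: le_trans; rewrite /rate -!addrA !lerD2l lerD// ler_sum// => i _.
  by rewrite maxxx.
by rewrite maxxx.
Qed.

Lemma delta_rate y k : delta * @rate R d n J h (pj y k) (qz y k) <= 1.
Proof. by apply: le_trans dlL; rewrite ler_wpM2l// rate_le. Qed.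

Lemma pj0 x k j : 0 <= pj x k j. Proof. exact: pj_ge0. Qed.
Lemma qz0 x k l : 0 <= qz x k l. Proof. by have /andP[] := qB x k l. Qed.

Lemma G_range (f : I -> V -> R) y k x : (forall l y, 0 <= f l y <= 1) -> 0 <= f k x + delta * G y k f x <= 1.
Proof.
move=> fr; apply: Gop_range => //; [exact: pj0|exact: qz0|exact: delta_rate].
Qed.

(** The invariant of the recursion: [f] is tested under the first law and [g] under the second.
    Neither the constant [Kf] nor the radii [N + 1] and [N + 2] of the supports grow along the
    steps. *)
Definition cls (sg be : R) (f g : I -> V -> R) : Prop :=
  [/\ forall k x, 0 <= f k x <= 1, forall k x, 0 <= g k x <= 1, forall k, elip Kf (f k), forall k, elip Kf (g k) &
   [/\ forall k x, N + 1 < enorm x -> f k x = 0, forall k x, N + 2 < enorm x -> g k x = 0 &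
    forall k x x', f k x - g k x' <= Th lam eta (sg^-1 + kap) be (x - x')]].

Lemma Th_small c be w : 2 * lam <= c -> 0 <= be -> Th lam eta c be w < 1 -> lam * Rr eta w <= 1.
Proof.
move=> cl be0 T1; apply: (psi_small lam_gt0 cl (ltW (Rr_gt0 eta0 w))).
by apply: le_lt_trans T1; rewrite /Th lerDl.
Qed.

(** [frozen_couple] for the coefficients frozen at [y] and [y']; the conclusion is the hypothesis
    [FG] of the cost transform. *)
Lemma frozen_pair sg be f g : s0 <= sg -> 0 <= be -> cls sg be f g ->
  forall k x x' y y', enorm x <= N + 1 -> enorm (y - x) <= e1 -> enorm (y' - x') <= e1 ->
  f k x + delta * G y k f x - (g k x' + delta * G y' k g x') <=
  Num.min 1 (Th lam eta ((sg + delta)^-1 + kap) (be + delta * bbar) (x - x')).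
Proof.
move=> ssg be0 [f01 g01 fL gL [fs gs fg]] k x x' y y' xN yx yx'.
have /andP[F0 F1] := G_range y k x f01; have /andP[G0 G1] := G_range y' k x' g01.
(* If the new cost is at least 1, the range [0, 1] of both sides suffices; otherwise the positions
   are close. *)
set Phi := Th _ _ _ _ _; have [h1|Phi1] := leP 1 Phi.
  by have := F1; have := G0; lra.
have lamp := lam_gt0.
have sg0 : 0 < sg by apply: lt_le_trans ssg.
have cl : 2 * lam <= (sg + delta)^-1 + kap by rewrite (le_trans kapl)// lerDr invr_ge0 addr_ge0// ltW.
have be'0 : 0 <= be + delta * bbar by rewrite addr_ge0 ?mulr_ge0.
have Rl := Th_small cl be'0 Phi1.
have [yN y'N wv vd vr] := pair_geometry lam1 lamd P4 P3 P5 xN yx yx' Rl; pose v := y - y'.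
rewrite -/v in wv vd vr.
(* [theta] is controlled only at positive arguments; for [y = y'] all differences of coefficients
   vanish and 0 is used instead of [theta 0]. *)
pose th := if y == y' then 0 else theta (enorm v).
have vp : y != y' -> 0 < enorm v.
  move=> yy; rewrite lt_neqAle enorm_ge0 andbT eq_sym; apply/eqP => /enorm_eq0/eqP; rewrite subr_eq0.
  by rewrite (negPf yy).
have thp : 0 <= th by rewrite /th; case: eqP => // /eqP yy; exact: th0 (vp yy) vd.
have th1' : th <= 1 by rewrite /th; case: eqP => // /eqP yy; exact: th1 (vp yy) vd.
have thr : enorm (x - x') < r1 -> th <= ths.
  move=> wr; rewrite /th; case: eqP => // /eqP yy; exact: thsH (vp yy) (vr wr) vd.
pose tv := H / 2 * th.
have tv0 : 0 <= tv by rewrite /tv !mulr_ge0.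
have pd' : \sum_(j : J) `|pj y k j - pj y' k j| * enorm (uu j) <= tv.
  rewrite /tv /th; case: eqP => [->|/eqP yy]; last by apply: pj_diff; exact: SFt.
  by rewrite mulr0 big1// => j _; rewrite subrr normr0 mul0r.
have bE : bz y k - bz y' k = (b y k - b y' k) - (bj y k - bj y' k).
  by apply/rowP => i; rewrite !mxE; ring.
have bD : enorm (bz y k - bz y' k) <= 2 * (B + #|J|%:R * (K%:R * Cn)).
  have t1 u : enorm u <= N + 5 -> enorm (bz u k) <= B + #|J|%:R * (K%:R * Cn).
    by move=> uN; apply: le_trans (enorm_triB _ _) _; rewrite lerD ?bB// (bj_le nuC _ _ cE).
  by apply: le_trans (enorm_triB _ _) _; rewrite [leRHS]mulr_natl mulr2n lerD ?t1.
have bDb : enorm (b y k - b y' k) <= 2 * B.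
  by apply: le_trans (enorm_triB _ _) _; have := bB k yN; have := bB k y'N; lra.
have [P2 P6 P7 P8 [P9 P10 P11]] := PP.
apply: (@frozen_couple R d n d0 lam eta lamp eta0 J h tau m uu (bz y k) (bz y' k) (sz y k) (sz y' k) (pj y k) (pj y' k)
  (qz y k) (qz y' k) k f g x x' sg kap be bbar s0 delta H Q lambda0 r1 th ths tv (2 * e1)
  (2 * (B + #|J|%:R * (K%:R * Cn))) (2 * B) err1 err2 err3 v (b y k - b y' k) (bj y k - bj y' k)) => //.
- by rewrite mulr_ge0// ltW.
- by move=> E' tE; apply: LB => // t; rewrite ger0_norm; have /andP[] := g01 k t.
- by move=> k' l t t'; have /andP[_ u1] := f01 k' t; have /andP[u2 _] := g01 l t'; rewrite lerBlDr (le_trans u1)// lerDl.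
- exact: pj0.
- exact: pj0.
- exact: qz0.
- exact: qz0.
- by apply: le_trans dlL; rewrite ler_wpM2l// rates_le.
- exact: le_trans (bj_diff _ _ _) pd'.
- rewrite -hs2_rows /th; case: eqP => [yy|/eqP yy].
    rewrite /v yy !subrr inner0l !mulr0 mul0r add0r /hs2 big1// => i _; rewrite big1// => j _.
    by rewrite !mxE expr0n.
  by rewrite -[leRHS]mulrA [theta _ * _]mulrC mulrA; exact: SFb.
Qed.

Hypothesis KfE : s0^-1 + kap + 2 <= Kf.

(** The transforms inherit the Lipschitz constant of the cost, plus 2 from the cut-off, rather than
    that of [f] and [g]; hence [Kf] is stable. The cut-off confines the bound on [f'] to a ball,
    while the bound on [g'] holds everywhere, as the unlocalised second law requires. *)
Lemma class_step sg be f g : s0 <= sg -> 0 <= be -> cls sg be f g ->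
  exists f' g' : I -> V -> R, [/\ cls (sg + delta) (be + delta * bbar) f' g',
    forall k x y, enorm x <= N + 2^-1 -> enorm (y - x) <= e1 -> f k x + delta * G y k f x <= f' k x &
    forall k x y, enorm (y - x) <= e1 -> g' k x <= g k x + delta * G y k g x].
Proof.
move=> ssg be0 C; have [f01 g01 fL gL [fs gs fg]] := C.
set c' := (sg + delta)^-1 + kap; set be' := be + delta * bbar.
have lamp := lam_gt0.
have sg0 : 0 < sg by apply: lt_le_trans ssg.
have sgd : 0 < sg + delta by rewrite ltr_wpDr.
have kap0 : 0 <= kap by apply: le_trans kapl; rewrite mulr_ge0// ltW.
have c'0 : 0 <= c' by rewrite addr_ge0// invr_ge0 ltW.
have c'l : 2 * lam <= c' by rewrite (le_trans kapl)// lerDr invr_ge0 ltW.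
have be'0 : 0 <= be' by rewrite addr_ge0 ?mulr_ge0.
have cL : c' <= s0^-1 + kap.
  rewrite lerD2r lef_pV2 ?posrE//; apply: le_trans ssg _; by rewrite lerDl.
pose Psi w := Num.min 1 (Th lam eta c' be' w).
pose FF y x k := f k x + delta * G y k f x; pose GG y x k := g k x + delta * G y k g x.
have Psi01 w : 0 <= Psi w <= 1 by rewrite /Psi le_min ler01 ge_min lexx/= Th_ge0.
have PsiL : elip c' Psi.
  have H1 x y : Psi x <= Psi y + c' * enorm (x - y).
    have e0' : 0 <= c' * enorm (x - y) by rewrite mulr_ge0 ?enorm_ge0.
    have := Th_up lamp eta0 be' y (x - y) c'0; rewrite (addrC y) subrK => h1.
    rewrite -lerBlDr le_min !lerBlDr; apply/andP; split.
      by rewrite (le_trans (_ : _ <= 1))// ?ge_min ?lexx// lerDl.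
    by apply: le_trans h1; rewrite ge_min lexx orbT.
  move=> x y; rewrite ler_norml lerBlDl H1 andbT.
  by rewrite lerNl opprB lerBlDl enormB H1.
have Psi1 w : 1 <= enorm w -> Psi w = 1.
  move=> w1; rewrite /Psi min_l// leNgt; apply/negP => /(Th_small c'l be'0).
  apply/negP; rewrite -ltNge; apply: lt_le_trans (_ : Rr eta w <= _); last by rewrite ler_peMl// ltW// Rr_gt0.
  apply: le_lt_trans w1 _.
  by rewrite /Rr /enorm ltr_sqrt ?Rr_arg_gt0// ltrDl exprn_gt0.
have FF01 y x k : 0 <= FF y x k <= 1 by exact: G_range.
have GG01 y x k : 0 <= GG y x k <= 1 by exact: G_range.
have FG k x x' y y' : enorm x <= N + 1 -> enorm (y - x) <= e1 -> enorm (y' - x') <= e1 ->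
    FF y x k - GG y' x' k <= Psi (x - x').
  by move=> h1 h2 h3; exact: (frozen_pair ssg be0 C k h1 h2 h3).
exists (fh N e1 Psi FF), (gh N e1 Psi FF); split.
- split.
  + by move=> k x; exact: fh01.
  + by move=> k x; rewrite gh_ge0// gh_le1.
  + move=> k x y; have fe : elip (c' + 2) (fh N e1 Psi FF k) by apply: fh_elip.
    apply: le_trans (fe x y) _.
    rewrite ler_wpM2r ?enorm_ge0//; apply: le_trans KfE; by rewrite lerD2r.
  + move=> k x y; have ge : elip c' (gh N e1 Psi FF k) by apply: gh_elip.
    apply: le_trans (ge x y) _.
    rewrite ler_wpM2r ?enorm_ge0//; apply: le_trans KfE; apply: le_trans cL _; by rewrite lerDl.
  + split; [by move=> k x; exact: fh_supp|by move=> k x; exact: gh_supp|move=> k x x'].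
    have h1 : fh N e1 Psi FF k x - gh N e1 Psi FF k x' <= Psi (x - x') by apply: fgh.
    apply: le_trans h1 _.
    by rewrite /Psi ge_min lexx orbT.
- by move=> k x y xN yx; exact: fh_ge.
- by move=> k x y yx; exact: (@gh_le _ _ _ N e1 Psi FF GG).
Qed.

End coupling_setting.

(** * Choice of small parameters *)

Section small.
Context {R : realType}.

(** Each pair of the list is one smallness condition, a coefficient and its bound; most parameters
    of the scheme come from one such list. *)
Lemma exists_small (s : seq (R * R)) : all (fun p => 0 < p.2) s ->
  exists2 x : R, 0 < x <= 1 & forall p, p \in s -> p.1 * x <= p.2.
Proof.
elim: s => [|[c t] s IH] /=; first by exists 1 => //; rewrite ltr01 lexx.
move=> /andP[t0 sp]; have [x /andP[x0 x1] Hx] := IH sp.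
have c0 : 0 < `|c| + 1 by rewrite ltr_wpDl.
exists (Num.min x (t / (`|c| + 1))).
  by rewrite lt_min x0/= divr_gt0//= ge_min x1.
move=> p; rewrite in_cons => /orP[/eqP->/=|ps].
  apply: (@le_trans _ _ ((`|c| + 1) * (t / (`|c| + 1)))); last by rewrite mulrC divfK// gt_eqF.
  apply: (@le_trans _ _ ((`|c| + 1) * Num.min x (t / (`|c| + 1)))).
    by rewrite ler_wpM2r ?le_min ?(ltW x0) ?divr_ge0 ?(ltW t0) ?(ltW c0)// (le_trans (ler_norm _))// lerDl.
  by rewrite ler_wpM2l ?(ltW c0)// ge_min lexx orbT.
have [p0|p0] := leP 0 p.1.
  by apply: le_trans (Hx p ps); rewrite ler_wpM2l// ge_min lexx.
have m0 : 0 < Num.min x (t / (`|c| + 1)) by rewrite lt_min x0 divr_gt0.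
apply: (@le_trans _ _ 0); first by rewrite mulr_le0_ge0 ?ltW.
by rewrite ltW// (allP sp).
Qed.

Lemma sum_six_le (e A1 A2 A3 A4 A5 A6 : R) : 0 <= e -> A1 <= e / 16 -> A2 <= e / 16 -> A3 <= e / 16 -> A4 <= e / 16 -> A5 <= e / 16 -> A6 <= e / 16 ->
  A1 + (A2 + A3) + A4 + (A6 + A5) <= e / 2.
Proof.
by move=> h0 h1 h2 h3 h4 h5 h6; lra.
Qed.

Lemma err_half_le1 (u : R) : 2 * u <= 1 -> u + 1 / 2 <= 1.
Proof. by move=> h1; lra. Qed.

Lemma half_add_eighth_le (v u : R) : 0 <= v -> u <= v / 8 -> v / 2 + u <= v.
Proof. by move=> h0 h1; lra. Qed.

Lemma addr1_le5 (N : R) : N + 1 <= N + 5.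
Proof. by lra. Qed.
Lemma addr4_le5 (N : R) : N + 4 + 1 <= N + 5.
Proof. by lra. Qed.
Lemma addr_inv8_le_half (N : R) : N + 8^-1 <= N + 2^-1.
Proof. by lra. Qed.

Lemma enorm_le_tri (d : nat) (x p : 'rV[R]_d) (u v : R) : enorm p <= u -> enorm (x - p) <= v -> enorm x <= u + v.
Proof. by move=> h1 h2; have T := enorm_tri x p 0; rewrite !subr0 in T; lra. Qed.

Lemma enorm_half (d : nat) (x y p : 'rV[R]_d) (u v w : R) :
  enorm (y - p) <= u -> enorm (x - p) <= v -> 2 * u <= w -> 2 * v <= w -> enorm (y - x) <= w.
Proof. by move=> h1 h2 h3 h4; have T := enorm_tri y p x; rewrite (enormB p) in T; lra. Qed.

Lemma double_le_half (e A1 A2 : R) : A1 <= A2 -> 4 * A2 <= e -> 2 * A1 <= e / 2.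
Proof. by move=> h1 h2; lra. Qed.

Lemma eta_sqr_le (eta r1 lam : R) : 0 <= eta -> 0 <= r1 -> 0 <= lam -> 2 * eta <= r1 -> 64 * eta <= lam * r1 ^+ 2 -> eta ^+ 2 <= lam * r1 ^+ 3 / 64.
Proof.
move=> h0 r0 l0 h1 h2; rewrite ler_pdivlMr// expr2.
apply: (@le_trans _ _ (lam * r1 ^+ 2 * r1)); last by rewrite (exprSr r1 2) mulrA.
have -> : eta * eta * 64 = 64 * eta * eta by ring.
by apply: ler_pM => //; [rewrite mulr_ge0|lra].
Qed.

Lemma sum_five_eighths_le (bbar A1 A2 A3 A4 A5 : R) : 0 <= bbar -> A1 <= bbar / 8 -> A2 <= bbar / 8 -> A3 <= bbar / 8 -> A4 <= bbar / 8 ->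
   A5 <= bbar / 8 -> A1 + A2 + (A3 + A4) + A5 <= bbar.
Proof. by move=> h0 h1 h2 h3 h4 h5; lra. Qed.

End small.

(** * Construction of one step of the recursion *)

Section scheme.
Context {R : realType} {d n : nat}.
Hypothesis d0 : (0 < d)%N.
Local Notation V := 'rV[R]_d.
Local Notation I := 'I_n.+1.
Local Notation Ig mu D f := (Rintegral mu D f).
Implicit Types (x y p w v : V) (k l : I) (f g : I -> V -> R).
Variables (eps0 : R) (a : V -> I -> 'M[R]_d) (b : V -> I -> V) (nu : V -> I -> {measure set Rd R d -> \bar R})
  (q : V -> I -> I -> R) (sl : V -> I -> 'M[R]_d) (lambda0 Cn Qb Q H delta1 : R) (theta : R -> R).
Hypotheses (e0 : 0 < eps0) (l0 : 0 < lambda0).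
Hypothesis nuC : forall x k, (\int[nu x k]_(u in @Rd0 R d) (mm u)%:E <= Cn%:E)%E.
Hypothesis slT : forall x k, (sl x k)^T = sl x k.
Hypothesis sls : forall x k, sl x k *m sl x k = a x k - lambda0%:M.
Hypothesis bB : forall N, exists B, forall x k, enorm x <= N -> enorm (b x k) <= B.
Hypothesis sB : forall N, exists B, forall x k, enorm x <= N -> forall i, enorm (row i (sl x k)) <= B.
Hypothesis tB : forall N e, 0 < e -> exists K0, forall K, (K0 <= K)%N -> forall x k, enorm x <= N ->
  Ig (nu x k) (tail K) (@mm R d) <= e.
Hypothesis qB : forall x k l, 0 <= qz q x k l <= Qb.
Hypotheses (H0 : 0 <= H) (Q0 : 0 <= Q) (delta10 : 0 < delta1).
Hypothesis th0 : forall r, 0 < r -> r <= delta1 -> 0 <= theta r.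
Hypothesis th1 : forall r, 0 < r -> r <= delta1 -> theta r <= 1.
Hypothesis thlim : forall t, 0 < t -> exists2 r1, 0 < r1 & forall r, 0 < r -> r <= r1 -> r <= delta1 -> theta r <= t.
Hypothesis SFb : forall k x z, enorm (x - z) <= delta1 ->
  2 * inner (x - z) (b x k - b z k) + hs2 (sl x k - sl z k) <= 2 * H * enorm (x - z) * theta (enorm (x - z)).
Hypothesis SFt : forall k x z, enorm (x - z) <= delta1 ->
  (tv_integral (@enorm R d) (nu x k) (nu z k) (@Rd0 R d) <= (H / 2 * theta (enorm (x - z)))%:E)%E.
Hypothesis F2 : forall k x z, \sum_(l < n.+1) `|qz q x k l - qz q z k l| <= Q * enorm (x - z).
Variables (lam kap : R).
Hypotheses (lam1 : 1 <= lam) (lamd : 2 <= lam * delta1) (lamH : 16 * (2 * H + 3) <= lam * lambda0)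
  (kapl : 2 * lam <= kap) (kapQ : Q / lam <= kap).
Local Notation AA f := (Aop eps0 a b nu q (fun x l => f l x)).

(** The mollification scale [sg] is fixed first, because the derivative constant [C] depends on it;
    then [tau] is taken so small that the Lindeberg error is at most half of [h * bb]. *)
Lemma walk_params Kf h bb t0 : 0 < Kf -> 0 < h -> 0 < bb -> 0 < t0 -> exists (tau : R) (m : nat),
  [/\ 0 <= tau, tau <= t0, m%:R * tau ^+ 2 = lambda0 * h * d%:R &
    forall (F : V -> R) x' (E' : 'I_d -> V), elip Kf F -> (forall x, `|F x| <= 1) -> tight E' ->
    `|avgm m (@evec R d) tau F x' - avgm m E' tau F x'| <= h * bb].
Proof.
move=> Kf0 h0 bb0 t00.
have [sg /andP[sg0 _] Hsg] := exists_small (s := [:: (2 * Kf * d%:R, h * bb / 2)]) ltac:(by rewrite /= divr_gt0// mulr_gt0).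
have sga : 2 * Kf * d%:R * sg <= h * bb / 2 by apply: (Hsg (_, _)); rewrite !inE eqxx.
have [C HC] := @Sm_reg R d sg sg0.
have C0 : 0 <= C by case: (HC 0 (fun=> 0) (elip_cst 0)) => // x; rewrite normr0.
have [tau0 /andP[tau00 _] Htau] := exists_small (s := [:: (2 * C * d%:R ^+ 4 * lambda0, bb / 2); (1, t0)])
  ltac:(by rewrite /= !divr_gt0// t00).
have tau0a : 2 * C * d%:R ^+ 4 * lambda0 * tau0 <= bb / 2 by apply: (Htau (_, _)); rewrite !inE eqxx.
have tau0b : 1 * tau0 <= t0 by apply: (Htau (_, _)); rewrite !inE eqxx ?orbT.
have dp : 0 < d%:R :> R by rewrite ltr0n.
pose X := lambda0 * h * d%:R.
have X0 : 0 < X by rewrite !mulr_gt0.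
(* Enough steps to force [tau <= tau0]; [tau] is then defined by the exact total variance [X]. *)
pose m := (Num.truncn (X / tau0 ^+ 2)).+1.
have m0 : 0 < m%:R :> R by rewrite ltr0n.
have mX : X / m%:R <= tau0 ^+ 2.
  have t2 : 0 < tau0 ^+ 2 by rewrite exprn_gt0.
  by rewrite ler_pdivrMr// mulrC -ler_pdivrMr//; apply: ltW; apply: truncnS_gt.
pose tau := Num.sqrt (X / m%:R).
have tau_0 : 0 <= tau by exact: sqrtr_ge0.
have mtau : m%:R * tau ^+ 2 = lambda0 * h * d%:R.
  by rewrite /tau sqr_sqrtr ?divr_ge0 ?(ltW X0) ?(ltW m0)// mulrC divfK// gt_eqF.
have tautau : tau <= tau0.
  by rewrite /tau -[leRHS](gtr0_norm tau00) -sqrtr_sqr ler_wsqrtr.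
exists tau, m; split => //; first by rewrite (le_trans tautau)// -[leLHS]mul1r.
move=> F x' E' FK F1 tE.
apply: le_trans (avgm_lindeberg d0 sg0 HC m x' (ltW Kf0) FK F1 (@tight_evec R d) tE tau_0) _.
have -> : m%:R * (2 * (C * (d%:R * tau) ^+ 3)) = h * (2 * C * d%:R ^+ 4 * lambda0 * tau).
  have -> : m%:R * (2 * (C * (d%:R * tau) ^+ 3)) = 2 * C * d%:R ^+ 3 * tau * (m%:R * tau ^+ 2) by ring.
  rewrite mtau; ring.
have h1 : h * (2 * C * d%:R ^+ 4 * lambda0 * tau) <= h * (bb / 2).
  rewrite ler_wpM2l ?(ltW h0)//; apply: le_trans tau0a; rewrite ler_wpM2l//.
  by apply: mulr_ge0 (ltW l0); rewrite mulr_ge0 ?exprn_ge0 ?mulr_ge0.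
have h2 : 2 * (Kf * (sg * d%:R)) <= h * (bb / 2).
  have -> : 2 * (Kf * (sg * d%:R)) = 2 * Kf * d%:R * sg by ring.
  by rewrite mulrA.
have -> : h * bb = h * (bb / 2) + h * (bb / 2) by field.
exact: lerD.
Qed.

(** The difference quotient at [p] is exactly the generator frozen at [y] applied to the mollified
    function at [p]. Moving the evaluation point from [p] to [y] is paid by [Gop_lip], which is what
    limits [zeta]. *)
Lemma smoothed_generator (J : finType) (E : J -> set (Rd R d)) (uu : J -> V) (K : nat) (z : R) (cE : cells eps0 E uu K z)
  h tau m eps zeta e Kf Na C delta (F : I -> V -> R) p y k :
  0 < h -> 0 < eps -> 0 <= Kf -> 0 < delta ->
  (forall l, elip Kf (F l)) ->
  (forall l, reg C (Sm eps (F l))) ->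
  (forall (f : I -> V -> R) y k, (forall l, reg C (f l)) -> enorm y <= Na ->
     `|AA f y k - Gz eps0 b nu q sl E uu h tau m y k f y| <= e / 2) ->
  4 * @Lam R d n Cn Qb J K h * Kf * zeta <= e -> enorm y <= Na -> enorm (y - p) <= zeta ->
  `|AA (fun l => Sm eps (F l)) y k -
    (Sm eps (fun x => F k x + delta * Gz eps0 b nu q sl E uu h tau m y k F x) p - Sm eps (F k) p) / delta| <= e.
Proof.
move=> h0 ep0 Kf0 dl0 FL FR GA ze yN yp.
have q0 l : 0 <= qz q y k l by have /andP[] := qB y k l.
have p0 j : 0 <= pj nu E uu y k j by exact: pj_ge0.
have lF l : lip (F l) by exists Kf.
rewrite SmD'//; last by apply: lipZ; exact: lip_Gop.
rewrite SmZ'//; last exact: lip_Gop.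
have E3 (A B : R) : (A + delta * B - A) / delta = B by field; rewrite gt_eqF.
rewrite E3.
rewrite /Gz Sm_Gop// -/(Gz _ _ _ _ _ _ _ _ _ _ _ _ _ _).
have X1 := GA (fun l => Sm eps (F l)) y k FR yN.
have SL l : elip Kf (Sm eps (F l)) by exact: Sm_elip.
have X2 := Gop_lip d0 tau m uu (bz eps0 b nu E uu y k) (sz sl y k) k h0 p0 q0 y p Kf0 SL.
rewrite -/(Gz _ _ _ _ _ _ _ _ _ _ _ _ _ _) in X2.
have X3 : 2 * rate h (d := d) (pj nu E uu y k) (qz q y k) * (Kf * enorm (y - p)) <= e / 2.
  have L0 := rate_ge0 (d := d) h0 p0 q0.
  have L1 := rate_le nuC qB cE h y k.
  have t1 : rate h (d := d) (pj nu E uu y k) (qz q y k) * (Kf * enorm (y - p)) <= @Lam R d n Cn Qb J K h * (Kf * zeta).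
    by apply: ler_pM => //; rewrite ?mulr_ge0 ?enorm_ge0// ler_wpM2l.
  have t2 : 4 * (@Lam R d n Cn Qb J K h * (Kf * zeta)) <= e by rewrite !mulrA.
  rewrite -mulrA; exact: double_le_half t1 t2.
by move: X1 X2 X3; rewrite !ler_norml /Gz => /andP[u1 u2] /andP[u3 u4] u5; apply/andP; split; lra.
Qed.

Lemma scheme (N s0 bbar etabar e : R) : 0 <= N -> 0 < s0 -> 0 < bbar -> 0 < etabar -> 0 < e ->
  let Kf := s0^-1 + kap + 2 in
  exists eta eps zeta C delta0 : R, [/\ [/\ 0 < eta, eta <= etabar & 0 < eps],
   [/\ 8 * (eps * d%:R) <= 1, Kf * (eps * d%:R) <= e, 0 < zeta & 0 < delta0],
   forall K (F : V -> R), elip K F -> (forall x, `|F x| <= 1) -> reg C (Sm eps F) &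
   forall delta sg be f g, 0 < delta -> delta <= delta0 -> s0 <= sg -> 0 <= be -> cls lam kap N eta Kf sg be f g ->
   exists f' g' : I -> V -> R, [/\ cls lam kap N eta Kf (sg + delta) (be + delta * bbar) f' g',
     forall p y k, enorm p <= N -> enorm (y - p) <= zeta ->
       AA (fun l => Sm eps (f l)) y k <= (Sm eps (f' k) p - Sm eps (f k) p) / delta + e &
     forall p y k, enorm p <= N + 4 -> enorm (y - p) <= zeta ->
       (Sm eps (g' k) p - Sm eps (g k) p) / delta - e <= AA (fun l => Sm eps (g l)) y k]].
Proof.
move=> N0 s00 bb0 eb0 ep0 Kf.
have lamp : 0 < lam by apply: lt_le_trans lam1.
have kap0 : 0 < kap by apply: lt_le_trans kapl; rewrite mulr_gt0.
pose cm := s0^-1 + kap.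
have cm0 : 0 < cm by rewrite addr_gt0 ?invr_gt0.
have Kf0 : 0 < Kf by rewrite /Kf addr_gt0.
(* Each parameter depends only on earlier ones: [ths] and [r1] handle the diagonal, [eta] smooths
   the cost, [e1] limits the distance of frozen points, [eps] fixes the test functions and [C]; then
   come the cells, [h], the walk and [zeta]. *)
have [ths /andP[ths0 _] Hths] := exists_small (s := [:: (cm * (2 * H), bbar / 8)]) ltac:(by rewrite /= divr_gt0).
have T1 := Hths _ (mem_head _ _); rewrite /= in T1.
have [rth rth0 Hrth] := thlim ths0.
have [r1 /andP[r10 _] Hr1] := exists_small (s := [:: (2, rth); (Q, bbar / 8); (2 / s0 ^+ 2, bbar / 8)])
  ltac:(by rewrite /= rth0 divr_gt0).
have r1a : 2 * r1 <= rth by apply: (Hr1 (_, _)); rewrite !inE eqxx.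
have r1b : Q * r1 <= bbar / 8 by apply: (Hr1 (_, _)); rewrite !inE eqxx ?orbT.
have r1c : 2 / s0 ^+ 2 * r1 <= bbar / 8 by apply: (Hr1 (_, _)); rewrite !inE eqxx ?orbT.
have [eta /andP[eta0 _] Heta] := exists_small (s := [:: (1, etabar); (2, r1); (64, lam * r1 ^+ 2)])
  ltac:(by rewrite /= eb0 r10 mulr_gt0 ?exprn_gt0).
have eta1 : 1 * eta <= etabar by apply: (Heta (_, _)); rewrite !inE eqxx.
have eta2 : 2 * eta <= r1 by apply: (Heta (_, _)); rewrite !inE eqxx ?orbT.
have eta3 : 64 * eta <= lam * r1 ^+ 2 by apply: (Heta (_, _)); rewrite !inE eqxx ?orbT.
rewrite mul1r in eta1.
have [err1 /andP[err10 _] Herr1] := exists_small (s := [:: (cm, bbar / 8); (2, 1)]) ltac:(by rewrite /= divr_gt0 ?ltr01).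
have err1a : cm * err1 <= bbar / 8 by apply: (Herr1 (_, _)); rewrite !inE eqxx.
have err1b : 2 * err1 <= 1 by apply: (Herr1 (_, _)); rewrite !inE eqxx ?orbT.
have [B HB] := bB (N + 5); have [S HS] := sB (N + 5).
have B0 : 0 <= B by apply: le_trans (HB 0 ord0 _); rewrite ?enorm_ge0// enorm0 addr_ge0.
pose SS := `|S|.
have SS0 : 0 <= SS by rewrite /SS normr_ge0.
have HSS y k : enorm y <= N + 5 -> forall i, enorm (row i (sl y k)) <= SS.
  by move=> yN i; apply: le_trans (HS y k yN i) _; exact: ler_norm.
have [e1 /andP[e10 e11] He1] := exists_small (s := [:: (2, r1); (4, delta1); (Q * 2, bbar / 8); ((H * 2 + 2 * (2 * B)) / eta, err1 / 2)])
  ltac:(by rewrite /= r10 delta10 !divr_gt0).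
have e1a : 2 * e1 <= r1 by apply: (He1 (_, _)); rewrite !inE eqxx.
have e1b : 4 * e1 <= delta1 by apply: (He1 (_, _)); rewrite !inE eqxx ?orbT.
have e1c : Q * 2 * e1 <= bbar / 8 by apply: (He1 (_, _)); rewrite !inE eqxx ?orbT.
have e1d : (H * 2 + 2 * (2 * B)) / eta * e1 <= err1 / 2 by apply: (He1 (_, _)); rewrite !inE eqxx ?orbT.
have [eps /andP[eps00 _] Heps] := exists_small (s := [:: (2 * d%:R, e1); (8 * d%:R, 1); (Kf * d%:R, e)])
  ltac:(by rewrite /= e10 ltr01 ep0).
have epsa : 2 * d%:R * eps <= e1 by apply: (Heps (_, _)); rewrite !inE eqxx.
have epsb : 8 * d%:R * eps <= 1 by apply: (Heps (_, _)); rewrite !inE eqxx ?orbT.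
have epsc : Kf * d%:R * eps <= e by apply: (Heps (_, _)); rewrite !inE eqxx ?orbT.
have [C HC] := @Sm_reg R d eps eps00.
have C0 : 0 <= C by case: (HC 0 (fun=> 0) (elip_cst 0)) => // x; rewrite normr0.
have Cj0 := @Cj_ge0 R d eps0 C C0.
have Cn0 := Cn_ge0 nuC.
have [t /andP[t0 _] Ht] := exists_small (s := [:: (Cj eps0 (d := d) C, e / 16)]) ltac:(by rewrite /= divr_gt0).
have ta : Cj eps0 (d := d) C * t <= e / 16 by apply: (Ht (_, _)); rewrite !inE eqxx.
have [K HK] := tB (N + 5) t0.
have [z /andP[z0 _] Hz] := exists_small (s := [:: (4 * (d%:R * C) * K%:R * K%:R * Cn, e / 16)]) ltac:(by rewrite /= divr_gt0).
have za : 4 * (d%:R * C) * K%:R * K%:R * Cn * z <= e / 16 by apply: (Hz (_, _)); rewrite !inE eqxx.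
have [J [E [uu cE]]] := @cells_exist R d eps0 K z z0.
pose BB := B + #|J|%:R * (K%:R * Cn).
pose c8 := (8 / r1 ^+ 3 + lam / r1 ^+ 2) * (64 * lambda0 ^+ 2 * d%:R ^+ 2).
have [s /andP[sp s1] Hs] := exists_small (s := [:: ((2 * BB) ^+ 2 / 2 / eta, err1 / 2); (c8, 1 / 2);
    (C * d%:R ^+ 4 * SS ^+ 3, e / 16); (C * d%:R ^+ 5 * lambda0 ^+ 2, e / 16); (C * d%:R ^+ 2 * BB ^+ 2, e / 16)])
  ltac:(by rewrite /= !divr_gt0).
have sa : (2 * BB) ^+ 2 / 2 / eta * s <= err1 / 2 by apply: (Hs (_, _)); rewrite !inE eqxx.
have sb : c8 * s <= 1 / 2 by apply: (Hs (_, _)); rewrite !inE eqxx ?orbT.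
have sc : C * d%:R ^+ 4 * SS ^+ 3 * s <= e / 16 by apply: (Hs (_, _)); rewrite !inE eqxx ?orbT.
have sd : C * d%:R ^+ 5 * lambda0 ^+ 2 * s <= e / 16 by apply: (Hs (_, _)); rewrite !inE eqxx ?orbT.
have se : C * d%:R ^+ 2 * BB ^+ 2 * s <= e / 16 by apply: (Hs (_, _)); rewrite !inE eqxx ?orbT.
(* A square, so that the diffusion error of order [sqrt h] is linear in [s]. *)
pose h := s ^+ 2.
have h0 : 0 < h by rewrite exprn_gt0.
have hs : h <= s by rewrite /h expr2 ler_piMr// ltW.
have sqh : Num.sqrt h = s by rewrite sqrtr_sqr gtr0_norm.
have [tau0 /andP[tau00 _] Htau] := exists_small (s := [:: (C * d%:R ^+ 4 * lambda0, e / 16)]) ltac:(by rewrite /= !divr_gt0).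
have tau0b : C * d%:R ^+ 4 * lambda0 * tau0 <= e / 16 by apply: (Htau (_, _)); rewrite !inE eqxx ?orbT.
have [tau [m [tau_0 tautau mtau LB]]] := walk_params Kf0 h0 (ltac:(by rewrite divr_gt0) : 0 < bbar / 2) tau00.
have GA (f : I -> V -> R) y k : (forall l, reg C (f l)) -> enorm y <= N + 5 ->
     `|AA f y k - Gz eps0 b nu q sl E uu h tau m y k f y| <= e / 2.
  move=> fC yN.
  apply: le_trans (gen_approx d0 q e0 l0 nuC slT sls cE (ltW z0) h0 tau_0 mtau fC yN (HB y k yN) SS0 (HSS y k yN) (HK K (leqnn K) y k yN)) _.
  rewrite sqh -/BB.
  have g1 : C * d%:R ^+ 4 * s * SS ^+ 3 <= e / 16 by rewrite mulrAC.
  have g2 : C * d%:R ^+ 4 * lambda0 * tau <= e / 16.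
    by apply: le_trans tau0b; rewrite ler_wpM2l// !mulr_ge0 ?exprn_ge0// ltW.
  have g3 : C * d%:R ^+ 5 * lambda0 ^+ 2 * h <= e / 16.
    by apply: le_trans sd; rewrite ler_wpM2l// mulr_ge0 ?sqr_ge0// mulr_ge0 ?exprn_ge0.
  have g4 : C * d%:R ^+ 2 * h * BB ^+ 2 <= e / 16.
    by rewrite mulrAC; apply: le_trans se; rewrite ler_wpM2l// mulr_ge0 ?sqr_ge0// mulr_ge0 ?exprn_ge0.
  have g5 : 4 * (d%:R * C) * z * K%:R * K%:R * Cn <= e / 16.
    have -> : 4 * (d%:R * C) * z * K%:R * K%:R * Cn = 4 * (d%:R * C) * K%:R * K%:R * Cn * z by ring.
    exact: za.
  move: g1 g2 g3 g4 g5 ta; set A1 := _ * SS ^+ 3; set A2 := _ * tau; set A3 := _ * h; set A4 := _ * BB ^+ 2; set A5 := _ * Cn; set A6 := _ * t.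
  by apply: sum_six_le; rewrite ltW.
set LL := @Lam R d n Cn Qb J K h.
have LL0 : 0 < LL.
  have hi : 0 < h^-1 by rewrite invr_gt0.
  have Qb0 := Qb0 qB; rewrite /LL /Lam.
  by rewrite -!addrA ltr_pwDl// !addr_ge0 ?mulr_ge0 ?(ltW hi).
have [zeta /andP[ze0 ze1] Hze] := exists_small (s := [:: (2, e1); (4 * LL * Kf, e)]) ltac:(by rewrite /= e10 ep0).
have zea : 2 * zeta <= e1 by apply: (Hze (_, _)); rewrite !inE eqxx.
have zeb : 4 * LL * Kf * zeta <= e by apply: (Hze (_, _)); rewrite !inE eqxx ?orbT.
have PP : @small_params R d lambda0 Cn Q H J K lam kap B s0 bbar eta r1 ths e1 err1 (1 / 2) (bbar / 2) h tau m.
  split => //.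
  - exact: eta_sqr_le (ltW eta0) (ltW r10) (ltW lamp) eta2 eta3.
  - have -> : (H * (2 * e1) + 2 * e1 * (2 * B) + h * (2 * (B + #|J|%:R * (K%:R * Cn))) ^+ 2 / 2) / eta =
      (H * 2 + 2 * (2 * B)) / eta * e1 + (2 * BB) ^+ 2 / 2 / eta * h by rewrite /BB; field; rewrite gt_eqF.
    have -> : err1 = err1 / 2 + err1 / 2 by field.
    apply: lerD => //; apply: le_trans sa; rewrite ler_wpM2l//.
    by apply: divr_ge0 (ltW eta0); apply: divr_ge0 => //; exact: sqr_ge0.
  - rewrite mulrA; apply: le_trans sb; rewrite ler_wpM2l//.
    apply: mulr_ge0; last by apply: mulr_ge0; rewrite ?sqr_ge0// mulr_ge0 ?sqr_ge0.
    by apply: addr_ge0; apply: divr_ge0; rewrite ?exprn_ge0 ?(ltW r10) ?(ltW lamp).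
  - have Qe : Q * (2 * e1) <= bbar / 8 by rewrite mulrA.
    split.
    + exact: err_half_le1.
    + exact: half_add_eighth_le (ltW bb0) Qe.
    + rewrite !mulrDr; apply: sum_five_eighths_le (ltW bb0) _ err1a r1b Qe _; first by rewrite mulrA.
      apply: le_trans r1c; rewrite [leRHS]mulrAC ler_wpM2r ?invr_ge0 ?sqr_ge0//.
      by rewrite mulr_natl mulr2n lerD2l -(ler_pM2l (ltr0n R 2 : (0 < 2 :> R))) (le_trans eta2)// ler_peMl ?(ltW r10)// ler1n.
(* With [delta <= LL^-1], a time step is an average over jumps. *)
exists eta, eps, zeta, C, LL^-1; split => //.
  split => //; last by rewrite invr_gt0.
    have -> : 8 * (eps * d%:R) = 8 * d%:R * eps by ring.
    exact: epsb.
  have -> : Kf * (eps * d%:R) = Kf * d%:R * eps by ring.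
  exact: epsc.
move=> delta sg be f g dl0 dlL ssg be0 fgC.
have dlLL : delta * LL <= 1 by rewrite -ler_pdivlMr// div1r.
have thsH r : 0 < r -> r <= 2 * r1 -> r <= delta1 -> theta r <= ths.
  by move=> r0 rr; apply: Hrth => //; rewrite (le_trans rr).
have P1 : eta <= r1 / 2 by rewrite ler_pdivlMr// mulrC.
have err20 : 0 <= 1 / 2 :> R by rewrite divr_ge0.
have err30 : 0 <= bbar / 2 by rewrite divr_ge0// ltW.
have [f' [g' [C1 Cf Cg]]] := class_step d0 nuC qB H0 Q0 th0 th1 SFb SFt F2 cE lam1 lamd lamH kapl kapQ s00 (ltW bb0)
  eta0 r10 e10 err20 err30 h0 HB thsH (ltW ths0) P1 e1a e1b e11 PP LB
  (ltW dl0) dlLL (lexx Kf) ssg be0 fgC.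
have [f01 g01 fL gL [fs gs fg]] := fgC.
have [f'01 g'01 f'L g'L _] := C1.
have n1 (F : V -> R) : (forall x, 0 <= F x <= 1) -> forall x, `|F x| <= 1.
  by move=> H1 x; have /andP[u1 u2] := H1 x; rewrite ger0_norm.
have d8 : eps * d%:R <= 8^-1.
  have t1 : 8 * (eps * d%:R) = 8 * d%:R * eps by ring.
  rewrite -[leRHS]div1r ler_pdivlMr// mulrC t1; exact: epsb.
have dle1 : 2 * (eps * d%:R) <= e1.
  have -> : 2 * (eps * d%:R) = 2 * d%:R * eps by ring.
  exact: epsa.
exists f', g'; split => // p y k pN yp.
- have yN : enorm y <= N + 5.
    by apply: le_trans (enorm_le_tri pN (le_trans yp ze1)) _; exact: addr1_le5.
  have X := smoothed_generator cE k h0 eps00 (ltW Kf0) dl0 fL (fun l => HC _ _ (fL l) (n1 _ (f01 l))) GA zeb yN yp.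
  rewrite ler_norml in X; have {X} /andP[_ X] := X; rewrite lerBlDl in X; apply: le_trans X _.
  rewrite lerD2r ler_pM2r ?invr_gt0// lerD2r.
  have [KG HG] : lip (fun x => f k x + delta * Gz eps0 b nu q sl E uu h tau m y k f x).
    apply: lipD; first by exists Kf.
    by apply: lipZ; apply: lip_Gop => // l; exists Kf.
  apply: (Sm_le eps00 HG (f'L k)) => x xp; apply: Cf.
    by apply: le_trans (enorm_le_tri pN (le_trans xp d8)) _; exact: addr_inv8_le_half.
  exact: enorm_half yp xp zea dle1.
- have yN : enorm y <= N + 5.
    by apply: le_trans (enorm_le_tri pN (le_trans yp ze1)) _; exact: addr4_le5.
  have X := smoothed_generator cE k h0 eps00 (ltW Kf0) dl0 gL (fun l => HC _ _ (gL l) (n1 _ (g01 l))) GA zeb yN yp.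
  rewrite ler_norml in X; have {X} /andP[X _] := X; rewrite lerBrDr in X; apply: le_trans X.
  rewrite [leRHS]addrC lerD2r ler_pM2r ?invr_gt0// lerD2r.
  have [KG HG] : lip (fun x => g k x + delta * Gz eps0 b nu q sl E uu h tau m y k g x).
    apply: lipD; first by exists Kf.
    by apply: lipZ; apply: lip_Gop => // l; exists Kf.
  apply: (Sm_le eps00 (g'L k) HG) => x xp; apply: Cg.
  exact: enorm_half yp xp zea dle1.
Qed.

End scheme.

(** * Measurability of the paths *)

Section bounded_measurable.
Context {R : realType} {dT : measure_display} {T : measurableType dT}.
Variable P : probability T R.
Local Notation Ex F := (Rintegral P setT F).
Implicit Types (F G : T -> R).

Definition bmeas F := measurable_fun setT F /\ exists M : R, forall w, `|F w| <= M.

Lemma bmeas_int F : bmeas F -> P.-integrable setT (EFin \o F).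
Proof.
move=> [mF [M HM]]; apply: measurable_bounded_integrable => //; first by rewrite (le_lt_trans (probability_le1 P measurableT))// ltry.
by exists M; split=> [|N MN w _ /=]; [exact: num_real|exact: le_trans (HM w) (ltW MN)].
Qed.

Lemma bmeas_cst (c : R) : bmeas (fun=> c).
Proof. by split; [exact: measurable_cst|exists `|c|]. Qed.

Lemma bmeasD F G : bmeas F -> bmeas G -> bmeas (fun w => F w + G w).
Proof.
move=> [mF [M HM]] [mG [N HN]]; split; first exact: measurable_funD.
by exists (M + N) => w; rewrite (le_trans (ler_normD _ _))// lerD.
Qed.

Lemma bmeasM F G : bmeas F -> bmeas G -> bmeas (fun w => F w * G w).
Proof.
move=> [mF [M HM]] [mG [N HN]]; split; first exact: measurable_funM.
by exists (M * N) => w; rewrite normrM ler_pM.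
Qed.

Lemma bmeasZ (c : R) F : bmeas F -> bmeas (fun w => c * F w).
Proof. by move=> bF; apply: bmeasM => //; exact: bmeas_cst. Qed.

Lemma bmeasB F G : bmeas F -> bmeas G -> bmeas (fun w => F w - G w).
Proof.
move=> bF bG; rewrite (_ : (fun w => _) = fun w => F w + (-1) * G w); last by apply/funext => w; rewrite mulN1r.
by apply: bmeasD => //; exact: bmeasZ.
Qed.

Lemma bmeas_indic (A : set T) : measurable A -> bmeas (\1_A).
Proof.
move=> mA; split; first exact: measurable_indic.
by exists 1 => w; rewrite indicE; case: (_ \in _); rewrite ?normr1 ?normr0.
Qed.

Lemma Ex_cst (c : R) : Ex (fun=> c) = c.
Proof. rewrite Rintegral_cst// -[RHS]mulr1; congr (_ * _); rewrite -[RHS]/(fine 1%E); congr fine; exact: (@probability_setT _ _ _ P). Qed.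

Lemma ExD F G : bmeas F -> bmeas G -> Ex (fun w => F w + G w) = Ex F + Ex G.
Proof. by move=> bF bG; rewrite RintegralD//; exact: bmeas_int. Qed.

Lemma ExB F G : bmeas F -> bmeas G -> Ex (fun w => F w - G w) = Ex F - Ex G.
Proof. by move=> bF bG; rewrite RintegralB//; exact: bmeas_int. Qed.

Lemma ExZ (c : R) F : bmeas F -> Ex (fun w => c * F w) = c * Ex F.
Proof. by move=> bF; rewrite RintegralZl//; exact: bmeas_int. Qed.

Lemma Ex_sum (J : finType) (F : J -> T -> R) : (forall j, bmeas (F j)) -> Ex (fun w => \sum_j F j w) = \sum_j Ex (F j).
Proof. by move=> bF; rewrite Rintegral_sum// => j; exact: bmeas_int. Qed.

Lemma Ex_le F G : bmeas F -> bmeas G -> (forall w, F w <= G w) -> Ex F <= Ex G.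
Proof. by move=> bF bG FG; apply: le_Rintegral => //; exact: bmeas_int. Qed.

Lemma Ex_abs F (M : R) : bmeas F -> (forall w, `|F w| <= M) -> `|Ex F| <= M.
Proof.
move=> bF FM; rewrite ler_norml; apply/andP; split.
  by rewrite -(Ex_cst (- M)); apply: Ex_le => // [|w]; [exact: bmeas_cst|have := FM w; rewrite ler_norml => /andP[]].
by rewrite -[leRHS]Ex_cst; apply: Ex_le => // [|w]; [exact: bmeas_cst|have := FM w; rewrite ler_norml => /andP[]].
Qed.

Lemma Ex_indic (A : set T) F : Ex (fun w => \1_A w * F w) = Rintegral P A F.
Proof.
rewrite -(Rintegral_mul_indic P F (@subsetT _ A)); apply: eq_Rintegral => w _; exact: mulrC.
Qed.

End bounded_measurable.

Section distance_to_set.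
Context {R : realType} {d : nat}.
Local Notation V := 'rV[R]_d.
Implicit Types (B : set V) (x y : V).

Definition dst B x : R := inf [set enorm (x - y) | y in B].

Lemma dst_lb B x y : B y -> dst B x <= enorm (x - y).
Proof.
by move=> By; apply: ge_inf; [exists 0 => _ [z _ <-]; exact: enorm_ge0|exists y].
Qed.

Lemma dst_ge0 B x : 0 <= dst B x.
Proof.
have [->|/set0P[y By]] := eqVneq B set0; first by rewrite /dst image_set0 inf0.
by apply: lb_le_inf; [exists (enorm (x - y)); exists y|move=> _ [z _ <-]; exact: enorm_ge0].
Qed.

Lemma dst_in B x : B x -> dst B x = 0.
Proof.
by move=> Bx; apply/eqP; rewrite eq_le dst_ge0 andbT; apply: le_trans (dst_lb x Bx) _; rewrite subrr enorm0.
Qed.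

Lemma dst_elip B : B !=set0 -> elip 1 (dst B).
Proof.
move=> [b Bb]; have H1 x y : dst B x <= dst B y + 1 * enorm (x - y).
  rewrite mul1r -lerBlDr; apply: lb_le_inf; first by exists (enorm (y - b)); exists b.
  move=> _ [z Bz <-]; rewrite lerBlDr; apply: le_trans (dst_lb x Bz) _.
  by rewrite [leRHS]addrC; exact: (enorm_tri x y z).
move=> x y; rewrite ler_norml lerBlDl H1 andbT.
by rewrite lerNl opprB lerBlDl enormB H1.
Qed.

Lemma dst_closed B x : closed B -> B !=set0 -> dst B x = 0 -> B x.
Proof.
move=> cB [b Bb] d0; apply: cB => U /nbhs_ballP[e /= e0 eU].
have e0' : dst B x < e by rewrite d0.
have [_ [y By <-] ye] := inf_lt (ltac:(by exists (enorm (x - b)); exists b) : [set enorm (x - y) | y in B] !=set0) e0'.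
exists y; split => //; apply: eU; rewrite -ball_normE /ball_/=.
exact: le_lt_trans (norm_le_enorm _) ye.
Qed.

End distance_to_set.

Section step_times.
Context {R : realType}.

(* Grid times above [r], so that right continuity of the paths applies. *)
Definition stept (m : nat) (r : R) : R := (Num.truncn (r * m.+1%:R)).+1%:R / m.+1%:R.

Lemma stept_gt m (r : R) : Num.max r 0 < stept m r.
Proof.
rewrite gt_max; apply/andP; split; last by rewrite divr_gt0.
by rewrite ltr_pdivlMr// truncnS_gt.
Qed.

Lemma stept_le m (r : R) : stept m r <= Num.max r 0 + m.+1%:R^-1.
Proof.
rewrite ler_pdivrMr// mulrDl mulVf// -natr1 lerD2r.
have [r0|r0] := leP 0 r.
  by rewrite truncn_le mulr_ge0.
rewrite mul0r; suff -> : Num.truncn (r * m.+1%:R) = 0%N by [].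
apply/eqP; rewrite -leqn0 truncn_le_nat; apply: lt_trans (ltr01).
by rewrite pmulr_llt0.
Qed.

Lemma stept_cvg (r : R) : stept m r @[m --> \oo] --> (Num.max r 0)^'+.
Proof.
move=> U [e /= e0 eU].
suff : \forall m \near \oo, U (stept m r) by [].
near=> m; apply: eU; last exact: stept_gt.
rewrite /ball_/= ltr_distlC; apply/andP; split.
  by apply: lt_trans (stept_gt m r); rewrite ltrBlDr ltrDl.
apply: le_lt_trans (stept_le m r) _; rewrite ltrD2l.
near: m; apply: near_infty_natSinv_lt (PosNum e0).
Unshelve. all: by end_near. Qed.

Lemma measurable_truncn (m j : nat) : measurable [set r : R | Num.truncn (r * m.+1%:R) = j].
Proof.
have mle i : measurable [set r : R | (Num.truncn (r * m.+1%:R) <= i)%N].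
  rewrite (_ : [set _ | _] = [set` `]-oo, (i.+1%:R / m.+1%:R)[]); first exact: measurable_itv.
  by apply/seteqP; split => r /=; rewrite in_itv/= truncn_le_nat ltr_pdivlMr.
case: j => [|j].
  rewrite (_ : [set _ | _] = [set r : R | (Num.truncn (r * m.+1%:R) <= 0)%N]); first exact: mle.
  by apply/seteqP; split => r /= => [->//|]; rewrite leqn0 => /eqP.
rewrite (_ : [set _ | _] = [set r : R | (Num.truncn (r * m.+1%:R) <= j.+1)%N] `\` [set r : R | (Num.truncn (r * m.+1%:R) <= j)%N]).
  exact: measurableD.
apply/seteqP; split => r /= => [->|[h1 /negP]]; first by rewrite leqnn ltnn.
by rewrite -ltnNge => h2; apply/eqP; rewrite eqn_leq h1.
Qed.

Lemma measurable_step d (T : measurableType d) (H : R -> T -> R) m :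
  (forall t, 0 <= t -> measurable_fun setT (H t)) ->
  measurable_fun setT (fun rw : R * T => H (stept m rw.1) rw.2).
Proof.
move=> mH _ B mB; rewrite setTI.
rewrite (_ : _ @^-1` B = \bigcup_j ([set r : R | Num.truncn (r * m.+1%:R) = j] `*` (H (j.+1%:R / m.+1%:R) @^-1` B))).
  apply: bigcup_measurable => j _; apply: measurableX; first exact: measurable_truncn.
  by rewrite -[X in measurable X]setTI; apply: mH.
apply/seteqP; split => [[r w] /= h|[r w] [j _] [/= h1 h2]]; first by exists (Num.truncn (r * m.+1%:R)).
by rewrite /stept h1.
Qed.

End step_times.

Section paths.
Context {R : realType} {d n : nat}.
Local Notation V := 'rV[R]_d.
Local Notation I := 'I_n.+1.

(** Paths with the sigma-field of the coordinates up to [T]: adaptedness becomes measurability on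
    this type. *)
Definition OmT (T : \bar R) := g_sigma_algebraType (@genS R d n T).

Section filtration.
Variable T : \bar R.

Lemma measurable_pX (t : R) : 0 <= t -> (t%:E <= T)%E -> measurable_fun setT (fun w : OmT T => pX w t : Rd R d).
Proof.
move=> t0 tT; apply: (@measurability _ _ _ (Rd R d) setT (fun w : OmT T => (pX w t : Rd R d)) (@open V) erefl).
move=> _ [U oU <-]; rewrite setTI; apply: sub_sigma_algebra.
by exists t; split=> //; split=> //; left; exists U.
Qed.

Lemma measurable_pL (t : R) k : 0 <= t -> (t%:E <= T)%E -> measurable [set w : OmT T | pL w t = k].
Proof.
move=> t0 tT; apply: sub_sigma_algebra.
by exists t; split=> //; split=> //; right; exists k.
Qed.

Lemma sum_regime (F : I -> R) (l : I) : \sum_(k < n.+1) (l == k)%:R * F k = F l.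
Proof.
rewrite (bigD1 l)//= eqxx mul1r big1 ?addr0// => k kl.
by rewrite eq_sym (negPf kl) mul0r.
Qed.

Lemma measurable_state (phi : I -> V -> R) (t : R) : (forall k, borel_fun (phi k)) -> 0 <= t -> (t%:E <= T)%E ->
  measurable_fun setT (fun w : OmT T => phi (pL w t) (pX w t)).
Proof.
move=> mphi t0 tT.
rewrite (_ : (fun w => _) = fun w : OmT T => \sum_(k < n.+1) \1_[set w : OmT T | pL w t = k] w * phi k (pX w t)).
  apply: measurable_sum => k; apply: measurable_funM.
    by apply: measurable_indic; exact: measurable_pL.
  exact: measurableT_comp (mphi k) (measurable_pX t0 tT).
apply/funext => w; rewrite -[LHS](sum_regime (fun k => phi k (pX w t))); apply: eq_bigr => k _; congr (_ * _).
rewrite indicE; congr (_%:R); congr nat_of_bool; apply/idP/idP => [/eqP h|]; first exact: mem_set.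
by move=> /set_mem/= /eqP.
Qed.

End filtration.

Lemma path_cvg (w : pathRdS R d n) (r : R) (g : V -> R) : continuous g ->
  g (pX w (stept m r)) @[m --> \oo] --> g (pX w r).
Proof.
move=> cg; apply: continuous_cvg; first exact: cg.
have -> : pX w r = pX w (Num.max r 0).
  by have [|r0] := leP 0 r => //; exact: pX_frozen.
have r0 : 0 <= Num.max r 0 by rewrite le_max lexx orbT.
have [h _] := pX_cadlag w r0.
exact: (cvg_comp (stept^~ r) (pX w) (stept_cvg (r := r)) h).
Qed.

Lemma path_regime (w : pathRdS R d n) (r : R) : \forall m \near \oo, pL w (stept m r) = pL w r.
Proof.
have -> : pL w r = pL w (Num.max r 0).
  by have [|r0] := leP 0 r => //; exact: pL_frozen.
have r0 : 0 <= Num.max r 0 by rewrite le_max lexx orbT.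
have [[e [e0 He]] _] := pL_cadlag w r0.
near=> m; apply: He; first exact: ltW (stept_gt m r).
apply: le_lt_trans (stept_le m r) _; rewrite ltrD2l.
near: m; apply: near_infty_natSinv_lt (PosNum e0).
Unshelve. all: by end_near. Qed.

Local Notation Om := (OmegaS R d n).

(** Right continuity makes the path a limit of step processes. To work with real-valued limits, an
    open set is described by the distance to its complement. *)
Lemma joint_pX : measurable_fun setT (fun rw : R * Om => pX rw.2 rw.1 : Rd R d).
Proof.
apply: (@measurability _ _ _ (Rd R d) setT (fun rw : R * Om => (pX rw.2 rw.1 : Rd R d)) (@open V) erefl).
move=> _ [U oU <-]; rewrite setTI.
have cU : closed (~` U) by exact: open_closedC.
rewrite (_ : _ @^-1` U = ~` ((fun rw : R * Om => pX rw.2 rw.1) @^-1` (~` U))); last by rewrite preimage_setC setCK.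
apply: measurableC.
have [->|/set0P U0] := eqVneq (~` U) set0; first by rewrite preimage_set0.
rewrite (_ : _ @^-1` _ = (fun rw : R * Om => dst (~` U) (pX rw.2 rw.1)) @^-1` [set 0]); last first.
  apply/seteqP; split => [[r w]|[r w]] /=; first exact: dst_in.
  exact: dst_closed.
rewrite -[X in measurable X]setTI; suff : measurable_fun setT (fun rw : R * Om => dst (~` U) (pX rw.2 rw.1)) by apply.
have dc : continuous (dst (~` U)) by apply: elip_continuous (dst_elip U0).
apply: (measurable_fun_cvg (h := fun m (rw : R * Om) => dst (~` U) (pX rw.2 (stept m rw.1)))).
  move=> m; apply: (measurable_step (H := fun t (w : Om) => dst (~` U) (pX w t))) => t t0.
  by apply: (@measurable_state +oo%E (fun=> dst (~` U))); rewrite ?leey// => k; exact: borel_cont.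
by move=> [r w] _; exact: path_cvg.
Qed.

Lemma joint_pL k : measurable_fun setT (fun rw : R * Om => (pL rw.2 rw.1 == k)%:R : R).
Proof.
apply: (measurable_fun_cvg (h := fun m (rw : R * Om) => (pL rw.2 (stept m rw.1) == k)%:R : R)).
  move=> m; apply: (measurable_step (H := fun t (w : Om) => (pL w t == k)%:R : R)) => t t0.
  apply: (@measurable_state +oo%E (fun l _ => (l == k)%:R)); rewrite ?leey// => l; exact: measurable_cst.
move=> [r w] _ /=; apply: cvg_near_cst.
have := path_regime w r; apply: filterS => m /= -> //.
Qed.

Lemma joint_state (phi : I -> V -> R) : (forall k, borel_fun (phi k)) ->
  measurable_fun setT (fun rw : R * Om => phi (pL rw.2 rw.1) (pX rw.2 rw.1)).
Proof.
move=> mphi.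
rewrite (_ : (fun rw => _) = fun rw : R * Om => \sum_(k < n.+1) (pL rw.2 rw.1 == k)%:R * phi k (pX rw.2 rw.1)).
  apply: measurable_sum => k; apply: measurable_funM; first exact: joint_pL.
  exact: measurableT_comp (mphi k) joint_pX.
by apply/funext => rw; rewrite sum_regime.
Qed.

Lemma path_measurable (phi : I -> V -> R) (w : Om) : (forall k, borel_fun (phi k)) ->
  measurable_fun setT (fun r : R => phi (pL w r) (pX w r)).
Proof. by move=> /joint_state m; exact: (measurableT_comp m (pair2_measurable w)). Qed.

End paths.

(** * Time integrals along a path *)

Section time_integrals.
Context {R : realType}.
Local Notation leb := (@lebesgue_measure R).
Implicit Types (F G : R -> R).

Lemma itv_length (s t : R) : s <= t -> fine (leb `]s, t]%classic) = t - s.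
Proof.
move=> st; rewrite lebesgue_measure_itv/= lte_fin; case: ltP => // ts.
by rewrite (@le_anti _ _ t s) ?subrr// ts.
Qed.

Lemma itv_int (i : interval R) F (M s t : R) : [set` i] `<=` `[s, t]%classic -> measurable_fun setT F -> (forall r, `|F r| <= M) ->
  leb.-integrable [set` i] (EFin \o F).
Proof.
move=> ist mF FM; apply: measurable_bounded_integrable.
- exact: measurable_itv.
- apply: (@le_lt_trans _ _ (leb `[s, t]%classic)).
    by apply: le_measure; rewrite ?inE//; exact: measurable_itv.
  by rewrite lebesgue_measure_itv/=; case: ifP => _; rewrite ?ltry.
- exact: measurable_funTS.
- by exists M; split=> [|N MN w _ /=]; [exact: num_real|exact: le_trans (FM w) (ltW MN)].
Qed.

Lemma itv_oc_cc (s t : R) : `]s, t]%classic `<=` `[s, t]%classic.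
Proof. by move=> r /=; rewrite !in_itv/= => /andP[/ltW -> ->]. Qed.

Lemma Rint_oc_int F (M s t : R) : measurable_fun setT F -> (forall r, `|F r| <= M) -> leb.-integrable `]s, t] (EFin \o F).
Proof. by move=> mF FM; exact: itv_int (@itv_oc_cc s t) mF FM. Qed.

Lemma Rint_oc_le F G (M N s t : R) : measurable_fun setT F -> (forall r, `|F r| <= M) ->
  measurable_fun setT G -> (forall r, `|G r| <= N) -> (forall r, s < r -> r <= t -> F r <= G r) ->
  Rintegral leb `]s, t] F <= Rintegral leb `]s, t] G.
Proof.
move=> mF FM mG GN FG; apply: le_Rintegral; [exact: measurable_itv|exact: Rint_oc_int mF FM|exact: Rint_oc_int mG GN|].
by move=> r /=; rewrite in_itv/= => /andP[]; exact: FG.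
Qed.

Lemma Rint_oc_cst (c s t : R) : s <= t -> Rintegral leb `]s, t] (fun=> c) = (t - s) * c.
Proof. by move=> st; rewrite Rintegral_cst ?itv_length 1?mulrC//; exact: measurable_itv. Qed.

Lemma Rint_oc_dist F (M c e s t : R) : s <= t -> measurable_fun setT F -> (forall r, `|F r| <= M) ->
  (forall r, s < r -> r <= t -> `|F r - c| <= e) -> `|Rintegral leb `]s, t] F - (t - s) * c| <= (t - s) * e.
Proof.
move=> st mF FM Fc; rewrite ler_norml lerBlDl lerBrDl -mulrBr -mulrDr -!Rint_oc_cst//; apply/andP; split.
  apply: (Rint_oc_le (M := `|c - e|)) FM _ => // r sr rt.
  by have := Fc r sr rt; rewrite ler_norml lerBlDl lerBrDl => /andP[].
apply: (Rint_oc_le mF FM (N := `|c + e|)) => //.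
by move=> r sr rt; have := Fc r sr rt; rewrite ler_norml lerBlDl lerBrDl => /andP[].
Qed.

Lemma Rint_split F (M s t : R) : 0 <= s -> s <= t -> measurable_fun setT F -> (forall r, `|F r| <= M) ->
  Rintegral leb `[0, t] F - Rintegral leb `[0, s] F = Rintegral leb `]s, t] F.
Proof.
move=> s0 st mF FM; apply: Rintegral_itvB; rewrite ?bnd_simp//.
exact: (@itv_int _ F M 0 t (@subset_refl _ _)).
Qed.

Lemma Rint_cc_bound F (M t : R) : 0 <= t -> measurable_fun setT F -> (forall r, `|F r| <= M) ->
  `|Rintegral leb `[0, t] F| <= t * M.
Proof.
move=> t0 mF FM; rewrite -Rintegral_itv_obnd_cbnd; last exact: Rint_oc_int mF FM.
have H r : 0 < r -> r <= t -> `|F r - 0| <= M by rewrite subr0.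
by have := Rint_oc_dist t0 mF FM H; rewrite mulr0 !subr0.
Qed.

Lemma fubini_bounded d (T : measurableType d) (P : probability T R) (f : R * T -> R) (s t M : R) :
  s <= t -> measurable_fun setT f -> (forall x, 0 <= f x <= M) ->
  [/\ bmeas (fun w => Rintegral leb `]s, t] (fun r => f (r, w))),
   measurable_fun setT (fun r => Rintegral P setT (fun w => f (r, w)))
   & Rintegral P setT (fun w => Rintegral leb `]s, t] (fun r => f (r, w))) =
     Rintegral leb `]s, t] (fun r => Rintegral P setT (fun w => f (r, w)))].
Proof.
move=> st mf f0M.
have fM x : `|f x| <= M by have /andP[h1 h2] := f0M x; rewrite ger0_norm.
pose D := `]s, t]%classic : set R.
have mD : measurable D by exact: measurable_itv.
pose g (x : R * T) : \bar R := (f x * \1_D x.1)%:E.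
have mg : measurable_fun setT g.
  apply/measurable_EFinP; apply: measurable_funM => //.
  by apply: measurableT_comp => //; exact: measurable_indic.
have g0 x : (0 <= g x)%E.
  by rewrite lee_fin; have /andP[h _] := f0M x; rewrite mulr_ge0.
have mfr w : measurable_fun setT (fun r => f (r, w)) by exact: (measurableT_comp mf (pair2_measurable w)).
have mfw r : measurable_fun setT (fun w => f (r, w)) by exact: (measurableT_comp mf (pair1_measurable r)).
have bfw r : bmeas (fun w => f (r, w)) by split => //; exists M.
have GE w : fubini_G leb g w = (Rintegral leb `]s, t] (fun r => f (r, w)))%:E.
  have h := @Rint_oc_int _ M s t (mfr w) (fun r => fM (r, w)).
  transitivity (\int[leb]_(r in D) (f (r, w))%:E)%E.
    rewrite [RHS]integral_mkcond; apply: eq_integral => r _; rewrite /g patchE indicE.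
    by case: ifP => _; rewrite ?mulr1 ?mulr0.
  by rewrite /Rintegral fineK//; exact: integrable_fin_num h.
have FE r : fubini_F P g r = (Rintegral P setT (fun w => f (r, w)) * \1_D r)%:E.
  rewrite /fubini_F /g.
  under eq_integral do rewrite /= mulrC EFinM.
  rewrite (integralZl measurableT (bmeas_int P (bfw r))) mulrC EFinM /Rintegral fineK//.
  exact: integrable_fin_num (bmeas_int P (bfw r)).
have mEx : measurable_fun setT (fun r => Rintegral P setT (fun w => f (r, w))).
  apply/measurable_EFinP.
  have mEf : measurable_fun setT (EFin \o f) by exact/measurable_EFinP.
  have := measurable_fun_fubini_tonelli_F (m2 := P) (EFin \o f) mEf (fun x => ltac:(by rewrite /= lee_fin; have /andP[] := f0M x)).
  apply: eq_measurable_fun => r _ /=; rewrite /fubini_F /= /Rintegral fineK//.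
  exact: integrable_fin_num (bmeas_int P (bfw r)).
split=> //.
  split.
    apply/measurable_EFinP; rewrite (_ : EFin \o _ = fubini_G leb g); last by apply/funext => w; rewrite GE.
    exact: measurable_fun_fubini_tonelli_G.
  exists ((t - s) * M) => w; have H r : s < r -> r <= t -> `|f (r, w) - 0| <= M by rewrite subr0.
  by have := Rint_oc_dist st (mfr w) (fun r => fM (r, w)) H; rewrite mulr0 !subr0.
rewrite -(Rintegral_mul_indic leb _ (@subsetT _ D)).
rewrite {1}/Rintegral [in RHS]/Rintegral; congr fine.
transitivity (\int[P]_w fubini_G leb g w)%E; first by apply: eq_integral => w _; rewrite GE.
rewrite -fubini_tonelli//.
by apply: eq_integral => r _; have := FE r; rewrite /fubini_F => ->.
Qed.

End time_integrals.

(** * Martingale increments *)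

Section dynkin.
Context {R : realType} {d n : nat}.
Local Notation V := 'rV[R]_d.
Local Notation I := 'I_n.+1.
Local Notation Om := (OmegaS R d n).
Local Notation leb := (@lebesgue_measure R).
Variable P : probability Om R.
Local Notation Ex F := (Rintegral P setT F).
Implicit Types (phi L beta : I -> V -> R) (w : Om) (r s t : R).

Definition state phi r w : R := phi (pL w r) (pX w r).

Definition mg_pair phi L := is_martingale P (fun t => <<s @genS R d n t%:E >>)
  (fun t w => state phi t w - state phi 0 w - Rintegral leb `[0, t] (fun r => state L r w)).

Definition bborel phi (M : R) := (forall k, borel_fun (phi k)) /\ forall k x, `|phi k x| <= M.

Lemma genS_sub (s t : \bar R) : (s <= t)%E -> @genS R d n s `<=` @genS R d n t.
Proof. by move=> st A [r [r0 [rs HA]]]; exists r; split=> //; split=> //; exact: le_trans st. Qed.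

Lemma filtration_sub (s t : \bar R) : (s <= t)%E -> <<s @genS R d n s >> `<=` <<s @genS R d n t >>.
Proof. by move=> st; apply: sub_smallest2r; [exact: smallest_sigma_algebra|exact: genS_sub]. Qed.

Lemma filtration_measurable t (A : set Om) : <<s @genS R d n t%:E >> A -> measurable A.
Proof. by apply: filtration_sub; rewrite leey. Qed.

Lemma bmeas_state phi M t : bborel phi M -> 0 <= t -> bmeas (state phi t).
Proof.
move=> [mphi phiM] t0; split; last by exists M => w; exact: phiM.
by apply: (measurable_state (T := +oo%E)) => //; rewrite leey.
Qed.

Lemma state_path phi M w : bborel phi M -> measurable_fun setT (fun r => state phi r w).
Proof. by move=> [mphi _]; exact: path_measurable. Qed.

Section pair.
Variables (phi L : I -> V -> R) (M C : R).
Hypotheses (HP : bborel phi M) (HL : bborel L C) (mg : mg_pair phi L).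

Definition occ s t w : R := Rintegral leb `]s, t] (fun r => state L r w).

Let Z t w := state phi t w - state phi 0 w - Rintegral leb `[0, t] (fun r => state L r w).

Lemma C_ge0 : 0 <= C. Proof. by apply: le_trans (HL.2 ord0 0). Qed.

Let bZ t : 0 <= t -> bmeas (Z t).
Proof.
move=> t0; have [mZ _] := mg t0; split.
  by move=> _ B mB; rewrite setTI; apply: (@filtration_measurable t); exact: mZ.
exists (M + M + t * C) => w; apply: le_trans (ler_normB _ _) _; apply: lerD.
  by apply: le_trans (ler_normB _ _) _; rewrite lerD// HP.2.
by apply: Rint_cc_bound => //; [exact: state_path HL|move=> r; exact: HL.2].
Qed.

Let ZE s t w : 0 <= s -> s <= t -> Z t w - Z s w = state phi t w - state phi s w - occ s t w.
Proof.
move=> s0 st; rewrite /Z /occ -(Rint_split s0 st (state_path w HL) (fun r => HL.2 _ _)).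
by ring.
Qed.

Lemma bmeas_occ s t : 0 <= s -> s <= t -> bmeas (occ s t).
Proof.
move=> s0 st; have t0 := le_trans s0 st.
rewrite (_ : occ s t = fun w => (state phi t w - state phi s w) - (Z t w - Z s w)).
  by apply: bmeasB; apply: bmeasB; [exact: bmeas_state HP _|exact: bmeas_state HP _|exact: bZ|exact: bZ].
by apply/funext => w; rewrite ZE//; ring.
Qed.

Lemma dynkin s t A : 0 <= s -> s <= t -> <<s @genS R d n s%:E >> A ->
  Ex (fun w => \1_A w * (state phi t w - state phi s w)) = Ex (fun w => \1_A w * occ s t w).
Proof.
move=> s0 st FA; have t0 := le_trans s0 st.
have bA : bmeas (\1_A : Om -> R) := bmeas_indic (filtration_measurable FA).
have [_ [_ H]] := mg t0; have {}H := H s s0 st A FA.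
have E1 : Ex (fun w => \1_A w * (Z t w - Z s w)) = 0.
  rewrite (_ : (fun w => _) = fun w => \1_A w * Z t w - \1_A w * Z s w); last by apply/funext => w; rewrite mulrBr.
  rewrite (ExB P (bmeasM bA (bZ t0)) (bmeasM bA (bZ s0))).
  by rewrite !Ex_indic /Rintegral H subrr.
have b1 := bmeasM bA (bmeasB (bZ t0) (bZ s0)).
have b2 := bmeasM bA (bmeas_occ s0 st).
rewrite (_ : (fun w => \1_A w * (state phi t w - state phi s w)) = fun w => \1_A w * (Z t w - Z s w) + \1_A w * occ s t w).
  by rewrite (ExD P b1 b2) E1 add0r.
by apply/funext => w; rewrite -mulrDr (ZE _ s0 st) subrK.
Qed.

Lemma occ_bound s t w : s <= t -> `|occ s t w| <= (t - s) * C.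
Proof.
move=> st; have H r : s < r -> r <= t -> `|state L r w - 0| <= C by rewrite subr0 => _ _; exact: HL.2.
by have := Rint_oc_dist st (state_path w HL) (fun r => HL.2 _ _) H; rewrite mulr0 subr0.
Qed.

Lemma dynkin_bound s t A : 0 <= s -> s <= t -> <<s @genS R d n s%:E >> A ->
  `|Ex (fun w => \1_A w * state phi t w) - Ex (fun w => \1_A w * state phi s w)| <= (t - s) * C.
Proof.
move=> s0 st FA; have t0 := le_trans s0 st.
have bA : bmeas (\1_A : Om -> R) := bmeas_indic (filtration_measurable FA).
rewrite -ExB; [|by apply: bmeasM => //; exact: bmeas_state HP _|by apply: bmeasM => //; exact: bmeas_state HP _].
rewrite (_ : (fun w => _) = fun w => \1_A w * (state phi t w - state phi s w)); last by apply/funext => w; rewrite mulrBr.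
rewrite dynkin//; apply: Ex_abs; first by apply: bmeasM => //; exact: bmeas_occ.
move=> w; rewrite normrM; apply: le_trans (occ_bound w st); rewrite ler_piMl//.
by rewrite indicE; case: (_ \in _); rewrite ?normr1 ?normr0.
Qed.

End pair.

(** The mean of [beta] moves at speed at most [C], so its time integral is [t - s] times its initial
    mean up to order [(t - s)^2]. For a bump this controls the mean time spent away from the
    starting cell. *)
Lemma mean_occupation beta Lb Mb C s t A : bborel beta Mb -> (forall k x, 0 <= beta k x) -> bborel Lb C -> mg_pair beta Lb ->
  0 <= s -> s <= t -> <<s @genS R d n s%:E >> A ->
  bmeas (occ beta s t) /\
  `|Ex (fun w => \1_A w * occ beta s t w) - (t - s) * Ex (fun w => \1_A w * state beta s w)| <= (t - s) * ((t - s) * C).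
Proof.
move=> Hb b0 HL mg s0 st FA.
have mA := filtration_measurable FA; have bA : bmeas (\1_A : Om -> R) := bmeas_indic mA.
have mst : measurable_fun setT (fun rw : R * Om => state beta rw.1 rw.2) by exact: joint_state Hb.1.
have bst x : 0 <= state beta x.1 x.2 <= Mb by rewrite b0 (le_trans (ler_norm _))// Hb.2.
have [bo _ _] := fubini_bounded P st mst bst.
split=> //.
pose f (rw : R * Om) := \1_A rw.2 * state beta rw.1 rw.2.
have mf : measurable_fun setT f.
  by apply: measurable_funM => //; apply: measurableT_comp; [exact: measurable_indic|exact: measurable_snd].
have f01 x : 0 <= f x <= Mb.
  have /andP[h1 h2] := bst x; rewrite /f indicE; case: (_ \in _); first by rewrite mul1r h1.
  by rewrite mul0r lexx (le_trans h1 h2).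
have [_ mE E1] := fubini_bounded P st mf f01.
have -> : Ex (fun w => \1_A w * occ beta s t w) = Rintegral leb `]s, t] (fun r => Ex (fun w => \1_A w * state beta r w)).
  rewrite -[RHS]E1; congr (Rintegral _ _ _); apply/funext => w; rewrite /occ /f /= -RintegralZl//.
  by apply: (Rint_oc_int (M := Mb)); [exact: state_path Hb|move=> r; exact: Hb.2].
apply: (Rint_oc_dist (M := Mb) st mE).
  move=> r; apply: Ex_abs; last by move=> w; have /andP[h1 h2] := f01 (r, w); rewrite ger0_norm.
  split; last by exists Mb => w; have /andP[h1 h2] := f01 (r, w); rewrite ger0_norm.
  exact: (measurableT_comp mf (pair1_measurable r)).
move=> r sr rt; apply: le_trans (dynkin_bound Hb HL mg s0 (ltW sr) FA) _.
by rewrite ler_wpM2r ?(C_ge0 HL)// lerB.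
Qed.

(* [sg] and [sg2] are signs: the lemma serves both as an upper and as a lower bound of the increment. *)
Lemma one_step sg sg2 phi L beta Lb m M C Mb B s t A : bborel phi M -> bborel L C -> mg_pair phi L ->
  bborel beta Mb -> (forall k x, 0 <= beta k x) -> bborel Lb B -> mg_pair beta Lb -> bmeas m ->
  0 <= s -> s <= t -> <<s @genS R d n s%:E >> A ->
  (forall w r, A w -> s < r -> r <= t -> sg * state L r w <= m w + sg2 * (state beta s w - state beta r w)) ->
  sg * Ex (fun w => \1_A w * (state phi t w - state phi s w)) <=
  (t - s) * Ex (fun w => \1_A w * m w) + `|sg2| * ((t - s) * ((t - s) * B)).
Proof.
move=> HP HL mg Hb b0 HLb mgb bm s0 st FA H.
have bA : bmeas (\1_A : Om -> R) := bmeas_indic (filtration_measurable FA).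
have [bo Hbo] := mean_occupation Hb b0 HLb mgb s0 st FA.
have bsb := bmeas_state Hb s0.
have bol := bmeas_occ HP HL mg s0 st.
rewrite (dynkin HP HL mg s0 st FA) -ExZ; last exact: bmeasM.
(* The integral of the hypothesis over the time interval; its second term has mean of order
   [(t - s)^2] by [mean_occupation]. *)
pose g w := (t - s) * (\1_A w * m w) + sg2 * ((t - s) * (\1_A w * state beta s w) - \1_A w * occ beta s t w).
have b1 : bmeas (fun w => (t - s) * (\1_A w * m w)) by apply: bmeasZ; exact: bmeasM.
have b2 : bmeas (fun w => (t - s) * (\1_A w * state beta s w)) by apply: bmeasZ; exact: bmeasM.
have b3 : bmeas (fun w => \1_A w * occ beta s t w) by exact: bmeasM.
have b4 := bmeasB b2 b3.
have bg : bmeas g by apply: bmeasD => //; exact: bmeasZ.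
apply: (@le_trans _ _ (Ex g)).
  apply: Ex_le => //; first by apply: bmeasZ; exact: bmeasM.
  move=> w; rewrite /g !indicE; have [/set_mem Aw|] := boolP (w \in A); last by rewrite !mul0r !mulr0 subrr mulr0 addr0.
  rewrite (_ : true%:R = 1 :> R)// !mul1r /occ.
  set c := m w + sg2 * state beta s w.
  have mc : measurable_fun setT (fun r => c - sg2 * state beta r w).
    apply: measurable_funB; first exact: measurable_cst.
    by apply: measurable_funM; [exact: measurable_cst|exact: state_path Hb].
  have mL : measurable_fun setT (fun r => sg * state L r w).
    by apply: measurable_funM; [exact: measurable_cst|exact: state_path HL].
  have HLr r : `|state L r w| <= C by exact: HL.2.
  have Hbr r : `|state beta r w| <= Mb by exact: Hb.2.
  have X : Rintegral leb `]s, t] (fun r => sg * state L r w) <= Rintegral leb `]s, t] (fun r => c - sg2 * state beta r w).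
    apply: (Rint_oc_le (M := `|sg| * C) (N := `|c| + `|sg2| * Mb)) => //.
    - by move=> r; rewrite normrM ler_wpM2l.
    - by move=> r; rewrite (le_trans (ler_normB _ _))// lerD2l normrM ler_wpM2l.
    - by move=> r sr rt; apply: le_trans (H w r Aw sr rt) _; rewrite /c mulrBr addrA.
  rewrite RintegralZl in X; [|exact: measurable_itv|exact: Rint_oc_int (state_path w HL) HLr].
  apply: le_trans X _.
  have ib := @Rint_oc_int _ _ _ s t (state_path w Hb) Hbr.
  rewrite RintegralB; [|exact: measurable_itv|by apply: (Rint_oc_int (M := `|c|)) => //; exact: measurable_cst|].
    rewrite Rint_oc_cst// (RintegralZl sg2 _ ib); last exact: measurable_itv.
    by rewrite /c mulrDr mulrBr addrA [in leRHS]mulrCA.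
  apply: (Rint_oc_int (M := `|sg2| * Mb)).
    by apply: measurable_funM; [exact: measurable_cst|exact: state_path Hb].
  by move=> r; rewrite normrM ler_wpM2l.
rewrite /g ExD//; last exact: bmeasZ.
rewrite !ExZ//; [|exact: bmeasM]; rewrite ExB// ExZ; last exact: bmeasM.
rewrite lerD2l; apply: le_trans (ler_norm _) _.
by rewrite normrM ler_wpM2l// distrC.
Qed.

End dynkin.

(** * Localisation *)

Section localisation.
Context {R : realType} {d n : nat}.
Local Notation V := 'rV[R]_d.
Local Notation I := 'I_n.+1.
Implicit Types (x y p : V).

(** The classifying map is defined everywhere, [inord] sending far points to an arbitrary cell;
    cells are small only inside the ball. *)
Lemma grid_partition (r kap : R) : 0 < kap -> exists (J : finType) (c : V -> J),
  (forall j, measurable ([set x | c x = j] : set (Rd R d))) /\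
  forall x y, enorm x <= r -> enorm y <= r -> c x = c y -> enorm (x - y) <= kap.
Proof.
move=> k0; pose s : R := kap / d.+1%:R.
have s0 : 0 < s by rewrite divr_gt0.
pose M := Num.truncn ((2 * r) / s).
pose ci x (i : 'I_d) := Num.truncn ((x 0 i + r) / s).
exists {ffun 'I_d -> 'I_M.+1}, (fun x => [ffun i => inord (ci x i)]); split.
  move=> j.
  have -> : [set x | [ffun i => inord (ci x i)] = j] =
     \bigcap_(i in [set: 'I_d]) [set x : V | [set t | inord (Num.truncn t) = j i] ((x 0 i + r) / s)].
    apply/seteqP; split => x /= h; first by move=> i _; rewrite -h ffunE.
    by apply/ffunP => i; rewrite ffunE; exact: h.
  apply: fin_bigcap_measurable; first exact: finite_finset.
  move=> i _; apply: borel_set; last first.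
    rewrite (_ : mkset _ = \bigcup_(k in [set k | inord k = j i]) [set t : R | Num.truncn (t * 1%:R) = k]).
      by apply: bigcup_measurable => k _; exact: measurable_truncn.
    apply/seteqP; split => t /= h; first by exists (Num.truncn t) => //=; rewrite mulr1.
    by case: h => k /= h1 h2; rewrite mulr1 in h2; rewrite h2.
  apply: measurable_funM; last exact: measurable_cst.
  by apply: measurable_funD; [exact: borel_coord|exact: measurable_cst].
have cb x i : enorm x <= r -> 0 <= (x 0 i + r) / s /\ (ci x i < M.+1)%N.
  move=> xr; have := coord_le_enorm x i; rewrite ler_norml => /andP[h1 h2].
  have h3 : 0 <= x 0 i + r by lra.
  split; first by rewrite divr_ge0// ltW.
  by rewrite ltnS /ci /M; apply: le_truncn; rewrite ler_pM2r ?invr_gt0//; lra.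
move=> x y xr yr /ffunP cE; apply: le_trans (enorm_le_sum _) _.
apply: (@le_trans _ _ (\sum_(i < d) s)).
  apply: ler_sum => i _; rewrite !mxE.
  have [x0 xM] := cb x i xr; have [y0 yM] := cb y i yr.
  have := cE i; rewrite !ffunE => /(congr1 val); rewrite /= !inordK// => E.
  have /andP[a1 a2] := truncn_itv x0; have /andP[b1 b2] := truncn_itv y0.
  rewrite -/(ci x i) E in a1 a2; rewrite -/(ci y i) in b1 b2.
  rewrite -natr1 in a2 b2.
  have D : `|(x 0 i + r) / s - (y 0 i + r) / s| <= 1 by rewrite ler_norml; lra.
  rewrite -mulrBl normrM (gtr0_norm (_ : 0 < s^-1)) ?invr_gt0// ler_pdivrMr// mul1r in D.
  by move: D; congr (`|_| <= _); ring.
rewrite sumr_const card_ord -mulr_natl /s mulrCA ler_piMr ?(ltW k0)//.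
by rewrite ler_pdivrMr// mul1r ler_nat.
Qed.

Definition nbhd_ind (S : set V) (kap : R) (x : V) : R := Num.max 0 (Num.min 1 (2 - kap^-1 * dst S x)).

Lemma clamp_elip (K : R) (F : V -> R) : 0 <= K -> elip K F -> elip K (fun x => Num.max 0 (Num.min 1 (F x))).
Proof.
move=> K0 HF; have H x y : Num.max 0 (Num.min 1 (F x)) <= Num.max 0 (Num.min 1 (F y)) + K * enorm (x - y).
  have e0 : 0 <= K * enorm (x - y) by rewrite mulr_ge0 ?enorm_ge0.
  have F1 : F x <= F y + K * enorm (x - y).
    by have := HF x y; rewrite ler_norml lerBlDl => /andP[_]; rewrite addrC.
  rewrite ge_max; apply/andP; split; first by rewrite addr_ge0// le_max lexx.
  apply: (@le_trans _ _ (Num.min 1 (F y) + K * enorm (x - y))); last by rewrite lerD2r le_max lexx orbT.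
  rewrite -lerBlDr le_min !lerBlDr; apply/andP; split; last by rewrite (le_trans _ F1)// ge_min lexx orbT.
  by rewrite ge_min; apply/orP; left; rewrite lerDl.
move=> x y; rewrite ler_norml lerBlDl H andbT.
by rewrite lerNl opprB lerBlDl enormB H.
Qed.

Lemma nbhd_ind01 S kap x : 0 <= nbhd_ind S kap x <= 1.
Proof. by rewrite /nbhd_ind le_max lexx/= ge_max ler01/= ge_min lexx. Qed.

Lemma nbhd_ind_elip S kap : 0 < kap -> S !=set0 -> elip kap^-1 (nbhd_ind S kap).
Proof.
move=> k0 S0; apply: clamp_elip; first by rewrite invr_ge0 ltW.
move=> x y; have -> : 2 - kap^-1 * dst S x - (2 - kap^-1 * dst S y) = - (kap^-1 * (dst S x - dst S y)) by ring.
rewrite normrN normrM gtr0_norm ?invr_gt0// ler_wpM2l ?invr_ge0 ?(ltW k0)//.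
by have := dst_elip S0 x y; rewrite mul1r.
Qed.

Lemma nbhd_ind_in S kap x : 0 < kap -> dst S x <= kap -> nbhd_ind S kap x = 1.
Proof.
move=> k0 xS; rewrite /nbhd_ind min_l; first by rewrite max_r.
by have : kap^-1 * dst S x <= 1; [rewrite mulrC ler_pdivrMr// mul1r|lra].
Qed.

Lemma nbhd_ind_out S kap x : 0 < kap -> 2 * kap <= dst S x -> nbhd_ind S kap x = 0.
Proof.
move=> k0 xS; rewrite /nbhd_ind max_l// ge_min.
have : 2 <= kap^-1 * dst S x by rewrite mulrC ler_pdivlMr.
by move=> h; apply/orP; right; lra.
Qed.

(** Coefficients may be frozen over a time step only while the path stays near its starting cell. A
    bump equal to 1 on the cell and 0 away from it detects departures through its own martingale. *)
Lemma cell_bumps (N zeta : R) : 0 < zeta -> exists (J : finType) (c : V -> J) (C r : R),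
  (forall j, measurable ([set x | c x = j] : set (Rd R d))) /\
  forall j k, exists beta : I -> V -> R,
   [/\ forall l, reg C (beta l), forall l, Cc_infty (beta l), forall l x, 0 <= beta l x <= 1,
       forall l x, r < enorm x -> beta l x = 0 &
       forall x, enorm x <= N -> c x = j -> beta k x = 1 /\ forall l y, beta l y != 0 -> l = k /\ enorm (y - x) <= zeta].
Proof.
(* Of the four parts of [zeta], one is the diameter of the cell, two are the decay of the indicator,
   and one is the mollification. *)
move=> z0; pose kap := zeta / 4.
have k0 : 0 < kap by rewrite divr_gt0.
have [J [c [mc cd]]] := grid_partition N k0.
pose eps := kap / d.+1%:R.
have ep0 : 0 < eps by rewrite divr_gt0.
have epd : eps * d%:R <= kap.
  by rewrite /eps mulrAC ler_pdivrMr// ler_wpM2l ?(ltW k0)// ler_nat.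
have [C HC] := @Sm_reg R d eps ep0.
have C0 : 0 <= C by case: (HC 0 (fun=> 0) (elip_cst 0)) => // x; rewrite normr0.
pose zf : V -> R := fun=> 0.
have z1 x : `|zf x| <= 1 by rewrite normr0.
have Sz : Sm eps zf = zf by apply/funext => x; rewrite Sm_cst.
have r0 : reg C zf by rewrite -Sz; exact: HC 0 zf (elip_cst 0) z1.
have cc0 : Cc_infty zf by rewrite -Sz; exact: (@Sm_Cc R d eps ep0 0 zf 1 0 (lexx 0) (elip_cst 0) z1 (fun _ _ => erefl)).
exists J, c, C, (N + 2 * kap + kap); split=> // j k.
pose S := [set x | c x = j /\ enorm x <= N] : set V.
have [SE|/set0P S0] := eqVneq S set0.
  exists (fun=> zf); split=> //; first by move=> l x; rewrite /zf lexx ler01.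
  by move=> x xN xj; have : S x by []; rewrite SE.
pose F := nbhd_ind S kap.
have FL : elip kap^-1 F by exact: nbhd_ind_elip.
have ki : 0 <= kap^-1 by rewrite invr_ge0 ltW.
have F1 x : `|F x| <= 1 by have /andP[h1 h2] := nbhd_ind01 S kap x; rewrite ger0_norm.
have SF x : F x != 0 -> exists2 y, S y & enorm (x - y) < 2 * kap.
  move=> Fx; have dl : dst S x < 2 * kap by rewrite ltNge; apply/negP => /(nbhd_ind_out k0) h; rewrite /F h eqxx in Fx.
  have [_ [y Sy <-] yl] := inf_lt (ltac:(by case: S0 => b Sb; exists (enorm (x - b)); exists b) : [set enorm (x - y) | y in S] !=set0) dl.
  by exists y.
have Fs x : N + 2 * kap < enorm x -> F x = 0.
  move=> xN; apply/eqP; apply: contraT => /SF[y [_ yN] xy].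
  have T := enorm_le_tri yN (ltW xy); lra.
exists (fun l => if l == k then Sm eps F else zf); split.
- by move=> l; case: eqP => // _; exact: HC FL F1.
- by move=> l; case: eqP => // _; exact: (Sm_Cc ep0 ki FL F1 Fs).
- move=> l x; case: eqP => _; last by rewrite /zf lexx ler01.
  apply/andP; split; first by apply: (Sm_ge0 ep0 _ FL) => y; have /andP[] := nbhd_ind01 S kap y.
  by apply: (Sm_le1 ep0 _ FL) => y; have /andP[] := nbhd_ind01 S kap y.
- by move=> l x xr; case: eqP => // _; apply: (Sm_supp ep0 Fs); apply: le_lt_trans xr; rewrite lerD2l.
- move=> x xN xj; have Sx : S x by []. 
  split.
    rewrite eqxx -(Sm_cst eps 1 x); apply: (Sm_ext ep0) => y yx.
    apply: nbhd_ind_in => //; apply: le_trans (dst_lb _ Sx) _; exact: le_trans epd.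
  move=> l y; case: (eqVneq l k) => [->|_]; last by rewrite /zf eqxx.
  move=> Fy; split=> //; apply: contraT => yx; move: Fy.
  rewrite (_ : Sm eps F y = 0) ?eqxx// -(Sm_cst eps 0 y); apply: (Sm_ext ep0) => y' y'y.
  apply/eqP; apply: contraT => /SF[u [uj uN] yu].
  have ux : enorm (u - x) <= kap by apply: cd => //; rewrite uj.
  have y'y2 := le_trans y'y epd.
  have T1 := enorm_tri y y' x; have T2 := enorm_tri y' u x; rewrite (enormB y y') in T1.
  by move: yx; rewrite -ltNge => yx; have := yx; rewrite /kap in k0 ux y'y2 yu *; lra.
Qed.

Lemma outer_bump (N : R) : 0 <= N -> exists (C : R) (beta : V -> R), [/\ reg C beta, Cc_infty beta, forall x, 0 <= beta x <= 1,
  forall x, N + 4 < enorm x -> beta x = 0 & forall x, enorm x <= N + 3 -> beta x = 1].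
Proof.
move=> N0; pose eps : R := 4^-1 / d.+1%:R.
have ep0 : 0 < eps by rewrite divr_gt0.
have epd : eps * d%:R <= 4^-1.
  by rewrite /eps mulrAC ler_pdivrMr// ler_wpM2l// ler_nat.
have [C HC] := @Sm_reg R d eps ep0.
(* This cut-off is 1 up to [N + 3 + 1/4] and 0 beyond [N + 3 + 3/4], leaving 1/4 on either side for
   the mollification. *)
pose F : V -> R := chi (N + (2 + 2^-1 + 4^-1)).
have FL : elip 2 F by exact: chi_elip.
have F1 x : `|F x| <= 1 by have /andP[h1 h2] := chi01 (N + (2 + 2^-1 + 4^-1)) x; rewrite ger0_norm.
have Fs x : N + (3 + 2^-1 + 4^-1) < enorm x -> F x = 0 by move=> h; apply: chi_out; lra.
exists C, (Sm eps F); split.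
- exact: HC FL F1.
- exact: (Sm_Cc ep0 _ FL F1 Fs).
- move=> x; apply/andP; split; first by apply: (Sm_ge0 ep0 _ FL) => y; have /andP[] := chi01 (N + (2 + 2^-1 + 4^-1)) y.
  by apply: (Sm_le1 ep0 _ FL) => y; have /andP[] := chi01 (N + (2 + 2^-1 + 4^-1)) y.
- by move=> x xN; apply: (Sm_supp ep0 Fs); lra.
- move=> x xN; rewrite -(Sm_cst eps 1 x); apply: (Sm_ext ep0) => y yx; apply: chi_in.
  by have T := enorm_le_tri xN (le_trans yx epd); lra.
Qed.

End localisation.

(** * Short-time bounds for martingale solutions *)

Section martingale_step.
Context {R : realType} {d n : nat}.
Hypothesis d0 : (0 < d)%N.
Local Notation V := 'rV[R]_d.
Local Notation I := 'I_n.+1.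
Local Notation Ig mu D f := (Rintegral mu D f).
Local Notation Om := (OmegaS R d n).
Variables (eps0 : R) (a : V -> I -> 'M[R]_d) (b : V -> I -> V) (nu : V -> I -> {measure set Rd R d -> \bar R})
  (q : V -> I -> I -> R) (sl : V -> I -> 'M[R]_d) (lambda0 Cn Qb : R).
Hypotheses (e0 : 0 < eps0) (l0 : 0 < lambda0).
Hypothesis nuC : forall x k, (\int[nu x k]_(u in @Rd0 R d) (mm u)%:E <= Cn%:E)%E.
Hypothesis slT : forall x k, (sl x k)^T = sl x k.
Hypothesis sls : forall x k, sl x k *m sl x k = a x k - lambda0%:M.
Hypothesis bB : forall N, exists B, forall x k, enorm x <= N -> enorm (b x k) <= B.
Hypothesis sB : forall N, exists B, forall x k, enorm x <= N -> forall i, enorm (row i (sl x k)) <= B.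
Hypothesis qB : forall x k l, 0 <= qz q x k l <= Qb.
Hypothesis tB : forall N e, 0 < e -> exists K0, forall K, (K0 <= K)%N -> forall x k, enorm x <= N ->
  Ig (nu x k) (tail K) (@mm R d) <= e.
Hypothesis am : forall k i j, borel_fun (fun x => a x k i j).
Hypothesis bm : forall k i, borel_fun (fun x => b x k 0 i).
Hypothesis qm : forall k l, borel_fun (fun x => q x k l).
Hypothesis num : forall k (B : set (Rd R d)), measurable B -> measurable_fun setT (fun x : Rd R d => nu x k B).
Implicit Types (phi beta : I -> V -> R) (C r s t : R) (w : Om).
Local Notation AA f := (Aop eps0 a b nu q (fun x l => f l x)).

Definition solves (P : probability Om R) := forall f : V -> I -> R, (forall l, Cc_infty (f ^~ l)) ->
    is_martingale P (fun t => <<s @genS R d n t%:E >>)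
      (fun t w => f (pX w t) (pL w t) - f (pX w 0) (pL w 0)
         - Rintegral (@lebesgue_measure R) `[0, t] (fun r => Aop eps0 a b nu q f (pX w r) (pL w r))).

Definition test_fun C r phi := [/\ forall l, reg C (phi l), forall l, Cc_infty (phi l),
  forall l x, r < enorm x -> phi l x = 0 & forall l x, `|phi l x| <= 1].

Lemma test_fun_pair C r : 0 <= C -> exists2 M, 0 <= M & forall phi, test_fun C r phi ->
  [/\ bborel phi 1, bborel (fun k y => AA phi y k) M & forall P, solves P -> mg_pair P phi (fun k y => AA phi y k)].
Proof.
move=> C0; have [M M0 HM] := Aop_bounded e0 l0 nuC slT sls bB sB qB r C0.
exists M; first exact: M0.
move=> phi [rC cC s1 p1]; apply: And3.
- by split=> // k; exact: (borel_iter_pd (l := [::]) (rC k)).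
- by split=> [k|k x]; [exact: (borel_Aop e0 nuC tB am bm qm num) rC|exact: HM].
- by move=> P sP; exact: (sP (fun x l => phi l x)).
Qed.

(** [A] is split by the cell and the regime at time [s]. Where the bump of the cell is nonzero, the
    path has kept its regime and is within [zeta], so the hypothesis applies; elsewhere the penalty
    [2 * M] is charged, and its mean integral is of order [(t - s)^2]. *)
Lemma local_step N zeta C r : 0 < zeta -> 0 <= C -> exists2 K, 0 <= K &
  forall P sg phi (m : I -> V -> R) (Mm : R) s t (A : set Om), solves P -> `|sg| = 1 -> test_fun C r phi -> bborel m Mm ->
  0 <= s -> s <= t -> <<s @genS R d n s%:E >> A -> (forall w, A w -> enorm (pX w s) <= N) ->
  (forall p y k, enorm p <= N -> enorm (y - p) <= zeta -> sg * AA phi y k <= m k p) ->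
  sg * Rintegral P setT (fun w => \1_A w * (state phi t w - state phi s w)) <=
  (t - s) * Rintegral P setT (fun w => \1_A w * state m s w) + (t - s) * ((t - s) * K).
Proof.
move=> z0 C0; have [M M0 HM] := test_fun_pair r C0.
have [J [c [Cb [rb [mc Hb]]]]] := @cell_bumps R d n N zeta z0.
have [[j0]|J0] := pselect (inhabited J); last first.
  exists 0 => // P sg phi m Mm s t A _ _ _ _ _ _ _ _ _.
  by exfalso; apply: J0; exact: (inhabits (c 0)).
have Cb0 : 0 <= Cb by have [beta [rC _ _ _ _]] := Hb j0 ord0; case: (rC ord0).
have [B B0 HB] := test_fun_pair rb Cb0.
exists (#|{: J * I}|%:R * (2 * M * B)); first by rewrite !mulr_ge0.
move=> P sg phi m Mm s t A sP sg1 tp bmm s0 st FA AN Hm.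
have [bp bL mgp] := HM phi tp.
pose Ap (p : J * I) : set Om := A `&` ([set w | c (pX w s) = p.1] `&` [set w | pL w s = p.2]).
have FAp p : <<s @genS R d n s%:E >> (Ap p).
  have h1 : measurable (A : set (@OmT R d n s%:E)) by [].
  have h2 : measurable ([set w | c (pX w s) = p.1] : set (@OmT R d n s%:E)).
    by rewrite -[X in measurable X]setTI; apply: (measurable_pX (T := s%:E) s0 (lexx _) measurableT (mc p.1)).
  have h3 := @measurable_pL R d n s%:E s p.2 s0 (lexx _).
  exact: (measurableI _ _ h1 (measurableI _ _ h2 h3)).
have bA : bmeas (\1_A : Om -> R) := bmeas_indic (filtration_measurable FA).
have bAp p : bmeas (\1_(Ap p) : Om -> R) := bmeas_indic (filtration_measurable (FAp p)).
have AE w : \1_A w = \sum_p \1_(Ap p) w :> R.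
  rewrite (bigD1 (c (pX w s), pL w s))//= big1 ?addr0.
    rewrite !indicE; congr (nat_of_bool _)%:R.
    by apply/idP/idP => [/set_mem h|/set_mem[h _]]; apply/mem_set.
  move=> [j k] jk; rewrite indicE memNset// => -[_ /= [h1 h2]].
  by rewrite -h1 -h2 eqxx in jk.
have bd : bmeas (fun w => state phi t w - state phi s w).
  by apply: bmeasB; apply: bmeas_state bp _ => //; exact: le_trans st.
have bms := bmeas_state bmm s0.
have EA F : bmeas F -> Rintegral P setT (fun w => \1_A w * F w) = \sum_p Rintegral P setT (fun w => \1_(Ap p) w * F w).
  move=> bF; rewrite -Ex_sum; last by move=> p; exact: bmeasM.
  by congr (Rintegral _ _ _); apply/funext => w; rewrite AE mulr_suml.
rewrite (EA _ bd) (EA _ bms) !mulr_sumr.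
have -> : (t - s) * ((t - s) * (#|{: J * I}|%:R * (2 * M * B))) = \sum_(p : J * I) (2 * M) * ((t - s) * ((t - s) * B)).
  by rewrite sumr_const -mulr_natl; ring.
rewrite -big_split/=; apply: ler_sum => -[j k] _.
have [beta [rC cC b01 bs bN]] := Hb j k.
have tb : test_fun Cb rb beta.
  by split=> // l x; have /andP[h1 h2] := b01 l x; rewrite ger0_norm.
have [bb bLb mgb] := HB beta tb.
have b0 l x : 0 <= beta l x by have /andP[] := b01 l x.
have M2 : `|2 * M| = 2 * M by rewrite ger0_norm// mulr_ge0.
rewrite -[X in _ + X * _]M2.
apply: (one_step bp bL (mgp P sP) bb b0 bLb (mgb P sP) bms s0 st (FAp (j, k))).
move=> w r' [Aw [/= cj Lk]] sr rt.
have Xs := AN w Aw; have [b1 bz] := bN (pX w s) Xs cj.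
have sL l y : `|sg * AA phi y l| <= M by rewrite normrM sg1 mul1r; exact: bL.2.
(* The penalty [2 * M] suffices because [m] is at least [- M] at the starting point. *)
have mlow : - M <= state m s w.
  have h := Hm (pX w s) (pX w s) k Xs; rewrite subrr enorm0 in h.
  rewrite /state Lk; apply: le_trans (h (ltW z0)).
  by have := sL k (pX w s); rewrite ler_norml => /andP[].
have bsE : state beta s w = 1 by rewrite /state Lk.
rewrite bsE; have /andP[br0 br1] := b01 (pL w r') (pX w r').
rewrite -/(state beta r' w) in br0 br1.
have [br|br] := eqVneq (state beta r' w) 0.
  rewrite br subr0 mulr1; have := sL (pL w r') (pX w r'); rewrite ler_norml => /andP[_ h].
  by rewrite /state in h mlow *; lra.
have [Lr Xr] := bz _ _ br.
apply: (@le_trans _ _ (state m s w)).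
  by rewrite /state Lr Lk; exact: Hm.
by rewrite lerDl !mulr_ge0// subr_ge0.
Qed.

(** From beyond [N + 4] the generator of [phi] can only be negative once the path is in the ball of
    radius [N + 3], and by [outer_bump] the mean time spent there is of order [(t - s)^2]. *)
Lemma outer_step N C : 0 <= N -> 0 <= C -> exists2 K, 0 <= K &
  forall P phi s t (A : set Om), solves P -> test_fun C (N + 3) phi -> (forall l x, 0 <= phi l x) ->
  0 <= s -> s <= t -> <<s @genS R d n s%:E >> A -> (forall w, A w -> N + 4 < enorm (pX w s)) ->
  - Rintegral P setT (fun w => \1_A w * (state phi t w - state phi s w)) <= (t - s) * ((t - s) * K).
Proof.
move=> N0 C0; have [M M0 HM] := test_fun_pair (N + 3) C0.
have [Cb [beta [rC cC b01 bs b1]]] := outer_bump (d := d) N0.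
have Cb0 : 0 <= Cb by case: rC.
have [B B0 HB] := test_fun_pair (N + 4) Cb0.
exists (M * B); first by rewrite mulr_ge0.
move=> P phi s t A sP tp p0 s0 st FA AN.
have [bp bL mgp] := HM phi tp.
have tb : test_fun Cb (N + 4) (fun=> beta).
  by split=> // l x; have /andP[h1 h2] := b01 x; rewrite ger0_norm.
have [bb bLb mgb] := HB _ tb.
have b0 (l : I) x : 0 <= (fun=> beta) l x by have /andP[] := b01 x.
have mM : `|- M| = M by rewrite normrN ger0_norm.
have := one_step (sg := -1) (sg2 := - M) bp bL (mgp P sP) bb b0 bLb (mgb P sP) (bmeas_cst 0) s0 st FA.
rewrite mM mulN1r [X in _ <= X + _](_ : _ = 0); last first.
  rewrite (_ : (fun w => _) = fun=> 0); last by apply/funext => w; rewrite mulr0.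
  by rewrite Ex_cst mulr0.
rewrite add0r => H; apply: le_trans (H _) _; last first.
  by have -> : M * ((t - s) * ((t - s) * B)) = (t - s) * ((t - s) * (M * B)) by ring.
move=> w r' Aw sr rt; rewrite add0r.
have -> : state (fun=> beta) s w = 0 by rewrite /state bs//; exact: AN.
rewrite sub0r mulrNN mulN1r.
have [Xr|Xr] := leP (enorm (pX w r')) (N + 3).
  rewrite /state b1// mulr1.
  by have := bL.2 (pL w r') (pX w r'); rewrite ler_norml => /andP[h _]; rewrite lerNl.
have [rp _ sp _] := tp.
apply: (@le_trans _ _ 0); last exact: (mulr_ge0 M0 (b0 (pL w r') (pX w r'))).
by rewrite oppr_le0; exact: (Aop_outside_ge0 eps0 b nu q slT sls _ rp sp).
Qed.

End martingale_step.

Lemma increment_le (R : realType) (A B C E e K : R) : A - B <= E + K -> E <= C - B + e -> A <= C + e + K.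
Proof. by move=> h1 h2; lra. Qed.

Lemma decrement_le (R : realType) (DA DB E F S S' e dl K K' : R) : - DA <= E + dl * (dl * K) -> - DB <= dl * (dl * K') ->
  E <= S - S' + e -> DA + DB = F - S -> S' - e - dl * (dl * (K + K')) <= F.
Proof. by move=> h1 h2 h3 h4; rewrite !mulrDr; lra. Qed.

Lemma measurable_ball_event (R : realType) (d n : nat) (T : \bar R) (s N : R) : 0 <= s -> (s%:E <= T)%E ->
  measurable ([set w : @OmT R d n T | enorm (pX w s) <= N]).
Proof.
move=> s0 sT.
have mB : measurable ([set x : 'rV[R]_d | enorm x <= N] : set (Rd R d)).
  rewrite (_ : mkset _ = [set x : 'rV[R]_d | `]-oo, N]%classic (enorm x)]).
    by apply: borel_set => //; exact: borel_enorm.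
  by apply/seteqP; split => x /=; rewrite in_itv.
by have := @measurable_pX R d n T s s0 sT measurableT _ mB; rewrite setTI.
Qed.

Section almost_sure.
Context {R : realType} {dT : measure_display} {T : measurableType dT}.
Variable P : probability T R.
Local Notation Ex F := (Rintegral P setT F).

Lemma Ex_prob (S : set T) : measurable S -> Ex (\1_S) = fine (P S).
Proof.
move=> mS; rewrite (_ : \1_S = fun w => \1_S w * 1); last by apply/funext => w; rewrite mulr1.
by rewrite (Ex_indic P S (fun=> 1)) Rintegral_cst// mul1r.
Qed.

Lemma Ex_sure (S : set T) F (c : R) : measurable S -> P S = 1%E -> bmeas F -> (forall w, S w -> F w = c) -> Ex F = c.
Proof.
move=> mS PS bF FS; have bS : bmeas (\1_S : T -> R) := bmeas_indic mS.
have b1 := bmeasB (bmeas_cst (T := T) (1 : R)) bS.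
have bc := bmeas_cst (T := T) c.
have bFc := bmeasB bF bc.
have [_ [M HM]] := bFc.
have E0 : Ex (fun w => (F w - c) * (1 - \1_S w)) = 0.
  apply/eqP; rewrite -normr_le0.
  have X : forall w, `|(F w - c) * (1 - \1_S w)| <= M * (1 - \1_S w).
    move=> w; rewrite normrM indicE; case: (w \in S); last by rewrite subr0 normr1 !mulr1.
    by rewrite subrr normr0 !mulr0.
  have Y : Ex (fun w => M * (1 - \1_S w)) = 0.
    by rewrite (ExZ P M b1) (ExB P (bmeas_cst 1) bS) Ex_cst Ex_prob// PS /= subrr mulr0.
  rewrite ler_norml; apply/andP; split.
    rewrite -[X in - X]Y -mulN1r -ExZ; last exact: bmeasZ.
    apply: Ex_le; [exact: bmeasZ (bmeasZ _ b1)|exact: bmeasM|].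
    by move=> w; have := X w; rewrite ler_norml mulN1r => /andP[].
  rewrite -Y; apply: Ex_le; [exact: bmeasM|exact: bmeasZ|].
  by move=> w; have := X w; rewrite ler_norml => /andP[].
rewrite -[RHS](Ex_cst P c) -[RHS]addr0 -E0 -(ExD P bc (bmeasM bFc b1)).
congr (Rintegral _ _ _); apply/funext => w; rewrite indicE.
have [/set_mem/FS ->|_] := boolP (w \in S); first by rewrite subrr mul0r addr0.
by rewrite subr0 mulr1 addrC subrK.
Qed.

End almost_sure.

(** * One time step under the first and under the second law *)

Section martingale_increments.
Context {R : realType} {d n : nat}.
Hypothesis d0 : (0 < d)%N.
Local Notation V := 'rV[R]_d.
Local Notation I := 'I_n.+1.
Local Notation Ig mu D f := (Rintegral mu D f).
Local Notation Om := (OmegaS R d n).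
Variables (eps0 : R) (a : V -> I -> 'M[R]_d) (b : V -> I -> V) (nu : V -> I -> {measure set Rd R d -> \bar R})
  (q : V -> I -> I -> R) (sl : V -> I -> 'M[R]_d) (lambda0 Cn Qb : R).
Hypotheses (e0 : 0 < eps0) (l0 : 0 < lambda0).
Hypothesis nuC : forall x k, (\int[nu x k]_(u in @Rd0 R d) (mm u)%:E <= Cn%:E)%E.
Hypothesis slT : forall x k, (sl x k)^T = sl x k.
Hypothesis sls : forall x k, sl x k *m sl x k = a x k - lambda0%:M.
Hypothesis bB : forall N, exists B, forall x k, enorm x <= N -> enorm (b x k) <= B.
Hypothesis sB : forall N, exists B, forall x k, enorm x <= N -> forall i, enorm (row i (sl x k)) <= B.
Hypothesis qB : forall x k l, 0 <= qz q x k l <= Qb.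
Hypothesis tB : forall N e, 0 < e -> exists K0, forall K, (K0 <= K)%N -> forall x k, enorm x <= N ->
  Ig (nu x k) (tail K) (@mm R d) <= e.
Hypothesis am : forall k i j, borel_fun (fun x => a x k i j).
Hypothesis bm : forall k i, borel_fun (fun x => b x k 0 i).
Hypothesis qm : forall k l, borel_fun (fun x => q x k l).
Hypothesis num : forall k (B : set (Rd R d)), measurable B -> measurable_fun setT (fun x : Rd R d => nu x k B).
Implicit Types (phi beta : I -> V -> R) (C r s t : R) (w : Om).
Local Notation AA f := (Aop eps0 a b nu q (fun x l => f l x)).

Local Notation test_fun := (@test_fun R d n).
Local Notation solves := (solves eps0 a b nu q).

(** [local_step] with [m] the difference quotient: after multiplication by [delta] the values of
    [phi] cancel and those of [phi'] remain. *)
Lemma step_upper N zeta C r e : 0 < zeta -> 0 <= C -> 0 <= e -> exists2 K, 0 <= K &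
  forall P s delta (A : set Om) phi phi', solves P -> test_fun C r phi -> bborel phi' 1 -> 0 < delta -> 0 <= s ->
  <<s @genS R d n s%:E >> A -> (forall w, A w -> enorm (pX w s) <= N) ->
  (forall p y k, enorm p <= N -> enorm (y - p) <= zeta -> AA phi y k <= (phi' k p - phi k p) / delta + e) ->
  Rintegral P setT (fun w => \1_A w * state phi (s + delta) w) <=
  Rintegral P setT (fun w => \1_A w * state phi' s w) + delta * e + delta * (delta * K).
Proof.
move=> z0 C0 e0'; have [K K0 HK] := local_step e0 l0 nuC slT sls bB sB qB tB am bm qm num N r z0 C0.
have [M M0 HM] := test_fun_pair e0 l0 nuC slT sls bB sB qB tB am bm qm num r C0.
exists K => // P s delta A phi phi' sP tp bp' dl0 s0 FA AN H.
have [bp _ _] := HM phi tp.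
have bA : bmeas (\1_A : Om -> R) := bmeas_indic (filtration_measurable FA).
have st : s <= s + delta by rewrite lerDl ltW.
have s1 : 0 <= s + delta by rewrite addr_ge0// ltW.
pose m k p := (phi' k p - phi k p) / delta + e.
have bmm : bborel m ((1 + 1) / delta + e).
  split=> [k|k x].
    apply: measurable_funD; last exact: measurable_cst.
    apply: measurable_funM; last exact: measurable_cst.
    by apply: measurable_funB; [exact: bp'.1|exact: bp.1].
  rewrite /m (le_trans (ler_normD _ _))// lerD ?(ger0_norm e0')//.
  rewrite normrM (ger0_norm (_ : 0 <= delta^-1)) ?invr_ge0 ?(ltW dl0)// ler_wpM2r ?invr_ge0 ?(ltW dl0)//.
  by apply: le_trans (ler_normB _ _) _; rewrite lerD// ?bp'.2 ?bp.2.
have H1 p y k : enorm p <= N -> enorm (y - p) <= zeta -> 1 * AA phi y k <= m k p by rewrite mul1r; exact: H.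
have X := HK P 1 phi m _ s (s + delta) A sP (normr1 R) tp bmm s0 st FA AN H1.
have E1 : s + delta - s = delta by ring.
rewrite E1 mul1r in X.
have bs1 := bmeasM bA (bmeas_state bp s1); have bs0 := bmeasM bA (bmeas_state bp s0).
have bs' := bmeasM bA (bmeas_state bp' s0).
rewrite (_ : (fun w => \1_A w * (state phi (s + delta) w - state phi s w)) =
  fun w => \1_A w * state phi (s + delta) w - \1_A w * state phi s w) in X; last by apply/funext => w; rewrite mulrBr.
rewrite (ExB P bs1 bs0) in X.
have Y : delta * Rintegral P setT (fun w => \1_A w * state m s w) <=
    Rintegral P setT (fun w => \1_A w * state phi' s w) - Rintegral P setT (fun w => \1_A w * state phi s w) + delta * e.
  rewrite -(ExB P bs' bs0) -(ExZ P delta (bmeasM bA (bmeas_state bmm s0))) -[X in _ + X](Ex_cst P) -(ExD P (bmeasB bs' bs0) (bmeas_cst _)).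
  apply: Ex_le; [exact: bmeasZ (bmeasM bA (bmeas_state bmm s0))|exact: bmeasD (bmeasB bs' bs0) (bmeas_cst _)|].
  move=> w; rewrite -mulrBr mulrCA /state /m mulrDr mulrCA mulfV ?gt_eqF// mulr1 mulrDr lerD2l.
  rewrite ler_piMl ?mulr_ge0 ?(ltW dl0)//; rewrite indicE; exact: lern1.
exact: increment_le X Y.
Qed.

(** Unlike the first law, the second is not restricted to a ball. The state is split at radius
    [N + 4]: [local_step] with sign -1 applies inside, and [outer_step] outside, where [phi] and
    [phi'] vanish. *)
Lemma step_lower N zeta C e : 0 < zeta -> 0 <= C -> 0 <= e -> 0 <= N -> exists2 K, 0 <= K &
  forall P s delta phi phi', solves P -> test_fun C (N + 3) phi -> (forall l x, 0 <= phi l x) -> bborel phi' 1 ->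
  (forall l x, N + 4 < enorm x -> phi' l x = 0) -> 0 < delta -> 0 <= s ->
  (forall p y k, enorm p <= N + 4 -> enorm (y - p) <= zeta -> (phi' k p - phi k p) / delta - e <= AA phi y k) ->
  Rintegral P setT (state phi' s) - delta * e - delta * (delta * K) <= Rintegral P setT (state phi (s + delta)).
Proof.
move=> z0 C0 e0' N0.
have [K K0 HK] := local_step e0 l0 nuC slT sls bB sB qB tB am bm qm num (N + 4) (N + 3) z0 C0.
have [K' K'0 HK'] := outer_step e0 l0 nuC slT sls bB sB qB tB am bm qm num N0 C0.
have [M M0 HM] := test_fun_pair e0 l0 nuC slT sls bB sB qB tB am bm qm num (N + 3) C0.
exists (K + K'); first exact: addr_ge0.
move=> P s delta phi phi' sP tp p0 bp' sp' dl0 s0 H.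
have [bp _ _] := HM phi tp; have [_ _ sp _] := tp.
pose A : set Om := [set w | enorm (pX w s) <= N + 4].
have FA : <<s @genS R d n s%:E >> A.
  exact: (@measurable_ball_event R d n s%:E s (N + 4) s0 (lexx _)).
have FAc : <<s @genS R d n s%:E >> (~` A).
  have h1 : measurable (A : set (@OmT R d n s%:E)) by [].
  exact: (measurableC h1).
have bA : bmeas (\1_A : Om -> R) := bmeas_indic (filtration_measurable FA).
have bAc : bmeas (\1_(~` A) : Om -> R) := bmeas_indic (filtration_measurable FAc).
have st : s <= s + delta by rewrite lerDl ltW.
have s1 : 0 <= s + delta by rewrite addr_ge0// ltW.
have E1 : s + delta - s = delta by ring.
pose m k p := e - (phi' k p - phi k p) / delta.
have bmm : bborel m (e + (1 + 1) / delta).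
  split=> [k|k x].
    apply: measurable_funB; first exact: measurable_cst.
    apply: measurable_funM; last exact: measurable_cst.
    by apply: measurable_funB; [exact: bp'.1|exact: bp.1].
  rewrite /m (le_trans (ler_normB _ _))// lerD ?(ger0_norm e0')//.
  rewrite normrM (ger0_norm (_ : 0 <= delta^-1)) ?invr_ge0 ?(ltW dl0)// ler_wpM2r ?invr_ge0 ?(ltW dl0)//.
  by apply: le_trans (ler_normB _ _) _; rewrite lerD// ?bp'.2 ?bp.2.
have H1 p y k : enorm p <= N + 4 -> enorm (y - p) <= zeta -> -1 * AA phi y k <= m k p.
  by move=> pN yp; rewrite mulN1r lerNl opprB; exact: H.
have X := HK P (-1) phi m _ s (s + delta) A sP (ltac:(by rewrite normrN normr1)) tp bmm s0 st FA (fun w h => h) H1.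
have X' := HK' P phi s (s + delta) (~` A) sP tp p0 s0 st FAc (fun w (h : ~ _) => ltac:(by rewrite ltNge; apply/negP)).
rewrite E1 mulN1r in X; rewrite E1 in X'.
have bs1 := bmeas_state bp s1; have bs0 := bmeas_state bp s0; have bs' := bmeas_state bp' s0.
have bd := bmeasB bs1 bs0.
have Z : Rintegral P setT (fun w => \1_A w * (state phi (s + delta) w - state phi s w)) +
   Rintegral P setT (fun w => \1_(~` A) w * (state phi (s + delta) w - state phi s w)) =
   Rintegral P setT (state phi (s + delta)) - Rintegral P setT (state phi s).
  rewrite -(ExB P bs1 bs0) -(ExD P (bmeasM bA bd) (bmeasM bAc bd)); congr (Rintegral _ _ _); apply/funext => w.
  by rewrite !indicE in_setC; case: (w \in A); rewrite /= ?mul1r ?mul0r ?addr0 ?add0r.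
have bms := bmeas_state bmm s0.
have Y : delta * Rintegral P setT (fun w => \1_A w * state m s w) <=
    Rintegral P setT (state phi s) - Rintegral P setT (state phi' s) + delta * e.
  rewrite -(ExB P bs0 bs') -(ExZ P delta (bmeasM bA bms)) -[X in _ + X](Ex_cst P) -(ExD P (bmeasB bs0 bs') (bmeas_cst _)).
  apply: Ex_le; [exact: bmeasZ (bmeasM bA bms)|exact: bmeasD (bmeasB bs0 bs') (bmeas_cst _)|].
  move=> w; have mE : delta * state m s w = state phi s w - state phi' s w + delta * e.
    by rewrite /state /m; field; rewrite gt_eqF.
  rewrite mulrCA mE indicE; have [_|] := boolP (w \in A); first by rewrite mul1r.
  rewrite notin_setE /A /= => /negP; rewrite -ltNge => Xs; rewrite mul0r /state sp' ?sp ?subrr ?add0r ?mulr_ge0 ?(ltW dl0)//.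
  by apply: lt_trans Xs; rewrite ltrD2l ltr_nat.
exact: decrement_le X X' Y Z.
Qed.

End martingale_increments.

(** * Iteration over the time grid *)

Lemma base_le (R : realType) (A S S' f g e t : R) : A <= S -> S - f <= e -> - e <= S' - g -> f - g <= t -> A - S' <= t + 2 * e.
Proof. by move=> h1 h2 h3 h4; lra. Qed.

Lemma induct_le (R : realType) (A B C D F e dl K1 K2 t u : R) (j : nat) : A <= B -> B <= C + e + dl * (dl * K1) -> D - e - dl * (dl * K2) <= F ->
  C - D <= t + u + j%:R * (2 * e + dl * (dl * (K1 + K2))) -> A - F <= t + u + j.+1%:R * (2 * e + dl * (dl * (K1 + K2))).
Proof. by move=> h1 h2 h3 h4; rewrite -natr1 mulrDl mul1r; move: h4; set J := j%:R * _; rewrite !mulrDr; lra. Qed.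

Section initial_class.
Context {R : realType} {d n : nat}.
Local Notation V := 'rV[R]_d.
Local Notation I := 'I_n.+1.
Implicit Types (x y w : V) (f : I -> V -> R).
Variables (lam eta : R).
Hypotheses (lamp : 0 < lam) (eta0 : 0 < eta).

Lemma Th_le c be w : 0 <= c -> Th lam eta c be w <= c * (enorm w + eta) + be.
Proof.
move=> c0; rewrite /Th lerD2r ler_wpM2l//.
have R0 := Rr_gt0 eta0 w; have l0 : 0 < 1 + lam * Rr eta w by rewrite addr_gt0// mulr_gt0.
apply: (@le_trans _ _ (Rr eta w)); last exact: Rr_le eta0 w.
by rewrite /psi ler_pdivrMr// ler_peMr ?(ltW R0)// lerDl mulr_ge0 ?ltW.
Qed.

(** If [lam R <= 1], then [psi >= R / 2] and twice the Lipschitz constant suffices; otherwise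
    [psi >= 1 / (2 lam)] and [kap >= 2 lam] makes the cost at least 1. *)
Lemma Th_init L kap w (t : R) : 0 <= L -> 2 * lam <= kap -> t <= 1 -> t <= L * enorm w ->
  t <= Th lam eta (2 * L + kap) 0 w.
Proof.
move=> L0 kl t1 tL; rewrite /Th addr0 mulrDl.
have R0 := Rr_gt0 eta0 w; have l0 : 0 < 1 + lam * Rr eta w by rewrite addr_gt0// mulr_gt0.
have k0 : 0 <= kap by apply: le_trans kl; rewrite mulr_ge0// ltW.
have p0 : 0 <= psi lam (Rr eta w) by rewrite /psi divr_ge0 ?ltW.
have wR := Rr_ge eta w.
have [h|h] := leP (lam * Rr eta w) 1.
  have p1 : Rr eta w <= 2 * psi lam (Rr eta w).
    rewrite /psi mulrA ler_pdivlMr// mulrC ler_wpM2r ?(ltW R0)//; lra.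
  apply: (@le_trans _ _ (2 * L * psi lam (Rr eta w))); last by rewrite lerDl mulr_ge0.
  apply: le_trans tL _; rewrite [2 * L]mulrC -mulrA ler_wpM2l//; exact: le_trans wR p1.
have p1 : 1 <= 2 * lam * psi lam (Rr eta w).
  rewrite /psi mulrA ler_pdivlMr// mul1r; lra.
apply: le_trans t1 _; apply: le_trans p1 _.
apply: (@le_trans _ _ (kap * psi lam (Rr eta w))); first by rewrite ler_wpM2r.
by rewrite lerDr; apply: mulr_ge0 => //; rewrite mulr_ge0.
Qed.

Definition cutoff (N : R) f : I -> V -> R := fun k x => chi N x * f k x.

Lemma cutoff01 N f : (forall k x, 0 <= f k x <= 1) -> forall k x, 0 <= cutoff N f k x <= 1.
Proof.
move=> f01 k x; have /andP[a1 a2] := f01 k x; have /andP[b1 b2] := chi01 N x.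
by rewrite /cutoff mulr_ge0//= mulr_ile1.
Qed.

Lemma cutoff_elip N L f : (forall k x, 0 <= f k x <= 1) -> (forall k, elip L (f k)) -> forall k, elip (L + 2) (cutoff N f k).
Proof.
move=> f01 fL k x y; have /andP[a1 a2] := f01 k x; have /andP[b1 b2] := chi01 N y.
rewrite /cutoff (_ : _ - _ = (chi N x - chi N y) * f k x + chi N y * (f k x - f k y)); last by ring.
apply: le_trans (ler_normD _ _) _; rewrite [leRHS]mulrDl [leRHS]addrC; apply: lerD.
  by rewrite normrM (ger0_norm a1); apply: le_trans (@chi_elip R d N x y); rewrite ler_piMr.
by rewrite normrM (ger0_norm b1); apply: le_trans (fL k x y); rewrite ler_piMl.
Qed.

(** The recursion starts from equal functions at [s = 1 / (2 (L + 2))], where [L + 2] is a Lipschitz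
    constant of the truncated function. *)
Lemma cutoff_cls N L kap Kf f : 0 <= L -> 2 * lam <= kap -> L + 2 <= Kf -> (forall k x, 0 <= f k x <= 1) -> (forall k, elip L (f k)) ->
  cls lam kap N eta Kf (2 * (L + 2))^-1 0 (cutoff N f) (cutoff N f).
Proof.
move=> L0 kl LK f01 fL.
have cL k : elip Kf (cutoff N f k).
  by move=> x y; apply: le_trans (cutoff_elip N f01 fL k x y) _; rewrite ler_wpM2r// enorm_ge0.
have c0 k x : N + 1 < enorm x -> cutoff N f k x = 0 by move=> xN; rewrite /cutoff chi_out// mul0r.
split=> //; [exact: cutoff01|exact: cutoff01|split=> //].
  by move=> k x xN; apply: c0; apply: lt_trans xN; rewrite ltrD2l ltr1n.
move=> k x x'; rewrite invrK; apply: Th_init => //; first by rewrite addr_ge0.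
  have /andP[_ h1] := cutoff01 N f01 k x; have /andP[h2 _] := cutoff01 N f01 k x'.
  by rewrite lerBlDr (le_trans h1)// lerDl.
exact: le_trans (ler_norm _) (cutoff_elip N f01 fL k x x').
Qed.

End initial_class.

Section iteration.
Context {R : realType} {d n : nat}.
Hypothesis d0 : (0 < d)%N.
Local Notation V := 'rV[R]_d.
Local Notation I := 'I_n.+1.
Local Notation Ig mu D f := (Rintegral mu D f).
Implicit Types (x y p w v : V) (k l : I) (f g : I -> V -> R).
Variables (eps0 : R) (a : V -> I -> 'M[R]_d) (b : V -> I -> V) (nu : V -> I -> {measure set Rd R d -> \bar R})
  (q : V -> I -> I -> R) (sl : V -> I -> 'M[R]_d) (lambda0 Cn Qb Q H delta1 : R) (theta : R -> R).
Hypotheses (e0 : 0 < eps0) (l0 : 0 < lambda0).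
Hypothesis nuC : forall x k, (\int[nu x k]_(u in @Rd0 R d) (mm u)%:E <= Cn%:E)%E.
Hypothesis slT : forall x k, (sl x k)^T = sl x k.
Hypothesis sls : forall x k, sl x k *m sl x k = a x k - lambda0%:M.
Hypothesis bB : forall N, exists B, forall x k, enorm x <= N -> enorm (b x k) <= B.
Hypothesis sB : forall N, exists B, forall x k, enorm x <= N -> forall i, enorm (row i (sl x k)) <= B.
Hypothesis tB : forall N e, 0 < e -> exists K0, forall K, (K0 <= K)%N -> forall x k, enorm x <= N ->
  Ig (nu x k) (tail K) (@mm R d) <= e.
Hypothesis qB : forall x k l, 0 <= qz q x k l <= Qb.
Hypotheses (H0 : 0 <= H) (Q0 : 0 <= Q) (delta10 : 0 < delta1).
Hypothesis th0 : forall r, 0 < r -> r <= delta1 -> 0 <= theta r.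
Hypothesis th1 : forall r, 0 < r -> r <= delta1 -> theta r <= 1.
Hypothesis thlim : forall t, 0 < t -> exists2 r1, 0 < r1 & forall r, 0 < r -> r <= r1 -> r <= delta1 -> theta r <= t.
Hypothesis SFb : forall k x z, enorm (x - z) <= delta1 ->
  2 * inner (x - z) (b x k - b z k) + hs2 (sl x k - sl z k) <= 2 * H * enorm (x - z) * theta (enorm (x - z)).
Hypothesis SFt : forall k x z, enorm (x - z) <= delta1 ->
  (tv_integral (@enorm R d) (nu x k) (nu z k) (@Rd0 R d) <= (H / 2 * theta (enorm (x - z)))%:E)%E.
Hypothesis F2 : forall k x z, \sum_(l < n.+1) `|qz q x k l - qz q z k l| <= Q * enorm (x - z).
Variables (lam kap : R).
Hypotheses (lam1 : 1 <= lam) (lamd : 2 <= lam * delta1) (lamH : 16 * (2 * H + 3) <= lam * lambda0)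
  (kapl : 2 * lam <= kap) (kapQ : Q / lam <= kap).
Local Notation AA f := (Aop eps0 a b nu q (fun x l => f l x)).

Hypothesis am : forall k i j, borel_fun (fun x => a x k i j).
Hypothesis bm : forall k i, borel_fun (fun x => b x k 0 i).
Hypothesis qm : forall k l, borel_fun (fun x => q x k l).
Hypothesis num : forall k (B : set (Rd R d)), measurable B -> measurable_fun setT (fun x : Rd R d => nu x k B).
Local Notation Om := (OmegaS R d n).
Local Notation solves := (solves eps0 a b nu q).

Lemma cls_tests N eta Kf eps C sg be f g : 0 <= N -> 0 <= Kf -> 0 < eps -> 8 * (eps * d%:R) <= 1 ->
  (forall K (F : V -> R), elip K F -> (forall x, `|F x| <= 1) -> reg C (Sm eps F)) ->
  cls lam kap N eta Kf sg be f g ->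
  test_fun C (N + 2) (fun l => Sm eps (f l)) /\ test_fun C (N + 3) (fun l => Sm eps (g l)) /\
  ((forall l x, 0 <= Sm eps (f l) x) /\ (forall l x, 0 <= Sm eps (g l) x)).
Proof.
move=> N0 Kf0 ep0 e8 HC [f01 g01 fL gL [fs gs _]].
have n1 (F : I -> V -> R) : (forall k x, 0 <= F k x <= 1) -> forall k x, `|F k x| <= 1.
  by move=> H1 k x; have /andP[u1 u2] := H1 k x; rewrite ger0_norm.
have ge0 (F : I -> V -> R) : (forall k, elip Kf (F k)) -> (forall k x, 0 <= F k x <= 1) -> forall k x, 0 <= Sm eps (F k) x.
  by move=> FL F01 k x; apply: (Sm_ge0 ep0 _ (FL k)) => y; have /andP[] := F01 k y.
have le1 (F : I -> V -> R) : (forall k, elip Kf (F k)) -> (forall k x, 0 <= F k x <= 1) -> forall k x, Sm eps (F k) x <= 1.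
  by move=> FL F01 k x; apply: (Sm_le1 ep0 _ (FL k)) => y; have /andP[] := F01 k y.
have e1 : eps * d%:R <= 1 by lra.
split; last split; last by split; apply: ge0.
- split.
  + by move=> l; exact: HC (fL l) (n1 _ f01 l).
  + by move=> l; exact: (Sm_Cc ep0 Kf0 (fL l) (n1 _ f01 l) (fs l)).
  + move=> l x xN; apply: (Sm_supp ep0 (fs l)); apply: le_lt_trans xN.
    rewrite (_ : N + 2 = N + 1 + 1); last by ring.
    by rewrite lerD2l.
  + by move=> l x; rewrite ger0_norm ?ge0// le1.
- split.
  + by move=> l; exact: HC (gL l) (n1 _ g01 l).
  + by move=> l; exact: (Sm_Cc ep0 Kf0 (gL l) (n1 _ g01 l) (gs l)).
  + move=> l x xN; apply: (Sm_supp ep0 (gs l)); apply: le_lt_trans xN.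
    rewrite (_ : N + 3 = N + 2 + 1); last by ring.
    by rewrite lerD2l.
  + by move=> l x; rewrite ger0_norm ?ge0// le1.
Qed.

Definition stays (N delta : R) (j : nat) : set Om := [set w | forall i, (i <= j)%N -> enorm (pX w (i%:R * delta)) <= N].

Lemma stays_filtration N delta j : 0 <= delta -> <<s @genS R d n (j%:R * delta)%:E >> (stays N delta j).
Proof.
move=> dl0; elim: j => [|j IH].
  have h := @measurable_ball_event R d n (0%:R * delta)%:E (0%:R * delta) N (ltac:(by rewrite mul0r)) (lexx _).
  rewrite (_ : stays N delta 0 = [set w | enorm (pX w (0%:R * delta)) <= N]); first exact: h.
  by apply/seteqP; split => w /= Hw; [exact: Hw|move=> i; rewrite leqn0 => /eqP ->].
have h := @measurable_ball_event R d n (j.+1%:R * delta)%:E (j.+1%:R * delta) N (ltac:(by rewrite mulr_ge0)) (lexx _).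
have h2 : <<s @genS R d n (j.+1%:R * delta)%:E >> (stays N delta j).
  by apply: filtration_sub IH; rewrite lee_fin ler_wpM2r// ler_nat.
rewrite (_ : stays N delta j.+1 = stays N delta j `&` [set w | enorm (pX w (j.+1%:R * delta)) <= N]).
  by have h3 : measurable (stays N delta j : set (@OmT R d n (j.+1%:R * delta)%:E)) by []; exact: (measurableI _ _ h3 h).
apply/seteqP; split => w /= Hw.
  by split; [move=> i ij; apply: Hw; exact: leqW|exact: Hw].
by case: Hw => H1 H2 i; rewrite leq_eqVlt => /orP[/eqP ->//|]; rewrite ltnS; exact: H1.
Qed.

Lemma start_event x k : measurable ([set w : Om | pX w 0 = x /\ pL w 0 = k]).
Proof.
have mB : measurable ([set y : V | enorm (y - x) <= 0] : set (Rd R d)).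
  rewrite (_ : mkset _ = [set y : V | `]-oo, 0]%classic (enorm (y - x))]); last by apply/seteqP; split => y /=; rewrite in_itv.
  apply: borel_set => //; apply: borel_cont; apply: (@elip_continuous _ _ 1) => // y y'.
  have := enorm_lip (y - x) (y' - x); rewrite mul1r; congr (_ <= enorm _); by rewrite opprB addrA subrK.
have h1 := @measurable_pX R d n +oo%E 0 (lexx 0) (leey _) measurableT _ mB; rewrite setTI in h1.
have h2 := @measurable_pL R d n +oo%E 0 k (lexx 0) (leey _).
rewrite (_ : mkset _ = (fun w : Om => (pX w 0 : Rd R d)) @^-1` [set y : V | enorm (y - x) <= 0] `&` [set w : Om | pL w 0 = k]).
  exact: (measurableI _ _ h1 h2).
apply/seteqP; split => w /= [H1 H2]; split=> //; first by rewrite H1 subrr enorm0.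
by apply/eqP; rewrite -subr_eq0; apply/eqP/enorm_eq0/eqP; rewrite eq_le H1 enorm_ge0.
Qed.

(** Backward induction: [HS] replaces a pair at time [(j + 1) * delta] by one at time [j * delta],
    until time 0, where the starting points are known. The martingale errors [delta^2 K] per step
    sum to order [delta]. *)
Lemma iterate N eta eps C zeta e s0 Kf bbar delta0 : 0 <= N -> 0 <= Kf -> 0 < s0 -> 0 <= bbar -> 0 < eps -> 8 * (eps * d%:R) <= 1 ->
  Kf * (eps * d%:R) <= e -> 0 <= C -> 0 <= e -> 0 < zeta ->
  (forall K (F : V -> R), elip K F -> (forall x, `|F x| <= 1) -> reg C (Sm eps F)) ->
  (forall delta sg be f g, 0 < delta -> delta <= delta0 -> s0 <= sg -> 0 <= be -> cls lam kap N eta Kf sg be f g ->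
    exists f' g' : I -> V -> R, [/\ cls lam kap N eta Kf (sg + delta) (be + delta * bbar) f' g',
     forall p y k, enorm p <= N -> enorm (y - p) <= zeta ->
       AA (fun l => Sm eps (f l)) y k <= (Sm eps (f' k) p - Sm eps (f k) p) / delta + e &
     forall p y k, enorm p <= N + 4 -> enorm (y - p) <= zeta ->
       (Sm eps (g' k) p - Sm eps (g k) p) / delta - e <= AA (fun l => Sm eps (g l)) y k]) ->
  exists2 K, 0 <= K & forall P1 P2 x z k delta (j : nat) sg be f g, solves P1 -> solves P2 ->
    P1 [set w : Om | pX w 0 = x /\ pL w 0 = k] = 1%E -> P2 [set w : Om | pX w 0 = z /\ pL w 0 = k] = 1%E ->
    0 < delta -> delta <= delta0 -> s0 <= sg -> 0 <= be -> cls lam kap N eta Kf sg be f g ->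
    Rintegral P1 setT (fun w : Om => \1_(stays N delta j) w * state (fun l => Sm eps (f l)) (j%:R * delta) w) -
    Rintegral P2 setT (state (fun l => Sm eps (g l)) (j%:R * delta)) <=
    Th lam eta ((sg + j%:R * delta)^-1 + kap) (be + j%:R * delta * bbar) (x - z) + 2 * e + j%:R * (2 * (delta * e) + delta * (delta * K)).
Proof.
move=> N0 Kf0 s00 bb0 ep0 e8 Ke C0 e0' z0 HC HS.
have [K1 K10 H1] := step_upper e0 l0 nuC slT sls bB sB qB tB am bm qm num N (N + 2) z0 C0 e0'.
have [K2 K20 H2] := step_lower e0 l0 nuC slT sls bB sB qB tB am bm qm num z0 C0 e0' N0.
exists (K1 + K2); first exact: addr_ge0.
move=> P1 P2 x z k delta j sg be f g sP1 sP2 st1 st2 dl0 dlL.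
have [M M0 HM] := test_fun_pair e0 l0 nuC slT sls bB sB qB tB am bm qm num (N + 2) C0.
have [M' M'0 HM'] := test_fun_pair e0 l0 nuC slT sls bB sB qB tB am bm qm num (N + 3) C0.
elim: j sg be f g => [|j IH] sg be f g ssg be0 fg.
  have [t1 [t2 [p1 p2]]] := cls_tests N0 Kf0 ep0 e8 HC fg.
  have [b1 _ _] := HM _ t1; have [b2 _ _] := HM' _ t2.
  rewrite !mul0r !addr0.
  have FA := @stays_filtration N delta 0 (ltW dl0); have bA : bmeas (\1_(stays N delta 0) : Om -> R) := bmeas_indic (filtration_measurable FA).
  have s1 := bmeas_state b1 (lexx 0); have s2 := bmeas_state b2 (lexx 0).
  have X1 : Rintegral P1 setT (fun w : Om => \1_(stays N delta 0) w * state (fun l => Sm eps (f l)) 0 w) <= Sm eps (f k) x.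
    rewrite -(Ex_sure (start_event x k) st1 s1 (c := Sm eps (f k) x)); last by move=> w [wx wk]; rewrite /state wx wk.
    apply: (Ex_le P1 (bmeasM bA s1) s1).
    by move=> w; rewrite ler_piMl ?p1// indicE; exact: lern1.
  have X2 : Rintegral P2 setT (state (fun l => Sm eps (g l)) 0) = Sm eps (g k) z.
    by apply: (Ex_sure (start_event z k) st2 s2) => w [wx wk]; rewrite /state wx wk.
  have [_ _ fL gL [_ _ fgT]] := fg.
  have Y1 := le_trans (Sm_close ep0 x Kf0 (fL k)) Ke; have Y2 := le_trans (Sm_close ep0 z Kf0 (gL k)) Ke.
  rewrite ler_norml in Y1; rewrite ler_norml in Y2; have /andP[_ Y1'] := Y1; have /andP[Y2' _] := Y2.
  rewrite X2; exact: base_le X1 Y1' Y2' (fgT k x z).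
have [f' [g' [fg' Hf Hg]]] := HS delta sg be f g dl0 dlL ssg be0 fg.
have ssg' : s0 <= sg + delta by rewrite (le_trans ssg)// lerDl ltW.
have be0' : 0 <= be + delta * bbar by rewrite addr_ge0// mulr_ge0// ltW.
have IHj := IH _ _ f' g' ssg' be0' fg'.
have [t1 [t2 [p1 p2]]] := cls_tests N0 Kf0 ep0 e8 HC fg; have [b1 _ _] := HM _ t1.
have [t1' [t2' [p1' p2']]] := cls_tests N0 Kf0 ep0 e8 HC fg'; have [b1' _ _] := HM _ t1'; have [b2' _ _] := HM' _ t2'.
have jd : 0 <= j%:R * delta by rewrite mulr_ge0// ltW.
have jE : j.+1%:R * delta = j%:R * delta + delta by rewrite -natr1 mulrDl mul1r.
have FA := @stays_filtration N delta j (ltW dl0).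
have X1 := H1 P1 (j%:R * delta) delta (stays N delta j) _ _ sP1 t1 b1' dl0 jd FA (fun (w : Om) h => h j (leqnn j)) Hf.
have s2' l x' : N + 4 < enorm x' -> Sm eps (g' l) x' = 0.
  by move=> xN; case: t2' => _ _ s _; apply: s; apply: lt_trans xN; rewrite ltrD2l ltr_nat.
have X2 := H2 P2 (j%:R * delta) delta _ _ sP2 t2 p2 b2' s2' dl0 jd Hg.
(* Dropping the confinement at the last grid time is allowed because the function is nonnegative. *)
have X3 : Rintegral P1 setT (fun w : Om => \1_(stays N delta j.+1) w * state (fun l => Sm eps (f l)) (j.+1%:R * delta) w) <=
   Rintegral P1 setT (fun w : Om => \1_(stays N delta j) w * state (fun l => Sm eps (f l)) (j%:R * delta + delta) w).
  rewrite -jE; have jd' : 0 <= j.+1%:R * delta by rewrite mulr_ge0// ltW.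
  have bs := bmeas_state b1 jd'.
  have bA : bmeas (\1_(stays N delta j) : Om -> R) := bmeas_indic (filtration_measurable FA).
  have bA' : bmeas (\1_(stays N delta j.+1) : Om -> R) := bmeas_indic (filtration_measurable (@stays_filtration N delta j.+1 (ltW dl0))).
  apply: Ex_le; [exact: bmeasM|exact: bmeasM|move=> w].
  rewrite ler_wpM2r ?p1// !indicE; have [/set_mem h|_] := boolP (w \in stays N delta j.+1); last by rewrite ler0n.
  by rewrite mem_set// => i ij; apply: h; exact: leqW.
rewrite -jE in X2.
have E1 : sg + delta + j%:R * delta = sg + j.+1%:R * delta by rewrite jE; ring.
have E2 : be + delta * bbar + j%:R * delta * bbar = be + j.+1%:R * delta * bbar by rewrite jE; ring.
rewrite E1 E2 in IHj.
exact: induct_le X3 X1 X2 IHj.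
Qed.

End iteration.

Lemma total_le (R : realType) (F1 F2 A1 A2 B1 B2 e e' th c w eta bT u : R) :
  F1 <= A1 + e -> A1 <= B1 + e' -> B2 - e' <= F2 -> B1 - B2 <= th + 2 * e' + u -> th <= c * (w + eta) + bT ->
  c * eta <= e -> bT <= e -> u <= 2 * (e - 2 * e') -> 0 <= e' -> F1 - F2 <= c * w + 5 * e.
Proof. by move=> h1 h2 h3 h4 h5 h6 h7 h8; rewrite mulrDr in h5; lra. Qed.

(** * Comparison of two starting points *)

Section comparison.
Context {R : realType} {d n : nat}.
Hypothesis d0 : (0 < d)%N.
Local Notation V := 'rV[R]_d.
Local Notation I := 'I_n.+1.
Local Notation Ig mu D f := (Rintegral mu D f).
Implicit Types (x y p w v : V) (k l : I) (f g : I -> V -> R).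
Variables (eps0 : R) (a : V -> I -> 'M[R]_d) (b : V -> I -> V) (nu : V -> I -> {measure set Rd R d -> \bar R})
  (q : V -> I -> I -> R) (sl : V -> I -> 'M[R]_d) (lambda0 Cn Qb Q H delta1 : R) (theta : R -> R).
Hypotheses (e0 : 0 < eps0) (l0 : 0 < lambda0).
Hypothesis nuC : forall x k, (\int[nu x k]_(u in @Rd0 R d) (mm u)%:E <= Cn%:E)%E.
Hypothesis slT : forall x k, (sl x k)^T = sl x k.
Hypothesis sls : forall x k, sl x k *m sl x k = a x k - lambda0%:M.
Hypothesis bB : forall N, exists B, forall x k, enorm x <= N -> enorm (b x k) <= B.
Hypothesis sB : forall N, exists B, forall x k, enorm x <= N -> forall i, enorm (row i (sl x k)) <= B.
Hypothesis tB : forall N e, 0 < e -> exists K0, forall K, (K0 <= K)%N -> forall x k, enorm x <= N ->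
  Ig (nu x k) (tail K) (@mm R d) <= e.
Hypothesis qB : forall x k l, 0 <= qz q x k l <= Qb.
Hypotheses (H0 : 0 <= H) (Q0 : 0 <= Q) (delta10 : 0 < delta1).
Hypothesis th0 : forall r, 0 < r -> r <= delta1 -> 0 <= theta r.
Hypothesis th1 : forall r, 0 < r -> r <= delta1 -> theta r <= 1.
Hypothesis thlim : forall t, 0 < t -> exists2 r1, 0 < r1 & forall r, 0 < r -> r <= r1 -> r <= delta1 -> theta r <= t.
Hypothesis SFb : forall k x z, enorm (x - z) <= delta1 ->
  2 * inner (x - z) (b x k - b z k) + hs2 (sl x k - sl z k) <= 2 * H * enorm (x - z) * theta (enorm (x - z)).
Hypothesis SFt : forall k x z, enorm (x - z) <= delta1 ->
  (tv_integral (@enorm R d) (nu x k) (nu z k) (@Rd0 R d) <= (H / 2 * theta (enorm (x - z)))%:E)%E.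
Hypothesis F2 : forall k x z, \sum_(l < n.+1) `|qz q x k l - qz q z k l| <= Q * enorm (x - z).
Variables (lam kap : R).
Hypotheses (lam1 : 1 <= lam) (lamd : 2 <= lam * delta1) (lamH : 16 * (2 * H + 3) <= lam * lambda0)
  (kapl : 2 * lam <= kap) (kapQ : Q / lam <= kap).

Hypothesis am : forall k i j, borel_fun (fun x => a x k i j).
Hypothesis bm : forall k i, borel_fun (fun x => b x k 0 i).
Hypothesis qm : forall k l, borel_fun (fun x => q x k l).
Hypothesis num : forall k (B : set (Rd R d)), measurable B -> measurable_fun setT (fun x : Rd R d => nu x k B).
Local Notation Om := (OmegaS R d n).
Local Notation solves := (solves eps0 a b nu q).



(** [L] does not enter the bound: from any [s0 > 0] the final cost coefficient is below
    [T^-1 + kap], and the parameters that depend on [L] only dictate how fine the time step must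
    be. *)
Lemma two_point T e N x z k P1 P2 f L : 0 < T -> 0 < e -> 0 <= N -> solves P1 -> solves P2 ->
  P1 [set w : Om | pX w 0 = x /\ pL w 0 = k] = 1%E -> P2 [set w : Om | pX w 0 = z /\ pL w 0 = k] = 1%E ->
  (forall k x, 0 <= f k x <= 1) -> 0 <= L -> (forall k, elip L (f k)) ->
  (forall delta j, 0 <= delta -> j%:R * delta <= T -> 1 - e <= Rintegral P1 setT (\1_(stays N delta j))) ->
  Rintegral P1 setT (state f T) - Rintegral P2 setT (state f T) <= (T^-1 + kap) * enorm (x - z) + 5 * e.
Proof.
move=> T0 ep0' N0 sP1 sP2 st1 st2 f01 L0 fL HN.
have lamp : 0 < lam by apply: lt_le_trans lam1.
have kap0 : 0 < kap by apply: lt_le_trans kapl; rewrite mulr_gt0.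
pose c := T^-1 + kap; have c0 : 0 < c by rewrite addr_gt0 ?invr_gt0.
pose s0 : R := (2 * (L + 2))^-1.
have s00 : 0 < s0 by rewrite invr_gt0 mulr_gt0// ltr_wpDl.
(* Over the whole interval [beta] grows to [T * bbar = e], and [etabar] ensures [c * eta <= e]. *)
pose bbar := e / T; have bb0 : 0 < bbar by rewrite divr_gt0.
pose etabar := e / c; have eb0 : 0 < etabar by rewrite divr_gt0.
have T4 : 0 < 4 + 4 * T by rewrite addr_gt0 ?mulr_gt0.
(* The generator errors sum to [2 T e'], and the mollification and time-step errors to a few more
   [e']; [4 + 4 T] covers both. *)
pose e' := e / (4 + 4 * T); have e'0 : 0 < e' by rewrite divr_gt0.
have [eta [eps [zeta [C [delta0 [[eta0 etab epp] [e8 Kfe z0 dl00] HC HS]]]]]] :=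
  scheme d0 e0 l0 nuC slT sls bB sB tB qB H0 Q0 delta10 th0 th1 thlim SFb SFt F2 lam1 lamd lamH kapl kapQ N0 s00 bb0 eb0 e'0.
set Kf := s0^-1 + kap + 2 in Kfe HS.
have Kf0 : 0 <= Kf by rewrite addr_ge0// addr_ge0 ?(ltW kap0)// invr_ge0 ltW.
have C0 : 0 <= C by case: (HC 0 (fun=> 0) (elip_cst 0)) => // y; rewrite normr0.
have [K K0 HK] := iterate e0 l0 nuC slT sls bB sB tB qB am bm qm num N0 Kf0 s00 (ltW bb0) epp e8 Kfe C0 (ltW e'0) z0 HC HS.
have [dm /andP[dm0 _] Hdm] := exists_small (s := [:: (1, delta0); (T * K, e')]) ltac:(by rewrite /= dl00 e'0).
have dma : 1 * dm <= delta0 by apply: (Hdm (_, _)); rewrite !inE eqxx.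
have dmb : T * K * dm <= e' by apply: (Hdm (_, _)); rewrite !inE eqxx ?orbT.
pose m := (Num.truncn (T / dm)).+1.
have m0 : 0 < m%:R :> R by rewrite ltr0n.
pose delta := T / m%:R.
have dl0 : 0 < delta by rewrite divr_gt0.
have dldm : delta <= dm.
  by rewrite /delta ler_pdivrMr// mulrC -ler_pdivrMr//; apply: ltW; apply: truncnS_gt.
have dlL : delta <= delta0 by apply: le_trans dldm _; rewrite -[leLHS]mul1r.
have mT : m%:R * delta = T by rewrite /delta mulrC divfK// gt_eqF.
have LK : L + 2 <= Kf.
  rewrite /Kf /s0 invrK; have := ltW kap0; lra.
have fc := cutoff_cls lamp eta0 N L0 kapl LK f01 fL.
have X := HK P1 P2 x z k delta m s0 0 _ _ sP1 sP2 st1 st2 dl0 dlL (lexx s0) (lexx 0) fc.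
rewrite mT add0r in X.
have [t1 [t2 [p1 p2]]] := cls_tests N0 Kf0 epp e8 HC fc.
have [M M0 HM] := test_fun_pair e0 l0 nuC slT sls bB sB qB tB am bm qm num (N + 2) C0; have [b1 _ _] := HM _ t1.
have FA := @stays_filtration R d n N delta m (ltW dl0); have bA : bmeas (\1_(stays N delta m) : Om -> R) := bmeas_indic (filtration_measurable FA).
have T0' := ltW T0.
have bf : bborel f 1.
  split=> [k'|k' y]; last by have /andP[h1 h2] := f01 k' y; rewrite ger0_norm.
  by apply: borel_cont; exact: elip_continuous L0 (fL k').
have bc : bborel (cutoff N f) 1.
  split=> [k'|k' y]; last by have /andP[h1 h2] := cutoff01 N f01 k' y; rewrite ger0_norm.
  apply: borel_cont; apply: elip_continuous (cutoff_elip N f01 fL k'); by rewrite addr_ge0.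
have bfT := bmeas_state bf T0'; have bcT := bmeas_state bc T0'; have bST := bmeas_state b1 T0'.
have close y l : `|Sm eps (cutoff N f l) y - cutoff N f l y| <= e'.
  by have [_ _ cL _ _] := fc; apply: le_trans (Sm_close epp y Kf0 (cL l)) Kfe.
have E1 : Rintegral P1 setT (state f T) <= Rintegral P1 setT (fun w : Om => \1_(stays N delta m) w * state (cutoff N f) T w) + e.
  have hN := HN delta m (ltW dl0) (ltac:(by rewrite mT)).
  have b2 := bmeasM bA bcT; have b3 := bmeasB (bmeas_cst (T := Om) (1 : R)) bA.
  apply: (@le_trans _ _ (Rintegral P1 setT (fun w : Om => \1_(stays N delta m) w * state (cutoff N f) T w + (1 - \1_(stays N delta m) w)))).
    apply: (Ex_le P1 bfT (bmeasD b2 b3)) => w.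
    have /andP[f0 f1] := f01 (pL w T) (pX w T).
    rewrite !indicE; have [/set_mem h|_] := boolP (w \in stays N delta m); last by rewrite mul0r add0r subr0.
    rewrite mul1r subrr addr0 /state /cutoff chi_in ?mul1r//.
    by have := h m (leqnn m); rewrite mT => /le_trans; apply; rewrite lerDl.
  rewrite (ExD P1 b2 b3) (ExB P1 (bmeas_cst 1) bA) Ex_cst lerD2l.
  by move: hN; set u := Rintegral _ _ _; lra.
have E2 : Rintegral P1 setT (fun w : Om => \1_(stays N delta m) w * state (cutoff N f) T w) <=
   Rintegral P1 setT (fun w : Om => \1_(stays N delta m) w * state (fun l => Sm eps (cutoff N f l)) T w) + e'.
  have b2 := bmeasM bA bcT; have b4 := bmeasM bA bST.
  rewrite -[X in _ + X](Ex_cst P1) -(ExD P1 b4 (bmeas_cst _)); apply: (Ex_le P1 b2 (bmeasD b4 (bmeas_cst _))) => w.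
  have := close (pX w T) (pL w T); rewrite ler_norml => /andP[h _].
  rewrite indicE; case: (w \in _); last by rewrite !mul0r add0r ltW.
  by rewrite lerBrDl lerBlDr in h; rewrite !mul1r.
have E3 : Rintegral P2 setT (state (fun l => Sm eps (cutoff N f l)) T) - e' <= Rintegral P2 setT (state f T).
  rewrite -[X in _ - X](Ex_cst P2) -(ExB P2 bST (bmeas_cst _)); apply: (Ex_le P2 (bmeasB bST (bmeas_cst _)) bfT) => w.
  have := close (pX w T) (pL w T); rewrite ler_norml => /andP[_ h].
  rewrite lerBlDr in h; rewrite /state lerBlDr; apply: le_trans h _; rewrite addrC lerD2r.
  have /andP[f0 _] := f01 (pL w T) (pX w T); have /andP[_ c1] := @chi01 R d N (pX w T).
  by rewrite /cutoff ler_piMl.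
have X' : Th lam eta ((s0 + T)^-1 + kap) (T * bbar) (x - z) <= c * (enorm (x - z) + eta) + T * bbar.
  have sT : (s0 + T)^-1 <= T^-1 by rewrite lef_pV2 ?posrE ?addr_gt0// lerDr ltW.
  apply: le_trans (Th_le lamp eta0 _ _ _) _; first by rewrite addr_ge0 ?(ltW kap0)// invr_ge0 addr_ge0// ltW.
  by rewrite lerD2r ler_wpM2r ?addr_ge0 ?enorm_ge0 ?(ltW eta0)// lerD2r.
have X1 : c * eta <= e by rewrite mulrC -ler_pdivlMr.
have X2 : T * bbar <= e by rewrite /bbar mulrC divfK// gt_eqF.
have eE : e = (4 + 4 * T) * e' by rewrite /e' mulrC divfK// gt_eqF.
have X3 : m%:R * (2 * (delta * e') + delta * (delta * K)) <= 2 * (e - 2 * e').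
  have -> : m%:R * (2 * (delta * e') + delta * (delta * K)) = 2 * (m%:R * delta) * e' + (m%:R * delta) * K * delta by ring.
  rewrite mT; have h : T * K * delta <= e'.
    by apply: le_trans dmb; rewrite ler_wpM2l// mulr_ge0.
  have h2 : 0 <= T * e' by rewrite mulr_ge0// ltW.
  apply: le_trans (lerD (lexx _) h) _; rewrite eE !mulrDl; move: (ltW e'0) h2.
  rewrite -!mulrA; set u := T * e'; set v := e'; move=> *; lra.
exact: total_le E1 E2 E3 X X' X1 X2 X3 (ltW e'0).
Qed.

End comparison.

(** * Tightness and approximation by Lipschitz functions *)

Section continuity_from_below.
Context {R : realType} {dT : measure_display} {T : measurableType dT}.

Lemma Ex_indic_below (P : probability T R) (E : nat -> set T) : (forall n, measurable (E n)) -> (forall n m, (n <= m)%N -> E n `<=` E m) ->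
  forall e, 0 < e -> exists n, Rintegral P setT (\1_(\bigcup_n E n)) - e <= Rintegral P setT (\1_(E n)).
Proof.
move=> mE nE e ep0; have mU : measurable (\bigcup_n E n) by exact: bigcupT_measurable.
have cv : P (E n) @[n --> \oo] --> P (\bigcup_n E n).
  by apply: nondecreasing_cvg_mu => // n m nm; apply/subsetPset; exact: nE.
have fP (A : set T) : measurable A -> P A \is a fin_num by move=> mA; exact: fin_num_measure.
have cv' : fine (P (E n)) @[n --> \oo] --> fine (P (\bigcup_n E n)) by apply: fine_cvg; rewrite fineK// fP.
have := cv' _ (nbhsx_ballx _ e ep0) => -[n _ /(_ n (leqnn n)) h].
exists n; rewrite !Ex_prob//; move: h; rewrite /ball/= ltr_norml => /andP[_ h]; lra.
Qed.

End continuity_from_below.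

Section bounded_paths.
Context {R : realType} {d n : nat}.
Local Notation Om := (OmegaS R d n).

(** By compactness of [0, S], local bounds suffice; near each time they come from the right limit
    and the left limit, and before time 0 the path is frozen. *)
Lemma path_bounded (w : pathRdS R d n) (S : R) : \forall N \near \oo, forall r, 0 <= r -> r <= S -> enorm (pX w r) <= N%:R.
Proof.
have cp : compact `[0, S]%classic by exact: segment_compact.
have /compact_near_coveringP /(_ nat \oo (fun N r => enorm (pX w r) <= N%:R) _) := cp.
move=> H; have {}H := H _; apply: filterS (H _) => [N HN r r0 rS|].
  by apply: (HN r); rewrite /= in_itv/= r0.
move=> r /=; rewrite in_itv/= => /andP[r0 rS].
have [hr hl] := pX_cadlag w r0.
have R1 (l : 'rV[R]_d) (F : set_system R) : Filter F -> pX w s @[s --> F] --> l -> \forall s \near F, enorm (pX w s) <= enorm l + 1.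
  move=> FF cv; have cv2 : enorm (pX w s) @[s --> F] --> enorm l.
    by apply: continuous_cvg cv; exact: enorm_continuous.
  have h := cv2 _ (nbhsx_ballx (enorm l) 1 ltr01).
  apply: (@filterS _ F FF _ _ _ h) => s /=; rewrite /ball/= ltr_norml => /andP[h1 h2]; lra.
have [M [HM Hnear]] : exists M : R, (0 <= M) /\ \forall s \near r, enorm (pX w s) <= M.
  have [e1 /= e10 h1] := R1 _ _ _ hr.
  have [Ml [e2 [e20 [Ml0 h2]]]] : exists Ml e2 : R, 0 < e2 /\ 0 <= Ml /\ forall s, r - e2 < s -> s < r -> enorm (pX w s) <= Ml.
    have [r00|r00] := ltP 0 r.
      have [l hl'] := hl r00; have [e2 /= e20 h2] := R1 _ _ _ hl'.
      exists (enorm l + 1), e2; split=> //; split; first by rewrite addr_ge0 ?enorm_ge0.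
      move=> s rs sr; apply: h2 => //=; rewrite gtr0_norm ?subr_gt0//; lra.
    exists (enorm (pX w 0)), 1; split=> //; split; first exact: enorm_ge0.
    by move=> s _ sr; rewrite (pX_frozen w)// (lt_le_trans sr).
  exists (enorm (pX w r) + 1 + Ml); split; first by rewrite !addr_ge0 ?enorm_ge0.
  apply/nbhs_ballP; exists (Num.min e1 e2) => /=; first by rewrite lt_min e10.
  move=> s; rewrite /ball/= lt_min => /andP[se1]; rewrite ltr_distl => /andP[_ se2].
  have [sr|rs|->] := ltgtP s r.
  - apply: le_trans (h2 s _ sr) _; last by rewrite lerDr addr_ge0 ?enorm_ge0.
    by rewrite ltrBlDr.
  - apply: (@le_trans _ _ (enorm (pX w r) + 1)); last by rewrite lerDl.
    exact: h1.
  - by rewrite -addrA lerDl addr_ge0.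
exists ([set s | enorm (pX w s) <= M], [set N | M <= N%:R]); first split=> //=.
  exists (Num.truncn M).+1 => //= N /= MN; apply: ltW; apply: lt_le_trans (truncnS_gt M) _; by rewrite ler_nat.
by move=> [s N] [/= h1 h2]; exact: le_trans h2.
Qed.

(** Only countably many times are inspected, for measurability; right continuity recovers all
    others. *)
Definition confined (S : R) (N : nat) : set Om :=
  \bigcap_(m in [set: nat]) \bigcap_(j in [set j : nat | j%:R / m.+1%:R <= S]) [set w | enorm (pX w (j%:R / m.+1%:R)) <= N%:R].

Lemma measurable_confined S N : measurable (confined S N).
Proof.
apply: bigcap_measurableType => m _; apply: bigcap_measurableType => j _.
by apply: (@measurable_ball_event R d n +oo%E); rewrite ?leey// divr_ge0.
Qed.

Lemma confined_le S N M : (N <= M)%N -> confined S N `<=` confined S M.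
Proof. by move=> NM w H m _ j jS; apply: le_trans (H m I j jS) _; rewrite ler_nat. Qed.

Lemma confined_all S : \bigcup_N confined S N = setT.
Proof.
apply/seteqP; split => // w _; have [N _ HN] := path_bounded w S.
by exists N => // m _ j jS; apply: (HN N (leqnn N)) => //; rewrite divr_ge0.
Qed.

Lemma confined_path S N (w : Om) r : confined (S + 1) N w -> 0 <= r -> r <= S -> enorm (pX w r) <= N%:R.
Proof.
move=> H r0 rS; have cv := @path_cvg R d n w r (@enorm R d) (@enorm_continuous R d).
apply: (cvgr_to_le cv); near=> m; apply: (H m I) => /=.
(* Grid times exceed [r] by at most [1 / (m + 1) <= 1], whence confinement up to [S + 1]. *)
apply: le_trans (stept_le m r) _; rewrite max_l// lerD// invf_le1//.
by rewrite ler1n.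
Unshelve. all: by end_near. Qed.

(** Whole paths are confined, so one radius serves all grids and can be chosen before the time
    step. *)
Lemma tight_paths (P : probability Om R) (T e : R) : 0 < e -> exists2 N : R, 0 <= N & forall delta j, 0 <= delta -> j%:R * delta <= T ->
  1 - e <= Rintegral P setT (\1_(stays N delta j)).
Proof.
move=> ep0; have [N HN] := Ex_indic_below P (measurable_confined (T + 1)) (@confined_le (T + 1)) ep0.
rewrite confined_all Ex_prob// in HN.
exists N%:R => // delta j dl0 jT.
rewrite (_ : fine (P setT) = 1) in HN; last by rewrite -[RHS]/(fine 1%E); congr fine; exact: (@probability_setT _ _ _ P).
apply: le_trans HN _; apply: Ex_le.
- by apply: bmeas_indic; exact: measurable_confined.
- by apply: bmeas_indic; exact: (filtration_measurable (@stays_filtration R d n N%:R delta j dl0)).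
move=> w; rewrite !indicE; have [/set_mem h|_] := boolP (w \in confined _ _); last by rewrite ler0n.
rewrite mem_set// => i ij; apply: (confined_path h); first by rewrite mulr_ge0.
by apply: le_trans jT; rewrite ler_wpM2r// ler_nat.
Qed.

End bounded_paths.

(** * Approximation of Borel functions in mean under two laws *)

Section lipschitz_approximation.
Context {R : realType} {d : nat} {dT : measure_display} {T : measurableType dT}.
Local Notation V := 'rV[R]_d.
Variables (P : bool -> probability T R) (Y : T -> V).
Hypothesis mY : measurable_fun setT (Y : T -> Rd R d).
Local Notation Ex i F := (Rintegral (P i) setT F).

(** The laws are indexed by [bool] so that a single Lipschitz function serves both. *)
Definition approx (f : V -> R) (e : R) := exists (L : R) (h : V -> R),
  [/\ 0 <= L, elip L h, forall x, 0 <= h x <= 1 & forall i, Ex i (fun w => `|f (Y w) - h (Y w)|) <= e].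

Lemma bmeas_comp (f : V -> R) (M : R) : borel_fun f -> (forall x, `|f x| <= M) -> bmeas (fun w => f (Y w)).
Proof. by move=> mf fM; split; [exact: measurableT_comp mf mY|exists M]. Qed.

Lemma bmeas_dist (f h : V -> R) L : borel_fun f -> (forall x, 0 <= f x <= 1) -> 0 <= L -> elip L h -> (forall x, 0 <= h x <= 1) ->
  bmeas (fun w => `|f (Y w) - h (Y w)|).
Proof.
move=> mf f01 L0 hL h01; apply: (@bmeas_comp (fun x => `|f x - h x|) 1).
  by apply: measurableT_comp => //; apply: measurable_funB => //; apply: borel_cont; exact: elip_continuous hL.
move=> x; rewrite normr_id; have := f01 x; have := h01 x; move=> /andP[a b] /andP[c e].
by rewrite ler_norml; lra.
Qed.

Definition approx_set (B : set V) := measurable (B : set (Rd R d)) /\ forall e, 0 < e -> approx \1_B e.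

Lemma indic01 (B : set V) x : 0 <= (\1_B x : R) <= 1.
Proof. by rewrite indicE; case: (_ \in _); rewrite ?lexx ?ler01. Qed.

Lemma borel_indic (B : set V) : measurable (B : set (Rd R d)) -> borel_fun (\1_B : V -> R).
Proof. by move=> mB; exact: measurable_indic. Qed.

Lemma measurable_preY (B : set V) : measurable (B : set (Rd R d)) -> measurable (Y @^-1` B).
Proof. by move=> mB; rewrite -[X in measurable X]setTI; exact: mY. Qed.

Lemma approx_below (B : nat -> set V) (e : R) : (forall n, measurable (B n : set (Rd R d))) -> (forall n m, (n <= m)%N -> B n `<=` B m) ->
  0 < e -> exists n, forall i, Ex i (fun w => \1_(\bigcup_n B n) (Y w) - \1_(B n) (Y w)) <= e.
Proof.
move=> mB nB ep0.
have E1 n w : \1_(B n) (Y w) = \1_(Y @^-1` B n) w :> R by [].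
have mp n := measurable_preY (mB n).
have np n m : (n <= m)%N -> Y @^-1` B n `<=` Y @^-1` B m by move=> nm w; exact: nB.
have H i := Ex_indic_below (P i) mp np ep0.
have [n1 h1] := H true; have [n2 h2] := H false.
exists (maxn n1 n2) => i.
have mU : measurable (Y @^-1` (\bigcup_n B n)) by apply: measurable_preY; exact: bigcupT_measurable.
have bU : bmeas (fun w => \1_(\bigcup_n B n) (Y w) : R) by exact: (bmeas_indic mU).
have bB m : bmeas (fun w => \1_(B m) (Y w) : R) by exact: (bmeas_indic (mp m)).
rewrite (ExB (P i) bU (bB _)) lerBlDr -lerBlDl.
have mono m m' : (m <= m')%N -> Ex i (fun w => \1_(B m) (Y w)) <= Ex i (fun w => \1_(B m') (Y w)).
  move=> mm; apply: (Ex_le (P i) (bB m) (bB m')) => w; rewrite !indicE.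
  by have [/set_mem h|_] := boolP (_ \in B m); [rewrite mem_set//; exact: nB h|rewrite ler0n].
rewrite -preimage_bigcup in h1 h2.
case: i mono => mono.
  by apply: le_trans h1 _; apply: mono; exact: leq_maxl.
by apply: le_trans h2 _; apply: mono; exact: leq_maxr.
Qed.

(** The Lipschitz functions [min (1, m * dst)], with [dst] the distance to the complement, increase
    to the indicator. *)
Lemma approx_open (U : set V) : open U -> approx_set U.
Proof.
move=> oU; have mU := Rd_open oU; split=> // e ep0.
have [CE|/set0P C0] := eqVneq (~` U) set0.
  exists 0, (fun=> 1); split=> //; [exact: elip_cst|by move=> x; rewrite ler01 lexx|].
  move=> i; rewrite (_ : (fun w => _) = fun=> 0) ?Ex_cst ?(ltW ep0)//.
  apply/funext => w; rewrite indicE mem_set ?subrr ?normr0//.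
  by apply: contrapT => h; have : (~` U) (Y w) by []; rewrite CE.
have cU : closed (~` U) by exact: open_closedC.
pose B n : set V := [set x | 1 <= n%:R * dst (~` U) x].
have dL := dst_elip C0.
have md : borel_fun (dst (~` U)) by apply: borel_cont; exact: elip_continuous dL.
have mB n : measurable (B n : set (Rd R d)).
  rewrite (_ : B n = [set x | `[1, +oo[%classic (n%:R * dst (~` U) x)]); last by apply/seteqP; split => x; rewrite /B/= in_itv/= andbT.
  by apply: borel_set => //; apply: measurable_funM => //; exact: measurable_cst.
have nB m p : (m <= p)%N -> B m `<=` B p.
  by move=> mp x /= h; apply: le_trans h _; rewrite ler_wpM2r ?dst_ge0// ler_nat.
have BU : \bigcup_m B m = U.
  apply/seteqP; split => x.
    move=> [m _ /= h]; apply: contrapT => Ux; have E : dst (~` U) x = 0 by exact: dst_in.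
    by rewrite /B/= E mulr0 ler10 in h.
  move=> Ux; have dp : 0 < dst (~` U) x.
    by rewrite lt_neqAle dst_ge0 andbT eq_sym; apply/eqP => /(dst_closed cU C0).
  exists (Num.truncn (dst (~` U) x)^-1).+1 => //=.
  by rewrite /B/= -ler_pdivrMr// mul1r ltW// truncnS_gt.
have [m Hm] := approx_below mB nB ep0; rewrite BU in Hm.
pose h x := Num.max 0 (Num.min 1 (m%:R * dst (~` U) x)).
have hL : elip m%:R h.
  apply: clamp_elip => // x y; rewrite -mulrBr normrM ger0_norm// ler_wpM2l//.
  by have := dL x y; rewrite mul1r.
have h01 x : 0 <= h x <= 1 by rewrite /h le_max lexx/= ge_max ler01/= ge_min lexx.
exists m%:R, h; split=> // i.
apply: le_trans (Hm i); apply: Ex_le.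
- exact: (bmeas_dist (borel_indic mU) (indic01 U) (ler0n _ m) hL h01).
- apply: bmeasB; first exact: (bmeas_indic (measurable_preY mU)).
  exact: (bmeas_indic (measurable_preY (mB m))).
move=> w; rewrite !indicE; have /andP[a1 a2] := h01 (Y w).
have [/set_mem Uw|Uw] := boolP (Y w \in U).
  rewrite ger0_norm ?subr_ge0// lerD2l lerN2.
  have [/set_mem Bw|_] := boolP (Y w \in B m); last by [].
  by rewrite /h min_l// max_r.
have dz : dst (~` U) (Y w) = 0 by apply: dst_in; move: Uw; rewrite notin_setE.
rewrite /h dz mulr0 (_ : Num.max 0 (Num.min 1 0) = 0) ?subrr ?normr0; last first.
  by rewrite min_r// maxxx.
by rewrite memNset ?subrr// => /= Bw; move: Bw; rewrite /B/= dz mulr0 ler10.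
Qed.

Lemma approxC (B : set V) : approx_set B -> approx_set (~` B).
Proof.
move=> [mB HB]; split=> [|e ep0]; first exact: (measurableC mB).
have [L [h [L0 hL h01 hE]]] := HB e ep0.
exists L, (fun x => 1 - h x); split=> //.
- by move=> x y; rewrite (_ : _ - _ = - (h x - h y)) ?normrN; [exact: hL|ring].
- by move=> x; have /andP[a1 a2] := h01 x; rewrite subr_ge0 a2/= gerBl.
move=> i; apply: le_trans (hE i); rewrite le_eqVlt; apply/orP; left; apply/eqP.
congr (Rintegral _ _ _); apply/funext => w; rewrite !indicE in_setC.
case: (_ \in _) => /=; first by rewrite sub0r normrN.
by rewrite sub0r normrN opprB addrCA subrr addr0.
Qed.

Lemma approxU (A B : set V) : approx_set A -> approx_set B -> approx_set (A `|` B).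
Proof.
move=> [mA HA] [mB HB]; split=> [|e ep0]; first exact: (measurableU _ _ mA mB).
have e2 : 0 < e / 2 by rewrite divr_gt0.
have [L [h [L0 hL h01 hE]]] := HA _ e2; have [L' [h' [L'0 hL' h01' hE']]] := HB _ e2.
have h01m x : 0 <= Num.max (h x) (h' x) <= 1.
  by have /andP[a1 a2] := h01 x; have /andP[b1 b2] := h01' x; rewrite le_max a1/= ge_max a2.
have hLm : elip (L + L') (fun x => Num.max (h x) (h' x)).
  move=> x y; apply: le_trans (_ : `|h x - h y| + `|h' x - h' y| <= _).
    by rewrite /Num.max; do 2?case: ltP => ?; rewrite ler_norml; have := ler_norm (h x - h y); have := ler_norm (h' x - h' y);
      have := ler_norm (- (h x - h y)); have := ler_norm (- (h' x - h' y)); rewrite !normrN; lra.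
  by rewrite mulrDl lerD.
exists (L + L'), (fun x => Num.max (h x) (h' x)); split=> //; first exact: addr_ge0.
move=> i.
have b1 := bmeas_dist (borel_indic mA) (indic01 A) L0 hL h01; have b2 := bmeas_dist (borel_indic mB) (indic01 B) L'0 hL' h01'.
have b3 := bmeas_dist (borel_indic (measurableU _ _ mA mB)) (indic01 (A `|` B)) (addr_ge0 L0 L'0) hLm h01m.
have -> : e = e / 2 + e / 2 by field.
apply: le_trans (lerD (hE i) (hE' i)); rewrite -(ExD (P i) b1 b2); apply: (Ex_le (P i) b3 (bmeasD b1 b2)) => w.
rewrite !indicE in_setU; have /andP[a1 a2] := h01 (Y w); have /andP[c1 c2] := h01' (Y w).
rewrite /Num.max; do 2?case: (_ \in _) => /=; case: ltP => hh; rewrite ler_norml;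
 have := ler_norm (1 - h (Y w)); have := ler_norm (1 - h' (Y w)); have := ler_norm (0 - h (Y w)); have := ler_norm (0 - h' (Y w));
 have := ler_norm (- (0 - h (Y w))); have := ler_norm (- (0 - h' (Y w))); rewrite ?normrN;
 have := normr_ge0 (1 - h (Y w)); have := normr_ge0 (1 - h' (Y w)); have := normr_ge0 (0 - h (Y w)); have := normr_ge0 (0 - h' (Y w)); lra.
Qed.

Lemma approx_bigcup (B : (set V)^nat) : (forall n, approx_set (B n)) -> approx_set (\bigcup_n B n).
Proof.
move=> HB; have mB n : measurable (B n : set (Rd R d)) by have [] := HB n.
have mU : measurable (\bigcup_n B n : set (Rd R d)) by exact: bigcupT_measurable.
split=> // e ep0.
pose A m := \big[setU/set0]_(i < m.+1) B i.
have HA m : approx_set (A m).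
  rewrite /A; elim: m => [|m IH]; first by rewrite big_ord_recl big_ord0 setU0.
  by rewrite big_ord_recr/=; exact: approxU.
have nA m p : (m <= p)%N -> A m `<=` A p.
  by move=> mp; exact: subset_bigsetU.
have AU : \bigcup_m A m = \bigcup_n B n.
  apply/seteqP; split => x.
    by move=> [m _]; rewrite /A -bigcup_mkord => -[j _ Bj]; exists j.
  by move=> [m _ Bm]; exists m => //; rewrite /A -bigcup_mkord; exists m => /=.
have e2 : 0 < e / 2 by rewrite divr_gt0.
have [m Hm] := approx_below (fun m => (HA m).1) nA e2; rewrite AU in Hm.
have [L [h [L0 hL h01 hE]]] := (HA m).2 _ e2.
exists L, h; split=> // i.
have b1 := bmeas_dist (borel_indic (HA m).1) (indic01 (A m)) L0 hL h01.
have b2 := bmeas_dist (borel_indic mU) (indic01 (\bigcup_n B n)) L0 hL h01.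
have b3 : bmeas (fun w => \1_(\bigcup_n B n) (Y w) - \1_(A m) (Y w) : R).
  apply: bmeasB; first exact: (bmeas_indic (measurable_preY mU)).
  exact: (bmeas_indic (measurable_preY (HA m).1)).
have -> : e = e / 2 + e / 2 by field.
apply: le_trans (lerD (Hm i) (hE i)); rewrite -(ExD (P i) b3 b1); apply: (Ex_le (P i) b2 (bmeasD b3 b1)) => w.
rewrite (_ : \1_(\bigcup_n B n) (Y w) - h (Y w) = (\1_(\bigcup_n B n) (Y w) - \1_(A m) (Y w)) + (\1_(A m) (Y w) - h (Y w))); last by rewrite addrA subrK.
apply: le_trans (ler_normD _ _) _; rewrite lerD2r ger0_norm// subr_ge0 !indicE.
have [/set_mem Am|_] := boolP (_ \in A m); last by rewrite ler0n.
by rewrite mem_set// -AU; exists m.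
Qed.

(** Approximable sets include the open sets and form a sigma-algebra. *)
Lemma approx_measurable (B : set V) : measurable (B : set (Rd R d)) -> approx_set B.
Proof.
move: B; apply: smallest_sub; last exact: approx_open.
split.
- by have := approx_open (@openT V) => /approxC; rewrite setCT.
- by move=> A HA; rewrite setTD; exact: approxC.
- exact: approx_bigcup.
Qed.

(** Binary digits: [g = (1_B + g') / 2], where [B] is the set [g >= 1/2] and [g'] again has values
    in [0, 1]. After [k] digits the remainder is at most [2^-k], and the digit errors, at most
    [e / 2] each, are averaged with geometric weights. *)
Lemma approx_fun (f : V -> R) (e : R) : borel_fun f -> (forall x, 0 <= f x <= 1) -> 0 < e -> approx f e.
Proof.
move=> mf f01 ep0.
suff H k : forall f : V -> R, borel_fun f -> (forall x, 0 <= f x <= 1) -> approx f (e / 2 + 2^-1 ^+ k).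
  pose k := (Num.truncn (e / 2)^-1).+1.
  have [L [h [L0 hL h01 hE]]] := H k f mf f01.
  exists L, h; split=> // i; apply: le_trans (hE i) _.
  suff h2 : 2^-1 ^+ k <= e / 2 by rewrite [leRHS](splitr e) lerD2l.
  have ei : 0 < (e / 2)^-1 by rewrite invr_gt0 divr_gt0.
  rewrite exprVn -[leRHS]invrK lef_pV2 ?posrE ?exprn_gt0//.
  apply: le_trans (ltW (truncnS_gt _)) _; rewrite -/k -natrX ler_nat ltnW//; exact: ltn_expl.
elim: k => [|k IH] {mf f01}g mg g01.
  exists 0, (fun=> 0); split=> //; [exact: elip_cst|by move=> x; rewrite lexx ler01|move=> i].
  have z01 (x : V) : 0 <= (0 : R) <= 1 by rewrite lexx ler01.
  rewrite expr0 -[leRHS](Ex_cst (P i)).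
  apply: (Ex_le (P i) (bmeas_dist mg g01 (lexx 0) (elip_cst 0) z01) (bmeas_cst _)).
  by move=> w; have /andP[a1 a2] := g01 (Y w); rewrite subr0 ger0_norm// (le_trans a2)// lerDr divr_ge0// ltW.
pose B := [set x | 2^-1 <= g x].
have mB : measurable (B : set (Rd R d)).
  rewrite (_ : B = [set x | `[2^-1, +oo[%classic (g x)]); last by apply/seteqP; split => x; rewrite /B/= in_itv/= andbT.
  exact: borel_set.
have [L [h [L0 hL h01 hE]]] := (approx_measurable mB).2 _ (ltac:(by rewrite divr_gt0) : 0 < e / 2).
pose g' x := 2 * g x - \1_B x.
have g'01 x : 0 <= g' x <= 1.
  have /andP[a1 a2] := g01 x; rewrite /g' indicE; have [/set_mem Bx|Bx] := boolP (x \in B).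
    by rewrite /B/= in Bx; rewrite (_ : true%:R = 1 :> R)//; apply/andP; split; lra.
  move: Bx; rewrite notin_setE /B/= => /negP; rewrite -ltNge => Bx.
  by rewrite (_ : false%:R = 0 :> R)//; apply/andP; split; lra.
have mg' : borel_fun g'.
  by apply: measurable_funB; [apply: measurable_funM => //; exact: measurable_cst|exact: borel_indic].
have [L' [h' [L'0 hL' h01' hE']]] := IH g' mg' g'01.
have h2L : elip (2^-1 * L + 2^-1 * L') (fun x => 2^-1 * h x + 2^-1 * h' x).
  by have := elipD (elipZ 2^-1 hL) (elipZ 2^-1 hL'); rewrite ger0_norm.
have h201 x : 0 <= 2^-1 * h x + 2^-1 * h' x <= 1.
  by have /andP[a1 a2] := h01 x; have /andP[c1 c2] := h01' x; apply/andP; split; lra.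
exists (2^-1 * L + 2^-1 * L'), (fun x => 2^-1 * h x + 2^-1 * h' x).
have L20 : 0 <= 2^-1 * L + 2^-1 * L' by rewrite addr_ge0 ?mulr_ge0.
split=> // i.
have b1 := bmeas_dist (borel_indic mB) (indic01 B) L0 hL h01.
have b2 := bmeas_dist mg' g'01 L'0 hL' h01'.
have b3 := bmeas_dist mg g01 L20 h2L h201.
have X : Ex i (fun w => `|g (Y w) - (2^-1 * h (Y w) + 2^-1 * h' (Y w))|) <=
   2^-1 * Ex i (fun w => `|\1_B (Y w) - h (Y w)|) + 2^-1 * Ex i (fun w => `|g' (Y w) - h' (Y w)|).
  rewrite -(ExZ (P i) _ b1) -(ExZ (P i) _ b2) -(ExD (P i) (bmeasZ _ b1) (bmeasZ _ b2)).
  apply: (Ex_le (P i) b3 (bmeasD (bmeasZ _ b1) (bmeasZ _ b2))) => w.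
  rewrite (_ : g (Y w) - _ = 2^-1 * (\1_B (Y w) - h (Y w)) + 2^-1 * (g' (Y w) - h' (Y w))); last by rewrite /g'; field.
  by apply: le_trans (ler_normD _ _) _; rewrite !normrM ger0_norm.
apply: le_trans X _; have := hE i; have := hE' i; rewrite exprS; set u := _ ^+ k.
set a1 := Rintegral _ _ _; set a2 := Rintegral _ _ _; lra.
Qed.

End lipschitz_approximation.

(** * Strong Feller property *)

Lemma final_le (R : realType) (e A A' B B' c w : R) : 0 <= e -> B - B' <= c * w + 5 * e -> c * w <= e ->
  - e <= A' - B' -> A' - B' <= e -> - e <= A - B -> A - B <= e -> A - A' <= 8 * e.
Proof. by move=> h0 h1 h2 h3 h4 h5 h6; lra. Qed.

Section equicontinuity.
Context {R : realType} {d n : nat}.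
Hypothesis d0 : (0 < d)%N.
Local Notation V := 'rV[R]_d.
Local Notation I := 'I_n.+1.
Local Notation Ig mu D f := (Rintegral mu D f).
Implicit Types (x y p w v : V) (k l : I) (f g : I -> V -> R).
Variables (eps0 : R) (a : V -> I -> 'M[R]_d) (b : V -> I -> V) (nu : V -> I -> {measure set Rd R d -> \bar R})
  (q : V -> I -> I -> R) (sl : V -> I -> 'M[R]_d) (lambda0 Cn Qb Q H delta1 : R) (theta : R -> R).
Hypotheses (e0 : 0 < eps0) (l0 : 0 < lambda0).
Hypothesis nuC : forall x k, (\int[nu x k]_(u in @Rd0 R d) (mm u)%:E <= Cn%:E)%E.
Hypothesis slT : forall x k, (sl x k)^T = sl x k.
Hypothesis sls : forall x k, sl x k *m sl x k = a x k - lambda0%:M.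
Hypothesis bB : forall N, exists B, forall x k, enorm x <= N -> enorm (b x k) <= B.
Hypothesis sB : forall N, exists B, forall x k, enorm x <= N -> forall i, enorm (row i (sl x k)) <= B.
Hypothesis tB : forall N e, 0 < e -> exists K0, forall K, (K0 <= K)%N -> forall x k, enorm x <= N ->
  Ig (nu x k) (tail K) (@mm R d) <= e.
Hypothesis qB : forall x k l, 0 <= qz q x k l <= Qb.
Hypotheses (H0 : 0 <= H) (Q0 : 0 <= Q) (delta10 : 0 < delta1).
Hypothesis th0 : forall r, 0 < r -> r <= delta1 -> 0 <= theta r.
Hypothesis th1 : forall r, 0 < r -> r <= delta1 -> theta r <= 1.
Hypothesis thlim : forall t, 0 < t -> exists2 r1, 0 < r1 & forall r, 0 < r -> r <= r1 -> r <= delta1 -> theta r <= t.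
Hypothesis SFb : forall k x z, enorm (x - z) <= delta1 ->
  2 * inner (x - z) (b x k - b z k) + hs2 (sl x k - sl z k) <= 2 * H * enorm (x - z) * theta (enorm (x - z)).
Hypothesis SFt : forall k x z, enorm (x - z) <= delta1 ->
  (tv_integral (@enorm R d) (nu x k) (nu z k) (@Rd0 R d) <= (H / 2 * theta (enorm (x - z)))%:E)%E.
Hypothesis F2 : forall k x z, \sum_(l < n.+1) `|qz q x k l - qz q z k l| <= Q * enorm (x - z).
Variables (lam kap : R).
Hypotheses (lam1 : 1 <= lam) (lamd : 2 <= lam * delta1) (lamH : 16 * (2 * H + 3) <= lam * lambda0)
  (kapl : 2 * lam <= kap) (kapQ : Q / lam <= kap).

Hypothesis am : forall k i j, borel_fun (fun x => a x k i j).
Hypothesis bm : forall k i, borel_fun (fun x => b x k 0 i).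
Hypothesis qm : forall k l, borel_fun (fun x => q x k l).
Hypothesis num : forall k (B : set (Rd R d)), measurable B -> measurable_fun setT (fun x : Rd R d => nu x k B).
Local Notation Om := (OmegaS R d n).
Local Notation solves := (solves eps0 a b nu q).



(** [rho] is independent of [f] because [two_point] is uniform in the Lipschitz constant, which
    depends on [f] and on [z]. Tightness is used under [P x k] only, so [N] is fixed before [z]. *)
Lemma equicontinuous T e x k (P : V -> I -> probability Om R) : 0 < T -> 0 < e -> (forall y l, solves (P y l)) ->
  (forall y l, P y l [set w : Om | pX w 0 = y /\ pL w 0 = l] = 1%E) ->
  exists2 rho, 0 < rho & forall z, enorm (x - z) <= rho -> forall f, (forall l, borel_fun (f l)) -> (forall l y, 0 <= f l y <= 1) ->
  Rintegral (P x k) setT (state f T) - Rintegral (P z k) setT (state f T) <= e.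
Proof.
move=> T0 ep0 sP stP.
have lamp : 0 < lam by apply: lt_le_trans lam1.
have kap0 : 0 < kap by apply: lt_le_trans kapl; rewrite mulr_gt0.
pose c := T^-1 + kap; have c0 : 0 < c by rewrite addr_gt0 ?invr_gt0.
(* Five parts for [two_point], one for the distance, and two for the Lipschitz approximation. *)
pose e8 := e / 8; have e80 : 0 < e8 by rewrite divr_gt0.
have [N N0 HN] := tight_paths (P x k) T e80.
exists (e8 / c); first by rewrite divr_gt0.
move=> z xz f mf f01.
pose P2 (i : bool) := if i then P x k else P z k.
have mY : measurable_fun setT (fun w : Om => pX w T : Rd R d) by exact: (@measurable_pX R d n +oo%E T (ltW T0) (leey _)).
have e9 : 0 < e8 / n.+1%:R by rewrite divr_gt0.
have /choice[Lh HLh] : forall l : I, exists p : R * (V -> R), [/\ 0 <= p.1, elip p.1 p.2, forall y, 0 <= p.2 y <= 1 &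
    forall i, Rintegral (P2 i) setT (fun w : Om => `|f l (pX w T) - p.2 (pX w T)|) <= e8 / n.+1%:R].
  by move=> l; have [L [h Hh]] := approx_fun P2 mY (mf l) (f01 l) e9; exists (L, h).
pose h l := (Lh l).2; pose L := \sum_(l < n.+1) (Lh l).1.
have L0 : 0 <= L by apply: sumr_ge0 => l _; have [] := HLh l.
have hL l : elip L (h l).
  have [l0' hl _ _] := HLh l; move=> y y'; apply: le_trans (hl y y') _; rewrite ler_wpM2r ?enorm_ge0//.
  by rewrite /L (bigD1 l)//= lerDl sumr_ge0// => l' _; have [] := HLh l'.
have h01 l y : 0 <= h l y <= 1 by have [_ _ + _] := HLh l; apply.
have bf : bborel f 1 by split=> // l y; have /andP[a1 a2] := f01 l y; rewrite ger0_norm.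
have bh : bborel h 1.
  split=> [l|l y]; last by have /andP[a1 a2] := h01 l y; rewrite ger0_norm.
  by apply: borel_cont; exact: elip_continuous L0 (hL l).
have bfT := bmeas_state bf (ltW T0); have bhT := bmeas_state bh (ltW T0).
have close i : `|Rintegral (P2 i) setT (state f T) - Rintegral (P2 i) setT (state h T)| <= e8.
  have bd l : bmeas (fun w : Om => `|f l (pX w T) - h l (pX w T)|).
    have [a1 a2 a3 _] := HLh l; exact: (bmeas_dist mY (mf l) (f01 l) a1 a2 a3).
  have bS : bmeas (fun w : Om => \sum_(l < n.+1) `|f l (pX w T) - h l (pX w T)|).
    split; first by apply: measurable_sum => l; case: (bd l).
    exists (\sum_(l < n.+1) (1 + 1)) => w; rewrite ger0_norm ?sumr_ge0//; apply: ler_sum => l _.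
    by apply: le_trans (ler_normB _ _) _; rewrite lerD ?bf.2 ?bh.2.
  have D1 (w : Om) : `|state f T w - state h T w| <= \sum_(l < n.+1) `|f l (pX w T) - h l (pX w T)|.
    by rewrite (bigD1 (pL w T))//= lerDl sumr_ge0.
  have bfh := bmeasB bfT bhT.
  have tot : Rintegral (P2 i) setT (fun w : Om => \sum_(l < n.+1) `|f l (pX w T) - h l (pX w T)|) <= e8.
    rewrite (Ex_sum (P2 i) (F := fun l (w : Om) => `|f l (pX w T) - h l (pX w T)|) bd).
    apply: (@le_trans _ _ (\sum_(l < n.+1) e8 / n.+1%:R)); first by apply: ler_sum => l _; have [_ _ _ H4] := HLh l; exact: H4.
    by rewrite sumr_const card_ord -[leLHS]mulr_natl mulrC divfK ?lexx// pnatr_eq0.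
  rewrite -(ExB (P2 i) bfT bhT) ler_norml; apply/andP; split.
    rewrite lerNl; apply: le_trans tot; rewrite -mulN1r -(ExZ (P2 i) (-1) bfh).
    apply: (Ex_le (P2 i) (bmeasZ _ bfh) bS) => w; apply: le_trans (D1 w).
    by rewrite mulN1r -normrN; exact: ler_norm.
  apply: le_trans tot; apply: (Ex_le (P2 i) bfh bS) => w; apply: le_trans (D1 w); exact: ler_norm.
have X := two_point d0 e0 l0 nuC slT sls bB sB tB qB H0 Q0 delta10 th0 th1 thlim SFb SFt F2 lam1 lamd lamH kapl kapQ
  am bm qm num T0 e80 N0 (sP x k) (sP z k) (stP x k) (stP z k) h01 L0 hL HN.
have cx : c * enorm (x - z) <= e8 by rewrite mulrC -ler_pdivlMr.
have := close true; have := close false; rewrite /P2 !ler_norml => /andP[a1 a2] /andP[a3 a4].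
have eE : e = 8 * e8 by rewrite /e8; field.
rewrite eE; move: X cx a1 a2 a3 a4; exact: final_le (ltW e80).
Qed.

End equicontinuity.

Section coefficient_bounds.
Context {R : realType} {d n : nat}.
Local Notation V := 'rV[R]_d.
Local Notation I := 'I_n.+1.
Implicit Types (x z : V) (k l : I).

(** The tails at 0 are small for each of the finitely many regimes, and [tail_compare] carries this
    to the whole ball. *)
Lemma tail_locbdd (nu : V -> I -> {measure set Rd R d -> \bar R}) (Cn H : R) (rho : R -> R) : 0 <= H ->
  (forall r s, 0 <= r -> r <= s -> rho r <= rho s) -> (forall r, 0 <= r -> 0 <= rho r) ->
  (forall x k, (\int[nu x k]_(u in @Rd0 R d) (mm u)%:E <= Cn%:E)%E) ->
  (forall k x z, (tv_integral (@enorm R d) (nu x k) (nu z k) (@Rd0 R d) <= (H * rho (enorm (x - z)))%:E)%E) ->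
  forall N e, 0 < e -> exists K0, forall K, (K0 <= K)%N -> forall x k, enorm x <= N ->
  Rintegral (nu x k) (tail K) (@mm R d) <= e.
Proof.
move=> H0 rm r0 nuC tv N e ep0.
have e6 : 0 < e / 6 by rewrite divr_gt0.
have /choice[K1 HK1] := fun k => tail_small (nuC 0 k) e6.
pose t := H * rho `|N|; have t0 : 0 <= t by rewrite mulr_ge0// r0.
exists (\max_(k < n.+1) K1 k + (Num.truncn (2 * t / e)).+3)%N => K KK x k xN.
have h1 : (1 < K)%N by apply: leq_trans KK; rewrite addnS addnS ltnS ltnS leq0n.
have xN' : enorm x <= `|N| by apply: le_trans xN (ler_norm N).
have tvx : (tv_integral (@enorm R d) (nu x k) (nu 0%R k) (@Rd0 R d) <= t%:E)%E.
  apply: le_trans (tv k x 0) _; rewrite lee_fin ler_wpM2l// subr0; exact: rm (enorm_ge0 x) xN'.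
apply: le_trans (tail_compare h1 (nuC x k) (nuC 0 k) tvx) _.
have h2 : Rintegral (nu 0 k) (tail K) (@mm R d) <= e / 6.
  by apply: HK1; apply: leq_trans KK; apply: leq_trans (leq_addr _ _); exact: (leq_bigmax k).
have h3 : t / K.-1%:R <= e / 2.
  have K0 : 0 < K.-1%:R :> R by rewrite ltr0n -ltnS prednK// ltnW.
  have u : 2 * t / e <= K.-1%:R.
    apply: ltW; apply: lt_le_trans (truncnS_gt _) _; rewrite ler_nat -ltnS prednK; last exact: ltnW.
    by apply: leq_trans KK; apply: leq_trans (leq_addl _ _).
  rewrite ler_pdivrMr// in u; rewrite ler_pdivrMr//.
  have -> : e / 2 * K.-1%:R = (K.-1%:R * e) / 2 by ring.
  by rewrite ler_pdivlMr// mulrC.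
lra.
Qed.

End coefficient_bounds.

(* S = {1,...,n0} is encoded as 'I_n.+1 (n0 = n+1 >= 1);
   P x k is the (unique) martingale solution for A from (x,k). *)
Theorem theorem5p4 (R : realType) (d n : nat) (eps0 : R)
  (a : 'rV[R]_d -> 'I_n.+1 -> 'M[R]_d) (b : 'rV[R]_d -> 'I_n.+1 -> 'rV[R]_d)
  (nu : 'rV[R]_d -> 'I_n.+1 -> {measure set Rd R d -> \bar R})
  (q : 'rV[R]_d -> 'I_n.+1 -> 'I_n.+1 -> R)
  (P : 'rV[R]_d -> 'I_n.+1 -> probability (OmegaS R d n) R) :
  (0 < d)%N -> 0 < eps0 ->
  coefficients_ok eps0 a b nu q ->
  assumption_A eps0 a b nu q ->
  assumption_F1_F2 a b nu q ->
  assumption_SF a b nu ->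
  (forall x k, mg_sol_A eps0 a b nu q (P x k) x k) ->
  forall (t : R), 0 < t ->
  forall f : 'rV[R]_d -> 'I_n.+1 -> R,
    (forall k, borel_fun (f ^~ k)) ->
    (exists M : R, forall x k, `|f x k| <= M) ->
    forall k : 'I_n.+1,
      continuous (fun x : 'rV[R]_d =>
        Rintegral (P x k) setT (fun w : OmegaS R d n => f (pX w t) (pL w t))).
Proof.
move=> d0 e0 [psa [am [bm [_ [_ [_ [_ [num [qm [q0 qs]]]]]]]]]] [_ [Aii [Cn nuC]]].
move=> [H1 [rho [sigma [H10 [rho0 [rhom [_ [_ [_ [sga [F1b [F1n F2q]]]]]]]]]]]].
move=> [lambda0 [sl [delta0 [H2 [theta [l0 [_ [psl [dl0 [H20 [th0 [thlim0 [SFb SFt]]]]]]]]]]]]] sP t t0 f mf [M fM] k.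
have slT x l : (sl x l)^T = sl x l by have [[]] := psl x l.
have sls x l : sl x l *m sl x l = a x l - lambda0%:M by have [] := psl x l.
have thlim r : 0 < r -> exists2 r1, 0 < r1 & forall s, 0 < s -> s <= r1 -> s <= delta0 -> theta s <= r.
  move=> r0; have [e1 /= e10 He1] := thlim0 _ (nbhsx_ballx 0 r r0).
  exists (e1 / 2); first by rewrite divr_gt0.
  move=> s s0 s1 _.
  have bs : ball_ [eta Num.norm] (0 : R) e1 s.
    rewrite /ball_/= sub0r normrN gtr0_norm//; apply: le_lt_trans s1 _.
    by rewrite ltr_pdivrMr// ltr_pMr// ltr1n.
  have := He1 s bs s0; rewrite /ball/= sub0r normrN => h; exact: le_trans (ler_norm _) (ltW h).
have [r1 r10 Hr1] := thlim 1 ltr01.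
(* On this smaller range [theta <= 1]. *)
pose delta1 := Num.min delta0 r1.
have delta10 : 0 < delta1 by rewrite lt_min dl0.
have d1d0 : delta1 <= delta0 by rewrite ge_min lexx.
have th0' r : 0 < r -> r <= delta1 -> 0 <= theta r by move=> r0 rd; apply: th0; [exact: ltW|exact: le_trans d1d0].
have th1 r : 0 < r -> r <= delta1 -> theta r <= 1.
  by move=> r0 rd; apply: Hr1 => //; apply: le_trans rd _; rewrite ge_min lexx ?orbT.
have thlim' r : 0 < r -> exists2 r1, 0 < r1 & forall s, 0 < s -> s <= r1 -> s <= delta1 -> theta s <= r.
  move=> r0; have [r2 r20 Hr2] := thlim r r0; exists r2 => // s s0 s1 s2; apply: Hr2 => //; exact: le_trans d1d0.
have SFb' l x z : enorm (x - z) <= delta1 ->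
    2 * inner (x - z) (b x l - b z l) + hs2 (sl x l - sl z l) <= 2 * H2 * enorm (x - z) * theta (enorm (x - z)).
  by move=> xz; apply: SFb; exact: le_trans d1d0.
have SFt' l x z : enorm (x - z) <= delta1 ->
    (tv_integral (@enorm R d) (nu x l) (nu z l) (@Rd0 R d) <= (H2 / 2 * theta (enorm (x - z)))%:E)%E.
  by move=> xz; apply: SFt; exact: le_trans d1d0.
have F2' l x z : \sum_(i < n.+1) `|qz q x l i - qz q z l i| <= (n.+1%:R * H1) * enorm (x - z).
  apply: (@le_trans _ _ (\sum_(i < n.+1) H1 * enorm (x - z))).
    apply: ler_sum => i _; rewrite /qz; case: eqVneq => [_|il]; last by apply: F2q; rewrite eq_sym.
    by rewrite subrr normr0 mulr_ge0 ?enorm_ge0// ltW.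
  by rewrite sumr_const card_ord -[leLHS]mulr_natl mulrA.
(* Off-diagonal rates are nonnegative with sum [- q x l l], hence bounded by any upper bound of
   it. *)
have [Qb Qb0 HQb] : exists2 Qb, 0 <= Qb & forall (l : 'I_n.+1) (x : 'rV[R]_d), True -> - q x l l <= Qb.
  apply: fin_bound => l; have [c Hc] := Aii l; exists (- c) => x _; by rewrite lerN2.
have qB x l i : 0 <= qz q x l i <= Qb.
  rewrite /qz; case: eqVneq => [_|il]; first by rewrite lexx.
  rewrite q0 1?eq_sym//=; apply: le_trans (HQb l x I).
  have := qs x l; rewrite (bigD1 l)//= (bigD1 i)//= => /eqP; rewrite addrC addr_eq0 => /eqP <-.
  by rewrite lerDl sumr_ge0// => j /andP[jl _]; apply: q0; rewrite eq_sym.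
have F1b' l x z : 2 * inner (x - z) (b x l - b z l) <= H1 * enorm (x - z) * rho (enorm (x - z)).
  by apply: le_trans (F1b l x z); rewrite lerDr hs2_ge0.
have bB N : exists B, forall x l, enorm x <= N -> enorm (b x l) <= B.
  have [B _ HB] : exists2 B, 0 <= B & forall (l : 'I_n.+1) (x : 'rV[R]_d), enorm x <= N -> enorm (b x l) <= B.
    by apply: fin_bound => l; exact: (onesided_locbdd (ltW H10) rhom rho0 (F1b' l)).
  by exists B => x l; exact: HB.
have sB N : exists B, forall x l, enorm x <= N -> forall i, enorm (row i (sl x l)) <= B.
  have [B _ HB] : exists2 B, 0 <= B & forall (p : 'I_n.+1 * 'I_d) (x : 'rV[R]_d), enorm x <= N -> enorm (row p.2 (sl x p.1)) <= B.
    apply: fin_bound => -[l i].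
    have [B HB] := sqrt_locbdd (ltW H10) (ltW l0) rhom rho0 (F1b l) (fun x => sga x l) (fun x => slT x l) (fun x => sls x l) N.
    by exists B => x xN; exact: HB.
  by exists B => x l xN i; exact: (HB (l, i) x xN).
have tB := tail_locbdd (ltW H10) rhom rho0 nuC F1n.
pose Q : R := n.+1%:R * H1.
have Q0 : 0 <= Q by rewrite mulr_ge0// ltW.
have [lam [lam1 lamd lamH]] : exists lam : R, [/\ 1 <= lam, 2 <= lam * delta1 & 16 * (2 * H2 + 3) <= lam * lambda0].
  exists (Num.max 1 (Num.max (2 / delta1) (16 * (2 * H2 + 3) / lambda0))); split.
  - by rewrite le_max lexx.
  - by rewrite -ler_pdivrMr// !le_max lexx ?orbT.
  - by rewrite -ler_pdivrMr// !le_max lexx ?orbT.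
pose kap := Num.max (2 * lam) (Q / lam).
have kapl : 2 * lam <= kap by rewrite le_max lexx.
have kapQ : Q / lam <= kap by rewrite le_max lexx orbT.
have EQ := equicontinuous d0 e0 l0 nuC slT sls bB sB tB qB (ltW H20) Q0 delta10 th0' th1 thlim' SFb' SFt' F2'
  lam1 lamd lamH kapl kapQ am bm qm num.
have sP1 y l : solves eps0 a b nu q (P y l) by have [_] := sP y l.
have sP2 y l : P y l [set w : OmegaS R d n | pX w 0 = y /\ pL w 0 = l] = 1%E by have [] := sP y l.
pose M' := `|M| + 1; have M0 : 0 < M' by rewrite ltr_wpDl.
have fM' l y : `|f y l| <= M' by apply: le_trans (fM y l) _; rewrite (le_trans (ler_norm M))// lerDl.
(* An affine rescaling to [0, 1]; the estimate for [g] and for [1 - g] gives both one-sided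
   bounds. *)
pose g l y := (f y l + M') / (2 * M').
have M20 : 0 < 2 * M' by rewrite mulr_gt0.
have mg l : borel_fun (g l).
  by apply: measurable_funM; [apply: measurable_funD; [exact: mf|exact: measurable_cst]|exact: measurable_cst].
have g01 l y : 0 <= g l y <= 1.
  have := fM' l y; rewrite ler_norml => /andP[h1 h2]; rewrite /g divr_ge0 ?(ltW M20)//=; last by lra.
  by rewrite ler_pdivrMr// mul1r; lra.
have mg' l : borel_fun (fun y => 1 - g l y) by apply: measurable_funB; [exact: measurable_cst|exact: mg].
have g01' l y : 0 <= 1 - g l y <= 1 by have /andP[h1 h2] := g01 l y; rewrite subr_ge0 h2/= gerBl.
have bg : bborel g 1 by split=> // l y; have /andP[h1 h2] := g01 l y; rewrite ger0_norm.
have bf : bborel (fun l y => f y l) M' by split.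
have Eg y : Rintegral (P y k) setT (state g t) =
   (Rintegral (P y k) setT (fun w : OmegaS R d n => f (pX w t) (pL w t)) + M') / (2 * M').
  have b1 := bmeas_state bf (ltW t0).
  rewrite -[X in _ + X](Ex_cst (P y k)) -(ExD (P y k) b1 (bmeas_cst _)) mulrC -(ExZ (P y k) _ (bmeasD b1 (bmeas_cst _))).
  by congr (Rintegral _ _ _); apply/funext => w; rewrite /state /g mulrC.
have Eg' y : Rintegral (P y k) setT (state (fun l y => 1 - g l y) t) = 1 - Rintegral (P y k) setT (state g t).
  by rewrite -[X in X - _](Ex_cst (P y k)) -(ExB (P y k) (bmeas_cst _) (bmeas_state bg (ltW t0))).
move=> x; have FF : Filter (nbhs x) by exact: nbhs_filter.
apply/(@cvgrPdist_le _ _ _ (nbhs x)) => e ep0.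
have e2 : 0 < e / (2 * M') by rewrite divr_gt0.
have [r r0 Hr] := EQ t _ x k P t0 e2 sP1 sP2.
have rd0 : 0 < r / d.+1%:R by rewrite divr_gt0.
have /cvgr_dist_le/(_ _ rd0) : id y @[y --> x] --> x by exact: cvg_id.
apply: filterS => z /= xz.
have xzr : enorm (x - z) <= r.
  apply: le_trans (enorm_le_norm _) _; apply: (@le_trans _ _ (d.+1%:R * (r / d.+1%:R))).
    by apply: ler_pM => //; rewrite ler_nat.
  by rewrite mulrC divfK ?lexx// pnatr_eq0.
have h1 := Hr z xzr g mg g01; have h2 := Hr z xzr _ mg' g01'.
rewrite !Eg' in h2; rewrite !Eg in h1 h2.
set Fx := Rintegral (P x k) _ _ in h1 h2 *; set Fz := Rintegral (P z k) _ _ in h1 h2 *.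
have q1 : (Fx + M') / (2 * M') - (Fz + M') / (2 * M') = (Fx - Fz) / (2 * M') by rewrite -mulrBl; congr (_ / _); ring.
have h1' : (Fx - Fz) / (2 * M') <= e / (2 * M') by rewrite -q1.
have h2' : - (Fx - Fz) / (2 * M') <= e / (2 * M').
  rewrite mulNr -q1; move: h2; set A := (Fx + M') / _; set B := (Fz + M') / _.
  by rewrite (_ : 1 - A - (1 - B) = - (A - B))//; ring.
rewrite ler_pM2r ?invr_gt0// in h1'; rewrite ler_pM2r ?invr_gt0// in h2'.
by rewrite ler_norml h1' andbT lerNl.
Qed.
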